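(* Let $b>0$, let $\nu>0$ be non-integer, and let $\gamma=-\nu-1$. Put $\chi=b^2/4$. Then, as $|a|\to\infty$ in $|\arg a|<\tfrac12\pi$, $$\sum_{n=1}^\infty \frac{n^{-\nu-1} K_\nu(nb/a)}{n^2+a^2}-\mathrm{Res}(1)\sim \hat R(a;\nu)+R(a;-\nu),$$ where $$\hat R(a;\nu)=\frac{1}{2}a^{\gamma-1}\chi^{\nu/2}\, \Gamma(-\nu) \sum_{k=1}^\infty (-1)^k \zeta(1-2k)\, F_k^{(1)}(\nu;\chi)\,a^{-2k},$$ $$R(a;-\nu)=\frac{1}{2}a^{\nu-2}\chi^{-\nu/2}\,\Gamma(\nu) \sum_{k=0}^\infty(-1)^k\,\zeta(-\gamma+\nu-2k)\, F_k^{(1)}(-\nu;\chi)\,a^{-2k},$$ $$F_k^{(1)}(\pm\nu;\chi)=\sum_{r=0}^k\frac{(-\chi)^r}{(1\pm\nu)_r\, r!},$$ and $$\mathrm{Res}(1)=a^{\gamma-1}\left\{-\left(\frac{\pi}{2\sin\pi\nu}\right)^2 J_{-\nu}(b)+\frac{1}{2}\chi^{\nu/2}\Gamma(-\nu)\left(\log a+\gamma_0+\frac{1}{2}F(\chi)\left\{\psi(2)+\psi(-1-\nu)-\log\chi+F^{(1)}_*\right\}\right)\right\},$$ with $$F(\chi)=1-\chi^{-\nu/2}\,\Gamma(1+\nu)\, J_\nu(b),$$ $$F^{(1)}_*=\frac{\chi}{(1+\nu)F(\chi)}\sum_{r=1}^\infty \frac{(-\chi)^r}{(2+\nu)_r 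(2)_r}\,\Big\{\psi(2+r)-\psi(2)+\psi(2+\nu+r)-\psi(2+\nu)\Big\}.$$
   Context: $K_\nu$ is the modified Bessel function of the second kind, $J_{\pm\nu}$ the Bessel function of the first kind, $\zeta$ the Riemann zeta function, $\gamma_0=0.5772\ldots$ the Euler–Mascheroni constant, $\psi=\Gamma'/\Gamma$, $(x)_r=x(x+1)\cdots(x+r-1)$. Powers and logarithms take principal values. The product $F(\chi)F_*^{(1)}$ is understood after cancellation of $F(\chi)$. Meaning of the expansion: for every integer $K\ge1$ and every $\delta\in(0,\frac12\pi)$, the left-hand side minus both sums on the right truncated to indices $k<K$ is $O(|a|^{\nu-2-2K})$ as $|a|\to\infty$ uniformly in $|\arg a|\le\frac12\pi-\delta$. *)

(* Defs.v *)
(* Stdlib world, with Coquelicot. *)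
From Stdlib Require Import Reals Factorial ZArith.
From Coquelicot Require Import Coquelicot.
Open Scope R_scope.

(** ** Complex elementary functions, principal values *)

(* Takes values in (-PI, PI]; the value at 0 is irrelevant. *)
Definition Carg (z : C) : R :=
  if Rle_dec 0 (Im z) then acos (Re z / Cmod z) else - acos (Re z / Cmod z).

Definition Cln (z : C) : C := (ln (Cmod z), Carg z).

Definition Cexp (z : C) : C := (exp (Re z) * cos (Im z), exp (Re z) * sin (Im z)).

Definition Cpower (z : C) (s : R) : C := Cexp (RtoC s * Cln z)%C.

Definition CSeries (u : nat -> C) : C :=
  (Series (fun n => Re (u n)), Series (fun n => Im (u n))).

(** ** Gamma, psi, the Euler-Mascheroni constant, zeta *)

Fixpoint poch (x : R) (r : nat) : R :=
  match r with
  | O => 1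
  | S r' => poch x r' * (x + INR r')
  end.

(* Gauss's limit; unlike Euler's integral it is valid for every real x other
   than 0, -1, -2, ... *)
Definition Gamma (x : R) : R :=
  real (Lim_seq (fun n => INR (fact n) * Rpower (INR n) x / poch x (S n))).

Definition psi (x : R) : R := Derive Gamma x / Gamma x.

Definition euler_gamma : R :=
  real (Lim_seq (fun n => sum_n_m (fun k => / INR k) 1 n - ln (INR n))).

(* Zeta at real s <> 1. For s > 1 this is the Dirichlet series. The other
   branch is Hasse's series, the Euler transform of
   (1 - 2^(1-s)) zeta(s) = 1 - 2^(-s) + 3^(-s) - ...; it converges for every
   complex s, locally uniformly, and so gives the analytic continuation
   wherever 2^(1-s) <> 1, which for real s means s <> 1. *)
Definition zeta (s : R) : R :=
  if Rlt_dec 1 s then Series (fun k => Rpower (INR (S k)) (- s))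
  else / (1 - Rpower 2 (1 - s)) *
       Series (fun n => / 2 ^ S n *
         sum_n (fun k => (-1) ^ k * Binomial.C n k * Rpower (INR (S k)) (- s)) n).

(** ** Bessel functions *)

Definition BesselJ (nu x : R) : R :=
  Rpower (x / 2) nu *
  Series (fun r => (- (x ^ 2 / 4)) ^ r / (INR (fact r) * Gamma (nu + INR r + 1))).

Definition BesselI (nu : R) (z : C) : C :=
  (Cpower (z / 2) nu *
   CSeries (fun r => (z ^ 2 / 4) ^ r
                     / RtoC (INR (fact r) * Gamma (nu + INR r + 1))))%C.

(* Non-integer nu only: at integers the right-hand side is 0/0. *)
Definition BesselK (nu : R) (z : C) : C :=
  (RtoC (PI / 2) * (BesselI (- nu) z - BesselI nu z) / RtoC (sin (nu * PI)))%C.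

(** ** The sum and its expansion *)

Definition bessel_sum (b nu : R) (a : C) : C :=
  CSeries (fun m => let n := INR (S m) in
    (RtoC (Rpower n (- nu - 1)) * BesselK nu (RtoC (n * b) / a)
     / (RtoC (n ^ 2) + a ^ 2))%C).

(* F_k^(1)(mu; chi), used with mu = nu and mu = - nu. *)
Definition F1 (k : nat) (mu chi : R) : R :=
  sum_n (fun r => (- chi) ^ r / (poch (1 + mu) r * INR (fact r))) k.

Definition Rhat_term (nu gam chi : R) (a : C) (k : nat) : C :=
  (RtoC (1 / 2) * Cpower a (gam - 1) * RtoC (Rpower chi (nu / 2) * Gamma (- nu)) *
   RtoC ((-1) ^ k * zeta (1 - 2 * INR k) * F1 k nu chi) / a ^ (2 * k))%C.

Definition R_term (nu gam chi : R) (a : C) (k : nat) : C :=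
  (RtoC (1 / 2) * Cpower a (nu - 2) * RtoC (Rpower chi (- nu / 2) * Gamma nu) *
   RtoC ((-1) ^ k * zeta (- gam + nu - 2 * INR k) * F1 k (- nu) chi)
   / a ^ (2 * k))%C.

Definition Fchi (b nu chi : R) : R :=
  1 - Rpower chi (- nu / 2) * Gamma (1 + nu) * BesselJ nu b.

(* The product F(chi) F_*^(1), with the denominator F(chi) of F_*^(1)
   cancelled: F(chi) may vanish. *)
Definition FFstar (nu chi : R) : R :=
  chi / (1 + nu) *
  Series (fun j => let r := S j in
    (- chi) ^ r / (poch (2 + nu) r * poch 2 r) *
    (psi (2 + INR r) - psi 2 + psi (2 + nu + INR r) - psi (2 + nu))).

Definition Res1 (b nu gam chi : R) (a : C) : C :=
  (Cpower a (gam - 1) *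
   (RtoC (- ((PI / (2 * sin (PI * nu))) ^ 2 * BesselJ (- nu) b)) +
    RtoC (1 / 2 * Rpower chi (nu / 2) * Gamma (- nu)) *
    (Cln a +
     RtoC (euler_gamma +
           1 / 2 * (Fchi b nu chi * (psi 2 + psi (-1 - nu) - ln chi)
                    + FFstar nu chi)))))%C.

(* Main.v *)
(* Put h = 1/a and g(u) = u^(-nu-1) K_nu(bu) / (1+u^2); the sum is h^(nu+3) times S(h) = sum_n g(nh).

   The asymptotic shape comes from alternating sums: S(h) - 2 S(2h) = sum_n (-1)^(n-1) g(nh) is the value of
   Euler's transformation, which involves finite differences of g only, so it is small of high order on the
   remainder of the expansion of g at 0 and gives (1 - 2^(1+l)) zeta(-l) on each power u^l (Hasse).  Hence the
   difference E of h S(h) and its formal expansion satisfies E(h) - E(2h) = d + O(h^(2K)); as soon as E has a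
   limit q at 0, d = 0 and the dyadic sum gives E(h) = q + O(h^(2K)).

   The limit is found on the positive reals by comparing the sum with the integral: q = J + c gamma, where J is
   the Hadamard finite part of the integral of g over (0, oo) and c the coefficient of 1/u; other directions
   follow by differentiating in arg h, since with P(u) = u g(u) (singular powers removed) the derivative is a
   Riemann sum of P'.

   J is evaluated from 1/(1+u^2) = u^-2 - u^-4 + ... +- u^-2R +- u^-2R/(1+u^2): the powers against K_nu are
   finite parts of Mellin transforms of K at poles, and in the last term K_nu is replaced by the partial sums of
   its two power series, with an error O(4^-R).  The Mellin transforms are identified by a Bohr-Mollerup
   argument. *)

Require Import Defs.
From Stdlib Require Import Reals Factorial ZArith Lra Lia List ClassicalEpsilon.
From Stdlib Require Import ssreflect.
From Coquelicot Require Import Coquelicot.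
Import ListNotations.
Open Scope R_scope.

(** * Complex derivatives and elementary functions *)

(** The relation between E(h) and E(2h) cannot stand alone: every function of log2 h with period 1
    satisfies E(h) = E(2h). So a limit at 0 is needed in every direction, though without any rate.
    Non-integer exponents make the classical Euler-Maclaurin formula unsuitable at 0, whereas N-th
    differences are small on any function whose N-th derivative is O(|u|^(al - N)). Estimates of
    this symbol type are stable under products and hold on sectors Re z >= k |z|, where K decays
    exponentially. The exponent -1 is the one at which zeta(-l) has its pole; it is the source of ln
    a and of the Euler constant. The branch of K with u^(-nu) starts 2 nu orders earlier than the
    other one; with m the integer between nu and nu + 1, it is expanded m terms further than
    claimed, and the surplus joins the error. The analysis is reduced to real calculus along curves:
    improper integrals are limits of primitives, and special functions are identified by
    differential equations, recurrences and convexity instead of contour integrals. *)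

Lemma Cmod_le_abs (x y : R) : Cmod (x, y) <= Rabs x + Rabs y.
Proof.
rewrite /Cmod /=.
have Hx := Rabs_pos x; have Hy := Rabs_pos y.
apply: Rle_trans (sqrt_le_1_alt _ ((Rabs x + Rabs y)^2) _) _.
  have := Rsqr_abs x; have := Rsqr_abs y; rewrite /Rsqr; nra.
rewrite -Rsqr_pow2 sqrt_Rsqr; lra.
Qed.

Lemma Im_le_Cmod (z : C) : Rabs (Im z) <= Cmod z.
Proof.
apply: Rle_trans (Rmax_Cmod z); exact: Rmax_r.
Qed.

Lemma Cmod_eq_Re_Im (z : C) : Cmod z ^ 2 = Re z ^ 2 + Im z ^ 2.
Proof. exact: Cmod2_alt. Qed.

Lemma Re_mult (z w : C) : Re (z * w)%C = Re z * Re w - Im z * Im w.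
Proof. by []. Qed.
Lemma Im_mult (z w : C) : Im (z * w)%C = Re z * Im w + Im z * Re w.
Proof. by []. Qed.

Lemma C_eq (z w : C) : Re z = Re w -> Im z = Im w -> z = w.
Proof. case: z => a b; case: w => c d /= -> -> //. Qed.

Lemma Cmod_sub_sym (z w : C) : Cmod (z - w)%C = Cmod (w - z)%C.
Proof. rewrite -Cmod_opp; congr Cmod; ring. Qed.

Lemma Cmod_sub_triangle (z w : C) : Cmod z <= Cmod w + Cmod (z - w)%C.
Proof. rewrite {1}(_ : z = (w + (z - w))%C); [exact: Cmod_triangle | ring]. Qed.

Lemma RtoC_neq0 (x : R) : x <> 0 -> RtoC x <> 0%C.
Proof. by move=> h e; apply: h; apply: RtoC_inj. Qed.

Lemma Re_pos_neq0 (z : C) : 0 < Re z -> z <> 0%C.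
Proof. by move=> h e; move: h; rewrite e /=; lra. Qed.

Lemma Cmod_pos (z : C) : z <> 0%C -> 0 < Cmod z.
Proof. exact: (proj1 (Cmod_gt_0 z)). Qed.

Lemma Cmod_pos_neq0 (z : C) : 0 < Cmod z -> z <> 0%C.
Proof. exact: (proj2 (Cmod_gt_0 z)). Qed.

Lemma Re_pos_Cmod (z : C) : 0 < Re z -> 0 < Cmod z.
Proof. by move=> h; apply: Cmod_pos; apply: Re_pos_neq0. Qed.

(** The affine-approximation form makes products and compositions direct estimates; [Cder_CD] and
    [Cder_curve] are the links to real calculus. *)
Definition Cder (f : C -> C) (z l : C) : Prop :=
  forall eps : R, 0 < eps -> exists d : R, 0 < d /\
  forall w : C, Cmod (w - z)%C < d ->
  Cmod (f w - f z - l * (w - z))%C <= eps * Cmod (w - z)%C.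

Lemma Cder_lipschitz f z l : Cder f z l ->
  exists d : R, 0 < d /\ forall w, Cmod (w - z)%C < d ->
  Cmod (f w - f z)%C <= (Cmod l + 1) * Cmod (w - z)%C.
Proof.
move=> H; case: (H 1 Rlt_0_1) => d [d0 Hd]; exists d; split => // w /Hd h.
rewrite (_ : (f w - f z)%C = (l * (w - z) + (f w - f z - l * (w - z)))%C); last by ring.
apply: Rle_trans (Cmod_triangle _ _) _; rewrite Cmod_mult; lra.
Qed.

Lemma Cder_ext_loc f g z l r : 0 < r ->
  (forall w, Cmod (w - z)%C < r -> f w = g w) -> Cder f z l -> Cder g z l.
Proof.
move=> r0 E H eps e0; case: (H eps e0) => d [d0 Hd].
exists (Rmin d r); split; first by apply: Rmin_pos.
move=> w hw; have zz : Cmod (z - z)%C < r by rewrite (_ : (z - z)%C = 0%C); [rewrite Cmod_0 | ring].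
rewrite -!E //; last by apply: Rlt_le_trans hw (Rmin_r _ _).
apply: Hd; apply: Rlt_le_trans hw (Rmin_l _ _).
Qed.

Lemma Cder_ext f g z l : (forall w, f w = g w) -> Cder f z l -> Cder g z l.
Proof. move=> E; apply: (Cder_ext_loc _ _ _ _ 1); [lra|by move=> w _]. Qed.

Lemma Re_near (z w : C) : 0 < Re z -> Cmod (w - z)%C < Re z -> 0 < Re w.
Proof.
move=> h hw; have := re_le_Cmod (w - z)%C.
rewrite (_ : Re (w - z)%C = Re w - Re z) // => /Rabs_le_between; lra.
Qed.

Lemma Cder_ext_half f g z l : 0 < Re z ->
  (forall w, 0 < Re w -> f w = g w) -> Cder f z l -> Cder g z l.
Proof.
move=> h E; apply: (Cder_ext_loc _ _ _ _ (Re z)) => // w hw.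
by apply: E; apply: Re_near hw.
Qed.

Lemma Cder_const c z : Cder (fun _ => c) z 0%C.
Proof.
move=> e e0; exists 1; split; first lra.
move=> w _; rewrite (_ : (c - c - 0 * (w - z))%C = 0%C); last by ring.
rewrite Cmod_0; have := Cmod_ge_0 (w - z)%C; nra.
Qed.

Lemma Cder_id z : Cder (fun w => w) z 1%C.
Proof.
move=> e e0; exists 1; split; first lra.
move=> w _; rewrite (_ : (w - z - 1 * (w - z))%C = 0%C); last by ring.
rewrite Cmod_0; have := Cmod_ge_0 (w - z)%C; nra.
Qed.

Lemma Cder_plus f g z l m : Cder f z l -> Cder g z m ->
  Cder (fun w => f w + g w)%C z (l + m)%C.
Proof.
move=> Hf Hg e e0; case: (Hf (e/2)); first lra. move=> d1 [d10 H1].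
case: (Hg (e/2)); first lra. move=> d2 [d20 H2].
exists (Rmin d1 d2); split; first by apply: Rmin_pos.
move=> w hw; have h1 := H1 w (Rlt_le_trans _ _ _ hw (Rmin_l _ _)).
have h2 := H2 w (Rlt_le_trans _ _ _ hw (Rmin_r _ _)).
rewrite (_ : (_ - _ - _)%C = ((f w - f z - l * (w - z)) + (g w - g z - m * (w - z)))%C); last by ring.
apply: Rle_trans (Cmod_triangle _ _) _; lra.
Qed.

Lemma Cder_mult f g z l m : Cder f z l -> Cder g z m ->
  Cder (fun w => f w * g w)%C z (l * g z + f z * m)%C.
Proof.
move=> Hf Hg e e0.
have [d3 [d30 H3]] := Cder_lipschitz _ _ _ Hg.
set A := Cmod (g z) + Cmod m + 1; set B := Cmod l; set D := Cmod (f z).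
have A0 : 0 < A by rewrite /A; have := Cmod_ge_0 (g z); have := Cmod_ge_0 m; lra.
have B0 : 0 <= B by apply: Cmod_ge_0.
have D0 : 0 <= D by apply: Cmod_ge_0.
have m0 := Cmod_ge_0 m.
case: (Hf (e / (3 * A))); first by apply: Rdiv_lt_0_compat; lra.
move=> d1 [d10 H1].
case: (Hg (e / (3 * (D + 1)))); first by apply: Rdiv_lt_0_compat; lra.
move=> d2 [d20 H2].
set d4 := e / (3 * ((B + 1) * (Cmod m + 1))).
have d40 : 0 < d4 by apply: Rdiv_lt_0_compat; nra.
exists (Rmin (Rmin d1 d2) (Rmin (Rmin d3 1) d4)); split.
  by repeat apply: Rmin_pos => //; lra.
move=> w hw.
have w1 : Cmod (w - z)%C < d1 by apply: Rlt_le_trans hw _; apply: Rle_trans (Rmin_l _ _) _; apply: Rmin_l.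
have w2 : Cmod (w - z)%C < d2 by apply: Rlt_le_trans hw _; apply: Rle_trans (Rmin_l _ _) _; apply: Rmin_r.
have w3 : Cmod (w - z)%C < d3 by apply: Rlt_le_trans hw _; apply: Rle_trans (Rmin_r _ _) _; apply: Rle_trans (Rmin_l _ _) _; apply: Rmin_l.
have w5 : Cmod (w - z)%C < 1 by apply: Rlt_le_trans hw _; apply: Rle_trans (Rmin_r _ _) _; apply: Rle_trans (Rmin_l _ _) _; apply: Rmin_r.
have w4 : Cmod (w - z)%C < d4 by apply: Rlt_le_trans hw _; apply: Rle_trans (Rmin_r _ _) _; apply: Rmin_r.
have h1 := H1 w w1; have h2 := H2 w w2; have h3 := H3 w w3.
set t := Cmod (w - z)%C in hw w1 w2 w3 w4 w5 h1 h2 h3 *.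
have t0 : 0 <= t by apply: Cmod_ge_0.
rewrite (_ : (_ - _ - _)%C = ((f w - f z - l * (w - z)) * g w + l * (w - z) * (g w - g z) + f z * (g w - g z - m * (w - z)))%C); last by ring.
apply: Rle_trans (Cmod_triangle _ _) _.
apply: Rle_trans (Rplus_le_compat_r _ _ _ (Cmod_triangle _ _)) _.
rewrite !Cmod_mult -/t -/B -/D.
have gw : Cmod (g w) <= A.
  apply: Rle_trans (Cmod_sub_triangle (g w) (g z)) _; rewrite /A; nra.
have p1 : Cmod (f w - f z - l * (w - z))%C * Cmod (g w) <= e / 3 * t.
  apply: Rle_trans (Rmult_le_compat _ _ _ _ (Cmod_ge_0 _) (Cmod_ge_0 _) h1 gw) _.
  right; field; lra.
have p2 : B * t * Cmod (g w - g z)%C <= e / 3 * t.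
  have : B * t * Cmod (g w - g z)%C <= B * t * ((Cmod m + 1) * t).
    apply: Rmult_le_compat_l => //; nra.
  have : d4 * (3 * ((B + 1) * (Cmod m + 1))) = e by rewrite /d4; field; nra.
  move=> E1 E2; apply: Rle_trans E2 _.
  have : B * (Cmod m + 1) * t <= e / 3.
    have : (B + 1) * (Cmod m + 1) * t <= (B + 1) * (Cmod m + 1) * d4.
      by apply: Rmult_le_compat_l; [nra | lra].
    have : 0 <= (Cmod m + 1) * t by nra.
    nra.
  nra.
have p3 : D * Cmod (g w - g z - m * (w - z))%C <= e / 3 * t.
  apply: (Rle_trans _ ((D + 1) * (e / (3 * (D + 1)) * t))).
    apply: Rmult_le_compat => //; [exact: Cmod_ge_0 | lra].
  right; field; lra.
lra.
Qed.

Lemma Cder_scal c f z l : Cder f z l -> Cder (fun w => c * f w)%C z (c * l)%C.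
Proof.
move=> H; have := Cder_mult _ _ _ _ _ (Cder_const c z) H.
by rewrite (_ : (0 * f z + c * l)%C = (c * l)%C); last by ring.
Qed.

Lemma Cder_comp f g z l m : Cder g z m -> Cder f (g z) l ->
  Cder (fun w => f (g w)) z (l * m)%C.
Proof.
move=> Hg Hf e e0.
have [d3 [d30 H3]] := Cder_lipschitz _ _ _ Hg.
have m0 := Cmod_ge_0 m; have l0 := Cmod_ge_0 l.
case: (Hf (e / (2 * (Cmod m + 1)))); first by apply: Rdiv_lt_0_compat; lra.
move=> d1 [d10 H1].
case: (Hg (e / (2 * (Cmod l + 1)))); first by apply: Rdiv_lt_0_compat; lra.
move=> d2 [d20 H2].
set d4 := d1 / (Cmod m + 1).
have d40 : 0 < d4 by apply: Rdiv_lt_0_compat; lra.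
exists (Rmin (Rmin d3 d2) d4); split; first by repeat apply: Rmin_pos.
move=> w hw.
have w3 : Cmod (w - z)%C < d3 by apply: Rlt_le_trans hw _; apply: Rle_trans (Rmin_l _ _) _; apply: Rmin_l.
have w2 : Cmod (w - z)%C < d2 by apply: Rlt_le_trans hw _; apply: Rle_trans (Rmin_l _ _) _; apply: Rmin_r.
have w4 : Cmod (w - z)%C < d4 by apply: Rlt_le_trans hw _; apply: Rmin_r.
have h3 := H3 w w3; have h2 := H2 w w2.
have wg : Cmod (g w - g z)%C < d1.
  apply: Rle_lt_trans h3 _.
  have : d4 * (Cmod m + 1) = d1 by rewrite /d4; field; lra.
  nra.
have h1 := H1 _ wg.
set t := Cmod (w - z)%C in h2 h3 *.
rewrite (_ : (_ - _ - _)%C = ((f (g w) - f (g z) - l * (g w - g z)) + l * (g w - g z - m * (w - z)))%C); last by ring.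
apply: Rle_trans (Cmod_triangle _ _) _; rewrite Cmod_mult.
have p1 : Cmod (f (g w) - f (g z) - l * (g w - g z))%C <= e / 2 * t.
  apply: Rle_trans h1 _.
  apply: (Rle_trans _ (e / (2 * (Cmod m + 1)) * ((Cmod m + 1) * t))).
    apply: Rmult_le_compat_l h3; apply: Rlt_le; apply: Rdiv_lt_0_compat; lra.
  right; field; lra.
have p2 : Cmod l * Cmod (g w - g z - m * (w - z))%C <= e / 2 * t.
  apply: (Rle_trans _ ((Cmod l + 1) * (e / (2 * (Cmod l + 1)) * t))).
    apply: Rmult_le_compat => //; [exact: Cmod_ge_0 | lra].
  right; field; lra.
lra.
Qed.

Lemma Cder_inv (z : C) : z <> 0%C -> Cder (fun w => / w)%C z (- (/ z * / z))%C.
Proof.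
move=> z0 e e0; have mz := Cmod_pos _ z0.
set d4 := e * (Cmod z * (Cmod z * Cmod z)) / 2.
have zz : 0 < Cmod z * (Cmod z * Cmod z) by repeat apply: Rmult_lt_0_compat.
have d40 : 0 < d4 by apply: Rdiv_lt_0_compat; [apply: Rmult_lt_0_compat|lra].
exists (Rmin (Cmod z / 2) d4); split; first by apply: Rmin_pos; lra.
move=> w hw.
have w1 : Cmod (w - z)%C < Cmod z / 2 by apply: Rlt_le_trans hw _; apply: Rmin_l.
have w2 : Cmod (w - z)%C < d4 by apply: Rlt_le_trans hw _; apply: Rmin_r.
have mw : Cmod z / 2 < Cmod w.
  have := Cmod_sub_triangle z w; rewrite Cmod_sub_sym; lra.
have w0 : w <> 0%C by apply: Cmod_pos_neq0; lra.
rewrite (_ : (_ - _ - _)%C = ((w - z) * (w - z) * / (w * (z * z)))%C); last by field; split.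
have nz : (w * (z * z))%C <> 0%C by repeat apply: Cmult_neq_0.
rewrite !Cmod_mult Cmod_inv // !Cmod_mult.
set t := Cmod (w - z)%C in w2 *.
have t0 : 0 <= t by apply: Cmod_ge_0.
rewrite (Rmult_comm e) Rmult_assoc; apply: Rmult_le_compat_l => //.
have wzz : 0 < Cmod w * (Cmod z * Cmod z) by repeat apply: Rmult_lt_0_compat; lra.
apply: (Rmult_le_reg_r (Cmod w * (Cmod z * Cmod z))) => //.
rewrite Rmult_assoc Rinv_l; last lra.
have : Cmod z / 2 * (Cmod z * Cmod z) <= Cmod w * (Cmod z * Cmod z) by nra.
move=> hh; have : e * (Cmod z / 2 * (Cmod z * Cmod z)) <= e * (Cmod w * (Cmod z * Cmod z)) by nra.
rewrite /d4 in w2; lra.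
Qed.

Lemma Cder_eq f g z l m : Cder f z l -> (forall w, f w = g w) -> l = m -> Cder g z m.
Proof. by move=> H E <-; apply: Cder_ext H. Qed.

(** * Derivatives along real curves and mean value inequalities *)

Definition CD (f : R -> C) (t : R) (l : C) : Prop :=
  is_derive (fun s => Re (f s)) t (Re l) /\ is_derive (fun s => Im (f s)) t (Im l).

Lemma is_derive_eps (f : R -> R) (t l : R) :
  (forall eps, 0 < eps -> exists d, 0 < d /\ forall s, Rabs (s - t) < d ->
    Rabs (f s - f t - l * (s - t)) <= eps * Rabs (s - t)) -> is_derive f t l.
Proof.
move=> H; split; first exact: is_linear_scal_l.
move=> x Hx; have <- : t = x by apply: is_filter_lim_locally_unique.
move=> eps; case: (H eps (cond_pos eps)) => d [d0 Hd].
exists (mkposreal d d0) => s Hs; have := Hd s Hs.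
rewrite /minus /plus /opp /scal /= /mult /= /norm /= /abs /=.
by rewrite (_ : f s + - f t + - ((s + - t) * l) = f s - f t - l * (s - t)); last by ring.
Qed.

Lemma Cder_CD f z d t l : Cder f (z + RtoC t * d)%C l ->
  CD (fun s => f (z + RtoC s * d)%C) t (l * d)%C.
Proof.
move=> H.
have md := Cmod_ge_0 d.
have K : forall eps, 0 < eps -> exists e, 0 < e /\ forall s, Rabs (s - t) < e ->
  Cmod (f (z + RtoC s * d) - f (z + RtoC t * d) - l * d * RtoC (s - t))%C <= eps * Rabs (s - t).
  move=> eps e0; case: (H (eps / (Cmod d + 1))); first by apply: Rdiv_lt_0_compat; lra.
  move=> r [r0 Hr]; exists (r / (Cmod d + 1)); split; first by apply: Rdiv_lt_0_compat; lra.
  move=> s hs.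
  have E : ((z + RtoC s * d) - (z + RtoC t * d))%C = (RtoC (s - t) * d)%C by rewrite RtoC_minus; ring.
  have hs' : Rabs (s - t) * (Cmod d + 1) < r.
    have := Rmult_lt_compat_r (Cmod d + 1) _ _ ltac:(lra) hs.
    by rewrite (_ : r / (Cmod d + 1) * (Cmod d + 1) = r) //; field; lra.
  have a0 := Rabs_pos (s - t).
  have := Hr (z + RtoC s * d)%C; rewrite E Cmod_mult Cmod_R => /(_ ltac:(nra)).
  rewrite (_ : (l * (RtoC (s - t) * d) = l * d * RtoC (s - t))%C); last by ring.
  move=> h; apply: Rle_trans h _.
  rewrite (Rmult_comm (Rabs _)) -Rmult_assoc; apply: Rmult_le_compat_r => //.
  rewrite /Rdiv Rmult_assoc -{2}(Rmult_1_r eps); apply: Rmult_le_compat_l; first lra.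
  apply: (Rmult_le_reg_l (Cmod d + 1)); first lra.
  rewrite -Rmult_assoc Rinv_r; lra.
split; apply: is_derive_eps => eps e0; case: (K eps e0) => e [e1 He]; exists e; split => // s hs;
  apply: Rle_trans (He s hs).
- apply: Rle_trans (re_le_Cmod _); right; congr Rabs; move: (f _) (f _) => A B; rewrite /Re /Im /=; ring.
- apply: Rle_trans (Im_le_Cmod _); right; congr Rabs; move: (f _) (f _) => A B; rewrite /Re /Im /=; ring.
Qed.

Lemma MVT_le (f f' : R -> R) a b : a <= b ->
  (forall t, a <= t <= b -> is_derive f t (f' t)) ->
  (forall t, a <= t <= b -> 0 <= f' t) -> f a <= f b.
Proof.
move=> ab H P; case: (Req_dec a b) => [->|ne]; first lra.
case: (MVT_gen f a b f').
- move=> x; rewrite Rmin_left // Rmax_right // => hx; apply: H; lra.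
- move=> x; rewrite Rmin_left // Rmax_right // => hx.
  by apply/continuity_pt_filterlim; apply: ex_derive_continuous; exists (f' x); apply: H.
move=> c; rewrite Rmin_left // Rmax_right // => -[hc E].
have := P c hc; nra.
Qed.

(** Projecting on the unit vector (p, q) in the direction of f b - f a reduces the inequality to the
    monotonicity of the real function G - (p Re f + q Im f). *)
Lemma CD_mean (f f' : R -> C) (G g : R -> R) a b : a <= b ->
  (forall t, a <= t <= b -> CD f t (f' t)) ->
  (forall t, a <= t <= b -> is_derive G t (g t)) ->
  (forall t, a <= t <= b -> Cmod (f' t) <= g t) ->
  Cmod (f b - f a)%C <= G b - G a.
Proof.
move=> ab Hf HG Hle.
case: (Req_dec (Cmod (f b - f a)%C) 0) => [->|nz].
  have : G a <= G b; last lra.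
  apply: (MVT_le G g) => // t ht; apply: Rle_trans (Hle t ht); exact: Cmod_ge_0.
set m := Cmod _ in nz *.
set p := Re (f b - f a)%C / m; set q := Im (f b - f a)%C / m.
have pq : p ^ 2 + q ^ 2 = 1.
  rewrite /p /q; have := Cmod_eq_Re_Im (f b - f a)%C; rewrite -/m => E.
  apply: (Rmult_eq_reg_r (m ^ 2)); last by apply: pow_nonzero.
  rewrite Rmult_1_l {2}E; field; lra.
have E : m = p * (Re (f b) - Re (f a)) + q * (Im (f b) - Im (f a)).
  have := Cmod_eq_Re_Im (f b - f a)%C; rewrite -/m /p /q => E.
  change (m = Re (f b - f a)%C / m * Re (f b - f a)%C + Im (f b - f a)%C / m * Im (f b - f a)%C).
  transitivity ((Re (f b - f a)%C ^ 2 + Im (f b - f a)%C ^ 2) / m); last by field.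
  rewrite -E; field; lra.
have := MVT_le (fun t => G t - (p * Re (f t) + q * Im (f t)))
  (fun t => g t - (p * Re (f' t) + q * Im (f' t))) a b ab.
have H1 : forall t, a <= t <= b -> is_derive (fun t => G t - (p * Re (f t) + q * Im (f t))) t
  (g t - (p * Re (f' t) + q * Im (f' t))).
  move=> t ht; case: (Hf t ht) => h1 h2; have h3 := HG t ht.
  apply: (is_derive_minus G (fun t => p * Re (f t) + q * Im (f t))) => //.
  apply: (is_derive_plus (fun t => p * Re (f t)) (fun t => q * Im (f t))); by apply: is_derive_scal.
move=> /(_ H1) K; have : G a - (p * Re (f a) + q * Im (f a)) <= G b - (p * Re (f b) + q * Im (f b)).
  apply: K => t ht; have := Hle t ht; set w := f' t.
  have : p * Re w + q * Im w <= Cmod w.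
    have h := Cmod_eq_Re_Im w; have h0 := Cmod_ge_0 w.
    apply: Rsqr_incr_0_var => //; rewrite /Rsqr.
    have : (p * Im w - q * Re w) ^ 2 >= 0 by have := pow2_ge_0 (p * Im w - q * Re w); lra.
    have : (p ^ 2 + q ^ 2) * (Re w ^ 2 + Im w ^ 2) = Re w ^ 2 + Im w ^ 2 by rewrite pq; ring.
    nra.
  lra.
rewrite E; nra.
Qed.

Lemma Cder_mean f f' z d B :
  (forall t, 0 <= t <= 1 -> Cder f (z + RtoC t * d)%C (f' (z + RtoC t * d)%C)) ->
  (forall t, 0 <= t <= 1 -> Cmod (f' (z + RtoC t * d)%C) <= B) ->
  Cmod (f (z + d) - f z)%C <= B * Cmod d.
Proof.
move=> H1 H2.
have := CD_mean (fun s => f (z + RtoC s * d)%C) (fun s => f' (z + RtoC s * d)%C * d)%C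
  (fun s => B * Cmod d * s) (fun _ => B * Cmod d) 0 1 ltac:(lra).
rewrite (_ : (z + RtoC 1 * d = z + d)%C); last by ring.
rewrite (_ : (z + RtoC 0 * d = z)%C); last by ring.
move=> h; apply: (Rle_trans _ _ _ (h _ _ _)).
- by move=> t ht; apply: Cder_CD; apply: H1.
- move=> t _; move: (B * Cmod d) => c; auto_derive => //=; exact: Rmult_1_r.
- move=> t ht; rewrite Cmod_mult; apply: Rmult_le_compat_r; [exact: Cmod_ge_0|exact: H2].
- lra.
Qed.

(** * The complex exponential *)

Lemma Cexp_plus z w : Cexp (z + w)%C = (Cexp z * Cexp w)%C.
Proof.
apply: C_eq; rewrite /Cexp /Re /Im /= exp_plus ?cos_plus ?sin_plus; ring.
Qed.

Lemma Cexp_RtoC x : Cexp (RtoC x) = RtoC (exp x).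
Proof. apply: C_eq; rewrite /Cexp /= ?cos_0 ?sin_0; ring. Qed.

Lemma Cexp_0 : Cexp 0%C = 1%C.
Proof. by rewrite Cexp_RtoC exp_0. Qed.

Lemma Cmod_Cexp z : Cmod (Cexp z) = exp (Re z).
Proof.
have e0 := exp_pos (Re z).
have := Cmod_eq_Re_Im (Cexp z); rewrite /Cexp => E.
apply: Rsqr_inj; [exact: Cmod_ge_0|lra|].
rewrite !Rsqr_pow2 E /=; have := sin2_cos2 (Im z); rewrite /Rsqr => h.
transitivity (exp (Re z) * exp (Re z) * (sin (Im z) * sin (Im z) + cos (Im z) * cos (Im z))); first ring.
rewrite h; ring.
Qed.

Lemma Cexp_neq0 z : Cexp z <> 0%C.
Proof. apply: Cmod_pos_neq0; rewrite Cmod_Cexp; exact: exp_pos. Qed.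

Lemma exp_lin x : x <= 1/2 -> Rabs (exp x - 1 - x) <= 2 * x ^ 2.
Proof.
move=> hx; have l : 0 <= exp x - 1 - x by have := exp_ineq1_le x; lra.
rewrite Rabs_pos_eq //.
have m : exp x * (1 - x) <= 1.
  have := exp_ineq1_le (- x); rewrite exp_Ropp => h; have p := exp_pos x.
  have := Rmult_le_compat_l _ _ _ (Rlt_le _ _ p) h; rewrite Rinv_r; lra.
have : (exp x - 1 - x - 2 * x ^ 2) * (1 - x) <= 0.
  have := pow2_ge_0 x; nra.
nra.
Qed.

Lemma cos_lin y : Rabs (cos y - 1) <= y ^ 2.
Proof.
have [-> |h] : cos y = 1 - 2 * (sin (y/2)) ^ 2 \/ False.
- left; rewrite {1}(_ : y = 2 * (y/2)); last field.
  rewrite cos_2a_sin /=; ring.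
- have : Rabs (sin (y/2)) <= Rabs (y/2).
    have := bounded_variation sin cos 1 0 (y/2); rewrite sin_0 !Rminus_0_r Rmult_1_l; apply=> t _.
    split; [exact: is_derive_sin | by have := COS_bound t; split_Rabs; lra].
  move=> h; rewrite (_ : 1 - _ - 1 = - (2 * (sin (y/2))^2)); last by ring.
  rewrite Rabs_Ropp Rabs_pos_eq; last by have := pow2_ge_0 (sin (y/2)); lra.
  have : (sin (y/2))^2 <= (y/2)^2; last by have := pow2_ge_0 y; lra.
  rewrite -!Rsqr_pow2; exact: Rsqr_le_abs_1.
- by [].
Qed.

Lemma sin_lin y : Rabs (sin y - y) <= Rabs y ^ 3.
Proof.
have := bounded_variation (fun t => sin t - t) (fun t => cos t - 1) (y^2) 0 y.
rewrite sin_0 !Rminus_0_r => h; apply: Rle_trans (h _) _.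
  move=> t; rewrite Rminus_0_r => ht; split; first by auto_derive => //; ring.
  apply: Rle_trans (cos_lin t) _; rewrite -!Rsqr_pow2; exact: Rsqr_le_abs_1.
right; rewrite -(pow2_abs y); ring.
Qed.

Lemma Cexp_lin z : Cmod z <= 1/2 -> Cmod (Cexp z - 1 - z)%C <= 6 * Cmod z ^ 2.
Proof.
move=> hz; case: z hz => x y hz.
have E := Cmod_eq_Re_Im (x, y); rewrite /= in E.
have hx : Rabs x <= 1/2 by apply: Rle_trans hz; exact: (re_le_Cmod (x, y)).
have hy : Rabs y <= 1/2 by apply: Rle_trans hz; exact: (Im_le_Cmod (x, y)).
have x1 : x <= 1/2 by move: hx => /Rabs_le_between; lra.
have h1 := exp_lin x x1; have h2 := cos_lin y; have h3 := sin_lin y.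
apply: Rle_trans (Cmod_le_abs _ _) _ => /=.
have c1 : Rabs (cos y) <= 1 by have := COS_bound y; split_Rabs; lra.
have s1 : Rabs (sin y) <= Rabs y + Rabs y ^ 3.
  have := Rabs_triang (sin y - y) y; rewrite (_ : sin y - y + y = sin y); [lra|ring].
have y0 := Rabs_pos y; have x0 := Rabs_pos x.
have ex : Rabs (exp x - 1) <= 2 * Rabs x.
  have := Rabs_triang (exp x - 1 - x) x; rewrite (_ : exp x - 1 - x + x = exp x - 1); last ring.
  rewrite -(pow2_abs x) in h1; nra.
have E1 : Rabs (exp x * cos y + - (1) + - x) <= 2 * x^2 + 2 * y^2.
  rewrite (_ : _ + _ + _ = (exp x - 1 - x) * cos y + (1 + x) * (cos y - 1)); last by ring.
  apply: Rle_trans (Rabs_triang _ _) _; rewrite !Rabs_mult.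
  have : Rabs (1 + x) <= 2 by move: hx => /Rabs_le_between h; apply/Rabs_le_between; lra.
  have := Rabs_pos (exp x - 1 - x); have := Rabs_pos (cos y - 1); have := Rabs_pos (1 + x); nra.
have E2 : Rabs (exp x * sin y + - 0 + - y) <= 4 * x^2 + 4 * y^2.
  rewrite (_ : _ + _ + _ = (exp x - 1) * sin y + (sin y - y)); last by ring.
  apply: Rle_trans (Rabs_triang _ _) _; rewrite !Rabs_mult.
  have y3 : Rabs y ^ 3 <= Rabs y * (1/2).
    rewrite (_ : Rabs y ^ 3 = Rabs y * (Rabs y * Rabs y)); last by ring.
    by apply: Rmult_le_compat_l => //; nra.
  have y3' : Rabs y ^ 3 <= y ^ 2 / 2.
    rewrite -(pow2_abs y) (_ : Rabs y ^ 3 = Rabs y ^ 2 * Rabs y); last by ring.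
    have := pow2_ge_0 (Rabs y); nra.
  have p := Rabs_pos (exp x - 1).
  have : Rabs (exp x - 1) * Rabs (sin y) <= (2 * Rabs x) * (2 * Rabs y).
    apply: Rmult_le_compat => //; [exact: Rabs_pos | lra].
  have := pow2_ge_0 (Rabs x - Rabs y); rewrite -(pow2_abs x) -(pow2_abs y); nra.
move: E1 E2; rewrite E; lra.
Qed.

(** Serves wherever a derivative comes from an explicit second-order bound: the exponential, the
    logarithm, power series, integrals with a parameter. *)
Lemma Cder_quadratic f z l r B : 0 < r -> 
  (forall w, Cmod (w - z)%C < r -> Cmod (f w - f z - l * (w - z))%C <= B * Cmod (w - z)%C ^ 2) ->
  Cder f z l.
Proof.
move=> r0 H e e0; have b1 : 0 < Rabs B + 1 by have := Rabs_pos B; lra.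
have er : 0 < e / (Rabs B + 1) by apply: Rdiv_lt_0_compat.
exists (Rmin r (e / (Rabs B + 1))); split; first by apply: Rmin_pos.
move=> w hw; apply: Rle_trans (H w (Rlt_le_trans _ _ _ hw (Rmin_l _ _))) _.
have h2 := Rlt_le_trans _ _ _ hw (Rmin_r _ _).
set t := Cmod _ in h2 *; have t0 : 0 <= t by apply: Cmod_ge_0.
have : B <= Rabs B + 1 by have := Rle_abs B; lra.
have : t * (Rabs B + 1) <= e.
  have := Rmult_lt_compat_r _ _ _ b1 h2; rewrite (_ : e / (Rabs B + 1) * (Rabs B + 1) = e); [lra|field; lra].
move=> h3 h4; apply: (Rle_trans _ ((Rabs B + 1) * t * t)); [|nra].
rewrite /= Rmult_1_r -Rmult_assoc; apply: Rmult_le_compat_r => //; nra.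
Qed.

Lemma Cder_Cexp z : Cder Cexp z (Cexp z).
Proof.
apply: (Cder_quadratic _ _ _ (1/2) (Cmod (Cexp z) * 6)); first lra.
move=> w hw.
rewrite {1}(_ : w = (z + (w - z))%C); last by ring.
rewrite Cexp_plus (_ : (_ - _ - _)%C = (Cexp z * (Cexp (w - z) - 1 - (w - z)))%C); last by ring.
rewrite Cmod_mult Rmult_assoc; apply: Rmult_le_compat_l; first exact: Cmod_ge_0.
apply: Cexp_lin; lra.
Qed.

(** * Argument, logarithm and real powers on the right half-plane *)

Lemma Cmod_atan (z : C) : 0 < Re z ->
  Cmod z = Re z * sqrt (1 + (Im z / Re z) ^ 2).
Proof.
move=> h; have := Cmod_eq_Re_Im z => E.
rewrite -{1}(sqrt_pow2 (Cmod z)) ?E; last exact: Cmod_ge_0.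
rewrite -{2}(sqrt_pow2 (Re z)); last lra.
rewrite -sqrt_mult; [|exact: pow2_ge_0|have := pow2_ge_0 (Im z / Re z); lra].
congr sqrt; field; lra.
Qed.

(** The arctangent is smooth across the positive axis, where the two branches in the definition of
    [Carg] meet. *)
Lemma Carg_atan (z : C) : 0 < Re z -> Carg z = atan (Im z / Re z).
Proof.
move=> h.
set u := Im z / Re z.
have s0 : 0 < sqrt (1 + u ^ 2) by apply: sqrt_lt_R0; have := pow2_ge_0 u; lra.
have -> : Carg z = match Rle_dec 0 (Im z) with left _ => acos (cos (atan u)) | right _ => - acos (cos (atan u)) end.
  rewrite /Carg cos_atan (_ : Re z / Cmod z = 1 / sqrt (1 + u²)) //.
  rewrite Rsqr_pow2 Cmod_atan // -/u; field; lra.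
have [a1 a2] := atan_bound u.
case: (Rle_dec 0 (Im z)) => hz.
  have : 0 <= atan u.
    case: (Req_dec (Im z) 0) => [E|ne].
      by rewrite /u E /Rdiv Rmult_0_l atan_0; lra.
    left; rewrite -atan_0; apply: atan_increasing; apply: Rdiv_lt_0_compat; lra.
  move=> ?; apply: acos_cos; lra.
have : atan u < 0.
  rewrite -atan_0; apply: atan_increasing; rewrite /u.
  have : 0 < - Im z / Re z by apply: Rdiv_lt_0_compat; lra.
  rewrite /Rdiv Ropp_mult_distr_l_reverse; lra.
move=> ?; rewrite -cos_neg acos_cos; lra.
Qed.

Lemma Carg_bound (z : C) : 0 < Re z -> - PI / 2 < Carg z < PI / 2.
Proof. by move=> h; rewrite Carg_atan //; exact: atan_bound. Qed.

Lemma Cexp_Cln (z : C) : 0 < Re z -> Cexp (Cln z) = z.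
Proof.
move=> h; have m0 := Re_pos_Cmod z h.
set u := Im z / Re z.
have s0 : 0 < sqrt (1 + u ^ 2) by apply: sqrt_lt_R0; have := pow2_ge_0 u; lra.
apply: C_eq; rewrite /Cexp /Cln /= exp_ln // Carg_atan // -/u ?cos_atan ?sin_atan ?Rsqr_pow2 Cmod_atan // -/u.
  by field; lra.
rewrite (_ : Re z * sqrt (1 + u ^ 2) * (u / sqrt (1 + u ^ 2)) = Re z * u); last by field; lra.
rewrite /u; field; lra.
Qed.

(** A rough bound is all that has to be extracted from modulus and argument; [Cder_Cln] improves it
    to a derivative. *)
Lemma Cln_lipschitz (z : C) : 0 < Re z -> exists A, 0 < A /\
  forall w, Cmod (w - z)%C < Re z / 2 -> Cmod (Cln w - Cln z)%C <= A * Cmod (w - z)%C.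
Proof.
move=> h; have m0 := Re_pos_Cmod z h.
exists (4 * / Re z + 4 * Cmod z / (Re z * Re z)); split.
  have : 0 < / Re z by apply: Rinv_0_lt_compat.
  have : 0 < 4 * Cmod z / (Re z * Re z) by apply: Rdiv_lt_0_compat; nra.
  lra.
move=> w hw; have hzm : Re z <= Cmod z by apply: Rle_trans (Rle_abs _) (re_le_Cmod z).
have dR := re_le_Cmod (w - z)%C; have dI := Im_le_Cmod (w - z)%C.
change (Re (w - z)%C) with (Re w - Re z) in dR; change (Im (w - z)%C) with (Im w - Im z) in dI.
set t := Cmod (w - z)%C in hw dR dI *.
have rw : Re z / 2 < Re w by move: (dR) => /Rabs_le_between; lra.
have hwp : 0 < Re w by lra.
have mw := Re_pos_Cmod w hwp.
have mwz : Cmod w <= Cmod z + t by apply: Cmod_sub_triangle.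
have mzw : Cmod z <= Cmod w + t by rewrite /t Cmod_sub_sym; apply: Cmod_sub_triangle.
have L : forall a b, 0 < a -> 0 < b -> ln b - ln a <= (b - a) / a.
  move=> a b a0 b0; have := exp_ineq1_le (ln b - ln a).
  rewrite exp_plus exp_Ropp !exp_ln // => h1.
  rewrite (_ : (b - a) / a = b * / a - 1); [lra | field; lra].
rewrite (_ : (Cln w - Cln z)%C = (ln (Cmod w) - ln (Cmod z), Carg w - Carg z)); last by apply: C_eq.
apply: Rle_trans (Cmod_le_abs _ _) _; rewrite Rmult_plus_distr_r; apply: Rplus_le_compat.
  have h1 := L _ _ m0 mw; have h2 := L _ _ mw m0.
  have q1 : (Cmod w - Cmod z) / Cmod z <= 4 * / Re z * t.
    apply: (Rmult_le_reg_r (Cmod z)) => //; rewrite /Rdiv Rmult_assoc Rinv_l; last lra.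
    rewrite Rmult_1_r; apply: (Rle_trans _ (4 * / Re z * t * Re z)).
      have -> : 4 * / Re z * t * Re z = 4 * t by field; lra.
      lra.
    apply: Rmult_le_compat_l => //; have : 0 < / Re z by apply: Rinv_0_lt_compat.
    nra.
  have q2 : (Cmod z - Cmod w) / Cmod w <= 4 * / Re z * t.
    apply: (Rmult_le_reg_r (Cmod w)) => //; rewrite /Rdiv Rmult_assoc Rinv_l; last lra.
    rewrite Rmult_1_r; apply: (Rle_trans _ (4 * / Re z * t * (Re z / 2))).
      have -> : 4 * / Re z * t * (Re z / 2) = 2 * t by field; lra.
      lra.
    apply: Rmult_le_compat_l; last lra; have : 0 < / Re z by apply: Rinv_0_lt_compat.
    nra.
  apply/Rabs_le_between; lra.
rewrite !Carg_atan //.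
have := bounded_variation atan (fun x => / (1 + x ^ 2)) 1 (Im z / Re z) (Im w / Re w).
rewrite Rmult_1_l => B; apply: Rle_trans (B _) _.
  move=> x _; split.
    apply: (proj2 (is_derive_Reals _ _ _)).
    exact: derivable_pt_lim_atan.
  have p : 1 <= 1 + x ^ 2 by have := pow2_ge_0 x; lra.
  rewrite Rabs_pos_eq; last by left; apply: Rinv_0_lt_compat; lra.
  rewrite -Rinv_1; apply: Rinv_le_contravar; lra.
rewrite (_ : Im w / Re w - Im z / Re z = ((Im w - Im z) * Re z - Im z * (Re w - Re z)) * / (Re w * Re z)); last by field; lra.
have iz := Im_le_Cmod z.
rewrite Rabs_mult (Rabs_pos_eq (/ _)); last by left; apply: Rinv_0_lt_compat; nra.
have wz : 0 < Re w * Re z by nra.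
apply: (Rle_trans _ (t * (2 * Cmod z) * / (Re z * Re z / 2))).
  apply: Rmult_le_compat; [exact: Rabs_pos|left; exact: Rinv_0_lt_compat| |].
    apply: Rle_trans (Rabs_triang _ _) _; rewrite Rabs_Ropp !Rabs_mult (Rabs_pos_eq (Re z)); last lra.
    have := Rabs_pos (Im z); have := Rabs_pos (Im w - Im z); have := Rabs_pos (Re w - Re z); nra.
  apply: Rinv_le_contravar; nra.
right; field; lra.
Qed.

(** The logarithm is differentiated as an inverse function: with d = ln w - ln z one has w - z = z
    (e^d - 1), and the Lipschitz bound turns the error O(|d|^2) into O(|w - z|^2). *)
Lemma Cder_Cln (z : C) : 0 < Re z -> Cder Cln z (/ z)%C.
Proof.
move=> h; have nz := Re_pos_neq0 z h.
have [A [A0 HA]] := Cln_lipschitz z h.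
apply: (Cder_quadratic _ _ _ (Rmin (Re z / 2) (/ (2 * A))) (6 * A ^ 2)).
  apply: Rmin_pos; [lra | apply: Rinv_0_lt_compat; lra].
move=> w hw; have h1 := Rlt_le_trans _ _ _ hw (Rmin_l _ _); have h2 := Rlt_le_trans _ _ _ hw (Rmin_r _ _).
have wp : 0 < Re w by apply: (Re_near z w) => //; lra.
have hd := HA w h1; set t := Cmod (w - z)%C in h2 hd *.
set d := (Cln w - Cln z)%C in hd *.
have E : (w - z = z * (Cexp d - 1))%C.
  rewrite -{1}(Cexp_Cln w) // (_ : Cln w = (Cln z + d)%C); last by rewrite /d; ring.
  rewrite Cexp_plus Cexp_Cln //; ring.
rewrite (_ : (d - / z * (w - z))%C = (- (Cexp d - 1 - d))%C); last by rewrite E; field.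
have at2 : A * t <= 1/2.
  have := Rmult_lt_compat_l _ _ _ A0 h2; rewrite (_ : A * / (2 * A) = 1/2); [lra|field; lra].
rewrite Cmod_opp; apply: Rle_trans (Cexp_lin _ _) _; first lra.
rewrite Rmult_assoc; apply: Rmult_le_compat_l; first lra.
rewrite -Rpow_mult_distr; apply: pow_incr; split => //; exact: Cmod_ge_0.
Qed.

Lemma Cmod_Cpower (z : C) s : Cmod (Cpower z s) = Rpower (Cmod z) s.
Proof. rewrite /Cpower Cmod_Cexp /Rpower /Cln Re_mult /=; congr exp; ring. Qed.

Lemma Cpower_plus (z : C) s t : Cpower z (s + t) = (Cpower z s * Cpower z t)%C.
Proof. rewrite /Cpower -Cexp_plus; congr Cexp; rewrite RtoC_plus; ring. Qed.

Lemma Cpower_0 (z : C) : Cpower z 0 = 1%C.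
Proof. rewrite /Cpower (_ : (RtoC 0 * Cln z)%C = 0%C); [exact: Cexp_0 | ring]. Qed.

Lemma Cpower_1 (z : C) : 0 < Re z -> Cpower z 1 = z.
Proof. move=> h; rewrite /Cpower (_ : (RtoC 1 * Cln z)%C = Cln z); [exact: Cexp_Cln | ring]. Qed.

Lemma Cpower_nat (z : C) n : 0 < Re z -> Cpower z (INR n) = (z ^ n)%C.
Proof.
move=> h; elim: n => [|n IH]; first exact: Cpower_0.
by rewrite S_INR Cpower_plus IH Cpower_1 //= Cmult_comm.
Qed.

Lemma Cpower_neq0 (z : C) s : Cpower z s <> 0%C.
Proof. exact: Cexp_neq0. Qed.

Lemma Cpower_opp (z : C) s : Cpower z (- s) = (/ Cpower z s)%C.
Proof.
have h := Cpower_neq0 z s.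
have E : (Cpower z s * Cpower z (- s))%C = 1%C by rewrite -Cpower_plus Rplus_opp_r Cpower_0.
rewrite -(Cmult_1_l (/ Cpower z s)%C) -E; field.
exact: h.
Qed.

Lemma Re_scal (r : R) (z : C) : Re (RtoC r * z)%C = r * Re z.
Proof. rewrite Re_mult /=; ring. Qed.
Lemma Im_scal (r : R) (z : C) : Im (RtoC r * z)%C = r * Im z.
Proof. rewrite Im_mult /=; ring. Qed.

Lemma Cln_scal (r : R) (z : C) : 0 < r -> 0 < Re z -> Cln (RtoC r * z)%C = (RtoC (ln r) + Cln z)%C.
Proof.
move=> r0 h; have m0 := Re_pos_Cmod z h.
have h' : 0 < Re (RtoC r * z)%C by rewrite Re_scal; nra.
apply: C_eq => /=.
  rewrite Cmod_mult Cmod_R Rabs_pos_eq; last lra.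
  by rewrite ln_mult.
rewrite !Carg_atan // Re_scal Im_scal Rplus_0_l; congr atan; field; lra.
Qed.

Lemma Cpower_scal (r : R) (z : C) s : 0 < r -> 0 < Re z ->
  Cpower (RtoC r * z)%C s = (RtoC (Rpower r s) * Cpower z s)%C.
Proof.
move=> r0 h; rewrite /Cpower Cln_scal // Cmult_plus_distr_l Cexp_plus.
by rewrite -RtoC_mult Cexp_RtoC.
Qed.

Lemma Cln_RtoC (x : R) : 0 < x -> Cln (RtoC x) = RtoC (ln x).
Proof.
move=> h; apply: C_eq => /=.
  by rewrite Cmod_R Rabs_pos_eq //; lra.
by rewrite Carg_atan //= /Rdiv Rmult_0_l atan_0.
Qed.

Lemma Cpower_RtoC (x : R) s : 0 < x -> Cpower (RtoC x) s = RtoC (Rpower x s).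
Proof. by move=> h; rewrite /Cpower Cln_RtoC // -RtoC_mult Cexp_RtoC. Qed.

Lemma Re_inv (z : C) : Re (/ z)%C = Re z / Cmod z ^ 2.
Proof. by rewrite Cmod_eq_Re_Im. Qed.
Lemma Im_inv (z : C) : Im (/ z)%C = - Im z / Cmod z ^ 2.
Proof. by rewrite Cmod_eq_Re_Im. Qed.

Lemma Re_inv_pos (z : C) : 0 < Re z -> 0 < Re (/ z)%C.
Proof.
move=> h; rewrite Re_inv; apply: Rdiv_lt_0_compat => //.
apply: pow_lt; exact: Re_pos_Cmod.
Qed.

Lemma Cln_inv (z : C) : 0 < Re z -> Cln (/ z)%C = (- Cln z)%C.
Proof.
move=> h; have m0 := Re_pos_Cmod z h; have h' := Re_inv_pos z h; have nz := Re_pos_neq0 z h.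
apply: C_eq => /=.
  by rewrite Cmod_inv // ln_Rinv.
rewrite !Carg_atan // Re_inv Im_inv -atan_opp; congr atan; field; lra.
Qed.

Lemma Cpower_inv (z : C) s : 0 < Re z -> Cpower (/ z)%C s = Cpower z (- s).
Proof. move=> h; rewrite /Cpower Cln_inv // RtoC_opp; congr Cexp; ring. Qed.

Lemma Cder_Cpower (z : C) s : 0 < Re z ->
  Cder (fun w => Cpower w s) z (RtoC s * Cpower z (s - 1))%C.
Proof.
move=> h; have nz := Re_pos_neq0 z h.
apply: (Cder_eq _ _ _ _ _ (Cder_comp Cexp (fun w => RtoC s * Cln w)%C z _ _ (Cder_scal _ _ _ _ (Cder_Cln z h)) (Cder_Cexp _))) => //.
rewrite -/(Cpower z s) {1}(_ : s = (s - 1) + 1); last by ring.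
rewrite Cpower_plus Cpower_1 //; field; exact: nz.
Qed.

(** * Complex series and entire power series *)

Definition CSum (u : nat -> C) (l : C) : Prop :=
  is_series (fun n => Re (u n)) (Re l) /\ is_series (fun n => Im (u n)) (Im l).

Lemma CSum_CSeries u l : CSum u l -> CSeries u = l.
Proof.
by case=> h1 h2; apply: C_eq; rewrite /CSeries /=; apply: is_series_unique.
Qed.

Lemma CSum_unique u l m : CSum u l -> CSum u m -> l = m.
Proof. by move=> /CSum_CSeries <- /CSum_CSeries <-. Qed.

Lemma CSum_ext u v l : (forall n, u n = v n) -> CSum u l -> CSum v l.
Proof.
move=> E [h1 h2]; split; [move: h1 | move: h2]; apply: is_series_ext => n; by rewrite E.
Qed.

Lemma ex_series_dominated (u v : nat -> R) : (forall n, Rabs (u n) <= v n) -> ex_series v -> ex_series u.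
Proof. move=> h; exact: (ex_series_le u v h). Qed.

Lemma CSum_abs u : ex_series (fun n => Cmod (u n)) -> CSum u (CSeries u).
Proof.
move=> h; split => /=; apply: Series_correct; apply: (ex_series_dominated _ _ _ h) => n.
  exact: re_le_Cmod.
exact: Im_le_Cmod.
Qed.

Lemma CSum_plus u v l m : CSum u l -> CSum v m -> CSum (fun n => u n + v n)%C (l + m)%C.
Proof. move=> [a b] [c d]; split; exact: is_series_plus. Qed.

Lemma CSum_scal c u l : CSum u l -> CSum (fun n => c * u n)%C (c * l)%C.
Proof.
move=> [a b]; split; rewrite ?Re_mult ?Im_mult.
  apply: (is_series_minus (fun n => Re c * Re (u n)) (fun n => Im c * Im (u n))); exact: is_series_scal.
apply: (is_series_plus (fun n => Re c * Im (u n)) (fun n => Im c * Re (u n))); exact: is_series_scal.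
Qed.

Lemma CSum_minus u v l m : CSum u l -> CSum v m -> CSum (fun n => u n - v n)%C (l - m)%C.
Proof.
move=> h1 h2; have := CSum_plus _ _ _ _ h1 (CSum_scal (-1)%C _ _ h2).
rewrite (_ : (l + -1 * m = l - m)%C); last by ring.
apply: CSum_ext => n; ring.
Qed.

Lemma CSum_RtoC u l : is_series u l -> CSum (fun n => RtoC (u n)) (RtoC l).
Proof.
move=> h; split => //=.
have := is_series_scal 0 _ _ h; rewrite /scal /= /mult /= Rmult_0_l.
apply: is_series_ext => n; exact: Rmult_0_l.
Qed.

Lemma CSum_shift u l : CSum u l -> CSum (fun n => u (S n)) (l - u O)%C.
Proof.
move=> [a b]; split.
  apply: (is_series_incr_1 (fun n => Re (u n))).
  by rewrite (_ : plus _ _ = Re l) //; rewrite /plus /Re /=; ring.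
apply: (is_series_incr_1 (fun n => Im (u n))).
by rewrite (_ : plus _ _ = Im l) //; rewrite /plus /Im /=; ring.
Qed.

Lemma CSum_unshift u l : CSum (fun n => u (S n)) l -> CSum u (l + u O)%C.
Proof.
move=> [a b]; split.
  apply: (is_series_decr_1 (fun n => Re (u n))).
  by rewrite (_ : plus _ _ = Re l) //; rewrite /plus /opp /Re /=; ring.
apply: (is_series_decr_1 (fun n => Im (u n))).
by rewrite (_ : plus _ _ = Im l) //; rewrite /plus /opp /Im /=; ring.
Qed.

Lemma is_series_le (u v : nat -> R) l m : (forall n, u n <= v n) ->
  is_series u l -> is_series v m -> l <= m.
Proof.
move=> h hu hv.
apply: (is_lim_seq_le (sum_n u) (sum_n v) l m) => // n; exact: sum_n_m_le.
Qed.

(** Projecting all terms on the direction of l turns the claim into a comparison of two convergent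
    real series. *)
Lemma CSum_le u v l s : CSum u l -> (forall n, Cmod (u n) <= v n) -> is_series v s -> Cmod l <= s.
Proof.
move=> [h1 h2] hv hs.
case: (Req_dec (Cmod l) 0) => [->|nz].
  apply: (is_series_le (fun _ => 0) v) => //; last first.
    have := is_series_scal 0 _ _ h1; rewrite /scal /= /mult /= Rmult_0_l.
    by apply: is_series_ext => n; exact: Rmult_0_l.
  by move=> n; apply: Rle_trans (hv n); exact: Cmod_ge_0.
set m := Cmod l in nz *; have m0 : 0 < m by have := Cmod_ge_0 l; rewrite -/m; lra.
have E := Cmod_eq_Re_Im l; rewrite -/m in E.
have -> : m = Re l / m * Re l + Im l / m * Im l.
  transitivity ((Re l ^ 2 + Im l ^ 2) / m); last by field.
  rewrite -E; field; lra.
apply: (is_series_le (fun n => Re l / m * Re (u n) + Im l / m * Im (u n)) v) => //; last first.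
  apply: (is_series_plus (fun n => Re l / m * Re (u n)) (fun n => Im l / m * Im (u n))); exact: is_series_scal.
move=> n; apply: Rle_trans (hv n).
set w := u n; have h := Cmod_eq_Re_Im w; have h0 := Cmod_ge_0 w.
apply: (Rmult_le_reg_r m) => //.
have -> : (Re l / m * Re w + Im l / m * Im w) * m = Re l * Re w + Im l * Im w by field.
apply: Rsqr_incr_0_var; last by nra.
rewrite !Rsqr_pow2 Rpow_mult_distr h E.
have := pow2_ge_0 (Re l * Im w - Im l * Re w); nra.
Qed.

(** * Entire power series with real coefficients *)

Definition entire (a : nat -> R) : Prop :=
  forall r, 0 <= r -> ex_series (fun n => Rabs (a n) * r ^ n).

Definition CPS (a : nat -> R) (z : C) : C := CSeries (fun n => RtoC (a n) * z ^ n)%C.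

Lemma CPS_term (a : nat -> R) z n : Cmod (RtoC (a n) * z ^ n)%C = Rabs (a n) * Cmod z ^ n.
Proof. by rewrite Cmod_mult Cmod_R Cmod_pow. Qed.

Lemma CPS_sum a z : entire a -> CSum (fun n => RtoC (a n) * z ^ n)%C (CPS a z).
Proof.
move=> h; apply: CSum_abs; apply: (ex_series_ext (fun n => Rabs (a n) * Cmod z ^ n)).
  by move=> n; rewrite CPS_term.
apply: h; exact: Cmod_ge_0.
Qed.

Lemma CPS_bound a z r : entire a -> Cmod z <= r ->
  Cmod (CPS a z) <= Series (fun n => Rabs (a n) * r ^ n).
Proof.
move=> h hz; have z0 := Cmod_ge_0 z.
apply: CSum_le (CPS_sum a z h) _ (Series_correct _ (h r _)); last lra.
move=> n; rewrite CPS_term; apply: Rmult_le_compat_l; first exact: Rabs_pos.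
by apply: pow_incr.
Qed.

Lemma RtoC_pow x n : RtoC (x ^ n) = (RtoC x ^ n)%C.
Proof. by elim: n => //= n IH; rewrite RtoC_mult IH. Qed.

Lemma entire_ex a x : entire a -> ex_series (fun n => a n * x ^ n).
Proof.
move=> h; apply: (ex_series_dominated _ _ _ (h (Rabs x) (Rabs_pos x))) => n.
rewrite Rabs_mult RPow_abs; lra.
Qed.

Lemma CPS_RtoC a x : entire a -> CPS a (RtoC x) = RtoC (PSeries a x).
Proof.
move=> h; apply: CSum_CSeries.
apply: (CSum_ext (fun n => RtoC (a n * x ^ n))).
  by move=> n; rewrite RtoC_mult RtoC_pow.
apply: CSum_RtoC; apply: Series_correct; exact: entire_ex.
Qed.

Lemma entire_shift a : entire a -> entire (fun n => a (S n)).
Proof.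
move=> h r r0.
have h1 : ex_series (fun n => Rabs (a (S n)) * (r + 1) ^ S n).
  by have := (proj1 (ex_series_incr_1 (fun n => Rabs (a n) * (r+1) ^ n)) (h (r + 1) ltac:(lra))).
apply: (ex_series_dominated _ _ _ h1) => n.
rewrite Rabs_mult Rabs_Rabsolu (Rabs_pos_eq (r ^ n)); last by apply: pow_le.
apply: Rmult_le_compat_l; first exact: Rabs_pos.
apply: (Rle_trans _ ((r + 1) ^ n)); first by apply: pow_incr; lra.
rewrite /= -{1}(Rmult_1_l ((r+1)^n)); apply: Rmult_le_compat_r; last lra.
apply: pow_le; lra.
Qed.

Lemma entire_shiftn a k : entire a -> entire (fun n => a (n + k)%nat).
Proof.
move=> h; elim: k => [|k IH].
  move=> r r0; have := h r r0; apply: ex_series_ext => n; by rewrite Nat.add_0_r.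
move=> r r0; have := entire_shift _ IH r r0; apply: ex_series_ext => n; by rewrite Nat.add_succ_comm.
Qed.

Lemma INR_le_pow2 n : INR n <= 2 ^ n.
Proof.
elim: n => [|n IH]; first by rewrite /=; lra.
rewrite S_INR /=; have : 1 <= 2 ^ n by apply: pow_R1_Rle; lra.
lra.
Qed.

Lemma entire_derive a : entire a -> entire (PS_derive a).
Proof.
move=> h r r0; have h1 := entire_shift _ h (2 * r + 2) ltac:(lra).
have h2 := ex_series_scal 2 _ h1; apply: (ex_series_dominated _ _ _ h2) => n.
rewrite /PS_derive Rabs_mult Rabs_Rabsolu (Rabs_pos_eq (r ^ n)); last by apply: pow_le.
rewrite Rabs_mult (Rabs_pos_eq (INR _)); last exact: pos_INR.
rewrite /scal /= /mult /=.
have -> : INR (S n) * Rabs (a (S n)) * r ^ n = Rabs (a (S n)) * (INR (S n) * r ^ n) by ring.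
rewrite -(Rmult_assoc 2) (Rmult_comm 2) Rmult_assoc; apply: Rmult_le_compat_l; first exact: Rabs_pos.
have -> : 2 * r + 2 = 2 * (r + 1) by ring.
rewrite Rpow_mult_distr -Rmult_assoc; apply: Rmult_le_compat.
- exact: pos_INR.
- exact: pow_le.
- exact: (INR_le_pow2 (S n)).
- apply: pow_incr; lra.
Qed.

(** The generous factor (4 r)^n makes the bound inductive, and an entire series absorbs it because
    it converges at 4 r. *)
Lemma pow_quadratic (w z : C) r n : 1 <= r -> Cmod w <= r -> Cmod z <= r ->
  Cmod (w ^ n - z ^ n - RtoC (INR n) * z ^ (n - 1) * (w - z))%C <= (4 * r) ^ n * Cmod (w - z)%C ^ 2.
Proof.
move=> r1 hw hz; elim: n => [|n IH].
  rewrite (_ : (w ^ 0 - z ^ 0 - RtoC (INR 0) * z ^ (0 - 1) * (w - z))%C = 0%C); last by rewrite /=; ring.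
  rewrite Cmod_0; have := pow2_ge_0 (Cmod (w - z)%C); rewrite /=; lra.
have -> : (w ^ S n - z ^ S n - RtoC (INR (S n)) * z ^ (S n - 1) * (w - z) =
  w * (w ^ n - z ^ n - RtoC (INR n) * z ^ (n - 1) * (w - z)) + RtoC (INR n) * z ^ (n - 1) * ((w - z) * (w - z)))%C.
  rewrite S_INR RtoC_plus /= Nat.sub_0_r; case: n {IH} => [|n]; first by rewrite /=; ring.
  rewrite /= Nat.sub_0_r; ring.
apply: Rle_trans (Cmod_triangle _ _) _; rewrite !Cmod_mult Cmod_R Cmod_pow Rabs_pos_eq; last exact: pos_INR.
set t := Cmod (w - z)%C in IH *.
set D := Cmod _ in IH *.
have p1 : Cmod w * D <= r * ((4 * r) ^ n * t ^ 2) by apply: Rmult_le_compat => //; exact: Cmod_ge_0.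
have p2 : INR n * Cmod z ^ (n - 1) <= r * (4 * r) ^ n.
  apply: (Rle_trans _ (4 ^ n * r ^ n)); last first.
    rewrite -Rpow_mult_distr -{1}(Rmult_1_l ((4 * r) ^ n)); apply: Rmult_le_compat_r => //; apply: pow_le; lra.
  apply: Rmult_le_compat; [exact: pos_INR | apply: pow_le; exact: Cmod_ge_0| |].
    apply: Rle_trans (INR_le_pow2 n) _; apply: pow_incr; lra.
  apply: (Rle_trans _ (r ^ (n - 1))); first by apply: pow_incr; split => //; exact: Cmod_ge_0.
  apply: Rle_pow => //; lia.
have t2 : 0 <= t * t by nra.
have q : 0 <= (4 * r) ^ n * (t * t) by apply: Rmult_le_pos => //; apply: pow_le; lra.
rewrite [(4 * r) ^ S n]/=; rewrite /= in p1 *; nra.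
Qed.

Lemma Cder_CPS a z : entire a -> Cder (CPS a) z (CPS (PS_derive a) z).
Proof.
move=> h; set r := Cmod z + 1; have z0 := Cmod_ge_0 z.
have hs := h (4 * r) ltac:(rewrite /r; lra).
apply: (Cder_quadratic _ _ _ 1 (Series (fun n => Rabs (a n) * (4 * r) ^ n))); first lra.
move=> w hw.
have D1 : CSum (fun n => RtoC (INR n * a n) * z ^ (n - 1))%C (CPS (PS_derive a) z).
  rewrite -(Cplus_0_r (CPS _ _)).
  have -> : RtoC 0 = (RtoC (INR 0 * a O) * z ^ (0 - 1))%C by rewrite /= Rmult_0_l; ring.
  apply: (CSum_unshift (fun n => RtoC (INR n * a n) * z ^ (n - 1))%C).
  apply: (CSum_ext _ _ _ _ (CPS_sum _ z (entire_derive _ h))) => n.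
  by rewrite /PS_derive /= Nat.sub_0_r.
have S1 := CSum_minus _ _ _ _ (CSum_minus _ _ _ _ (CPS_sum a w h) (CPS_sum a z h)) (CSum_scal (w - z)%C _ _ D1).
rewrite (Cmult_comm (CPS (PS_derive a) z)).
have S2 := is_series_scal (Cmod (w - z)%C ^ 2) _ _ (Series_correct _ hs).
rewrite Rmult_comm; apply: CSum_le S1 _ S2 => n.
rewrite (_ : (_ - _ - _)%C = (RtoC (a n) * (w ^ n - z ^ n - RtoC (INR n) * z ^ (n - 1) * (w - z)))%C); last by rewrite RtoC_mult; ring.
rewrite Cmod_mult Cmod_R /scal /= /mult /= (Rmult_comm (_ * (_ * 1))) Rmult_assoc; apply: Rmult_le_compat_l; first exact: Rabs_pos.
apply: pow_quadratic; rewrite /r; try lra.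
have := Cmod_sub_triangle w z; lra.
Qed.

Lemma CPS_decr a z : entire a -> CPS a z = (RtoC (a O) + z * CPS (fun n => a (S n)) z)%C.
Proof.
move=> h; apply: CSum_CSeries.
have := CSum_scal z _ _ (CPS_sum _ z (entire_shift _ h)) => H.
rewrite Cplus_comm (_ : RtoC (a O) = (RtoC (a O) * z ^ 0)%C); last by rewrite /=; ring.
apply: (CSum_unshift (fun n => RtoC (a n) * z ^ n)%C).
apply: CSum_ext H => n /=; ring.
Qed.

Lemma CPS_ext a b z : (forall n, a n = b n) -> CPS a z = CPS b z.
Proof. by move=> E; rewrite /CPS /CSeries; f_equal; apply: Series_ext => n; rewrite E. Qed.

Lemma entire_scal c a : entire a -> entire (fun n => c * a n).
Proof.
move=> h r r0; apply: (ex_series_ext (fun n => scal (Rabs c) (Rabs (a n) * r ^ n))).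
  by move=> n; rewrite /scal /= /mult /= Rabs_mult Rmult_assoc.
apply: (ex_series_scal (Rabs c)); exact: h.
Qed.

Lemma entire_dominated a b : (forall n, Rabs (a n) <= Rabs (b n)) -> entire b -> entire a.
Proof.
move=> E h r r0; apply: (ex_series_dominated _ _ _ (h r r0)) => n.
rewrite Rabs_mult Rabs_Rabsolu (Rabs_pos_eq (r ^ n)); last exact: pow_le.
apply: Rmult_le_compat_r => //; exact: pow_le.
Qed.

Lemma entire_expn : entire (fun n => / INR (fact n)).
Proof.
move=> r r0; exists (exp r); have := is_exp_Reals r; rewrite /is_pseries.
apply: is_series_ext => n; rewrite pow_n_pow /scal /= /mult /= Rabs_pos_eq; first by rewrite Rmult_comm.
left; apply: Rinv_0_lt_compat; exact: INR_fact_lt_0.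
Qed.

Lemma Cder_zero_const f z w :
  (forall t, 0 <= t <= 1 -> Cder f (z + RtoC t * (w - z))%C 0%C) -> f w = f z.
Proof.
move=> H; have := Cder_mean f (fun _ => 0%C) z (w - z)%C 0 H.
rewrite Cmod_0 Rmult_0_l (_ : (z + (w - z) = w)%C); last by ring.
move=> /(_ (fun t _ => Rle_refl 0)) h; have h0 := Cmod_ge_0 (f w - f z)%C.
have /Cmod_eq_0 E : Cmod (f w - f z)%C = 0 by lra.
rewrite -(Cplus_0_r (f z)) -E; ring.
Qed.

Lemma CPS_0 a : entire a -> CPS a 0%C = RtoC (a O).
Proof. move=> h; rewrite CPS_decr //; ring. Qed.

(** The product of the series with e^(-w) has derivative zero, hence keeps its value 1 at the
    origin. *)
Lemma Cexp_CPS z : Cexp z = CPS (fun n => / INR (fact n)) z.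
Proof.
set e := fun n => / INR (fact n).
have D : forall w, CPS (PS_derive e) w = CPS e w.
  move=> w; apply: CPS_ext => n; rewrite /PS_derive /e fact_simpl mult_INR.
  field; split; [exact: INR_fact_neq_0 | exact: not_0_INR].
have H : forall w, Cder (fun w => CPS e w * Cexp (- (1) * w))%C w 0%C.
  move=> w; apply: (Cder_eq _ _ _ _ _ (Cder_mult _ _ w _ _ (Cder_CPS e w entire_expn)
    (Cder_comp Cexp (fun w => - (1) * w)%C w _ _ (Cder_scal (- (1))%C _ _ _ (Cder_id w)) (Cder_Cexp _)))) => //.
  rewrite D; ring.
have := Cder_zero_const (fun w => CPS e w * Cexp (- (1) * w))%C 0%C z (fun t _ => H _).
rewrite CPS_0; last exact: entire_expn.
rewrite (_ : (- (1) * 0 = 0)%C); last by ring.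
rewrite Cexp_0 {2}/e /= Rinv_1 Cmult_1_l => E.
have := Cexp_plus z (- (1) * z)%C.
rewrite (_ : (z + - (1) * z = 0)%C); last by ring.
rewrite Cexp_0 => E2.
transitivity (Cexp z * (CPS e z * Cexp (- (1) * z)))%C; first by rewrite E; ring.
transitivity (CPS e z * (Cexp z * Cexp (- (1) * z)))%C; first ring.
rewrite -E2; ring.
Qed.

(** * Symbol classes on sectors *)

(** The closed sector of half-angle arccos k without its vertex; the theorem takes k = sin delta,
    and k = 1 gives the positive real axis. *)
Definition Sect (k : R) (z : C) : Prop := 0 < Re z /\ k * Cmod z <= Re z.

(* [al] is the order: the j-th derivative is O(|z|^(al - j)) on D for j <= N. *)
Fixpoint Sm (D : C -> Prop) (N : nat) (al : R) (f : C -> C) : Prop :=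
  (exists B, 0 <= B /\ forall z, D z -> Cmod (f z) <= B * Rpower (Cmod z) al) /\
  match N with
  | O => True
  | S n => exists f', (forall z, D z -> Cder f z (f' z)) /\ Sm D n (al - 1) f'
  end.

Lemma Sm_bound D N al f : Sm D N al f ->
  exists B, 0 <= B /\ forall z, D z -> Cmod (f z) <= B * Rpower (Cmod z) al.
Proof. by case: N => [|n] [h _]. Qed.

Lemma Sm_0 D al f B : 0 <= B -> (forall z, D z -> Cmod (f z) <= B * Rpower (Cmod z) al) ->
  Sm D 0 al f.
Proof. by move=> B0 h; split => //; exists B. Qed.

Lemma Sm_S D n al f f' : 
  (exists B, 0 <= B /\ forall z, D z -> Cmod (f z) <= B * Rpower (Cmod z) al) ->
  (forall z, D z -> Cder f z (f' z)) -> Sm D n (al - 1) f' -> Sm D (S n) al f.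
Proof. by move=> h1 h2 h3; split => //; exists f'. Qed.

Lemma Sm_pred D n al f : Sm D (S n) al f -> Sm D n al f.
Proof.
elim: n al f => [|n IH] al f; first by case.
case=> hb [f' [hd hs]]; apply: (Sm_S _ _ _ _ f') => //; exact: IH.
Qed.

Lemma Sm_ext (D : C -> Prop) n al f g : (forall z, D z -> 0 < Re z) -> 
  (forall z, 0 < Re z -> f z = g z) -> Sm D n al f -> Sm D n al g.
Proof.
move=> sub E; case: n => [|n] [[B [B0 hB]] h].
  by apply: (Sm_0 _ _ _ B) => // z hz; rewrite -E; [exact: hB | exact: sub].
case: h => f' [hd hs]; apply: (Sm_S _ _ _ _ f') => //.
  by exists B; split => // z hz; rewrite -E; [exact: hB | exact: sub].
by move=> z hz; apply: (Cder_ext_half f) => //; [exact: sub | exact: hd].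
Qed.

Lemma Sm_plus D n al f g : Sm D n al f -> Sm D n al g -> Sm D n al (fun z => f z + g z)%C.
Proof.
elim: n al f g => [|n IH] al f g [[A [A0 hA]] hf] [[B [B0 hB]] hg].
  apply: (Sm_0 _ _ _ (A + B)); first lra.
  move=> z hz; apply: Rle_trans (Cmod_triangle _ _) _; rewrite Rmult_plus_distr_r.
  by apply: Rplus_le_compat; [apply: hA | apply: hB].
case: hf => f' [hf hf']; case: hg => g' [hg hg'].
apply: (Sm_S _ _ _ _ (fun z => f' z + g' z)%C); last exact: IH.
  exists (A + B); split; first lra.
  move=> z hz; apply: Rle_trans (Cmod_triangle _ _) _; rewrite Rmult_plus_distr_r.
  by apply: Rplus_le_compat; [apply: hA | apply: hB].
by move=> z hz; apply: Cder_plus; [apply: hf | apply: hg].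
Qed.

Lemma Sm_zero D n al : Sm D n al (fun _ => 0%C).
Proof.
have b : exists B, 0 <= B /\ forall z, D z -> Cmod 0%C <= B * Rpower (Cmod z) al.
  by exists 0; split; [lra | move=> z _; rewrite Cmod_0 Rmult_0_l; lra].
elim: n al b => [|n IH] al b; first by split.
apply: (Sm_S _ _ _ _ (fun _ => 0%C)) => //; first by move=> z _; exact: Cder_const.
apply: IH; exists 0; split; [lra | move=> z _; rewrite Cmod_0 Rmult_0_l; lra].
Qed.

Lemma Sm_weaken (D : C -> Prop) n al be B f : (forall z, D z -> 0 < Cmod z) -> 0 <= B ->
  (forall z, D z -> Rpower (Cmod z) (al - be) <= B) -> Sm D n al f -> Sm D n be f.
Proof.
move=> pos B0; elim: n al be f => [|n IH] al be f hw [[A [A0 hA]] h].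
  apply: (Sm_0 _ _ _ (A * B)); first nra.
  move=> z hz; apply: Rle_trans (hA z hz) _; rewrite Rmult_assoc; apply: Rmult_le_compat_l => //.
  rewrite {1}(_ : al = (al - be) + be); last by ring.
  rewrite Rpower_plus; apply: Rmult_le_compat_r; last exact: hw.
  left; exact: exp_pos.
case: h => f' [hd hs]; apply: (Sm_S _ _ _ _ f') => //.
  exists (A * B); split; first nra.
  move=> z hz; apply: Rle_trans (hA z hz) _; rewrite Rmult_assoc; apply: Rmult_le_compat_l => //.
  rewrite {1}(_ : al = (al - be) + be); last by ring.
  rewrite Rpower_plus; apply: Rmult_le_compat_r; last exact: hw.
  left; exact: exp_pos.
apply: (IH (al - 1)) => //.
by move=> z hz; rewrite (_ : al - 1 - (be - 1) = al - be); [apply: hw | ring].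
Qed.

Lemma Sm_eq D n al be f : al = be -> Sm D n al f -> Sm D n be f.
Proof. by move=> ->. Qed.

Lemma Sm_mult D n al be f g : Sm D n al f -> Sm D n be g -> Sm D n (al + be) (fun z => f z * g z)%C.
Proof.
have key : forall al be f g (A B : R), 0 <= A -> 0 <= B ->
  (forall z, D z -> Cmod (f z) <= A * Rpower (Cmod z) al) ->
  (forall z, D z -> Cmod (g z) <= B * Rpower (Cmod z) be) ->
  forall z, D z -> Cmod (f z * g z)%C <= A * B * Rpower (Cmod z) (al + be).
  move=> a b F G A B A0 B0 hA hB z hz; rewrite Cmod_mult Rpower_plus.
  have -> : A * B * (Rpower (Cmod z) a * Rpower (Cmod z) b) = (A * Rpower (Cmod z) a) * (B * Rpower (Cmod z) b) by ring.
  apply: Rmult_le_compat; try exact: Cmod_ge_0; [exact: hA | exact: hB].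
elim: n al be f g => [|n IH] al be f g hf0 hg0; move: (hf0) (hg0) => [[A [A0 hA]] hf] [[B [B0 hB]] hg].
  apply: (Sm_0 _ _ _ (A * B)); first nra; exact: key.
case: hf => f' [hf hf']; case: hg => g' [hg hg'].
apply: (Sm_S _ _ _ _ (fun z => f' z * g z + f z * g' z)%C).
- exists (A * B); split; [nra | exact: key].
- by move=> z hz; apply: Cder_mult; [apply: hf | apply: hg].
- apply: Sm_plus.
    apply: (Sm_eq _ _ (al - 1 + be)); first ring.
    apply: IH => //; exact: Sm_pred.
  apply: (Sm_eq _ _ (al + (be - 1))); first ring.
  apply: IH => //; exact: Sm_pred.
Qed.

Lemma Sm_const D n c : (forall z, D z -> 0 < Cmod z) -> Sm D n 0 (fun _ => c).
Proof.
move=> pos.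
have b : exists B, 0 <= B /\ forall z, D z -> Cmod c <= B * Rpower (Cmod z) 0.
  exists (Cmod c); split; [exact: Cmod_ge_0 | move=> z hz; rewrite Rpower_O; [lra | exact: pos]].
case: n => [|n]; first by split.
apply: (Sm_S _ _ _ _ (fun _ => 0%C)) => //; first by move=> z _; exact: Cder_const.
exact: Sm_zero.
Qed.

Lemma Sm_scal (D : C -> Prop) n al c f : (forall z, D z -> 0 < Cmod z) -> Sm D n al f -> Sm D n al (fun z => c * f z)%C.
Proof.
move=> pos h; apply: (Sm_eq _ _ (0 + al)); first ring.
apply: Sm_mult => //; exact: Sm_const.
Qed.

Lemma Sm_power (D : C -> Prop) n s : (forall z, D z -> 0 < Re z) -> Sm D n s (fun z => Cpower z s).
Proof.
move=> pos; elim: n s => [|n IH] s.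
  by apply: (Sm_0 _ _ _ 1); [lra | move=> z _; rewrite Cmod_Cpower; lra].
apply: (Sm_S _ _ _ _ (fun z => RtoC s * Cpower z (s - 1))%C).
- exists 1; split; [lra | move=> z _; rewrite Cmod_Cpower; lra].
- by move=> z /pos; exact: Cder_Cpower.
- apply: Sm_scal => //; by move=> z /pos; exact: Re_pos_Cmod.
Qed.

Lemma Sm_id (D : C -> Prop) n : (forall z, D z -> 0 < Re z) -> Sm D n 1 (fun z => z).
Proof.
move=> pos; apply: (Sm_ext _ _ _ (fun z => Cpower z 1)) => //; last exact: Sm_power.
by move=> z; exact: Cpower_1.
Qed.

(** From |1 + z^2|^2 = (1 - |z|^2)^2 + 4 (Re z)^2: the sector keeps z away from the poles i and
    -i. *)
Lemma one_plus_sq_lb k z : 0 < k <= 1 -> Sect k z -> k * (1 + Cmod z ^ 2) <= Cmod (1 + z * z)%C.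
Proof.
move=> hk [h1 h2].
have E : Cmod (1 + z * z)%C ^ 2 = (1 - Cmod z ^ 2) ^ 2 + 4 * Re z ^ 2.
  rewrite !Cmod_eq_Re_Im; case: z {h1 h2} => x y /=; ring.
have m0 := Cmod_ge_0 z.
apply: Rsqr_incr_0_var; last exact: Cmod_ge_0.
rewrite !Rsqr_pow2 E.
have h3 : (k * Cmod z) ^ 2 <= Re z ^ 2 by apply: pow_incr; nra.
have h4 : 0 <= (1 - k ^ 2) * (1 - Cmod z ^ 2) ^ 2.
  apply: Rmult_le_pos; [nra | exact: pow2_ge_0].
rewrite Rpow_mult_distr in h3 *; nra.
Qed.

Lemma one_plus_sq_neq0 z : 0 < Re z -> (1 + z * z)%C <> 0%C.
Proof.
move=> h E; have h1 : Re (1 + z * z)%C = 0 by rewrite E.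
have h2 : Im (1 + z * z)%C = 0 by rewrite E.
case: z h h1 h2 E => x y /= h h1 h2 _; have : y = 0 by nra.
move=> y0; rewrite y0 in h1; nra.
Qed.

(** The derivative -2 z (1 + z^2)^(-2) has order 1 + 2 be; the bound on |z|^(be + 2) weakens this to
    be - 1 and closes the induction. The applications are be = 0 near the origin and be = -2 at
    infinity. *)
Lemma Sm_inv1 (D : C -> Prop) n k be : 0 < k <= 1 -> (forall z, D z -> Sect k z) ->
  (exists B, 0 <= B /\ forall z, D z -> Rpower (Cmod z) (- be) <= B * (1 + Cmod z ^ 2)) ->
  (exists B, 0 <= B /\ forall z, D z -> Rpower (Cmod z) (be + 2) <= B) ->
  Sm D n be (fun z => / (1 + z * z))%C.
Proof.
move=> hk sub [B [B0 hB]] [A [A0 hA]].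
have posR : forall z, D z -> 0 < Re z by move=> z /sub [].
have pos : forall z, D z -> 0 < Cmod z by move=> z /posR; exact: Re_pos_Cmod.
have b : exists B, 0 <= B /\ forall z, D z -> Cmod (/ (1 + z * z))%C <= B * Rpower (Cmod z) be.
  exists (B / k); split; first by apply: Rmult_le_pos => //; left; apply: Rinv_0_lt_compat; lra.
  move=> z hz; have nz := one_plus_sq_neq0 z (posR z hz).
  rewrite Cmod_inv //; have p := Cmod_pos _ nz.
  apply: (Rmult_le_reg_l (Cmod (1 + z * z)%C)) => //; rewrite Rinv_r; last lra.
  have h1 := one_plus_sq_lb k z hk (sub z hz); have h2 := hB z hz.
  have q : 0 < Rpower (Cmod z) be by exact: exp_pos.
  have E : Rpower (Cmod z) (- be) * Rpower (Cmod z) be = 1 by rewrite -Rpower_plus Rplus_opp_l Rpower_O //; apply: pos.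
  have : 1 <= B * (1 + Cmod z ^ 2) * Rpower (Cmod z) be by rewrite -{1}E; apply: Rmult_le_compat_r; lra.
  move=> h3; apply: Rle_trans h3 _.
  have -> : B * (1 + Cmod z ^ 2) * Rpower (Cmod z) be = k * (1 + Cmod z ^ 2) * (B / k * Rpower (Cmod z) be) by field; lra.
  apply: Rmult_le_compat_r => //; apply: Rmult_le_pos; [apply: Rmult_le_pos => //; left; apply: Rinv_0_lt_compat; lra | lra].
elim: n => [|n IH]; first by split.
apply: (Sm_S _ _ _ _ (fun z => (-2) * (z * ((/ (1 + z * z)) * (/ (1 + z * z)))))%C) => //.
  move=> z hz; have nz := one_plus_sq_neq0 z (posR z hz).
  apply: (Cder_eq _ _ _ _ _ (Cder_comp (fun w => / w)%C (fun w => 1 + w * w)%C z _ _ 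
     (Cder_plus _ _ _ _ _ (Cder_const 1%C z) (Cder_mult _ _ _ _ _ (Cder_id z) (Cder_id z))) (Cder_inv _ nz))) => //.
  by field.
apply: Sm_scal => //.
apply: (Sm_weaken _ _ (1 + (be + be)) _ A) => //.
  by move=> z hz; rewrite (_ : 1 + (be + be) - (be - 1) = be + 2); [apply: hA | ring].
by apply: Sm_mult; [exact: Sm_id | exact: Sm_mult].
Qed.

Lemma Sm_CPS (D : C -> Prop) n M c a : (forall z, D z -> 0 < Re z) -> (forall z, D z -> Cmod z <= M) -> entire a ->
  Sm D n 0 (fun z => CPS a (RtoC c * (z * z)))%C.
Proof.
move=> posR hM; have pos : forall z, D z -> 0 < Cmod z by move=> z /posR; exact: Re_pos_Cmod.
elim: n a => [|n IH] a ha.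
  all: have b : exists B, 0 <= B /\ forall z, D z -> Cmod (CPS a (RtoC c * (z * z))%C) <= B * Rpower (Cmod z) 0.
  1,3: exists (Rabs (Series (fun n => Rabs (a n) * (Rabs c * (M * M)) ^ n))); split; first exact: Rabs_pos.
  1,2: move=> z hz; rewrite Rpower_O; last exact: pos.
  1,2: rewrite Rmult_1_r; apply: Rle_trans (Rle_abs _); apply: CPS_bound => //.
  1,2: rewrite !Cmod_mult Cmod_R; apply: Rmult_le_compat_l; first exact: Rabs_pos.
  1,2: by have := hM z hz; have := pos z hz; nra.
by split.
apply: (Sm_S _ _ _ _ (fun z => RtoC (2 * c) * (z * CPS (PS_derive a) (RtoC c * (z * z))))%C) => //.
  move=> z hz; apply: (Cder_eq _ _ _ _ _ (Cder_comp (CPS a) (fun w => RtoC c * (w * w))%C z _ _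
     (Cder_scal (RtoC c) _ _ _ (Cder_mult _ _ _ _ _ (Cder_id z) (Cder_id z))) (Cder_CPS _ _ ha))) => //.
  rewrite RtoC_mult; ring.
apply: Sm_scal => //.
apply: (Sm_weaken _ _ (1 + 0) _ (Rabs M ^ 2)) => //; first exact: pow2_ge_0.
  move=> z hz; rewrite (_ : 1 + 0 - (0 - 1) = INR 2); last by rewrite /=; ring.
  rewrite Rpower_pow; last exact: pos.
  apply: pow_incr; split; [exact: Cmod_ge_0 | apply: Rle_trans (Rle_abs M); exact: hM].
apply: Sm_mult; [exact: Sm_id | apply: IH; exact: entire_derive].
Qed.

(** * Forward differences, with the sign of Euler's transformation *)

Definition Dl (h : C) (f : C -> C) (z : C) : C := (f z - f (z + h))%C.

Fixpoint Dn (n : nat) (h : C) (f : C -> C) : C -> C :=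
  match n with O => f | S m => Dn m h (Dl h f) end.

(** In contrast to [Sm], a bound is asked only of the N-th derivative, which is what controls the
    N-th difference. *)
Fixpoint Dbd (N : nat) (D : C -> Prop) (f : C -> C) (B : R) : Prop :=
  match N with
  | O => forall z, D z -> Cmod (f z) <= B
  | S n => exists f', (forall z, D z -> Cder f z (f' z)) /\ Dbd n D f' B
  end.

(** One difference uses up one derivative by the mean value inequality; the domain shrinks to the
    points from which the whole step stays in D. *)
Lemma Dbd_Dl N D f B h : Dbd (S N) D f B ->
  Dbd N (fun z => forall t, 0 <= t <= 1 -> D (z + RtoC t * h)%C) (Dl h f) (B * Cmod h).
Proof.
elim: N f => [|N IH] f [f' [hd hb]].
  move=> z hz; rewrite /Dl Cmod_sub_sym; apply: (Cder_mean f f') => t ht.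
    by apply: hd; apply: hz.
  by apply: hb; apply: hz.
exists (Dl h f'); split; last exact: IH.
move=> z hz; rewrite /Dl.
have z0 : D z by rewrite (_ : z = (z + RtoC 0 * h)%C); [apply: hz; lra | ring].
have z1 : D (z + h)%C by rewrite (_ : (z + h)%C = (z + RtoC 1 * h)%C); [apply: hz; lra | ring].
have H1 := Cder_comp f (fun w => w + h)%C z _ _ (Cder_plus _ _ _ _ _ (Cder_id z) (Cder_const h z)) (hd _ z1).
apply: (Cder_eq _ _ _ _ _ (Cder_plus _ _ _ _ _ (hd z z0) (Cder_scal (-1)%C _ _ _ H1))) => [w|]; ring.
Qed.

Lemma Dn_bound N D f B h z : 0 <= B -> Dbd N D f B ->
  (forall t, 0 <= t <= INR N -> D (z + RtoC t * h)%C) ->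
  Cmod (Dn N h f z) <= Cmod h ^ N * B.
Proof.
elim: N D f B => [|N IH] D f B B0 hb hz.
  rewrite /= Rmult_1_l; apply: hb; rewrite (_ : z = (z + RtoC 0 * h)%C); [apply: hz; rewrite /=; lra | ring].
rewrite /= (Rmult_comm (Cmod h)) Rmult_assoc (Rmult_comm (Cmod h)).
apply: (IH _ _ _ _ (Dbd_Dl _ _ _ _ _ hb)); first by apply: Rmult_le_pos => //; exact: Cmod_ge_0.
move=> t ht s hs.
rewrite (_ : (z + RtoC t * h + RtoC s * h)%C = (z + RtoC (t + s) * h)%C); last by rewrite RtoC_plus; ring.
apply: hz; rewrite S_INR; lra.
Qed.

Lemma Rpower_le_base x y s : 0 < x <= y -> s <= 0 -> Rpower y s <= Rpower x s.
Proof.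
move=> [x0 xy] hs; rewrite /Rpower; have : ln x <= ln y by apply: ln_le.
move=> h; have : s * ln y <= s * ln x by nra.
case=> [l|->]; [left; exact: exp_increasing | lra].
Qed.

(** As al - N <= 0, the power |z|^(al - N) is largest at the smallest modulus m. *)
Lemma Sm_Dbd D N al f : Sm D N al f -> al <= INR N -> exists B, 0 <= B /\ forall m, 0 < m ->
  Dbd N (fun w => D w /\ m <= Cmod w) f (B * Rpower m (al - INR N)).
Proof.
elim: N al f => [|N IH] al f [[B [B0 hB]] h] hal.
  exists B; split => // m m0 z [hz hm]; apply: Rle_trans (hB z hz) _; apply: Rmult_le_compat_l => //.
  rewrite Rminus_0_r; apply: Rpower_le_base; [lra | exact: hal].
case: h => f' [hd hs]; rewrite S_INR in hal *.
case: (IH _ _ hs); first lra.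
move=> A [A0 hA]; exists A; split => // m m0; exists f'; split; first by move=> z [hz _]; exact: hd.
rewrite (_ : al - (INR N + 1) = al - 1 - INR N); [exact: hA | ring].
Qed.

Lemma Sm_Dn D N al f : Sm D N al f -> al <= INR N -> exists B, 0 <= B /\ forall h z m, 0 < m ->
  (forall t, 0 <= t <= INR N -> D (z + RtoC t * h)%C /\ m <= Cmod (z + RtoC t * h)%C) ->
  Cmod (Dn N h f z) <= B * (Cmod h ^ N * Rpower m (al - INR N)).
Proof.
move=> hs hal; case: (Sm_Dbd _ _ _ _ hs hal) => B [B0 hB]; exists B; split => // h z m m0 hz.
rewrite (_ : B * (Cmod h ^ N * Rpower m (al - INR N)) = Cmod h ^ N * (B * Rpower m (al - INR N))); last by ring.
apply: (Dn_bound _ _ _ _ _ _ _ (hB m m0)) => //.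
apply: Rmult_le_pos => //; left; exact: exp_pos.
Qed.

(** * The Gamma and digamma functions *)

Lemma ln_le_sub1 x : 0 < x -> ln x <= x - 1.
Proof. by move=> h; have := exp_ineq1_le (ln x); rewrite exp_ln //; lra. Qed.

Lemma ln_ratio_le a b : 0 < a -> 0 < b -> ln b - ln a <= (b - a) / a.
Proof.
move=> a0 b0; rewrite -ln_div //; apply: Rle_trans (ln_le_sub1 _ _) _; first exact: Rdiv_lt_0_compat.
right; field; lra.
Qed.

Lemma sum_SnR (f : nat -> R) n : sum_n f (S n) = sum_n f n + f (S n).
Proof. exact: sum_Sn. Qed.

(** The logarithm of the term of index n + 1 in Gauss's limit; the shift keeps ln 0 out. *)
Definition lnG (n : nat) (x : R) : R :=
  ln (INR (fact (S n))) + x * ln (INR (S n)) - sum_n (fun k => ln (x + INR k)) (S n).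

Definition dlnG (n : nat) (x : R) : R :=
  ln (INR (S n)) - sum_n (fun k => / (x + INR k)) (S n).

Lemma poch_pos x n : 0 < x -> 0 < poch x n.
Proof.
move=> h; elim: n => /= [|n IH]; first lra.
apply: Rmult_lt_0_compat => //; have := pos_INR n; lra.
Qed.

Lemma ln_poch x n : 0 < x -> ln (poch x (S n)) = sum_n (fun k => ln (x + INR k)) n.
Proof.
move=> h; elim: n => [|n IH].
  by rewrite sum_O /= Rmult_1_l.
rewrite sum_Sn -IH [poch x (S (S n))]/= ln_mult //; first exact: (poch_pos x (S n)).
by have := pos_INR (S n); rewrite -/(INR (S n)); lra.
Qed.

Lemma lnG_exp n x : 0 < x ->
  exp (lnG n x) = INR (fact (S n)) * Rpower (INR (S n)) x / poch x (S (S n)).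
Proof.
move=> h; have p := poch_pos x (S (S n)) h.
rewrite /lnG -ln_poch // exp_plus exp_plus exp_Ropp !exp_ln //.
exact: INR_fact_lt_0.
Qed.

Lemma is_derive_lnG n x : 0 < x -> is_derive (lnG n) x (dlnG n x).
Proof.
move=> h; rewrite /lnG /dlnG.
apply: (is_derive_minus (fun x => ln (INR (fact (S n))) + x * ln (INR (S n))) (fun x => sum_n (fun k => ln (x + INR k)) (S n))).
  move: (ln (INR (fact (S n)))) (ln (INR (S n))) => a b; auto_derive => //; ring.
apply: (is_derive_sum_n (fun k x => ln (x + INR k))) => k _.
have := pos_INR k => hk.
auto_derive; first lra.
by rewrite Rmult_1_l.
Qed.

(** Both bounds come from ln t <= t - 1; the upper one telescopes, which is what [CVU_telescoping]
    asks for. *)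
Lemma lnG_step n x : 0 < x -> 0 <= lnG (S n) x - lnG n x <= x * (x + 1) * (/ INR (S n) - / INR (S (S n))).
Proof.
move=> h.
have p1 : 0 < INR (S n) by apply: lt_0_INR; lia.
have p2 : 0 < INR (S (S n)) by apply: lt_0_INR; lia.
have E2 : INR (S (S n)) = INR (S n) + 1 by rewrite S_INR.
have -> : lnG (S n) x - lnG n x = x * (ln (INR (S (S n))) - ln (INR (S n))) - (ln (x + INR (S (S n))) - ln (INR (S (S n)))).
  rewrite /lnG (sum_SnR _ (S n)).
  have -> : ln (INR (fact (S (S n)))) = ln (INR (S (S n))) + ln (INR (fact (S n))).
    rewrite fact_simpl mult_INR ln_mult //; exact: INR_fact_lt_0.
  ring.
have a1 := ln_ratio_le _ _ p1 p2; have a2 := ln_ratio_le _ _ p2 p1.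
have a3 := ln_ratio_le (INR (S (S n))) (x + INR (S (S n))) p2 ltac:(lra).
have a4 := ln_ratio_le (x + INR (S (S n))) (INR (S (S n))) ltac:(lra) p2.
set m := INR (S n) in p1 E2 a1 a2 a3 a4 *; rewrite E2 in p2 a1 a2 a3 a4 *.
have b1 : / (m + 1) <= ln (m + 1) - ln m by have E : (m - (m + 1)) / (m + 1) = - / (m + 1) by [field; lra]; lra.
have b2 : ln (m + 1) - ln m <= / m by have E : (m + 1 - m) / m = / m by [field; lra]; lra.
have b4 : x * / (x + (m + 1)) <= ln (x + (m + 1)) - ln (m + 1).
  lra.
have c1 := Rmult_le_compat_l _ _ _ (Rlt_le _ _ h) b1; have c2 := Rmult_le_compat_l _ _ _ (Rlt_le _ _ h) b2.
split; first lra.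
have -> : x * (x + 1) * (/ m - / (m + 1)) = x * ((x + 1) / (m * (m + 1))) by field; lra.
have : x * / m - x * / (x + (m + 1)) <= x * ((x + 1) / (m * (m + 1))); last lra.
have -> : x * / m - x * / (x + (m + 1)) = x * ((x + 1) / (m * (x + (m + 1)))) by field; lra.
apply: Rmult_le_compat_l; first lra; apply: Rmult_le_compat_l; first lra.
apply: Rinv_le_contravar; nra.
Qed.

Lemma dlnG_step n x : 0 < x -> 0 <= dlnG (S n) x - dlnG n x <= (x + 1) * (/ INR (S n) - / INR (S (S n))).
Proof.
move=> h.
have p1 : 0 < INR (S n) by apply: lt_0_INR; lia.
have p2 : 0 < INR (S (S n)) by apply: lt_0_INR; lia.
have E2 : INR (S (S n)) = INR (S n) + 1 by rewrite S_INR.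
have -> : dlnG (S n) x - dlnG n x = (ln (INR (S (S n))) - ln (INR (S n))) - / (x + INR (S (S n))).
  by rewrite /dlnG (sum_SnR _ (S n)); ring.
have a1 := ln_ratio_le _ _ p1 p2; have a2 := ln_ratio_le _ _ p2 p1.
set m := INR (S n) in p1 E2 a1 a2 *; rewrite E2 in p2 a1 a2 *.
have b3 : / (x + (m + 1)) <= / (m + 1) by apply: Rinv_le_contravar; lra.
split; first lra.
have -> : (x + 1) * (/ m - / (m + 1)) = (x + 1) / (m * (m + 1)) by field; lra.
have : / m - / (x + (m + 1)) <= (x + 1) / (m * (m + 1)); last lra.
have -> : / m - / (x + (m + 1)) = (x + 1) / (m * (x + (m + 1))) by field; lra.
apply: Rmult_le_compat_l; first lra.
apply: Rinv_le_contravar; nra.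
Qed.

(** Summing the increments from n on leaves at most B / (n + 1), uniformly in x, so the sequence is
    uniformly Cauchy. *)
Lemma CVU_telescoping (f : nat -> R -> R) (B : R) (D : R -> Prop) :
  (forall n x, D x -> 0 <= f (S n) x - f n x <= B * (/ INR (S n) - / INR (S (S n)))) ->
  CVU_dom f D.
Proof.
move=> H; apply CVU_dom_cauchy => eps.
have K : forall n k x, D x -> 0 <= f (n + k)%nat x - f n x <= B * (/ INR (S n) - / INR (S (n + k))).
  move=> n k x hx; elim: k => [|k IH]; first by rewrite Nat.add_0_r; lra.
  have := H (n + k)%nat x hx; rewrite Nat.add_succ_r; lra.
have B0 : 0 <= Rabs B by exact: Rabs_pos.
have [N hN] : exists N, Rabs B / eps < INR N by exists (Z.to_nat (up (Rabs B / eps))); have [h _] := archimed (Rabs B / eps); apply: Rlt_le_trans h _; rewrite INR_IZR_INZ; apply: IZR_le; lia.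
have e0 := cond_pos eps.
have K2 : forall n k x, D x -> (N <= n)%nat -> 0 <= f (n + k)%nat x - f n x < eps.
  move=> n k x hx hn; have [h1 h2] := K n k x hx; split => //; apply: Rle_lt_trans h2 _.
  have p1 : 0 < INR (S n) by apply: lt_0_INR; lia.
  have p2 : 0 < / INR (S (n + k)) by apply: Rinv_0_lt_compat; apply: lt_0_INR; lia.
  have p3 : / INR (S (n + k)) <= / INR (S n) by apply: Rinv_le_contravar => //; apply: le_INR; lia.
  apply: (Rle_lt_trans _ (Rabs B * / INR (S n))).
    have := Rle_abs B; nra.
  apply: (Rmult_lt_reg_r (INR (S n))) => //; rewrite Rmult_assoc Rinv_l; last lra.
  have : INR N <= INR (S n) by apply: le_INR; lia.
  have := Rmult_lt_compat_r _ _ _ e0 hN; rewrite (_ : Rabs B / eps * eps = Rabs B); last by field; lra.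
  nra.
exists N => n m x hx hn hm.
case: (Nat.le_ge_cases n m) => c.
  have := K2 n (m - n)%nat x hx hn; rewrite (_ : (n + (m - n))%nat = m); last lia.
  move=> h; rewrite Rabs_left1; lra.
have := K2 m (n - m)%nat x hx hm; rewrite (_ : (m + (n - m))%nat = n); last lia.
move=> h; rewrite Rabs_right; lra.
Qed.

Lemma open_interval b : open (fun x : R => 0 < x < b).
Proof. apply: open_and; [exact: open_gt | exact: open_lt]. Qed.

Lemma connected_interval b : is_connected (fun x : R => 0 < x < b).
Proof. move=> x y z hx hy hz; lra. Qed.

Lemma CVU_lnG b : CVU_dom lnG (fun x => 0 < x < b).
Proof.
apply: (CVU_telescoping _ (b * (b + 1))) => n x hx; have [h1 h2] := lnG_step n x ltac:(lra).
split => //; apply: Rle_trans h2 _; apply: Rmult_le_compat_r; last nra.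
have p1 : 0 < INR (S n) by apply: lt_0_INR; lia.
have : / INR (S (S n)) <= / INR (S n); last lra.
apply: Rinv_le_contravar => //; apply: le_INR; lia.
Qed.

Lemma CVU_dlnG b : CVU_dom dlnG (fun x => 0 < x < b).
Proof.
apply: (CVU_telescoping _ (b + 1)) => n x hx; have [h1 h2] := dlnG_step n x ltac:(lra).
split => //; apply: Rle_trans h2 _; apply: Rmult_le_compat_r; last lra.
have p1 : 0 < INR (S n) by apply: lt_0_INR; lia.
have : / INR (S (S n)) <= / INR (S n); last lra.
apply: Rinv_le_contravar => //; apply: le_INR; lia.
Qed.

Lemma CVU_lim (f : nat -> R -> R) D x : CVU_dom f D -> D x ->
  is_lim_seq (fun n => f n x) (real (Lim_seq (fun n => f n x))).
Proof.
move=> H hx; have := CVU_CVS_dom _ _ H x hx.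
by move=> h; apply: Lim_seq_correct'.
Qed.

Lemma CVU_dom_ext (f g : nat -> R -> R) D : (forall n x, D x -> f n x = g n x) -> CVU_dom f D -> CVU_dom g D.
Proof.
move=> E h eps; case: (h eps) => N hN; exists N => n hn x hx.
rewrite -E // (_ : Lim_seq (fun n => g n x) = Lim_seq (fun n => f n x)); first exact: hN.
apply: Lim_seq_ext => k; by rewrite E.
Qed.

Definition lnGamma x := real (Lim_seq (fun n => lnG n x)).
Definition digam x := real (Lim_seq (fun n => dlnG n x)).

Lemma lnGamma_lim x : 0 < x -> is_lim_seq (fun n => lnG n x) (lnGamma x).
Proof. move=> h; apply: (CVU_lim _ _ _ (CVU_lnG (x + 1))); lra. Qed.

Lemma digam_lim x : 0 < x -> is_lim_seq (fun n => dlnG n x) (digam x).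
Proof. move=> h; apply: (CVU_lim _ _ _ (CVU_dlnG (x + 1))); lra. Qed.

Lemma is_derive_lnGamma x : 0 < x -> is_derive lnGamma x (digam x).
Proof.
move=> h.
have D n y : 0 < y < x + 1 -> Derive (lnG n) y = dlnG n y.
  by move=> hy; apply: is_derive_unique; apply: is_derive_lnG; lra.
have := CVU_Derive lnG (fun y => 0 < y < x + 1) (open_interval _) (connected_interval _) (CVU_lnG _).
have -> : digam x = real (Lim_seq (fun n => Derive (lnG n) x)).
  rewrite /digam; congr real; apply: Lim_seq_ext => n; rewrite D //; lra.
apply; last lra.
- by move=> n y hy; exists (dlnG n y); apply: is_derive_lnG; lra.
- move=> n y hy; apply/continuity_pt_filterlim.
  change (continuous (Derive (lnG n)) y).
  apply: (continuous_ext_loc _ (dlnG n)).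
    apply: (filter_imp _ _ _ (open_interval (x + 1) y hy)) => t ht; by rewrite D.
  apply: ex_derive_continuous.
  rewrite /dlnG; apply: (ex_derive_minus (fun _ => ln (INR (S n))) (fun x => sum_n (fun k => / (x + INR k)) (S n))).
    exact: ex_derive_const.
  apply: (ex_derive_sum_n (fun k x => / (x + INR k))) => k _.
  auto_derive; have := pos_INR k; lra.
- apply: CVU_dom_ext (CVU_dlnG (x + 1)) => n y hy; by rewrite D.
Qed.

Definition Gseq (x : R) (n : nat) : R := INR (fact n) * Rpower (INR n) x / poch x (S n).

Lemma Gseq_lim_pos x : 0 < x -> is_lim_seq (Gseq x) (exp (lnGamma x)).
Proof.
move=> h; apply/is_lim_seq_incr_1.
apply: (is_lim_seq_ext (fun n => exp (lnG n x))); first by move=> n; rewrite lnG_exp.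
apply: is_lim_seq_continuous; last exact: lnGamma_lim.
apply/continuity_pt_filterlim; apply: ex_derive_continuous; auto_derive; done.
Qed.

Lemma Gamma_exp x : 0 < x -> Gamma x = exp (lnGamma x).
Proof. by move=> h; rewrite /Gamma (is_lim_seq_unique _ _ (Gseq_lim_pos x h)). Qed.

Lemma Gamma_pos x : 0 < x -> 0 < Gamma x.
Proof. by move=> h; rewrite Gamma_exp //; exact: exp_pos. Qed.

(** * Gamma and psi off the poles of Gamma *)

Definition nonpole (x : R) := forall n : nat, x + INR n <> 0.

Lemma nonpole_pos x : 0 < x -> nonpole x.
Proof. move=> h n; have := pos_INR n; lra. Qed.

Lemma nonpole_S x : nonpole x -> nonpole (x + 1).
Proof. move=> h n; have := h (S n); rewrite S_INR; lra. Qed.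

Lemma nonpole_neq0 x : nonpole x -> x <> 0.
Proof. move=> h; have := h O; rewrite /=; lra. Qed.

Lemma nonpole_pred x : x - 1 <> 0 -> nonpole x -> nonpole (x - 1).
Proof. move=> h0 h [|n]; first by rewrite /=; lra. have := h n; rewrite S_INR; lra. Qed.

Lemma poch_S_r x n : poch x (S n) = poch x n * (x + INR n).
Proof. by []. Qed.

Lemma poch_S_l x n : poch x (S n) = x * poch (x + 1) n.
Proof.
elim: n => [|n IH]; first by rewrite /=; ring.
rewrite poch_S_r IH (poch_S_r (x + 1)) S_INR; ring.
Qed.

Lemma poch_neq0 x n : nonpole x -> poch x n <> 0.
Proof. move=> h; elim: n => /= [|n IH]; [lra | apply: Rmult_integral_contrapositive; split => //]. Qed.

Lemma Gseq_lim_shift (x l : R) : nonpole x -> is_lim_seq (Gseq (x + 1)) l -> is_lim_seq (Gseq x) (l / x).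
Proof.
move=> h H; have x0 := nonpole_neq0 _ h.
apply: (is_lim_seq_ext_loc (fun n => Gseq (x + 1) n * ((1 + (x + 1) * / INR n) / x))).
  exists 1%nat => n hn.
  have p0 : 0 < INR n by apply: lt_0_INR; lia.
  rewrite /Gseq Rpower_plus Rpower_1 // (poch_S_l x n) [poch (x + 1) (S n)]/=.
  have h1 := poch_neq0 (x + 1) n (nonpole_S _ h); have h2 := h (S n); rewrite S_INR in h2.
  field; repeat split => //; lra.
have -> : l / x = l * ((1 + (x + 1) * 0) / x) by field.
rewrite /Rdiv.
apply: is_lim_seq_mult' => //; apply: is_lim_seq_mult'; last exact: is_lim_seq_const.
apply: is_lim_seq_plus'; first exact: is_lim_seq_const.
apply: is_lim_seq_mult'; first exact: is_lim_seq_const.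
have := is_lim_seq_inv _ _ is_lim_seq_INR; apply; done.
Qed.

(** Facts about [Gamma] are proved on the positive axis, where logarithms are available, and carried
    to the left by the recurrence. *)
Lemma nonpole_ind (P : R -> Prop) : (forall x, 0 < x -> P x) ->
  (forall x, nonpole x -> P (x + 1) -> P x) -> forall x, nonpole x -> P x.
Proof.
move=> h1 h2 x; have [n hn] : exists n : nat, 0 < x + INR n.
  exists (Z.to_nat (up (- x))); have [h _] := archimed (- x).
  have : IZR (up (- x)) <= INR (Z.to_nat (up (-x))) by rewrite INR_IZR_INZ; apply: IZR_le; lia.
  lra.
elim: n x hn => [|n IH] x hn hx; first by apply: h1; move: hn; rewrite /=; lra.
apply: h2 => //; apply: IH; [rewrite S_INR in hn; lra | exact: nonpole_S].
Qed.

Lemma Gamma_lim x : nonpole x -> is_lim_seq (Gseq x) (Gamma x).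
Proof.
move: x; apply: nonpole_ind => x h.
  by rewrite Gamma_exp //; exact: Gseq_lim_pos.
move=> IH; have H := Gseq_lim_shift _ _ h IH.
rewrite /Gamma (is_lim_seq_unique _ _ H); exact: H.
Qed.

Lemma Gamma_S x : nonpole x -> Gamma (x + 1) = x * Gamma x.
Proof.
move=> h; have H := Gseq_lim_shift _ _ h (Gamma_lim _ (nonpole_S _ h)).
rewrite {2}/Gamma (is_lim_seq_unique _ _ H) /=; field; exact: nonpole_neq0.
Qed.

Lemma Gamma_neq0 x : nonpole x -> Gamma x <> 0.
Proof.
move: x; apply: nonpole_ind => x h; first by have := Gamma_pos _ h; lra.
by rewrite Gamma_S // => h1 e; apply: h1; rewrite e Rmult_0_r.
Qed.

Lemma is_derive_Gamma_pos x : 0 < x -> is_derive Gamma x (Gamma x * digam x).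
Proof.
move=> h; apply: (is_derive_ext_loc (fun y => exp (lnGamma y))).
  apply: (filter_imp (fun y => 0 < y)); first by move=> y hy; rewrite Gamma_exp.
  exact: (open_gt 0 x h).
rewrite Gamma_exp // Rmult_comm; apply: (is_derive_comp exp lnGamma); last exact: is_derive_lnGamma.
exact: is_derive_exp.
Qed.

Lemma psi_pos x : 0 < x -> psi x = digam x.
Proof.
move=> h; rewrite /psi (is_derive_unique _ _ _ (is_derive_Gamma_pos x h)); have := Gamma_pos x h => ?; field; lra.
Qed.

Lemma nonpole_near x : nonpole x -> locally x nonpole.
Proof.
move: x; apply: nonpole_ind => x h.
  apply: (filter_imp (fun y => 0 < y)); first exact: nonpole_pos.
  exact: (open_gt 0 x h).
move=> [d hd].
have x0 : 0 < Rabs x by apply: Rabs_pos_lt; exact: nonpole_neq0.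
have K : forall y : R, Rabs (y - x) < Rmin d (Rabs x) -> nonpole y.
  move=> y hy'.
  have h1 := Rlt_le_trans _ _ _ hy' (Rmin_l _ _); have h2 := Rlt_le_trans _ _ _ hy' (Rmin_r _ _).
  have E : y = (y + 1) - 1 by ring.
  rewrite E; apply: nonpole_pred.
    by rewrite -E => e; move: h2; rewrite e (_ : 0 - x = - x) ?Rabs_Ropp; [lra | ring].
  apply: hd; change (Rabs (y + 1 - (x + 1)) < d).
  by have -> : y + 1 - (x + 1) = y - x by ring.
exists (mkposreal (Rmin d (Rabs x)) (Rmin_pos _ _ (cond_pos d) x0)) => y hy.
exact: K.
Qed.

Lemma ex_derive_Gamma x : nonpole x -> ex_derive Gamma x.
Proof.
move: x; apply: nonpole_ind => x h.
  by exists (Gamma x * digam x); exact: is_derive_Gamma_pos.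
move=> [l hl]; exists ((l * x - Gamma (x + 1)) / x ^ 2).
apply: (is_derive_ext_loc (fun y => Gamma (y + 1) / y)).
  apply: (filter_imp nonpole); last exact: nonpole_near.
  have K : forall y : R, nonpole y -> Gamma (y + 1) / y = Gamma y.
    by move=> y hy; rewrite Gamma_S //; field; exact: nonpole_neq0.
  move=> y hy; exact: K.
have x0 := nonpole_neq0 _ h.
have H : is_derive (fun y => Gamma (y + 1)) x l.
  have H2 : is_derive (fun y : R => y + 1) x 1 by auto_derive.
  have := is_derive_comp Gamma (fun y => y + 1) x l 1 hl H2.
  by rewrite /scal /= /mult /= Rmult_1_l.
have := is_derive_div _ _ _ _ _ H (is_derive_id x) x0; rewrite /one /=.
by rewrite Rmult_1_r.
Qed.

Lemma psi_S x : nonpole x -> psi (x + 1) = psi x + / x.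
Proof.
move=> h; have x0 := nonpole_neq0 _ h; have g0 := Gamma_neq0 _ h.
have [l hl] := ex_derive_Gamma _ h.
have H : is_derive Gamma (x + 1) (Gamma x + x * l).
  apply: (is_derive_ext_loc (fun y => (y - 1) * Gamma (y - 1))).
    have [d hd] := nonpole_near _ h.
    have K : forall y : R, Rabs (y - (x + 1)) < d -> (y - 1) * Gamma (y - 1) = Gamma y.
      move=> y hy; rewrite -Gamma_S; first by congr Gamma; ring.
      apply: hd; change (Rabs (y - 1 - x) < d).
      by have -> : y - 1 - x = y - (x + 1) by ring.
    exists d => y hy; exact: K.
  have H2 : is_derive (fun y : R => y - 1) (x + 1) 1 by auto_derive.
  have H1 : is_derive (fun y => Gamma (y - 1)) (x + 1) l.
    have hl' : is_derive Gamma (x + 1 - 1) l by rewrite (_ : x + 1 - 1 = x) //; ring.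
    have := is_derive_comp Gamma (fun y => y - 1) (x + 1) l 1 hl' H2.
    by rewrite /scal /= /mult /= Rmult_1_l.
  have := is_derive_mult _ _ _ _ _ H2 H1 Rmult_comm; rewrite /plus /mult /=.
  by rewrite (_ : x + 1 - 1 = x) ?Rmult_1_l //; ring.
rewrite /psi (is_derive_unique _ _ _ H) (is_derive_unique _ _ _ hl) Gamma_S //; field; split => //.
Qed.

Lemma Gamma_1 : Gamma 1 = 1.
Proof.
rewrite /Gamma (is_lim_seq_unique _ 1) //.
apply: (is_lim_seq_ext_loc (fun n => / (1 + / INR n))).
  exists 1%nat => n hn; have n0 : 0 < INR n by apply: lt_0_INR; lia.
  rewrite Rpower_1 //.
  have -> : poch 1 (S n) = INR (fact n) * (INR n + 1).
    elim: (n) => [|m IH]; first by rewrite /=; ring.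
    rewrite poch_S_r IH fact_simpl mult_INR S_INR; ring.
  have := INR_fact_neq_0 n; move=> ?; field; repeat split => //; lra.
have -> : Finite 1 = Rbar_inv (Finite (1 + 0)) by rewrite /= Rplus_0_r Rinv_1.
apply: is_lim_seq_inv; last by move=> [] /=; lra.
apply: is_lim_seq_plus'; first exact: is_lim_seq_const.
have := is_lim_seq_inv _ _ is_lim_seq_INR; apply; done.
Qed.

Lemma ln_concave a t : 0 < a -> 0 <= t <= 1 -> (1 - t) * ln a + t * ln (a + 1) <= ln (a + t).
Proof.
move=> a0 ht.
have h1 := ln_ratio_le (a + t) a ltac:(lra) a0; have h2 := ln_ratio_le (a + t) (a + 1) ltac:(lra) ltac:(lra).
have : (1 - t) * (ln a - ln (a + t)) + t * (ln (a + 1) - ln (a + t)) <= (1 - t) * ((a - (a + t)) / (a + t)) + t * ((a + 1 - (a + t)) / (a + t)) by nra.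
have -> : (1 - t) * ((a - (a + t)) / (a + t)) + t * ((a + 1 - (a + t)) / (a + t)) = 0 by field; lra.
lra.
Qed.

Lemma lnG_convex n x t : 0 < x -> 0 <= t <= 1 -> lnG n (x + t) <= (1 - t) * lnG n x + t * lnG n (x + 1).
Proof.
move=> h ht; rewrite /lnG.
have : (1 - t) * sum_n (fun k => ln (x + INR k)) (S n) + t * sum_n (fun k => ln (x + 1 + INR k)) (S n) <= sum_n (fun k => ln (x + t + INR k)) (S n); last by nra.
have -> : (1 - t) * sum_n (fun k => ln (x + INR k)) (S n) + t * sum_n (fun k => ln (x + 1 + INR k)) (S n) =
  sum_n (fun k => (1 - t) * ln (x + INR k) + t * ln (x + 1 + INR k)) (S n).
  have := sum_n_plus (fun k => (1 - t) * ln (x + INR k)) (fun k => t * ln (x + 1 + INR k)) (S n).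
  by rewrite /plus /= => ->; congr (_ + _); symmetry; apply: (sum_n_mult_l).
apply: sum_n_m_le => k; have := pos_INR k => hk.
rewrite (_ : x + 1 + INR k = (x + INR k) + 1); last by ring.
rewrite (_ : x + t + INR k = (x + INR k) + t); last by ring.
apply: ln_concave => //; lra.
Qed.

(** Log-convexity between x and x + 1, with the recurrence inserted for the right end;
    [bohr_mollerup] takes it in this form. It passes to the limit from the concavity of ln in each
    Gauss product. *)
Lemma Gamma_convex x t : 0 < x -> 0 <= t <= 1 -> Gamma (x + t) <= Gamma x * Rpower x t.
Proof.
move=> h ht.
have H : lnGamma (x + t) <= (1 - t) * lnGamma x + t * lnGamma (x + 1).
  apply: (is_lim_seq_le (fun n => lnG n (x + t)) (fun n => (1 - t) * lnG n x + t * lnG n (x + 1)) (lnGamma (x + t)) ((1 - t) * lnGamma x + t * lnGamma (x + 1))).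
  - by move=> n; apply: lnG_convex.
  - apply: lnGamma_lim; lra.
  - apply: is_lim_seq_plus'; apply: is_lim_seq_mult'; (try exact: is_lim_seq_const); apply: lnGamma_lim; lra.
have E : lnGamma (x + 1) = ln x + lnGamma x.
  apply: exp_inv; rewrite exp_plus exp_ln // -!Gamma_exp ?Gamma_S //; [exact: nonpole_pos | lra].
rewrite E in H; rewrite !Gamma_exp /Rpower -?exp_plus; try lra.
have : lnGamma (x + t) <= lnGamma x + t * ln x by lra.
case=> [l|->]; [left; exact: exp_increasing | lra].
Qed.

(** * Non-integers, the sine product and the reflection formula *)

Definition nonint (x : R) := forall m : Z, x <> IZR m.

Lemma nonint_plus x m : nonint x -> nonint (x + IZR m).
Proof. move=> h k e; apply: (h (k - m)%Z); rewrite minus_IZR; lra. Qed.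

Lemma nonint_S x : nonint x -> nonint (x + 1).
Proof. exact: (nonint_plus x 1). Qed.

Lemma nonint_P x : nonint x -> nonint (x - 1).
Proof. exact: (nonint_plus x (-1)). Qed.

Lemma nonint_opp x : nonint x -> nonint (- x).
Proof. move=> h k e; apply: (h (- k)%Z); rewrite opp_IZR; lra. Qed.

Lemma nonint_plus_nat x n : nonint x -> nonint (x + INR n).
Proof. rewrite INR_IZR_INZ; exact: nonint_plus. Qed.

Lemma nonint_minus_nat x n : nonint x -> nonint (x - INR n).
Proof.
move=> h; rewrite INR_IZR_INZ; have := nonint_plus x (- Z.of_nat n) h; by rewrite opp_IZR.
Qed.

Lemma nonint_nonpole x : nonint x -> nonpole x.
Proof. move=> h n e; apply: (h (- Z.of_nat n)%Z); rewrite opp_IZR -INR_IZR_INZ; lra. Qed.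

Lemma nonint_neq0 x : nonint x -> x <> 0.
Proof. move=> h; exact: (h 0%Z). Qed.

Lemma nonint_01 x : 0 < x < 1 -> nonint x.
Proof.
move=> [h1 h2] m e; rewrite e in h1 h2.
have /lt_IZR a : 0 < IZR m by []. have /lt_IZR b : IZR m < 1 by []. lia.
Qed.

Lemma nat_above x : exists n : nat, x < INR n.
Proof.
exists (Z.to_nat (up x)); have [h _] := archimed x.
have : IZR (up x) <= INR (Z.to_nat (up x)) by rewrite INR_IZR_INZ; apply: IZR_le; lia.
lra.
Qed.

(** Induction in both directions, because identities are established on (0, 1) and spread by
    recurrences. *)
Lemma nonint_ind (P : R -> Prop) : (forall x, 0 < x < 1 -> P x) ->
  (forall x, nonint x -> P x -> P (x + 1)) -> (forall x, nonint x -> P (x + 1) -> P x) ->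
  forall x, nonint x -> P x.
Proof.
move=> h1 h2 h3.
have up : forall n x, nonint x -> 0 < x < INR n + 1 -> P x.
  elim=> [|n IH] x hx; first by rewrite /= => h; apply: h1; lra.
  rewrite S_INR => h; case: (Rlt_dec x 1) => hx1; first by apply: h1; lra.
  have hx2 : x <> 1 by exact: (hx 1%Z).
  rewrite (_ : x = (x - 1) + 1); last by ring.
  by apply: h2; [exact: nonint_P | apply: IH; [exact: nonint_P | lra]].
have pos : forall x, nonint x -> 0 < x -> P x.
  move=> x hx h0; have [n hn] := nat_above x; apply: (up n) => //; lra.
have dn : forall n x, nonint x -> 0 < x + INR n -> P x.
  elim=> [|n IH] x hx; first by rewrite /= Rplus_0_r; exact: pos.
  rewrite S_INR => h; apply: h3 => //; apply: IH; [exact: nonint_S | lra].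
move=> x hx; have [n hn] := nat_above (- x); apply: (dn n) => //; lra.
Qed.

Lemma sin_nonint x : nonint x -> sin (PI * x) <> 0.
Proof.
move=> h /sin_eq_0_0 [k hk]; apply: (h k); have := PI_RGT_0 => p.
apply: (Rmult_eq_reg_l PI); lra.
Qed.

(* Wallis-type integrals: the ratio of the values at x and at 0 satisfies a
   two-term recursion, which is the sine product. *)
Definition Wal (n : nat) (x : R) : R := RInt (fun t => cos t ^ n * cos (2 * x * t)) 0 (PI / 2).

Lemma Wal_ex n x : ex_RInt (fun t => cos t ^ n * cos (2 * x * t)) 0 (PI / 2).
Proof.
apply: (ex_RInt_continuous (V := R_CompleteNormedModule)) => t _.
apply: ex_derive_continuous; auto_derive; done.
Qed.

(** Two integrations by parts at once: B is a primitive of the difference of the two integrands, and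
    it vanishes at both ends. *)
Lemma Wal_rec n x : ((INR n + 2) ^ 2 - 4 * x ^ 2) * Wal (S (S n)) x = (INR n + 2) * (INR n + 1) * Wal n x.
Proof.
set B := fun t => (INR n + 2) * (cos t ^ S n * sin t * cos (2 * x * t)) - 2 * x * (cos t ^ S (S n) * sin (2 * x * t)).
set b := fun t => ((INR n + 2) ^ 2 - 4 * x ^ 2) * (cos t ^ S (S n) * cos (2 * x * t)) - (INR n + 2) * (INR n + 1) * (cos t ^ n * cos (2 * x * t)).
have D : forall t, is_derive B t (b t).
  move=> t; rewrite /B /b; auto_derive => //.
  rewrite -/(INR (S n)) -/(INR (S (S n))) !S_INR -!/(cos t ^ n).
  have := sin2_cos2 t; rewrite /Rsqr => E.
  have E2 : sin t * sin t = 1 - cos t * cos t by lra.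
  set c := cos t in E2 *; set s := sin t in E2 *; set C2 := cos (2 * x * t); set S2 := sin (2 * x * t).
  transitivity ((INR n + 2) * ((- (INR n + 1) * c ^ n * (s * s) + c ^ S n * c) * C2 - c ^ S n * s * S2 * (2 * x))
     - 2 * x * (- (INR n + 2) * c ^ S n * s * S2 + c ^ S (S n) * C2 * (2 * x))).
    by rewrite /=; ring.
  rewrite E2 /=; ring.
have I1 : is_RInt b 0 (PI / 2) (minus (B (PI / 2)) (B 0)).
  apply: (is_RInt_derive B b) => t _; first exact: D.
  apply: ex_derive_continuous; rewrite /b; auto_derive; done.
have E : minus (B (PI / 2)) (B 0) = 0.
  have -> : B (PI / 2) = 0 by rewrite /B cos_PI2 -!tech_pow_Rmult; ring.
  have -> : B 0 = 0 by rewrite /B Rmult_0_r sin_0; ring.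
  exact: minus_eq_zero.
rewrite E in I1.
have I2 : is_RInt b 0 (PI / 2) (((INR n + 2) ^ 2 - 4 * x ^ 2) * Wal (S (S n)) x - (INR n + 2) * (INR n + 1) * Wal n x).
  apply: (is_RInt_minus (V := R_NormedModule) (fun t => ((INR n + 2) ^ 2 - 4 * x ^ 2) * (cos t ^ S (S n) * cos (2 * x * t)))
    (fun t => (INR n + 2) * (INR n + 1) * (cos t ^ n * cos (2 * x * t)))).
    apply: (is_RInt_scal (V := R_NormedModule) (fun t => cos t ^ S (S n) * cos (2 * x * t))); apply: (RInt_correct (V := R_CompleteNormedModule)); exact: Wal_ex.
  apply: (is_RInt_scal (V := R_NormedModule) (fun t => cos t ^ n * cos (2 * x * t))); apply: (RInt_correct (V := R_CompleteNormedModule)); exact: Wal_ex.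
have := is_RInt_unique (V := R_CompleteNormedModule) _ _ _ _ I1; rewrite (is_RInt_unique (V := R_CompleteNormedModule) _ _ _ _ I2); lra.
Qed.

Lemma Wal_0_x x : x <> 0 -> Wal 0 x = sin (PI * x) / (2 * x).
Proof.
move=> x0; apply: (is_RInt_unique (V := R_CompleteNormedModule)).
have -> : sin (PI * x) / (2 * x) = minus (sin (2 * x * (PI / 2)) / (2 * x)) (sin (2 * x * 0) / (2 * x)).
  rewrite /minus /plus /opp /= Rmult_0_r sin_0 (_ : 2 * x * (PI / 2) = PI * x); last by field.
  by field.
apply: (is_RInt_derive (fun t => sin (2 * x * t) / (2 * x)) (fun t => cos t ^ 0 * cos (2 * x * t))) => t _.
  by auto_derive => //; rewrite /=; field.
apply: ex_derive_continuous; auto_derive; done.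
Qed.

Lemma Wal_0_0 : Wal 0 0 = PI / 2.
Proof.
rewrite /Wal (RInt_ext _ (fun _ => 1)).
  by rewrite RInt_const /scal /= /mult /=; ring.
by move=> t _; rewrite Rmult_0_r Rmult_0_l cos_0 /=; ring.
Qed.

Lemma Wal_pos m : 0 < Wal (2 * m) 0.
Proof.
elim: m => [|m IH]; first by rewrite Wal_0_0; have := PI_RGT_0; lra.
have := Wal_rec (2 * m) 0; rewrite (_ : (2 * S m)%nat = S (S (2 * m))); last lia.
have := pos_INR (2 * m) => h E.
have : 0 < (INR (2 * m) + 2) * (INR (2 * m) + 1) * Wal (2 * m) 0 by apply: Rmult_lt_0_compat => //; nra.
rewrite -E => P; apply: (Rmult_lt_reg_l ((INR (2 * m) + 2) ^ 2 - 4 * 0 ^ 2)); [nra | lra].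
Qed.

Lemma tcos_le_sin t : 0 <= t <= PI / 2 -> t * cos t <= sin t.
Proof.
move=> ht; have := MVT_le (fun t => sin t - t * cos t) (fun t => t * sin t) 0 t ltac:(lra).
rewrite sin_0 Rmult_0_l => h; have : 0 - 0 <= sin t - t * cos t; last lra.
apply: h => s hs; first by auto_derive => //; ring.
apply: Rmult_le_pos; first lra; apply: sin_ge_0; have := PI_RGT_0; lra.
Qed.

(** One has 1 - cos(2xt) = 2 sin(xt)^2 <= 2 x^2 t^2, and two of the cosines absorb t^2 since t cos t
    <= sin t. What remains is the integrand of a decrement of the Wallis integrals. *)
Lemma Wal_diff m x : Rabs (Wal (S (S (2 * m))) x - Wal (S (S (2 * m))) 0) <= 2 * x ^ 2 * (Wal (2 * m) 0 - Wal (S (S (2 * m))) 0).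
Proof.
set n := (2 * m)%nat.
have cor k y := RInt_correct (V := R_CompleteNormedModule) _ _ _ (Wal_ex k y).
have I1 := is_RInt_minus (V := R_NormedModule) _ _ _ _ _ _ (cor (S (S n)) x) (cor (S (S n)) 0).
have I2 := is_RInt_scal (V := R_NormedModule) _ _ _ (2 * x ^ 2) _ (is_RInt_minus (V := R_NormedModule) _ _ _ _ _ _ (cor n 0) (cor (S (S n)) 0)).
apply: (norm_RInt_le (V := R_NormedModule) _ _ _ _ _ _ _ _ I1 I2); first by have := PI_RGT_0; lra.
move=> t ht; rewrite /norm /= /abs /= /minus /plus /opp /scal /= /mult /=.
rewrite Rmult_0_r Rmult_0_l cos_0 !Rmult_1_r.
have c0 : 0 <= cos t by apply: cos_ge_0; lra.
set c := cos t in c0 *.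
have cn : 0 <= c ^ n by apply: pow_le.
have E : 1 - cos (2 * x * t) = 2 * sin (x * t) ^ 2.
  rewrite (_ : 2 * x * t = 2 * (x * t)); last by ring.
  rewrite cos_2a_sin /=; ring.
rewrite (_ : c * (c * c ^ n) * cos (2 * x * t) + - (c * (c * c ^ n)) = - (c ^ n * (c * c) * (1 - cos (2 * x * t)))); last by ring.
rewrite Rabs_Ropp E Rabs_pos_eq; last first.
  apply: Rmult_le_pos; [nra | have := pow2_ge_0 (sin (x * t)); lra].
have s1 : sin (x * t) ^ 2 <= (x * t) ^ 2.
  rewrite -!Rsqr_pow2; apply: Rsqr_le_abs_1.
  have := bounded_variation sin cos 1 0 (x * t); rewrite sin_0 !Rminus_0_r Rmult_1_l; apply=> u _.
  split; [exact: is_derive_sin | by have := COS_bound u; split_Rabs; lra].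
have s2 := tcos_le_sin t ht; rewrite -/c in s2.
have s3 : (t * c) ^ 2 <= 1 - c * c.
  have := sin2_cos2 t; rewrite /Rsqr -/c => h; have : 0 <= t * c by nra.
  nra.
have s4 : (c * c) * sin (x * t) ^ 2 <= x ^ 2 * (1 - c * c).
  apply: (Rle_trans _ (c * c * (x * t) ^ 2)); first by apply: Rmult_le_compat_l => //; nra.
  have -> : c * c * (x * t) ^ 2 = x ^ 2 * (t * c) ^ 2 by ring.
  apply: Rmult_le_compat_l => //; exact: pow2_ge_0.
have := Rmult_le_compat_l _ _ _ cn s4; rewrite /=; lra.
Qed.

Fixpoint sprod (x : R) (m : nat) : R :=
  match m with O => 1 | S k => sprod x k * (1 - x ^ 2 / INR (S k) ^ 2) end.

Lemma Wal_sprod m x : Wal (2 * m) x * Wal 0 0 * sprod x m = Wal 0 x * Wal (2 * m) 0.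
Proof.
elim: m => [|m IH]; first by rewrite /=; ring.
have r1 := Wal_rec (2 * m) x; have r0 := Wal_rec (2 * m) 0.
rewrite (_ : (2 * S m)%nat = S (S (2 * m))); last lia.
have E : INR (2 * m) = 2 * INR m by rewrite mult_INR.
rewrite E in r1 r0; have h := pos_INR m.
rewrite [sprod x (S m)]/= -/(INR (S m)) S_INR.
set M := INR m in r1 r0 h *; set w2 := Wal (S (S (2 * m))) x in r1 *; set w20 := Wal (S (S (2 * m))) 0 in r0 *.
set w := Wal (2 * m) x in IH r1 *; set w0 := Wal (2 * m) 0 in IH r0 *.
have e1 : w2 * (1 - x ^ 2 / (M + 1) ^ 2) = (2 * M + 1) / (2 * M + 2) * w.
  apply: (Rmult_eq_reg_l ((2 * M + 2) ^ 2)); last by apply: pow_nonzero; lra.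
  transitivity (((2 * M + 2) ^ 2 - 4 * x ^ 2) * w2); first by field; lra.
  rewrite r1; field; lra.
have e0 : w20 = (2 * M + 1) / (2 * M + 2) * w0.
  apply: (Rmult_eq_reg_l ((2 * M + 2) ^ 2)); last by apply: pow_nonzero; lra.
  transitivity (((2 * M + 2) ^ 2 - 4 * 0 ^ 2) * w20); first by ring.
  rewrite r0; field; lra.
transitivity (Wal 0 0 * sprod x m * (w2 * (1 - x ^ 2 / (M + 1) ^ 2))); first by rewrite /=; ring.
rewrite e1 e0.
transitivity ((2 * M + 1) / (2 * M + 2) * (w * Wal 0 0 * sprod x m)); first ring.
rewrite IH; ring.
Qed.

(** By the recursion at x = 0 the decrement in [Wal_diff] is the fraction 1/(2m + 1) of the integral
    itself. *)
Lemma Wal_ratio x : is_lim_seq (fun m => Wal (2 * m) x / Wal (2 * m) 0) 1.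
Proof.
apply/is_lim_seq_incr_1.
have H : forall m, Rabs (Wal (2 * S m) x / Wal (2 * S m) 0 - 1) <= 2 * x ^ 2 * / INR (S m).
  move=> m; have p := Wal_pos (S m); have h := Wal_diff m x; have r0 := Wal_rec (2 * m) 0.
  rewrite (_ : (2 * S m)%nat = S (S (2 * m))) in p *; last lia.
  have E : INR (2 * m) = 2 * INR m by rewrite mult_INR.
  rewrite E in r0; have hm := pos_INR m.
  set w2 := Wal _ x in h *; set w20 := Wal (S _) 0 in p h r0 *; set w0 := Wal (2 * m) 0 in h r0.
  have e0 : w0 - w20 = / (2 * INR m + 1) * w20.
    apply: (Rmult_eq_reg_l (2 * INR m + 1)); last lra.
    apply: (Rmult_eq_reg_l (2 * INR m + 2)); last lra.
    transitivity ((2 * INR m + 2) * (2 * INR m + 1) * w0 - (2 * INR m + 2) * (2 * INR m + 1) * w20); first ring.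
    rewrite -r0; field; lra.
  rewrite (_ : w2 / w20 - 1 = (w2 - w20) / w20); last by field; lra.
  rewrite /Rdiv Rabs_mult (Rabs_pos_eq (/ w20)); last by left; exact: Rinv_0_lt_compat.
  apply: (Rmult_le_reg_r w20) => //; rewrite Rmult_assoc Rinv_l; last lra.
  rewrite Rmult_1_r; apply: Rle_trans h _; rewrite e0 -Rmult_assoc; apply: Rmult_le_compat_r; first lra.
  apply: Rmult_le_compat_l; first by have := pow2_ge_0 x; lra.
  rewrite S_INR; apply: Rinv_le_contravar; lra.
have L : is_lim_seq (fun m => 2 * x ^ 2 * / INR (S m)) 0.
  have -> : Finite 0 = Rbar_mult (2 * x ^ 2) 0 by rewrite /= Rmult_0_r.
  apply: is_lim_seq_scal_l; have := is_lim_seq_inv _ _ (proj1 (is_lim_seq_incr_1 INR p_infty) is_lim_seq_INR); apply; done.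
apply: (is_lim_seq_le_le (fun m => 1 - 2 * x ^ 2 * / INR (S m)) _ (fun m => 1 + 2 * x ^ 2 * / INR (S m))).
- by move=> m; have := H m; move=> /Rabs_le_between; lra.
- rewrite -{2}(Rminus_0_r 1); apply: is_lim_seq_minus' => //; exact: is_lim_seq_const.
- rewrite -{2}(Rplus_0_r 1); apply: is_lim_seq_plus' => //; exact: is_lim_seq_const.
Qed.

Lemma sprod_lim x : nonint x -> is_lim_seq (sprod x) (sin (PI * x) / (PI * x)).
Proof.
move=> h; have x0 := nonint_neq0 _ h; have s0 := sin_nonint _ h; have p := PI_RGT_0.
have w0 : Wal 0 x <> 0 by rewrite Wal_0_x // => e; apply: s0; rewrite (_ : sin (PI * x) = sin (PI * x) / (2 * x) * (2 * x)); [rewrite e; ring | field].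
have L : is_lim_seq (fun m => / (Wal (2 * m) x / Wal (2 * m) 0)) 1.
  rewrite -Rinv_1; have := is_lim_seq_inv _ _ (Wal_ratio x); apply; case; lra.
have -> : sin (PI * x) / (PI * x) = Wal 0 x / Wal 0 0 * 1.
  rewrite Wal_0_x // Wal_0_0; field; lra.
apply: (is_lim_seq_ext_loc (fun m => Wal 0 x / Wal 0 0 * / (Wal (2 * m) x / Wal (2 * m) 0))); last first.
  by apply: is_lim_seq_mult' => //; exact: is_lim_seq_const.
exists O => m _; have E := Wal_sprod m x; have p0 := Wal_pos m; have p00 := Wal_0_0.
have wx : Wal (2 * m) x <> 0.
  move=> e; rewrite e !Rmult_0_l in E; have : Wal 0 x * Wal (2 * m) 0 <> 0 by apply: Rmult_integral_contrapositive; split => //; lra.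
  lra.
apply: (Rmult_eq_reg_l (Wal (2 * m) x * Wal 0 0)); last by apply: Rmult_integral_contrapositive; split => //; lra.
rewrite E; field; repeat split => //; lra.
Qed.

Lemma poch_sprod x n : 0 < x < 1 ->
  poch x (S n) * poch (1 - x) (S n) = x * INR (fact n) ^ 2 * sprod x n * (INR n + 1 - x).
Proof.
move=> hx; elim: n => [|n IH]; first by rewrite /=; ring.
rewrite (poch_S_r x (S n)) (poch_S_r (1 - x) (S n)) fact_simpl mult_INR.
transitivity (poch x (S n) * poch (1 - x) (S n) * ((x + INR (S n)) * (1 - x + INR (S n)))); first ring.
rewrite IH [sprod x (S n)]/= -/(INR (S n)) !S_INR; have := pos_INR n => h; field; lra.
Qed.

(** The Gauss products at x and 1 - x, multiplied by the partial sine product, are elementary and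
    tend to 1/x; comparing with the product of the three limits gives the formula. *)
Lemma Gamma_reflect_01 x : 0 < x < 1 -> Gamma x * Gamma (1 - x) * sin (PI * x) = PI.
Proof.
move=> hx; have ni := nonint_01 x hx; have p := PI_RGT_0.
have L1 := is_lim_seq_mult' _ _ _ _ (Gamma_lim x (nonpole_pos x ltac:(lra))) (Gamma_lim (1 - x) (nonpole_pos (1 - x) ltac:(lra))).
have L2 := is_lim_seq_mult' _ _ _ _ L1 (sprod_lim x ni).
have L3 : is_lim_seq (fun n => Gseq x n * Gseq (1 - x) n * sprod x n) (/ x).
  apply: (is_lim_seq_ext_loc (fun n => / x * / (1 + (1 - x) * / INR n))).
    exists 1%nat => n hn; have n0 : 0 < INR n by apply: lt_0_INR; lia.
    have E := poch_sprod x n hx.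
    have p1 : 0 < poch x (S n) by apply: poch_pos; lra.
    have p2 : 0 < poch (1 - x) (S n) by apply: poch_pos; lra.
    have sn : sprod x n <> 0.
      move=> e; rewrite e in E; have : 0 < poch x (S n) * poch (1 - x) (S n) by apply: Rmult_lt_0_compat.
      rewrite E; lra.
    transitivity (INR (fact n) ^ 2 * (Rpower (INR n) x * Rpower (INR n) (1 - x)) / (poch x (S n) * poch (1 - x) (S n)) * sprod x n); last first.
      rewrite /Gseq; field; split; lra.
    rewrite -Rpower_plus (_ : x + (1 - x) = 1) ?Rpower_1 //; last by ring.
    rewrite E; field; repeat split => //; nra.
  rewrite -{2}(Rmult_1_r (/ x)); apply: is_lim_seq_mult'; first exact: is_lim_seq_const.
  have -> : Finite 1 = Rbar_inv (Finite (1 + (1 - x) * 0)) by rewrite /= Rmult_0_r Rplus_0_r Rinv_1.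
  apply: is_lim_seq_inv; last by case; lra.
  apply: is_lim_seq_plus'; first exact: is_lim_seq_const.
  apply: is_lim_seq_mult'; first exact: is_lim_seq_const.
  have := is_lim_seq_inv _ _ is_lim_seq_INR; apply; done.
have := is_lim_seq_unique _ _ L2; rewrite (is_lim_seq_unique _ _ L3) => -[E].
have : / x * (PI * x) = Gamma x * Gamma (1 - x) * (sin (PI * x) / (PI * x)) * (PI * x) by rewrite E.
rewrite (_ : / x * (PI * x) = PI); last by field; lra.
rewrite (_ : _ * (sin (PI * x) / (PI * x)) * (PI * x) = Gamma x * Gamma (1 - x) * sin (PI * x)); last by field; lra.
by [].
Qed.

Lemma Gamma_reflect x : nonint x -> Gamma x * Gamma (1 - x) = PI / sin (PI * x).
Proof.
move=> h; have s0 := sin_nonint _ h.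
suff E : Gamma x * Gamma (1 - x) * sin (PI * x) = PI.
  by apply: (Rmult_eq_reg_r (sin (PI * x))) => //; rewrite E; field.
move: x h {s0}; apply: nonint_ind; first exact: Gamma_reflect_01.
(* Multiplied by the sine, the product has period 1, so the value on (0, 1) spreads to all
   non-integers. *)
all: have step : forall x, nonint x -> Gamma (x + 1) * Gamma (1 - (x + 1)) * sin (PI * (x + 1)) = Gamma x * Gamma (1 - x) * sin (PI * x).
1,3: move=> x h; rewrite Rmult_plus_distr_l Rmult_1_r neg_sin Gamma_S; last exact: nonint_nonpole.
1,2: rewrite (_ : 1 - (x + 1) = - x); last by ring.
1,2: rewrite (_ : 1 - x = - x + 1); last by ring.
1,2: rewrite (Gamma_S (- x)); [ring | apply: nonint_nonpole; exact: nonint_opp].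
by move=> x h E; rewrite step.
by move=> x h; rewrite step.
Qed.

(** The quotient of two solutions of f(y + 1) = r(y) f(y) has period 1, and convexity compares its
    values at x and at 1 up to the factor (r(n + x) / r(n))^(1 - x), which tends to 1. A general
    multiplier r is kept since the lemma identifies Euler's integral, the Mellin transform of K and
    a Beta integral. *)
Lemma bohr_mollerup (r f1 f2 : R -> R) (x : R) : 0 < x <= 1 ->
  (forall y, 0 < y -> 0 < r y) -> (forall y, 0 < y -> 0 < f1 y) -> (forall y, 0 < y -> 0 < f2 y) ->
  (forall y, 0 < y -> f1 (y + 1) = r y * f1 y) -> (forall y, 0 < y -> f2 (y + 1) = r y * f2 y) ->
  (forall y t, 0 < y -> 0 <= t <= 1 -> f1 (y + t) <= f1 y * Rpower (r y) t) ->
  (forall y t, 0 < y -> 0 <= t <= 1 -> f2 (y + t) <= f2 y * Rpower (r y) t) ->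
  is_lim_seq (fun n => r (INR n + x) / r (INR n)) 1 ->
  f1 x * f2 1 = f2 x * f1 1.
Proof.
move=> hx hr p1 p2 e1 e2 c1 c2 L.
have key : forall f g, (forall y, 0 < y -> 0 < f y) -> (forall y, 0 < y -> 0 < g y) ->
  (forall y, 0 < y -> f (y + 1) = r y * f y) -> (forall y, 0 < y -> g (y + 1) = r y * g y) ->
  (forall y t, 0 < y -> 0 <= t <= 1 -> f (y + t) <= f y * Rpower (r y) t) ->
  (forall y t, 0 < y -> 0 <= t <= 1 -> g (y + t) <= g y * Rpower (r y) t) ->
  f x / g x <= f 1 / g 1.
  move=> f g pf pg ef eg cf cg.
  have q : forall y n, 0 < y -> f (y + INR n) / g (y + INR n) = f y / g y.
    move=> y n hy; elim: n => [|n IH]; first by rewrite Rplus_0_r.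
    have hn := pos_INR n; have py : 0 < y + INR n by lra.
    rewrite S_INR -Rplus_assoc ef // eg // -IH; have := pg _ py; have := hr _ py => ? ?; field; lra.
  have B : forall n, (1 <= n)%nat -> f x / g x <= f 1 / g 1 * Rpower (r (INR n + x) / r (INR n)) (1 - x).
    move=> n hn; have n0 : 0 < INR n by apply: lt_0_INR; lia.
    have nx : 0 < INR n + x by lra.
    have En : f 1 / g 1 = f (INR n) / g (INR n).
      have := q 1 (n - 1)%nat Rlt_0_1; rewrite minus_INR //= => <-.
      by rewrite (_ : 1 + (INR n - 1) = INR n) //; ring.
    rewrite En -(q x n); last lra.
    rewrite (Rplus_comm x).
    (* Convexity from n to n + x bounds f at n + x from above; convexity from n + x to n + 1 bounds
       g there from below. *)
    have a1 := cf (INR n) x n0 ltac:(lra).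
    have a2 := cg (INR n + x) (1 - x) nx ltac:(lra).
    rewrite (_ : INR n + x + (1 - x) = INR n + 1) in a2; last by ring.
    rewrite eg // in a2.
    have rn := hr _ n0; have rx := hr _ nx; have gn := pg _ n0; have gx := pg _ nx; have fn := pf _ n0.
    have E : Rpower (r (INR n + x) / r (INR n)) (1 - x) = Rpower (r (INR n + x)) (1 - x) * Rpower (r (INR n)) x / r (INR n).
      rewrite /Rpower ln_div // (_ : (1 - x) * (ln (r (INR n + x)) - ln (r (INR n))) = (1 - x) * ln (r (INR n + x)) + x * ln (r (INR n)) + - ln (r (INR n))); last by ring.
      by rewrite !exp_plus exp_Ropp exp_ln.
    rewrite E; set A := Rpower (r (INR n + x)) (1 - x) in a2 *; set D := Rpower (r (INR n)) x in a1 *.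
    have D0 : 0 < D by exact: exp_pos.
    apply: (Rmult_le_reg_r (g (INR n + x))) => //.
    rewrite /Rdiv Rmult_assoc Rinv_l; last lra.
    rewrite Rmult_1_r; apply: Rle_trans a1 _.
    apply: (Rmult_le_reg_r (g (INR n) * r (INR n))); first nra.
    rewrite (_ : f (INR n) * / g (INR n) * (A * D * / r (INR n)) * g (INR n + x) * (g (INR n) * r (INR n)) = f (INR n) * D * (g (INR n + x) * A)); last by field; lra.
    rewrite (Rmult_comm (g (INR n))); apply: Rmult_le_compat_l => //; nra.
  have L2 : is_lim_seq (fun n => f 1 / g 1 * Rpower (r (INR n + x) / r (INR n)) (1 - x)) (f 1 / g 1 * 1).
    apply: is_lim_seq_mult'; first exact: is_lim_seq_const.
    have -> : Finite 1 = Finite (Rpower 1 (1 - x)) by rewrite /Rpower ln_1 Rmult_0_r exp_0.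
    apply: (is_lim_seq_continuous (fun y => Rpower y (1 - x))) => //.
    apply/continuity_pt_filterlim; apply: (ex_derive_continuous (fun y => Rpower y (1 - x))).
    rewrite /Rpower; auto_derive; lra.
  rewrite Rmult_1_r in L2.
  apply: (is_lim_seq_le_loc (fun _ => f x / g x) _ (f x / g x) (f 1 / g 1) _ (is_lim_seq_const _) L2).
  by exists 1%nat.
have k1 := key f1 f2 p1 p2 e1 e2 c1 c2; have k2 := key f2 f1 p2 p1 e2 e1 c2 c1.
have a1 := p1 x ltac:(lra); have a2 := p2 x ltac:(lra); have b1 := p1 1 ltac:(lra); have b2 := p2 1 ltac:(lra).
apply: Rle_antisym.
  have := Rmult_le_compat_r (f2 x * f2 1) _ _ ltac:(nra) k1.
  rewrite (_ : f1 x / f2 x * (f2 x * f2 1) = f1 x * f2 1); last by field; lra.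
  rewrite (_ : f1 1 / f2 1 * (f2 x * f2 1) = f2 x * f1 1) //; field; lra.
have := Rmult_le_compat_r (f1 x * f1 1) _ _ ltac:(nra) k2.
rewrite (_ : f2 x / f1 x * (f1 x * f1 1) = f2 x * f1 1); last by field; lra.
rewrite (_ : f2 1 / f1 1 * (f1 x * f1 1) = f1 x * f2 1) //; field; lra.
Qed.

(** * Euler's integral and the incomplete Gamma function *)

Definition CI (f : R -> C) (a b : R) (l : C) : Prop :=
  is_RInt (fun t => Re (f t)) a b (Re l) /\ is_RInt (fun t => Im (f t)) a b (Im l).

Definition CInt (f : R -> C) (a b : R) : C :=
  (RInt (fun t => Re (f t)) a b, RInt (fun t => Im (f t)) a b).

Lemma CI_CInt f a b l : CI f a b l -> CInt f a b = l.
Proof. by case=> h1 h2; apply: C_eq; apply: (is_RInt_unique (V := R_CompleteNormedModule)). Qed.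

Lemma CI_unique f a b l m : CI f a b l -> CI f a b m -> l = m.
Proof. by move=> /CI_CInt <- /CI_CInt <-. Qed.

Lemma CI_plus f g a b l m : CI f a b l -> CI g a b m -> CI (fun t => f t + g t)%C a b (l + m)%C.
Proof. by move=> [h1 h2] [h3 h4]; split; apply: (is_RInt_plus (V := R_NormedModule)). Qed.

Lemma CI_scal c f a b l : CI f a b l -> CI (fun t => c * f t)%C a b (c * l)%C.
Proof.
move=> [h1 h2]; split; rewrite ?Re_mult ?Im_mult.
  apply: (is_RInt_minus (V := R_NormedModule) (fun t => Re c * Re (f t)) (fun t => Im c * Im (f t))); exact: (is_RInt_scal (V := R_NormedModule)).
apply: (is_RInt_plus (V := R_NormedModule) (fun t => Re c * Im (f t)) (fun t => Im c * Re (f t))); exact: (is_RInt_scal (V := R_NormedModule)).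
Qed.

(** The projection on the direction of l, as in [CSum_le], turns the claim into a comparison of real
    integrals. *)
Lemma CI_le f g a b l s : a <= b -> CI f a b l -> (forall t, a < t < b -> Cmod (f t) <= g t) ->
  is_RInt g a b s -> Cmod l <= s.
Proof.
move=> ab [h1 h2] hle hs.
have pos : forall h s', is_RInt h a b s' -> (forall t, a < t < b -> h t <= g t) -> s' <= s.
  move=> h s' hh le; exact: (is_RInt_le _ _ _ _ _ _ ab hh hs le).
case: (Req_dec (Cmod l) 0) => [->|nz].
  apply: (pos (fun _ => 0)).
    have := is_RInt_const (V := R_NormedModule) a b 0; rewrite /scal /= /mult /=; by rewrite Rmult_0_r.
  by move=> t ht; apply: Rle_trans (hle t ht); exact: Cmod_ge_0.
set m := Cmod l in nz *; have m0 : 0 < m by have := Cmod_ge_0 l; rewrite -/m; lra.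
have E := Cmod_eq_Re_Im l; rewrite -/m in E.
have -> : m = Re l / m * Re l + Im l / m * Im l.
  transitivity ((Re l ^ 2 + Im l ^ 2) / m); last by field.
  rewrite -E; field; lra.
apply: (pos (fun t => Re l / m * Re (f t) + Im l / m * Im (f t))).
  apply: (is_RInt_plus (V := R_NormedModule) (fun t => Re l / m * Re (f t)) (fun t => Im l / m * Im (f t))); exact: (is_RInt_scal (V := R_NormedModule)).
move=> t ht; apply: Rle_trans (hle t ht).
set w := f t; have h := Cmod_eq_Re_Im w; have h0 := Cmod_ge_0 w.
apply: (Rmult_le_reg_r m) => //.
have -> : (Re l / m * Re w + Im l / m * Im w) * m = Re l * Re w + Im l * Im w by field.
apply: Rsqr_incr_0_var; last by nra.
rewrite !Rsqr_pow2 Rpow_mult_distr h E.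
have := pow2_ge_0 (Re l * Im w - Im l * Re w); nra.
Qed.

Definition Ccont (f : R -> C) (t : R) : Prop :=
  continuous (fun s => Re (f s)) t /\ continuous (fun s => Im (f s)) t.

Lemma CI_cont f a b : (forall t, Rmin a b <= t <= Rmax a b -> Ccont f t) -> CI f a b (CInt f a b).
Proof.
move=> h; split; apply: (RInt_correct (V := R_CompleteNormedModule)); apply: (ex_RInt_continuous (V := R_CompleteNormedModule)) => t /h [] //.
Qed.

Lemma CI_derive f df a b : (forall t, Rmin a b <= t <= Rmax a b -> CD f t (df t)) ->
  (forall t, Rmin a b <= t <= Rmax a b -> Ccont df t) -> CI df a b (f b - f a)%C.
Proof.
move=> h1 h2; split.
  by apply: (is_RInt_derive (fun t => Re (f t)) (fun t => Re (df t))) => t ht; [case: (h1 t ht) | case: (h2 t ht)].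
by apply: (is_RInt_derive (fun t => Im (f t)) (fun t => Im (df t))) => t ht; [case: (h1 t ht) | case: (h2 t ht)].
Qed.

Lemma CD_Ccont f t l : CD f t l -> Ccont f t.
Proof. move=> [h1 h2]; split; apply: ex_derive_continuous; eexists; eassumption. Qed.

Lemma Ccont_mult f g t : Ccont f t -> Ccont g t -> Ccont (fun s => f s * g s)%C t.
Proof.
move=> [a b] [c d]; split.
  apply: (continuous_minus (V := R_NormedModule) (fun s => Re (f s) * Re (g s)) (fun s => Im (f s) * Im (g s))); exact: (continuous_mult (K := R_AbsRing)).
apply: (continuous_plus (V := R_NormedModule) (fun s => Re (f s) * Im (g s)) (fun s => Im (f s) * Re (g s))); exact: (continuous_mult (K := R_AbsRing)).
Qed.

Lemma Ccont_plus f g t : Ccont f t -> Ccont g t -> Ccont (fun s => f s + g s)%C t.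
Proof.
move=> [a b] [c d]; split.
  exact: (continuous_plus (V := R_NormedModule) (fun s => Re (f s)) (fun s => Re (g s))).
exact: (continuous_plus (V := R_NormedModule) (fun s => Im (f s)) (fun s => Im (g s))).
Qed.

Lemma Ccont_const c t : Ccont (fun _ => c) t.
Proof. by split; exact: continuous_const. Qed.

Lemma Cder_curve f (c : R -> R) t l dc : Cder f (RtoC (c t)) l -> is_derive c t dc ->
  CD (fun s => f (RtoC (c s))) t (l * RtoC dc)%C.
Proof.
move=> H hc.
have H' : Cder f (0 + RtoC (c t) * 1)%C l by rewrite (_ : (0 + RtoC (c t) * 1)%C = RtoC (c t)) //; ring.
have [h1 h2] := Cder_CD f 0%C 1%C (c t) l H'.
have E : forall s, (0 + RtoC s * 1)%C = RtoC s by move=> s; ring.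
split.
- have := is_derive_comp (fun s => Re (f (0 + RtoC s * 1)%C)) c t _ _ h1 hc.
  rewrite (_ : scal dc (Re (l * 1)%C) = Re (l * RtoC dc)%C); last by rewrite /scal /= /mult /=; ring.
  by apply: is_derive_ext => s; rewrite E.
- have := is_derive_comp (fun s => Im (f (0 + RtoC s * 1)%C)) c t _ _ h2 hc.
  rewrite (_ : scal dc (Im (l * 1)%C) = Im (l * RtoC dc)%C); last by rewrite /scal /= /mult /=; ring.
  by apply: is_derive_ext => s; rewrite E.
Qed.

Lemma exp_ge_pow t n : 0 <= t -> (t / INR (S n)) ^ (S n) <= exp t.
Proof.
move=> t0; have n0 : 0 < INR (S n) by apply: lt_0_INR; lia.
have E : exp t = exp (t / INR (S n)) ^ (S n).
  rewrite -Rpower_pow; last exact: exp_pos.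
  by rewrite /Rpower ln_exp; congr exp; field; lra.
rewrite E; apply: pow_incr; split.
  by apply: Rmult_le_pos => //; left; exact: Rinv_0_lt_compat.
have := exp_ineq1_le (t / INR (S n)); lra.
Qed.

(** The exponential beats every power of y; the order y^2 is singled out because it makes [Qf]
    differentiable at 0. *)
Lemma exp_pow_small x0 s : 0 < x0 -> exists B, 0 <= B /\ forall x y, x0 <= x -> 0 < y <= 1 ->
  exp (- (x / y)) * Rpower y s <= B * (y * y).
Proof.
move=> h; have [n hn] := nat_above (2 - s).
have n0 : 0 < INR (S n) by apply: lt_0_INR; lia.
exists ((INR (S n) / x0) ^ S n); split.
  apply: pow_le; apply: Rmult_le_pos; [lra | left; exact: Rinv_0_lt_compat].
move=> x y hx hy.
have xy : x0 / y <= x / y by apply: Rmult_le_compat_r => //; left; apply: Rinv_0_lt_compat; lra.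
have xy0 : 0 < x0 / y by apply: Rdiv_lt_0_compat; lra.
have h1 := exp_ge_pow (x / y) n ltac:(lra).
have q : 0 < (x0 / y / INR (S n)) ^ S n by apply: pow_lt; apply: Rdiv_lt_0_compat.
have h2 : (x0 / y / INR (S n)) ^ S n <= exp (x / y).
  apply: Rle_trans h1; apply: pow_incr; split; first by left; apply: Rdiv_lt_0_compat.
  apply: Rmult_le_compat_r => //; left; exact: Rinv_0_lt_compat.
have h3 : exp (- (x / y)) <= (INR (S n) / x0) ^ S n * y ^ S n.
  rewrite exp_Ropp -Rpow_mult_distr (_ : INR (S n) / x0 * y = / (x0 / y / INR (S n))); last by field; lra.
  rewrite pow_inv; apply: Rinv_le_contravar => //.
apply: (Rle_trans _ ((INR (S n) / x0) ^ S n * y ^ S n * Rpower y s)).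
  apply: Rmult_le_compat_r => //; left; exact: exp_pos.
rewrite Rmult_assoc; apply: Rmult_le_compat_l.
  apply: pow_le; apply: Rmult_le_pos; [lra | left; exact: Rinv_0_lt_compat].
rewrite -Rpower_pow -?Rpower_plus; last lra.
have E : y * y = Rpower y 2 by rewrite (_ : 2 = INR 2) // Rpower_pow /=; lra.
rewrite E /Rpower; have l0 : ln y <= 0 by rewrite -ln_1; apply: ln_le; lra.
have : (INR (S n) + s) * ln y <= 2 * ln y by rewrite S_INR; nra.
case=> [l|->]; [left; exact: exp_increasing | lra].
Qed.

(* By the substitution t = p / y, the integral of [Qf s p] over (0, 1) is p^(-s) Gamma(s, p), with the upper incomplete Gamma function. *)
Definition Qf (s : R) (p : C) (y : R) : C :=
  match Rle_dec y 0 with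
  | left _ => 0%C
  | right _ => (Cexp (- (p * RtoC (/ y))) * RtoC (Rpower y (- s - 1)))%C
  end.

Lemma Qf_pos s p y : 0 < y -> Qf s p y = (Cexp (- (p * RtoC (/ y))) * RtoC (Rpower y (- s - 1)))%C.
Proof. by move=> h; rewrite /Qf; case: Rle_dec => //; lra. Qed.

Lemma Qf_0 s p y : y <= 0 -> Qf s p y = 0%C.
Proof. by move=> h; rewrite /Qf; case: Rle_dec => //; lra. Qed.

Lemma Qf_mod s p y : 0 < y -> Cmod (Qf s p y) = exp (- (Re p / y)) * Rpower y (- s - 1).
Proof.
move=> h; rewrite Qf_pos // Cmod_mult Cmod_R Cmod_Cexp Rabs_pos_eq; last by left; exact: exp_pos.
by congr (exp _ * _); rewrite /Re /= /Rdiv; ring.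
Qed.

Lemma Qf_small s x0 : 0 < x0 -> exists B, 0 <= B /\ forall p y, x0 <= Re p -> y <= 1 ->
  Cmod (Qf s p y) <= B * (y * y).
Proof.
move=> h; have [B [B0 hB]] := exp_pow_small x0 (- s - 1) h; exists B; split => // p y hp hy.
case: (Rle_dec y 0) => h0.
  rewrite Qf_0 // Cmod_0; nra.
rewrite Qf_mod; last lra. apply: hB => //; lra.
Qed.

Lemma CD_Qf s p y : 0 < y ->
  CD (Qf (s - 1) p) y (p * Qf (s + 1) p y - RtoC s * Qf s p y)%C.
Proof.
move=> h.
have H : CD (fun t => Cexp (- (1) * (p * / RtoC t)) * Cpower (RtoC t) (- s))%C y
   (p * Qf (s + 1) p y - RtoC s * Qf s p y)%C.
  have hR : 0 < Re (RtoC y) by [].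
  have nz : RtoC y <> 0%C by apply: RtoC_neq0; lra.
  have K := Cder_mult _ _ _ _ _ (Cder_comp Cexp (fun w => - (1) * (p * / w))%C (RtoC y) _ _
     (Cder_scal (- (1))%C _ _ _ (Cder_scal p _ _ _ (Cder_inv _ nz))) (Cder_Cexp _)) (Cder_Cpower (RtoC y) (- s) hR).
  have := Cder_curve _ (fun t => t) y _ 1 K (is_derive_id y).
  set l := (_ * RtoC 1)%C; rewrite (_ : l = (p * Qf (s + 1) p y - RtoC s * Qf s p y)%C) //.
  rewrite /l !Qf_pos // -!Cpower_RtoC // RtoC_inv; last lra.
  set e := - (s + 1) - 1.
  have e2 : Cpower (RtoC y) (- s - 1) = (Cpower (RtoC y) e * RtoC y)%C.
    have -> : - s - 1 = e + 1 by rewrite /e; ring.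
    by rewrite Cpower_plus Cpower_1.
  have e1 : Cpower (RtoC y) (- s) = (Cpower (RtoC y) e * RtoC y * RtoC y)%C.
    rewrite -e2 -{3}(Cpower_1 (RtoC y)) // -Cpower_plus; congr Cpower; ring.
  rewrite e2 e1 (_ : (- (p * / RtoC y))%C = (- (1) * (p * / RtoC y))%C); last by ring.
  rewrite RtoC_opp; field; exact: nz.
case: H => h1 h2; split.
  apply: (is_derive_ext_loc (fun t => Re (Cexp (- (1) * (p * / RtoC t)) * Cpower (RtoC t) (- s))%C)) => //.
  apply: (filter_imp (fun t => 0 < t)); last exact: (open_gt 0 y h).
  move=> t ht; rewrite Qf_pos // Cpower_RtoC // RtoC_inv; last lra.
  rewrite (_ : - (s - 1) - 1 = - s); last by ring.
  by rewrite (_ : (- (p * / RtoC t))%C = (- (1) * (p * / RtoC t))%C); last by ring.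
apply: (is_derive_ext_loc (fun t => Im (Cexp (- (1) * (p * / RtoC t)) * Cpower (RtoC t) (- s))%C)) => //.
apply: (filter_imp (fun t => 0 < t)); last exact: (open_gt 0 y h).
move=> t ht; rewrite Qf_pos // Cpower_RtoC // RtoC_inv; last lra.
  rewrite (_ : - (s - 1) - 1 = - s); last by ring.
by rewrite (_ : (- (p * / RtoC t))%C = (- (1) * (p * / RtoC t))%C); last by ring.
Qed.

(** Flatness at 0 makes the incomplete Gamma integral an ordinary Riemann integral over [0, 1], with
    the extended integrand continuous up to the end point. *)
Lemma CD_Qf_0 s p : 0 < Re p -> CD (Qf s p) 0 0%C.
Proof.
move=> hp; have [B [B0 hB]] := Qf_small s (Re p) hp.
have K : forall eps, 0 < eps -> exists d, 0 < d /\ forall y, Rabs (y - 0) < d -> Cmod (Qf s p y) <= eps * Rabs (y - 0).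
  move=> e e0; exists (Rmin 1 (e / (B + 1))); split.
    apply: Rmin_pos; [lra | apply: Rdiv_lt_0_compat; lra].
  move=> y; rewrite Rminus_0_r => hy.
  have h1 := Rlt_le_trans _ _ _ hy (Rmin_l _ _); have h2 := Rlt_le_trans _ _ _ hy (Rmin_r _ _).
  apply: Rle_trans (hB p y ltac:(lra) _) _; first by move: h1 => /Rabs_lt_between; lra.
  have -> : y * y = Rabs y * Rabs y by rewrite -Rabs_mult Rabs_pos_eq //; nra.
  have := Rmult_lt_compat_r (B + 1) _ _ ltac:(lra) h2; rewrite (_ : e / (B + 1) * (B + 1) = e); last by field; lra.
  have := Rabs_pos y; nra.
split; apply: is_derive_eps => e e0; case: (K e e0) => d [d0 hd]; exists d; split => // y hy;
  apply: Rle_trans (hd y hy); rewrite (Qf_0 s p 0) /=; try lra.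
- by rewrite Rmult_0_l !Rminus_0_r; exact: re_le_Cmod.
- by rewrite Rmult_0_l !Rminus_0_r; exact: Im_le_Cmod.
Qed.

Lemma Ccont_Qf s p y : 0 < Re p -> 0 <= y -> Ccont (Qf s p) y.
Proof.
move=> hp; case=> [h|<-]; last by apply: CD_Ccont (CD_Qf_0 s p hp).
have := CD_Qf (s + 1) p y h; rewrite (_ : s + 1 - 1 = s); last by ring.
exact: CD_Ccont.
Qed.

Definition Qi (s : R) (p : C) : C := CInt (Qf s p) 0 1.

Lemma Qi_CI s p : 0 < Re p -> CI (Qf s p) 0 1 (Qi s p).
Proof.
move=> hp; apply: CI_cont => t; rewrite Rmin_left ?Rmax_right; try lra.
move=> ht; apply: Ccont_Qf => //; lra.
Qed.

(** Integration of the derivative of [Qf (s - 1)]: the recurrence of the upper incomplete Gamma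
    function, divided by p^s. *)
Lemma Qi_parts s p : 0 < Re p -> (p * Qi (s + 1) p = Cexp (- p) + RtoC s * Qi s p)%C.
Proof.
move=> hp.
have H : CI (fun y => p * Qf (s + 1) p y + (- RtoC s) * Qf s p y)%C 0 1 (Qf (s - 1) p 1 - Qf (s - 1) p 0)%C.
  apply: CI_derive => t; rewrite Rmin_left ?Rmax_right; try lra; move=> [h1 h2].
    case: h1 => [h1|<-].
      by have := CD_Qf s p t h1; rewrite (_ : (p * Qf (s + 1) p t + - RtoC s * Qf s p t)%C = (p * Qf (s + 1) p t - RtoC s * Qf s p t)%C); last by ring.
    rewrite !(Qf_0 _ _ 0); try lra; rewrite (_ : (p * 0 + - RtoC s * 0)%C = 0%C); last by ring.
    exact: CD_Qf_0.
  apply: Ccont_plus; apply: Ccont_mult; (try exact: Ccont_const); exact: Ccont_Qf.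
have := CI_unique _ _ _ _ _ H (CI_plus _ _ _ _ _ _ (CI_scal p _ _ _ _ (Qi_CI (s + 1) p hp)) (CI_scal (- RtoC s)%C _ _ _ _ (Qi_CI s p hp))).
rewrite (Qf_0 _ _ 0); last lra. rewrite Qf_pos; last lra.
rewrite Rinv_1 /Rpower ln_1 Rmult_0_r exp_0 (_ : (- (p * RtoC 1))%C = (- p)%C); last by ring.
move=> E; rewrite (_ : Cexp (- p)%C = (p * Qi (s + 1) p + - RtoC s * Qi s p)%C); first by ring.
rewrite -E; ring.
Qed.

Lemma Cexp_bound1 d : Cmod (Cexp d - 1)%C <= Cmod d * exp (Cmod d).
Proof.
have := Cder_mean Cexp Cexp 0%C d (exp (Cmod d)); rewrite Cplus_0_l Cexp_0 Rmult_comm; apply.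
  by move=> t _; exact: Cder_Cexp.
move=> t ht; rewrite Cplus_0_l Cmod_Cexp Re_scal; have := re_le_Cmod d => /Rabs_le_between h.
have : t * Re d <= Cmod d by have := Cmod_ge_0 d; nra.
case=> [l|->]; [left; exact: exp_increasing | lra].
Qed.

Lemma Cexp_bound2 d : Cmod (Cexp d - 1 - d)%C <= Cmod d ^ 2 * exp (Cmod d).
Proof.
have m0 := Cmod_ge_0 d.
have H := Cder_mean (fun w => Cexp w + -1 * w)%C (fun w => Cexp w + -1 * 1)%C 0%C d (Cmod d * exp (Cmod d)).
have -> : (Cexp d - 1 - d)%C = (Cexp (0 + d) + -1 * (0 + d) - (Cexp 0 + -1 * 0))%C by rewrite Cplus_0_l Cexp_0; ring.
rewrite (_ : Cmod d ^ 2 * exp (Cmod d) = Cmod d * exp (Cmod d) * Cmod d); last by ring.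
apply: H => t ht.
  by apply: Cder_plus; [exact: Cder_Cexp | apply: Cder_scal; exact: Cder_id].
rewrite Cplus_0_l (_ : (_ + -1 * 1)%C = (Cexp (RtoC t * d) - 1)%C); last by ring.
apply: Rle_trans (Cexp_bound1 _) _; rewrite Cmod_mult Cmod_R Rabs_pos_eq; last lra.
have td : t * Cmod d <= Cmod d by nra.
apply: Rmult_le_compat => //; [nra | left; exact: exp_pos |].
case: td => [l|->]; [left; exact: exp_increasing | lra].
Qed.

Lemma Cder_Qi s p : 0 < Re p -> Cder (Qi s) p (- Qi (s + 1) p)%C.
Proof.
(* For |w - p| < Re p / 2 the second-order remainder of the integrand is dominated by the integrand
   with s + 2 at the real point Re p / 2. *)
move=> hp; set x := Re p / 2.
have hx : 0 < Re (RtoC x) by rewrite /= /x; lra.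
have [I1 _] := Qi_CI (s + 2) (RtoC x) hx.
apply: (Cder_quadratic _ _ _ x (Re (Qi (s + 2) (RtoC x)))) => // w hw.
have hwp : Rabs (Re w - Re p) < x by apply: Rle_lt_trans hw; exact: (re_le_Cmod (w - p)%C).
have hwr : 0 < Re w by move: hwp => /Rabs_lt_between; rewrite /x; lra.
have J := CI_plus _ _ _ _ _ _ (CI_plus _ _ _ _ _ _ (Qi_CI s w hwr) (CI_scal (-1)%C _ _ _ _ (Qi_CI s p hp))) (CI_scal (w - p)%C _ _ _ _ (Qi_CI (s + 1) p hp)).
have I2 := is_RInt_scal (V := R_NormedModule) _ _ _ (Cmod (w - p)%C ^ 2) _ I1.
rewrite (_ : (Qi s w - Qi s p - - Qi (s + 1) p * (w - p))%C = (Qi s w + -1 * Qi s p + (w - p) * Qi (s + 1) p)%C); last by ring.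
rewrite Rmult_comm.
apply: (CI_le _ _ _ _ _ _ _ J _ I2); first lra.
move=> y hy; have y0 : 0 < y by lra. have yi : 0 < / y by apply: Rinv_0_lt_compat.
set d := (- ((w - p) * RtoC (/ y)))%C.
have -> : (Qf s w y + -1 * Qf s p y + (w - p) * Qf (s + 1) p y = Qf s p y * (Cexp d - 1 - d))%C.
  rewrite !Qf_pos // (_ : - s - 1 = (- (s + 1) - 1) + 1); last by ring.
  rewrite Rpower_plus Rpower_1 // RtoC_mult (_ : (- (w * RtoC (/ y)))%C = (- (p * RtoC (/ y)) + d)%C); last by rewrite /d; ring.
  rewrite Cexp_plus /d RtoC_inv; last lra.
  field; apply: RtoC_neq0; lra.
rewrite Cmod_mult /scal /= /mult /=.
have md : Cmod d = Cmod (w - p)%C * / y by rewrite /d Cmod_opp Cmod_mult Cmod_R Rabs_pos_eq //; lra.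
have b2 := Cexp_bound2 d; rewrite md in b2.
have -> : Re (Qf (s + 2) (RtoC x) y) = exp (- (x / y)) * Rpower y (- s - 1) * (/ y) ^ 2.
  rewrite Qf_pos // (_ : (- (RtoC x * RtoC (/ y)))%C = RtoC (- (x / y))); last by rewrite -RtoC_mult -RtoC_opp.
  rewrite Cexp_RtoC -RtoC_mult /= (_ : - (s + 2) - 1 = - s - 1 + - (INR 2)); last by rewrite /=; ring.
  rewrite Rpower_plus Rpower_Ropp Rpower_pow //; field; lra.
rewrite Qf_mod //; set a := Cmod (w - p)%C in hw b2 *.
have R0 : 0 < Rpower y (- s - 1) by exact: exp_pos.
have e1 : exp (- (Re p / y)) * exp (a * / y) <= exp (- (x / y)).
  rewrite -exp_plus; have : - (Re p / y) + a * / y <= - (x / y) by rewrite /x /Rdiv in hw *; nra.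
  case=> [l|->]; [left; exact: exp_increasing | lra].
have q0 : 0 <= (a * / y) ^ 2 by exact: pow2_ge_0.
apply: (Rle_trans _ (exp (- (Re p / y)) * Rpower y (- s - 1) * ((a * / y) ^ 2 * exp (a * / y)))).
  apply: Rmult_le_compat_l => //; apply: Rmult_le_pos; left; exact: exp_pos.
have := Rmult_le_compat_l _ _ _ (Rmult_le_pos _ _ (Rlt_le _ _ R0) q0) e1; rewrite /=; lra.
Qed.

(** The integral over (0, oo) is encoded by a primitive that vanishes at infinity; linearity and
    integration by parts become statements about limits at the two ends. *)
Definition Int (f : R -> R) (l : R) : Prop := exists F : R -> R,
  (forall u, 0 < u -> is_derive F u (f u)) /\ is_lim F p_infty 0 /\
  filterlim F (at_right 0) (locally (- l)).

Lemma Int_ext f g l : (forall u, 0 < u -> f u = g u) -> Int f l -> Int g l.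
Proof. by move=> E [F [h1 [h2 h3]]]; exists F; split => // u hu; rewrite -E //; exact: h1. Qed.

Lemma Int_scal c f l : Int f l -> Int (fun u => c * f u) (c * l).
Proof.
move=> [F [h1 [h2 h3]]]; exists (fun u => c * F u); split; first by move=> u /h1; exact: is_derive_scal.
split.
  have -> : Finite 0 = Rbar_mult c 0 by rewrite /= Rmult_0_r.
  exact: is_lim_scal_l.
rewrite (_ : - (c * l) = c * - l); last by ring.
apply: filterlim_comp h3 _; exact: (filterlim_scal_r (K := R_AbsRing) (V := R_NormedModule) c (- l)).
Qed.

Lemma filterlim_Rplus {T} (F : (T -> Prop) -> Prop) {FF : Filter F} (f g : T -> R) a b :
  filterlim f F (locally a) -> filterlim g F (locally b) -> filterlim (fun x => f x + g x) F (locally (a + b)).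
Proof.
move=> h1 h2.
exact: (filterlim_comp_2 _ _ _ h1 h2 (filterlim_plus (K := R_AbsRing) (V := R_NormedModule) a b)).
Qed.

Lemma Int_plus f g l m : Int f l -> Int g m -> Int (fun u => f u + g u) (l + m).
Proof.
move=> [F [h1 [h2 h3]]] [G [k1 [k2 k3]]]; exists (fun u => F u + G u); split.
  move=> u hu; apply: (is_derive_plus (V := R_NormedModule)); [exact: h1 | exact: k1].
split; last by rewrite Ropp_plus_distr; apply: filterlim_Rplus.
have -> : Finite 0 = Finite (0 + 0) by rewrite Rplus_0_r.
exact: (is_lim_plus' F G).
Qed.

Lemma mono_pos (F f : R -> R) : (forall u, 0 < u -> is_derive F u (f u)) -> (forall u, 0 < u -> 0 <= f u) ->
  forall x y, 0 < x <= y -> F x <= F y.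
Proof. by move=> h1 h2 x y hxy; apply: (MVT_le F f) => [|t ht|t ht]; [lra | apply: h1; lra | apply: h2; lra]. Qed.

Lemma mono_le_lim (F : R -> R) (l : R) : (forall x y, 0 < x <= y -> F x <= F y) -> is_lim F p_infty l ->
  forall x, 0 < x -> F x <= l.
Proof.
move=> h1 h2 x hx.
apply: (filterlim_le (F := Rbar_locally' p_infty) (fun _ => F x) F (F x) l) => //; last exact: filterlim_const.
exists x => y hy; apply: h1; lra.
Qed.

Lemma mono_ge_lim (F : R -> R) (l : R) : (forall x y, 0 < x <= y -> F x <= F y) -> filterlim F (at_right 0) (locally l) ->
  forall x, 0 < x -> l <= F x.
Proof.
move=> h1 h2 x hx.
apply: (filterlim_le (F := at_right 0) F (fun _ => F x) l (F x)) => //; last exact: filterlim_const.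
exists (mkposreal x hx) => y hy hy0; apply: h1; move: hy; rewrite /ball /= /AbsRing_ball /= /abs /minus /plus /opp /=.
move=> /Rabs_lt_between; lra.
Qed.

Lemma Int_ge0 f l : (forall u, 0 < u -> 0 <= f u) -> Int f l -> 0 <= l.
Proof.
move=> hf [F [h1 [h2 h3]]]; have m := mono_pos F f h1 hf.
have := mono_le_lim F 0 m h2 1 Rlt_0_1; have := mono_ge_lim F (- l) m h3 1 Rlt_0_1; lra.
Qed.

Lemma Int_pos f l : (forall u, 0 < u -> 0 < f u) -> Int f l -> 0 < l.
Proof.
move=> hf [F [h1 [h2 h3]]]; have m := mono_pos F f h1 (fun u hu => Rlt_le _ _ (hf u hu)).
have a := mono_le_lim F 0 m h2 2 ltac:(lra); have b := mono_ge_lim F (- l) m h3 1 Rlt_0_1.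
suff : F 1 < F 2 by lra.
case: (MVT_gen F 1 2 f).
- move=> x; rewrite Rmin_left ?Rmax_right; try lra; move=> hx; apply: h1; lra.
- move=> x; rewrite Rmin_left ?Rmax_right; try lra; move=> hx.
  by apply/continuity_pt_filterlim; apply: ex_derive_continuous; exists (f x); apply: h1; lra.
move=> c; rewrite Rmin_left ?Rmax_right; try lra; move=> -[hc E].
have := hf c ltac:(lra); nra.
Qed.

Lemma Int_le f g l m : (forall u, 0 < u -> f u <= g u) -> Int f l -> Int g m -> l <= m.
Proof.
move=> h hf hg; have := Int_ge0 _ _ _ (Int_plus _ _ _ _ hg (Int_scal (-1) _ _ hf)) => H.
have : 0 <= m + -1 * l; last lra.
by apply: H => u hu; have := h u hu; lra.
Qed.

Lemma Int_unique f l m : Int f l -> Int f m -> l = m.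
Proof. by move=> h1 h2; apply: Rle_antisym; [apply: (Int_le f f) | apply: (Int_le f f)] => // u _; lra. Qed.

Lemma Young_power v t : 0 < v -> 0 <= t <= 1 -> Rpower v t <= 1 - t + t * v.
Proof.
move=> v0 ht; set c := 1 - t + t * v; have c0 : 0 < c by rewrite /c; nra.
have h1 := ln_ratio_le c v c0 v0; have h2 := ln_ratio_le c 1 c0 Rlt_0_1; rewrite ln_1 in h2.
have : (1 - t) * (0 - ln c) + t * (ln v - ln c) <= (1 - t) * ((1 - c) / c) + t * ((v - c) / c) by nra.
have -> : (1 - t) * ((1 - c) / c) + t * ((v - c) / c) = 0.
  have -> : (1 - t) * ((1 - c) / c) + t * ((v - c) / c) = ((1 - t) * (1 - c) + t * (v - c)) / c by field; lra.
  by rewrite (_ : (1 - t) * (1 - c) + t * (v - c) = 0) ?/c /Rdiv ?Rmult_0_l //; ring.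
move=> h; rewrite -(exp_ln c) // /Rpower.
have : t * ln v <= ln c by nra.
case=> [l|->]; [left; exact: exp_increasing | lra].
Qed.

(* Log-convexity in the exponent follows from the pointwise Young inequality. *)
Lemma Int_young (g f0 f1 ft : R -> R) l0 l1 lt N t : 0 < N -> 0 <= t <= 1 ->
  (forall u, 0 < u -> 0 < g u) -> (forall u, 0 < u -> 0 <= f0 u) ->
  (forall u, 0 < u -> f1 u = g u * f0 u) -> (forall u, 0 < u -> ft u = Rpower (g u) t * f0 u) ->
  Int f0 l0 -> Int f1 l1 -> Int ft lt -> l1 = N * l0 -> lt <= l0 * Rpower N t.
Proof.
move=> N0 ht g0 p0 E1 Et h0 h1 h E.
have H := Int_scal (Rpower N t) _ _ (Int_plus _ _ _ _ (Int_scal (1 - t) _ _ h0) (Int_scal (t / N) _ _ h1)).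
have := Int_le _ _ _ _ _ h H; rewrite E.
have -> : Rpower N t * ((1 - t) * l0 + t / N * (N * l0)) = l0 * Rpower N t by field; lra.
apply=> u hu; rewrite E1 // Et //.
have v0 : 0 < g u / N by apply: Rdiv_lt_0_compat => //; exact: g0.
have Y := Young_power _ t v0 ht.
have -> : Rpower (g u) t = Rpower N t * Rpower (g u / N) t.
  rewrite Rpower_mult_distr //; congr (Rpower _ t); field; lra.
have -> : Rpower N t * ((1 - t) * f0 u + t / N * (g u * f0 u)) = Rpower N t * (1 - t + t * (g u / N)) * f0 u by field; lra.
apply: Rmult_le_compat_r; first exact: p0.
apply: Rmult_le_compat_l => //; left; exact: exp_pos.
Qed.

Lemma Int_logconvex (f0 f1 ft : R -> R) l0 l1 lt N t : 0 < N -> 0 <= t <= 1 ->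
  (forall u, 0 < u -> 0 <= f0 u) ->
  (exists c, 0 < c /\ (forall u, 0 < u -> f1 u = Rpower u c * f0 u) /\ (forall u, 0 < u -> ft u = Rpower u (c * t) * f0 u)) ->
  Int f0 l0 -> Int f1 l1 -> Int ft lt -> l1 = N * l0 -> lt <= l0 * Rpower N t.
Proof.
move=> N0 ht p0 [c [c0 [E1 Et]]]; apply: (Int_young (fun u => Rpower u c)) => // u hu; first exact: exp_pos.
by rewrite Rpower_mult Et.
Qed.

Lemma nonpole_dist s : nonpole s -> exists d, 0 < d /\ forall k, d <= Rabs (s + INR k).
Proof.
move: s; apply: nonpole_ind => x h.
  exists x; split => // k; have := pos_INR k => hk; rewrite Rabs_pos_eq; lra.
move=> [d [d0 hd]]; exists (Rmin d (Rabs x)); split.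
  apply: Rmin_pos => //; apply: Rabs_pos_lt; exact: nonpole_neq0.
case=> [|k]; first by rewrite /= Rplus_0_r; exact: Rmin_r.
apply: Rle_trans (Rmin_l _ _) _; rewrite S_INR; have := hd k; by rewrite (_ : x + 1 + INR k = x + (INR k + 1)) //; ring.
Qed.

(** * The lower incomplete Gamma function and Euler's integral *)

Definition gco (s : R) (k : nat) : R := / (INR (fact k) * (s + INR k)).

Lemma gco_bound s d k : 0 < d -> d <= Rabs (s + INR k) -> Rabs (gco s k) <= / d * / INR (fact k).
Proof.
move=> d0 hd; have f0 := INR_fact_lt_0 k.
rewrite /gco Rinv_mult Rabs_mult !Rabs_inv (Rabs_pos_eq (INR _)); last lra.
rewrite Rmult_comm; apply: Rmult_le_compat_r; first by left; exact: Rinv_0_lt_compat.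
exact: Rinv_le_contravar.
Qed.

Lemma entire_gco s : nonpole s -> entire (gco s).
Proof.
move=> /nonpole_dist [d [d0 hd]].
apply: (entire_dominated _ (fun k => / d * / INR (fact k))); last by apply: entire_scal; exact: entire_expn.
move=> k; apply: Rle_trans (gco_bound s d k d0 (hd k)) _; exact: Rle_abs.
Qed.

Lemma CPS_xderive a x : entire a -> CSum (fun n => RtoC (INR n * a n) * x ^ n)%C (x * CPS (PS_derive a) x)%C.
Proof.
move=> h; rewrite -(Cplus_0_r (x * _)%C).
have -> : RtoC 0 = (RtoC (INR 0 * a O) * x ^ 0)%C by rewrite /= Rmult_0_l; ring.
apply: (CSum_unshift (fun n => RtoC (INR n * a n) * x ^ n)%C).
apply: CSum_ext (CSum_scal x _ _ (CPS_sum _ x (entire_derive _ h))) => n.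
rewrite /PS_derive /=; ring.
Qed.

Lemma gS_ode s x : nonpole s -> (x * CPS (gco (s + 1)) x + RtoC s * CPS (gco s) x = Cexp x)%C.
Proof.
move=> hs; have E := entire_gco _ hs.
have -> : CPS (gco (s + 1)) x = CPS (PS_derive (gco s)) x.
  apply: CPS_ext => n; rewrite /PS_derive /gco fact_simpl mult_INR S_INR.
  have := nonpole_S _ hs n; have := INR_fact_neq_0 n; have := pos_INR n => h1 h2 h3; field; repeat split; try lra.
rewrite Cexp_CPS; apply: (CSum_unique (fun n => RtoC (/ INR (fact n)) * x ^ n)%C); last by apply: CPS_sum; exact: entire_expn.
apply: CSum_ext (CSum_plus _ _ _ _ (CPS_xderive _ x E) (CSum_scal (RtoC s) _ _ (CPS_sum _ x E))) => n.
rewrite Cmult_assoc -RtoC_mult -Cmult_plus_distr_r -RtoC_plus; congr (RtoC _ * _)%C.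
rewrite /gco; have := hs n; have := INR_fact_neq_0 n => h1 h2; field; split => //; lra.
Qed.

(* The series is p^(-s) times the lower incomplete Gamma function, and continues it to negative s. *)
Definition Nf (s : R) (p : C) : C := (Qi s p + CPS (gco s) (- (1) * p))%C.

Lemma Cder_gS s p : nonpole s -> Cder (fun w => CPS (gco s) (- (1) * w))%C p (- CPS (gco (s + 1)) (- (1) * p))%C.
Proof.
move=> hs; apply: (Cder_eq _ _ _ _ _ (Cder_comp (CPS (gco s)) (fun w => - (1) * w)%C p _ _
   (Cder_scal (- (1))%C _ _ _ (Cder_id p)) (Cder_CPS _ _ (entire_gco _ hs)))) => //.
have -> : CPS (gco (s + 1)) (- (1) * p)%C = CPS (PS_derive (gco s)) (- (1) * p)%C; last by ring.
apply: CPS_ext => n; rewrite /PS_derive /gco fact_simpl mult_INR S_INR.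
have := nonpole_S _ hs n; have := INR_fact_neq_0 n; have := pos_INR n => h1 h2 h3; field; repeat split; try lra.
Qed.

(** The two incomplete functions, multiplied by p^s, satisfy first-order equations with opposite
    inhomogeneous terms, so their sum is constant. *)
Lemma Nf_const s p : nonpole s -> 0 < Re p -> (Cpower p s * Nf s p)%C = Nf s 1.
Proof.
move=> hs hp.
have H : forall w, 0 < Re w -> Cder (fun w => Cpower w s * Nf s w)%C w 0%C.
  move=> w hw.
  apply: (Cder_eq _ _ _ _ _ (Cder_mult _ _ _ _ _ (Cder_Cpower w s hw) (Cder_plus _ _ _ _ _ (Cder_Qi s w hw) (Cder_gS s w hs)))) => //.
  have e1 := Qi_parts s w hw; have e2 := gS_ode s (- (1) * w)%C hs.
  have e3 : Cpower w s = (Cpower w (s - 1) * w)%C by rewrite {1}(_ : s = s - 1 + 1) ?Cpower_plus ?Cpower_1 //; ring.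
  rewrite e3 /Nf.
  transitivity (Cpower w (s - 1) * (RtoC s * Qi s w - w * Qi (s + 1) w + (- (1) * w * CPS (gco (s + 1)) (- (1) * w) + RtoC s * CPS (gco s) (- (1) * w))))%C; first by ring.
  rewrite e1 e2 (_ : (- (1) * w)%C = (- w)%C); last by ring.
  ring.
have := Cder_zero_const (fun w => Cpower w s * Nf s w)%C 1%C p.
rewrite Cpower_RtoC; last lra. rewrite /Rpower ln_1 Rmult_0_r exp_0 Cmult_1_l; apply=> t ht; apply: H.
rewrite (_ : Re _ = (1 - t) + t * Re p); last by rewrite /Re /=; ring.
case: (Req_dec t 1) => [->|]; nra.
Qed.

Lemma Qf_RtoC s (x : R) y : exists r, Qf s (RtoC x) y = RtoC r /\ (0 < y -> 0 < r).
Proof.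
case: (Rle_dec y 0) => h; first by exists 0; rewrite Qf_0 //; split => // ?; lra.
exists (exp (- (x * / y)) * Rpower y (- s - 1)); rewrite Qf_pos; last lra.
rewrite -RtoC_mult -RtoC_opp Cexp_RtoC -RtoC_mult; split => // _.
apply: Rmult_lt_0_compat; exact: exp_pos.
Qed.

Lemma RInt_0 a b : RInt (fun _ => 0) a b = 0.
Proof. by rewrite RInt_const /scal /= /mult /= Rmult_0_r. Qed.

Lemma Qi_RtoC s (x : R) : Qi s (RtoC x) = RtoC (Re (Qi s (RtoC x))).
Proof.
apply: C_eq => //=; transitivity (RInt (fun _ => 0) 0 1); last exact: RInt_0.
apply: RInt_ext => y _.
by have [r [-> _]] := Qf_RtoC s x y.
Qed.

Lemma Nf_real s : nonpole s -> Nf s 1 = RtoC (Re (Nf s 1)).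
Proof.
move=> hs; rewrite /Nf (_ : (- (1) * 1)%C = RtoC (-1)); last by apply: C_eq; rewrite /=; ring.
rewrite CPS_RtoC; last exact: entire_gco.
by rewrite Qi_RtoC -RtoC_plus.
Qed.

Definition Gr s := Re (Nf s 1).

Lemma Gr_S s : nonpole s -> Gr (s + 1) = s * Gr s.
Proof.
move=> hs; rewrite /Gr -Re_scal; congr Re; rewrite /Nf.
have e1 := Qi_parts s 1%C ltac:(rewrite /=; lra); have e2 := gS_ode s (- (1) * 1)%C hs.
rewrite Cmult_1_l in e1; rewrite e1.
rewrite (_ : CPS (gco (s + 1)) (- (1) * 1)%C = (RtoC s * CPS (gco s) (- (1) * 1) - Cexp (- (1) * 1))%C); last by rewrite -e2; ring.
rewrite (_ : (- (1) * 1 = - (1))%C); last by ring.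
ring.
Qed.

(** For y <= 1 and Re p >= 2 x0, half of Re p / y yields the decay and the other half keeps x0 / y
    for integrability at 0. *)
Lemma Qi_bound s x0 : 0 < x0 -> exists B, 0 <= B /\ forall p, 2 * x0 <= Re p -> Cmod (Qi s p) <= B * exp (- (Re p / 2)).
Proof.
move=> h; have hx : 0 < Re (RtoC x0) by [].
have [I1 _] := Qi_CI s (RtoC x0) hx.
have pos : 0 <= Re (Qi s (RtoC x0)).
  apply: (is_RInt_le (fun _ => 0) _ _ _ 0 _ _ _ I1); first lra.
    have := is_RInt_const (V := R_NormedModule) 0 1 0; by rewrite /scal /= /mult /= Rmult_0_r.
  by move=> y hy; have [r [-> hr]] := Qf_RtoC s x0 y; left; apply: hr; lra.
exists (Re (Qi s (RtoC x0))); split => // p hp.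
have I2 := is_RInt_scal (V := R_NormedModule) _ _ _ (exp (- (Re p / 2))) _ I1.
rewrite Rmult_comm; apply: (CI_le _ _ _ _ _ _ _ (Qi_CI s p _) _ I2); [lra | lra |].
move=> y hy; rewrite Qf_mod; last lra.
have -> : Re (Qf s (RtoC x0) y) = exp (- (x0 / y)) * Rpower y (- s - 1).
  rewrite Qf_pos; last lra.
  by rewrite -RtoC_mult -RtoC_opp Cexp_RtoC -RtoC_mult.
rewrite /scal /= /mult /= -Rmult_assoc; apply: Rmult_le_compat_r; first by left; exact: exp_pos.
rewrite -exp_plus; have yi : 1 <= / y by rewrite -Rinv_1; apply: Rinv_le_contravar; lra.
have : - (Re p / y) <= - (Re p / 2) + - (x0 / y) by rewrite /Rdiv; nra.
case=> [l|->]; [left; exact: exp_increasing | lra].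
Qed.

Lemma Rpower_to_0 s : 0 < s -> filterlim (fun t => Rpower t s) (at_right 0) (locally 0).
Proof.
move=> hs; apply/(filterlim_locally (F := at_right 0)) => eps; have e0 := cond_pos eps.
exists (mkposreal (Rpower eps (/ s)) (exp_pos _)) => t ht t0.
have ht' : t < Rpower eps (/ s) by move: ht; rewrite /ball /= /AbsRing_ball /= /abs /minus /plus /opp /= => /Rabs_lt_between; lra.
change (Rabs (Rpower t s - 0) < eps); rewrite Rminus_0_r Rabs_pos_eq; last by left; exact: exp_pos.
have -> : pos eps = Rpower (Rpower eps (/ s)) s by rewrite Rpower_mult Rinv_l ?Rpower_1 //; lra.
by apply: Rlt_Rpower_l.
Qed.

Lemma Rpower_exp_bound x0 s : 0 < x0 -> exists B, 0 <= B /\ forall t, 1 <= t -> Rpower t s * exp (- (x0 * t)) <= B / t ^ 2.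
Proof.
move=> h; have [B [B0 hB]] := exp_pow_small x0 (- s) h; exists B; split => // t ht.
have := hB x0 (/ t) ltac:(lra) _; rewrite (_ : x0 / / t = x0 * t); last by field; lra.
rewrite {1}/Rpower ln_Rinv; last lra.
rewrite (_ : - s * - ln t = s * ln t); last by ring.
rewrite -/(Rpower t s) (_ : B * (/ t * / t) = B / t ^ 2); last by field; lra.
rewrite Rmult_comm; apply; split; first by apply: Rinv_0_lt_compat; lra.
rewrite -Rinv_1; apply: Rinv_le_contravar; lra.
Qed.

Lemma is_lim_dominated (f g : R -> R) : (forall t, 1 <= t -> Rabs (f t) <= g t) -> is_lim g p_infty 0 -> is_lim f p_infty 0.
Proof.
move=> h hg; apply: (is_lim_le_le_loc (fun t => - g t) g).
- exists 1 => t ht; have := h t ltac:(lra); move=> /Rabs_le_between; lra.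
- rewrite -Ropp_0; exact: (is_lim_opp g p_infty 0).
- exact: hg.
Qed.

Lemma is_lim_inv_sq B : is_lim (fun t => B / t ^ 2) p_infty 0.
Proof.
apply: (is_lim_ext (fun t => B * (/ t * / t))).
  move=> t; case: (Req_dec t 0) => [->|h]; [rewrite /= Rmult_0_l /Rdiv Rinv_0; ring | field; done].
have -> : Finite 0 = Rbar_mult B (Rbar_mult 0 0) by rewrite /= !Rmult_0_r.
apply: is_lim_scal_l; apply: is_lim_mult => //; have := is_lim_inv _ _ _ (is_lim_id p_infty); by apply.
Qed.

(** The primitive is the lower incomplete function minus [Gr s]; by [Nf_const] this is minus the
    upper one, so it vanishes at infinity. *)
Lemma Gr_Int s : 0 < s -> Int (fun t => Rpower t (s - 1) * exp (- t)) (Gr s).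
Proof.
move=> hs; have np := nonpole_pos s hs.
pose f := fun w => (Cpower w s * CPS (gco s) (- (1) * w))%C.
exists (fun t => Re (f (RtoC t)) - Gr s); split; last split.
- move=> u hu; have hR : 0 < Re (RtoC u) by [].
  have K := Cder_mult _ _ _ _ _ (Cder_Cpower (RtoC u) s hR) (Cder_gS s (RtoC u) np).
  have [H _] := Cder_curve f (fun t => t) u _ 1 K (is_derive_id u).
  have := is_derive_minus (V := R_NormedModule) _ _ _ _ _ H (is_derive_const (V := R_NormedModule) (Gr s) u).
  set l := minus _ _; rewrite (_ : l = Rpower u (s - 1) * exp (- u)) // /l.
  have e2 := gS_ode s (- (1) * RtoC u)%C np.
  rewrite /minus opp_zero plus_zero_r.
  have e3 : Cpower (RtoC u) s = (Cpower (RtoC u) (s - 1) * RtoC u)%C by rewrite {1}(_ : s = s - 1 + 1) ?Cpower_plus ?Cpower_1 //; ring.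
  rewrite e3 (_ : ((RtoC s * _ * _ + _) * RtoC 1)%C = (Cpower (RtoC u) (s - 1) * (- (1) * RtoC u * CPS (gco (s + 1)) (- (1) * RtoC u) + RtoC s * CPS (gco s) (- (1) * RtoC u)))%C); last by ring.
  rewrite e2 Cpower_RtoC // (_ : (- (1) * RtoC u)%C = RtoC (- u)); last by rewrite RtoC_opp; ring.
  by rewrite Cexp_RtoC -RtoC_mult.
- have [B [B0 hB]] := Qi_bound s (1/2) ltac:(lra).
  have [A [A0 hA]] := Rpower_exp_bound (1/2) s ltac:(lra).
  apply: (is_lim_dominated _ (fun t => B * A / t ^ 2)); last exact: is_lim_inv_sq.
  move=> t ht; have hR : 0 < Re (RtoC t) by rewrite /=; lra.
  have E := Nf_const s (RtoC t) np hR.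
  have -> : Re (f (RtoC t)) - Gr s = Re (f (RtoC t) - Nf s 1)%C by [].
  rewrite -E /f /Nf (_ : (_ - _)%C = (- (Cpower (RtoC t) s * Qi s (RtoC t)))%C); last by ring.
  apply: Rle_trans (re_le_Cmod _) _; rewrite Cmod_opp Cmod_mult Cmod_Cpower Cmod_R Rabs_pos_eq; last lra.
  have h1 := hB (RtoC t) ltac:(rewrite /=; lra); have h2 := hA t ht.
  rewrite /= in h1; have R0 : 0 < Rpower t s by exact: exp_pos.
  rewrite (_ : 1 / 2 * t = t / 2) in h2; last by field.
  apply: (Rle_trans _ (Rpower t s * (B * exp (- (t / 2))))).
    by apply: Rmult_le_compat_l => //; lra.
  rewrite (_ : B * A / t ^ 2 = B * (A / t ^ 2)); last by field; lra.
  rewrite (_ : Rpower t s * (B * exp (- (t / 2))) = B * (Rpower t s * exp (- (t / 2)))); last by ring.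
  exact: Rmult_le_compat_l.
- have En := entire_gco s np.
  set B := Rabs (Series (fun n => Rabs (gco s n) * 1 ^ n)).
  rewrite -(Rplus_0_l (- Gr s)).
  apply: (filterlim_Rplus (at_right 0)); last exact: filterlim_const.
  have L : filterlim (fun t => B * Rpower t s) (at_right 0) (locally 0).
    rewrite -{2}(Rmult_0_r B); apply: filterlim_comp (Rpower_to_0 s hs) _.
    exact: (filterlim_scal_r (K := R_AbsRing) (V := R_NormedModule) B 0).
  apply: (filterlim_le_le (F := at_right 0) (fun t => - (B * Rpower t s)) _ (fun t => B * Rpower t s) 0) => //; last first.
    have L2 := filterlim_comp _ _ _ _ _ _ _ _ L (filterlim_opp (K := R_AbsRing) (V := R_NormedModule) 0).
    by rewrite opp_zero in L2.
  exists (mkposreal 1 Rlt_0_1) => t ht t0.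
  have ht' : t < 1 by move: ht; rewrite /ball /= /AbsRing_ball /= /abs /minus /plus /opp /= => /Rabs_lt_between; lra.
  apply/Rabs_le_between; apply: Rle_trans (re_le_Cmod _) _.
  rewrite /f Cmod_mult Cmod_Cpower Cmod_R (Rabs_pos_eq t); last lra.
  rewrite Rmult_comm; apply: Rmult_le_compat_r; first by left; exact: exp_pos.
  apply: Rle_trans (Rle_abs _); apply: CPS_bound => //.
  rewrite (_ : (- (1) * RtoC t)%C = RtoC (- t)); last by rewrite RtoC_opp; ring.
  rewrite Cmod_R Rabs_Ropp Rabs_pos_eq; lra.
Qed.

Lemma Gr_1 : Gr 1 = 1.
Proof.
apply: (Int_unique (fun t => Rpower t (1 - 1) * exp (- t))); first by apply: Gr_Int; lra.
apply: (Int_ext (fun t => exp (- t))).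
  by move=> u hu; rewrite Rminus_diag Rpower_O // Rmult_1_l.
exists (fun t => - exp (- t)); split; last split.
- move=> u _; auto_derive => //; ring.
- have [A [A0 hA]] := Rpower_exp_bound 1 0 ltac:(lra).
  apply: (is_lim_dominated _ (fun t => A / t ^ 2)); last exact: is_lim_inv_sq.
  move=> t ht; have := hA t ht; rewrite Rpower_O ?Rmult_1_l; last lra.
  rewrite Rabs_Ropp Rabs_pos_eq //; left; exact: exp_pos.
- have -> : - (1) = - exp (- 0) by rewrite Ropp_0 exp_0.
  apply: (filterlim_filter_le_1 _ (filter_le_within (F := locally 0) (fun x => 0 < x))).
  apply: (ex_derive_continuous (V := R_NormedModule) (fun t => - exp (- t)) 0); auto_derive; done.
Qed.

(** Euler's integral meets Gauss's limit: [bohr_mollerup] on (0, 1], the common recurrence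
    elsewhere. *)
Lemma Gr_Gamma s : nonpole s -> Gr s = Gamma s.
Proof.
have base : forall x, 0 < x <= 1 -> Gr x = Gamma x.
  move=> x hx.
  have L : is_lim_seq (fun n => (INR n + x) / INR n) 1.
    apply: (is_lim_seq_ext_loc (fun n => 1 + x * / INR n)).
      exists 1%nat => n hn; have n0 : 0 < INR n by apply: lt_0_INR; lia.
      field; lra.
    have -> : Finite 1 = Finite (1 + x * 0) by rewrite Rmult_0_r Rplus_0_r.
    apply: is_lim_seq_plus'; first exact: is_lim_seq_const.
    apply: is_lim_seq_mult'; first exact: is_lim_seq_const.
    have := is_lim_seq_inv _ _ is_lim_seq_INR; apply; done.
  have := bohr_mollerup (fun y => y) Gr Gamma x hx; rewrite Gr_1 Gamma_1 !Rmult_1_r; apply=> //.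
  - move=> y hy; apply: (Int_pos _ _ _ (Gr_Int y hy)) => u hu; apply: Rmult_lt_0_compat; exact: exp_pos.
  - exact: Gamma_pos.
  - by move=> y /nonpole_pos; exact: Gr_S.
  - by move=> y /nonpole_pos; exact: Gamma_S.
  - move=> y t hy ht; apply: (Int_logconvex _ _ _ (Gr y) (Gr (y + 1)) _ y t hy ht _ _ (Gr_Int y hy) (Gr_Int (y + 1) ltac:(lra)) (Gr_Int (y + t) ltac:(lra))).
    + move=> u _; apply: Rmult_le_pos; left; exact: exp_pos.
    + exists 1; split; first lra.
      split => u hu; rewrite -Rmult_assoc -Rpower_plus; congr (Rpower _ _ * _); ring.
    + apply: Gr_S; exact: nonpole_pos.
  - exact: Gamma_convex.
move: s; apply: nonpole_ind => x hx.
  have [n hn] := nat_above x; elim: n x hx hn => [|n IH] x hx; first by rewrite /=; lra.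
  rewrite S_INR => hn; case: (Rle_dec x 1) => h1; first exact: base.
  have np : nonpole (x - 1) by apply: nonpole_pos; lra.
  rewrite (_ : x = x - 1 + 1); last by ring.
  rewrite Gr_S // Gamma_S // IH //; lra.
rewrite Gr_S // Gamma_S // => E; apply: (Rmult_eq_reg_l x) => //; exact: nonpole_neq0.
Qed.

Lemma Qi_Gamma s p : nonpole s -> 0 < Re p ->
  Qi s p = (RtoC (Gamma s) * Cpower p (- s) - CPS (gco s) (- (1) * p))%C.
Proof.
move=> hs hp; have := Nf_const s p hs hp; rewrite Nf_real // -/(Gr s) Gr_Gamma // => <-.
rewrite Cpower_opp /Nf; field; exact: Cpower_neq0.
Qed.

(** * The function K: integral representation, decay, positivity *)

Fixpoint csum (u : nat -> C) (n : nat) : C :=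
  match n with O => 0%C | S m => (csum u m + u m)%C end.
Fixpoint rsum (u : nat -> R) (n : nat) : R :=
  match n with O => 0 | S m => rsum u m + u m end.

Lemma csum_ext u v n : (forall k, (k < n)%nat -> u k = v k) -> csum u n = csum v n.
Proof.
elim: n => //= n IH h; rewrite IH ?h //; by move=> k hk; apply: h; lia.
Qed.

Lemma csum_plus u v n : csum (fun k => u k + v k)%C n = (csum u n + csum v n)%C.
Proof. elim: n => /= [|n ->]; ring. Qed.

Lemma csum_scal c u n : csum (fun k => c * u k)%C n = (c * csum u n)%C.
Proof. elim: n => /= [|n ->]; ring. Qed.

Lemma csum_swap (T : nat -> nat -> C) m n :
  csum (fun j => csum (T j) n) m = csum (fun k => csum (fun j => T j k) m) n.
Proof.
elim: m => /= [|m IH]; first by elim: n => //= n <-; ring.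
by rewrite IH -csum_plus.
Qed.

(** For the cancellation of the truncated double sum in [Mint_partial]. *)
Lemma csum_antisym (T : nat -> nat -> C) n : (forall j k, T j k = (- T k j)%C) ->
  csum (fun j => csum (T j) n) n = 0%C.
Proof.
move=> h; set X := csum _ n.
have E : X = (- (1) * X)%C.
  rewrite {1}/X csum_swap /X -csum_scal; apply: csum_ext => j _; rewrite -csum_scal; apply: csum_ext => k _.
  rewrite h; ring.
have E2 : (X + X)%C = 0%C by rewrite {1}E; ring.
have r : Re X + Re X = 0 by exact: (f_equal Re E2).
have i : Im X + Im X = 0 by exact: (f_equal Im E2).
apply: C_eq; [change (Re X = 0) | change (Im X = 0)]; lra.
Qed.

Lemma csum_le u v n : (forall k, (k < n)%nat -> Cmod (u k) <= v k) -> Cmod (csum u n) <= rsum v n.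
Proof.
elim: n => /= [|n IH] h; first by rewrite Cmod_0; lra.
apply: Rle_trans (Cmod_triangle _ _) _; apply: Rplus_le_compat; first by apply: IH => k hk; apply: h; lia.
by apply: h; lia.
Qed.

Lemma rsum_sum_n u n : rsum u (S n) = sum_n u n.
Proof. elim: n => [|n IH]; first by rewrite sum_O /=; ring. by rewrite sum_SnR -IH. Qed.

Lemma rsum_le_series u l n : (forall k, 0 <= u k) -> is_series u l -> rsum u n <= l.
Proof.
move=> pos h.
have mono : forall k m, (k <= m)%nat -> rsum u k <= rsum u m.
  move=> k m; elim=> [|j _ IH]; [lra | rewrite /=; have := pos j; lra].
have L : is_lim_seq (fun m => rsum u (S m)) l.
  by apply: (is_lim_seq_ext (sum_n u)) => // m; rewrite rsum_sum_n.
apply: (is_lim_seq_le_loc (fun _ => rsum u n) _ (rsum u n) l _ (is_lim_seq_const _) L).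
by exists n => m hm; apply: mono; lia.
Qed.

Lemma rsum_scal c u n : rsum (fun k => c * u k) n = c * rsum u n.
Proof. elim: n => /= [|n ->]; ring. Qed.

Lemma CSum_csum u l : CSum u l -> forall eps, 0 < eps -> exists N, forall n, (N <= n)%nat -> Cmod (csum u n - l)%C < eps.
Proof.
move=> [h1 h2] eps e0.
have R1 : forall n, Re (csum u (S n)) = sum_n (fun k => Re (u k)) n.
  elim=> [|n IH]; first by rewrite sum_O /Re /Im /=; ring.
  by rewrite sum_SnR -IH.
have R2 : forall n, Im (csum u (S n)) = sum_n (fun k => Im (u k)) n.
  elim=> [|n IH]; first by rewrite sum_O /Re /Im /=; ring.
  by rewrite sum_SnR -IH.
have [N1 H1] := proj2 (is_lim_seq_spec (sum_n (fun k => Re (u k))) (Re l)) h1 (mkposreal (eps / 2) ltac:(lra)).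
have [N2 H2] := proj2 (is_lim_seq_spec (sum_n (fun k => Im (u k))) (Im l)) h2 (mkposreal (eps / 2) ltac:(lra)).
exists (S (N1 + N2)); case=> [|n] hn; first lia.
have a := H1 n ltac:(lia); have b := H2 n ltac:(lia); rewrite /= in a b.
rewrite (_ : (csum u (S n) - l)%C = (Re (csum u (S n)) - Re l, Im (csum u (S n)) - Im l)); last by apply: C_eq.
apply: Rle_lt_trans (Cmod_le_abs _ _) _; rewrite R1 R2; lra.
Qed.

Lemma CPS_split a z K : entire a ->
  CPS a z = (csum (fun k => RtoC (a k) * z ^ k) K + z ^ K * CPS (fun n => a (n + K)%nat) z)%C.
Proof.
move=> h; elim: K => [|K IH].
  rewrite /= Cplus_0_l Cmult_1_l; apply: CPS_ext => n; by rewrite Nat.add_0_r.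
rewrite IH (CPS_decr (fun n => a (n + K)%nat)); last exact: entire_shiftn.
rewrite (CPS_ext (fun n => a (S n + K)%nat) (fun n => a (n + S K)%nat)); last by move=> n; rewrite Nat.add_succ_comm.
rewrite /=; ring.
Qed.

Lemma fact_add n k : (fact n * fact k <= fact (n + k))%nat.
Proof.
elim: n => [|n IH] /=; first lia.
have : (n * fact n * fact k <= n * fact (n + k))%nat by rewrite -Nat.mul_assoc; apply: Nat.mul_le_mono_l.
have : (n * fact (n + k) <= (n + k) * fact (n + k))%nat by apply: Nat.mul_le_mono_r; lia.
nia.
Qed.

Lemma CPS_tail a c z K : 0 <= c -> (forall n, Rabs (a n) <= c * / INR (fact n)) ->
  Cmod (CPS a z - csum (fun k => RtoC (a k) * z ^ k) K)%C <= c * (Cmod z ^ K / INR (fact K) * exp (Cmod z)).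
Proof.
move=> c0 ha.
have ea : entire a.
  apply: (entire_dominated _ (fun n => c * / INR (fact n))); last by apply: entire_scal; exact: entire_expn.
  by move=> n; apply: Rle_trans (ha n) (Rle_abs _).
rewrite (CPS_split a z K ea) (_ : (_ + _ - _)%C = (z ^ K * CPS (fun n => a (n + K)%nat) z)%C); last by ring.
rewrite Cmod_mult Cmod_pow.
have m0 := Cmod_ge_0 z; have fK := INR_fact_lt_0 K.
have S1 : is_series (fun n => c / INR (fact K) * (/ INR (fact n) * Cmod z ^ n)) (c / INR (fact K) * exp (Cmod z)).
  apply: (is_series_scal (c / INR (fact K))).
  have := is_exp_Reals (Cmod z); rewrite /is_pseries; apply: is_series_ext => n.
  by rewrite pow_n_pow /scal /= /mult /= Rmult_comm.
have B : Cmod (CPS (fun n => a (n + K)%nat) z) <= c / INR (fact K) * exp (Cmod z).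
  apply: CSum_le (CPS_sum _ z (entire_shiftn _ K ea)) _ S1 => n.
  rewrite Cmod_mult Cmod_R Cmod_pow -Rmult_assoc; apply: Rmult_le_compat_r; first exact: pow_le.
  apply: Rle_trans (ha _) _; rewrite /Rdiv Rmult_assoc; apply: Rmult_le_compat_l => //.
  rewrite -Rinv_mult; apply: Rinv_le_contravar.
    by apply: Rmult_lt_0_compat => //; exact: INR_fact_lt_0.
  rewrite -mult_INR Nat.mul_comm; apply: le_INR; exact: fact_add.
apply: Rle_trans (Rmult_le_compat_l _ _ _ (pow_le _ K m0) B) _.
right; field; lra.
Qed.

Lemma Cexp_tail z K : Cmod (Cexp z - csum (fun k => RtoC (/ INR (fact k)) * z ^ k) K)%C <= Cmod z ^ K / INR (fact K) * exp (Cmod z).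
Proof.
rewrite Cexp_CPS -(Rmult_1_l (_ / _ * _)); apply: CPS_tail; first lra.
move=> n; have := INR_fact_lt_0 n => f0; rewrite Rabs_pos_eq; first lra.
left; exact: Rinv_0_lt_compat.
Qed.

(** One lower bound for all shifts bounds the coefficients of every series [gco (s - INR j)]
    uniformly in j. *)
Lemma nonint_dist s : nonint s -> exists d, 0 < d /\ forall j k : nat, d <= Rabs (s - INR j + INR k).
Proof.
move=> hs; have [d1 [d10 h1]] := nonpole_dist _ (nonint_nonpole _ hs).
have [d2 [d20 h2]] := nonpole_dist _ (nonint_nonpole _ (nonint_opp _ hs)).
exists (Rmin d1 d2); split; first exact: Rmin_pos.
move=> j k; case: (Nat.le_ge_cases j k) => h.
  apply: Rle_trans (Rmin_l _ _) _; have := h1 (k - j)%nat; rewrite minus_INR //.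
  by rewrite (_ : s + (INR k - INR j) = s - INR j + INR k) //; ring.
apply: Rle_trans (Rmin_r _ _) _; have := h2 (j - k)%nat; rewrite minus_INR //.
by rewrite -Rabs_Ropp (_ : - (- s + (INR j - INR k)) = s - INR j + INR k) //; ring.
Qed.

(** The coefficients of Gamma(1 + mu) (z/2)^(-mu) I_mu(z) in powers of z^2 / 4. *)
Definition Ec (mu : R) (r : nat) : R := / (poch (1 + mu) r * INR (fact r)).

Lemma entire_powfact c : entire (fun n => c ^ n * / INR (fact n)).
Proof.
move=> r r0; exists (exp (Rabs c * r)); have := is_exp_Reals (Rabs c * r); rewrite /is_pseries.
apply: is_series_ext => n; rewrite pow_n_pow /scal /= /mult /= Rabs_mult -RPow_abs Rpow_mult_distr.
rewrite (Rabs_pos_eq (/ _)); first ring.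
left; apply: Rinv_0_lt_compat; exact: INR_fact_lt_0.
Qed.

Lemma entire_Ec mu : nonpole (1 + mu) -> entire (Ec mu).
Proof.
move=> h; have [d [d0 hd]] := nonpole_dist _ h.
apply: (entire_dominated _ (fun n => (/ d) ^ n * / INR (fact n))); last exact: entire_powfact.
move=> n; have f0 := INR_fact_lt_0 n; rewrite /Ec Rinv_mult !Rabs_mult; apply: Rmult_le_compat_r; first exact: Rabs_pos.
elim: n {f0} => [|n IH]; first by rewrite /= Rinv_1; lra.
rewrite poch_S_r Rinv_mult Rabs_mult [(/ d) ^ S n]/= (Rmult_comm (/ d)) Rabs_mult.
apply: Rmult_le_compat => //; try exact: Rabs_pos.
rewrite Rabs_inv (Rabs_pos_eq (/ d)); last by left; exact: Rinv_0_lt_compat.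
exact: Rinv_le_contravar.
Qed.

(* [Lf mu] is Gamma(-mu) Gamma(1+mu) / 2 times I_mu, so by the reflection formula [Kf] is K: see [BesselK_Kf]. *)
Definition Lf (mu : R) (z : C) : C :=
  (RtoC (Gamma (- mu) / 2 * Rpower 2 (- mu)) * (Cpower z mu * CPS (Ec mu) (RtoC (/ 4) * (z * z))))%C.

Definition Kf (mu : R) (z : C) : C := (Lf mu z + Lf (- mu) z)%C.

Lemma nonint_1p mu : nonint mu -> nonpole (1 + mu).
Proof. by move=> h; rewrite Rplus_comm; apply: nonint_nonpole; exact: nonint_S. Qed.

(** The shifted Gamma values produced by integrating the Taylor series of e^(-py) termwise are the
    coefficients of the Bessel series. *)
Lemma Gamma_down mu j : nonint mu -> Gamma (- mu - INR j) * (-1) ^ j * / INR (fact j) = Gamma (- mu) * Ec mu j.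
Proof.
move=> h; rewrite /Ec Rinv_mult -Rmult_assoc; congr (_ * _).
elim: j => [|j IH]; first by rewrite /= Rminus_0_r Rinv_1.
have np : nonpole (- mu - INR (S j)).
  by apply: nonint_nonpole; apply: nonint_minus_nat; exact: nonint_opp.
have := Gamma_S _ np; rewrite (_ : - mu - INR (S j) + 1 = - mu - INR j); last by rewrite S_INR; ring.
move=> E; rewrite poch_S_r Rinv_mult -Rmult_assoc -IH E [(-1) ^ S j]/=.
have := nonint_1p _ h j => n0; rewrite S_INR; field; exact: n0.
Qed.

Lemma Cpower_plus_nat (p : C) s n : 0 < Re p -> Cpower p (s + INR n) = (Cpower p s * p ^ n)%C.
Proof. by move=> h; rewrite Cpower_plus Cpower_nat. Qed.

Lemma Lf_half mu z : 0 < Re z -> let p := (RtoC (/ 2) * z)%C in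
  Lf mu z = (RtoC (Gamma (- mu) / 2) * (Cpower p mu * CPS (Ec mu) (p * p)))%C.
Proof.
move=> hz p; rewrite /Lf.
have -> : (RtoC (/ 4) * (z * z))%C = (p * p)%C.
  rewrite /p (_ : / 4 = / 2 * / 2) ?RtoC_mult; [ring | field].
rewrite /p Cpower_scal //; last lra.
rewrite /Rpower ln_Rinv; last lra.
rewrite (_ : - mu * ln 2 = mu * - ln 2) ?RtoC_mult; ring.
Qed.

(* The integral of e^(-p(y + 1/y)) (y^nu + y^-nu) / y over (0, 1), which is 2 K_nu(2p). *)
Definition Mint (nu : R) (p : C) : C :=
  CInt (fun y => Cexp (- (p * RtoC y)) * (Qf nu p y + Qf (- nu) p y))%C 0 1.

Lemma Ccont_Cexp p y : Ccont (fun y => Cexp (- (p * RtoC y)))%C y.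
Proof.
have K := Cder_comp Cexp (fun w => - (1) * (p * w))%C (RtoC y) _ _
   (Cder_scal (- (1))%C _ _ _ (Cder_scal p _ _ _ (Cder_id _))) (Cder_Cexp _).
have [h1 h2] := CD_Ccont _ _ _ (Cder_curve _ (fun t => t) y _ 1 K (is_derive_id y)).
have E : forall t, (- (1) * (p * RtoC t))%C = (- (p * RtoC t))%C by move=> t; ring.
split; [move: h1 | move: h2]; apply: continuous_ext => t; by rewrite E.
Qed.

Lemma Mint_CI nu p : 0 < Re p -> CI (fun y => Cexp (- (p * RtoC y)) * (Qf nu p y + Qf (- nu) p y))%C 0 1 (Mint nu p).
Proof.
move=> hp; apply: CI_cont => t; rewrite Rmin_left ?Rmax_right; try lra; move=> ht.
apply: Ccont_mult; first exact: Ccont_Cexp.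
apply: Ccont_plus; apply: Ccont_Qf => //; lra.
Qed.

Lemma Qf_shift s p y j : 0 < y -> (RtoC y ^ j * Qf s p y)%C = Qf (s - INR j) p y.
Proof.
move=> h; rewrite !Qf_pos // -RtoC_pow (_ : - (s - INR j) - 1 = - s - 1 + INR j); last by ring.
rewrite Rpower_plus Rpower_pow // RtoC_mult; ring.
Qed.

Lemma CI_csum f a b l n : (forall k, CI (f k) a b (l k)) -> CI (fun y => csum (fun k => f k y) n) a b (csum l n).
Proof.
move=> h; elim: n => [|n IH] /=; last by apply: CI_plus.
split => /=; have := is_RInt_const (V := R_NormedModule) a b 0; by rewrite /scal /= /mult /= Rmult_0_r.
Qed.

Lemma Re_Qf_RtoC s x y : 0 < y -> Re (Qf s (RtoC x) y) = exp (- (x / y)) * Rpower y (- s - 1).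
Proof.
by move=> h; rewrite Qf_pos // -RtoC_mult -RtoC_opp Cexp_RtoC -RtoC_mult.
Qed.

(** The factor e^(-py) is replaced by its Taylor polynomial, each y^j of which lowers the parameter
    of [Qf] by j. *)
Lemma Mint_approx nu p J : 0 < Re p ->
  Cmod (Mint nu p - csum (fun j => RtoC (/ INR (fact j)) * (- (1) * p) ^ j * (Qi (nu - INR j) p + Qi (- nu - INR j) p)) J)%C <=
  Cmod p ^ J / INR (fact J) * exp (Cmod p) * (Re (Qi nu (RtoC (Re p))) + Re (Qi (- nu) (RtoC (Re p)))).
Proof.
move=> hp; have hx : 0 < Re (RtoC (Re p)) by [].
have [I1 _] := Qi_CI nu _ hx; have [I2 _] := Qi_CI (- nu) _ hx.
set c := Cmod p ^ J / INR (fact J) * exp (Cmod p).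
have I3 := is_RInt_scal (V := R_NormedModule) _ _ _ c _ (is_RInt_plus (V := R_NormedModule) _ _ _ _ _ _ I1 I2).
pose f j y := (RtoC (/ INR (fact j)) * (- (1) * p) ^ j * (Qf (nu - INR j) p y + Qf (- nu - INR j) p y))%C.
have I4 : CI (fun y => csum (fun j => f j y) J) 0 1 (csum (fun j => RtoC (/ INR (fact j)) * (- (1) * p) ^ j * (Qi (nu - INR j) p + Qi (- nu - INR j) p)) J)%C.
  apply: (CI_csum f) => j; apply: CI_scal; apply: CI_plus; exact: Qi_CI.
have I5 := CI_plus _ _ _ _ _ _ (Mint_CI nu p hp) (CI_scal (- (1))%C _ _ _ _ I4).
rewrite (_ : forall u v : C, (u - v)%C = (u + - (1) * v)%C); last by move=> u v; ring.
apply: (CI_le _ _ _ _ _ _ _ I5 _ I3); first lra.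
move=> y hy; have y0 : 0 < y by lra.
have -> : csum (fun j => f j y) J = (csum (fun j => RtoC (/ INR (fact j)) * (- (p * RtoC y)) ^ j) J * (Qf nu p y + Qf (- nu) p y))%C.
  rewrite Cmult_comm -csum_scal; apply: csum_ext => j _; rewrite /f -!(Qf_shift _ _ _ j) //.
  rewrite (_ : (- (p * RtoC y))%C = ((- (1) * p) * RtoC y)%C); last by ring.
  move: (- (1) * p)%C => q; rewrite Cpow_mult_l; ring.
rewrite (_ : (_ + _)%C = ((Cexp (- (p * RtoC y)) - csum (fun j => RtoC (/ INR (fact j)) * (- (p * RtoC y)) ^ j) J) * (Qf nu p y + Qf (- nu) p y))%C); last by ring.
rewrite Cmod_mult; apply: Rmult_le_compat; try exact: Cmod_ge_0.
  apply: Rle_trans (Cexp_tail _ J) _.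
  rewrite Cmod_opp Cmod_mult Cmod_R Rabs_pos_eq; last lra.
  have m0 := Cmod_ge_0 p; have py : Cmod p * y <= Cmod p by nra.
  have py0 : 0 <= Cmod p * y by nra.
  rewrite /c; apply: Rmult_le_compat.
  - apply: Rmult_le_pos; [exact: pow_le | left; apply: Rinv_0_lt_compat; exact: INR_fact_lt_0].
  - left; exact: exp_pos.
  - apply: Rmult_le_compat_r; [left; apply: Rinv_0_lt_compat; exact: INR_fact_lt_0 | by apply: pow_incr].
  - case: py => [l|->]; [left; exact: exp_increasing | lra].
apply: Rle_trans (Cmod_triangle _ _) _; rewrite !Qf_mod // /plus /= !Re_Qf_RtoC //; lra.
Qed.

Lemma csum_minus u v n : csum (fun k => u k - v k)%C n = (csum u n - csum v n)%C.
Proof. elim: n => /= [|n ->]; ring. Qed.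

Lemma pow_opp_p (p : C) j : ((- (1) * p) ^ j)%C = (RtoC ((-1) ^ j) * p ^ j)%C.
Proof.
rewrite Cpow_mult_l RtoC_pow; congr (_ ^ _ * _)%C; apply: C_eq => /=; ring.
Qed.

(** Each [Qi] splits into a Gamma term, which feeds the two Bessel series, and an incomplete series.
    The latter, truncated at J, form a double sum with coefficients 1/(j! k!) times 1/(nu - j + k) +
    1/(-nu - j + k). Exchanging j and k changes its sign, so it vanishes and only the tails are
    left. *)
Lemma Mint_partial nu p J : nonint nu -> 0 < Re p ->
  csum (fun j => RtoC (/ INR (fact j)) * (- (1) * p) ^ j * (Qi (nu - INR j) p + Qi (- nu - INR j) p))%C J =
  (csum (fun j => RtoC (Gamma (- nu)) * Cpower p nu * (RtoC (Ec nu j) * (p * p) ^ j) + RtoC (Gamma nu) * Cpower p (- nu) * (RtoC (Ec (- nu) j) * (p * p) ^ j)) J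
  - csum (fun j => RtoC (/ INR (fact j)) * (- (1) * p) ^ j *
     ((CPS (gco (nu - INR j)) (- (1) * p) - csum (fun k => RtoC (gco (nu - INR j) k) * (- (1) * p) ^ k) J)
     + (CPS (gco (- nu - INR j)) (- (1) * p) - csum (fun k => RtoC (gco (- nu - INR j) k) * (- (1) * p) ^ k) J))) J)%C.
Proof.
move=> hn hp; set q := (- (1) * p)%C.
have Z : csum (fun j => csum (fun k => RtoC (/ INR (fact j)) * q ^ j * (RtoC (gco (nu - INR j) k) * q ^ k) + RtoC (/ INR (fact j)) * q ^ j * (RtoC (gco (- nu - INR j) k) * q ^ k)) J)%C J = 0%C.
  apply: csum_antisym => j k.
  have E : forall s, / INR (fact j) * gco s k = / (INR (fact j) * INR (fact k)) * / (s + INR k) by move=> s; rewrite /gco !Rinv_mult; ring.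
  have E' : forall s, / INR (fact k) * gco s j = / (INR (fact j) * INR (fact k)) * / (s + INR j) by move=> s; rewrite /gco !Rinv_mult; ring.
  rewrite (_ : (_ + _)%C = (RtoC (/ INR (fact j) * gco (nu - INR j) k + / INR (fact j) * gco (- nu - INR j) k) * (q ^ j * q ^ k))%C); last by rewrite RtoC_plus !RtoC_mult; ring.
  rewrite (_ : (RtoC (/ INR (fact k)) * q ^ k * (RtoC (gco (nu - INR k) j) * q ^ j) + _)%C = (RtoC (/ INR (fact k) * gco (nu - INR k) j + / INR (fact k) * gco (- nu - INR k) j) * (q ^ j * q ^ k))%C); last by rewrite RtoC_plus !RtoC_mult; ring.
  rewrite !E !E' (_ : - nu - INR j + INR k = - (nu - INR k + INR j)); last by ring.
  rewrite (_ : - nu - INR k + INR j = - (nu - INR j + INR k)); last by ring.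
  rewrite !Rinv_opp (_ : forall a b c : R, a * b + a * - c = - (a * c + a * - b)); last by move=> a b c; ring.
  rewrite RtoC_opp; ring.
rewrite -csum_minus -(Cplus_0_r (csum _ J)) -Z -csum_plus; apply: csum_ext => j _.
rewrite csum_plus !csum_scal.
have np1 : nonpole (nu - INR j) by apply: nonint_nonpole; exact: nonint_minus_nat.
have np2 : nonpole (- nu - INR j) by apply: nonint_nonpole; apply: nonint_minus_nat; exact: nonint_opp.
rewrite (Qi_Gamma _ _ np1 hp) (Qi_Gamma _ _ np2 hp) -/q.
have G1 := Gamma_down nu j hn; have G2 := Gamma_down (- nu) j (nonint_opp _ hn); rewrite Ropp_involutive in G2.
have P1 : Cpower p (- (- nu - INR j)) = (Cpower p nu * p ^ j)%C by rewrite -Cpower_plus_nat //; congr Cpower; ring.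
have P2 : Cpower p (- (nu - INR j)) = (Cpower p (- nu) * p ^ j)%C by rewrite -Cpower_plus_nat //; congr Cpower; ring.
rewrite P1 P2 Cpow_mult_l.
have -> : (RtoC (Gamma (- nu)) * Cpower p nu * (RtoC (Ec nu j) * (p ^ j * p ^ j)))%C = (RtoC (Gamma (- nu) * Ec nu j) * (Cpower p nu * (p ^ j * p ^ j)))%C by rewrite RtoC_mult; ring.
have -> : (RtoC (Gamma nu) * Cpower p (- nu) * (RtoC (Ec (- nu) j) * (p ^ j * p ^ j)))%C = (RtoC (Gamma nu * Ec (- nu) j) * (Cpower p (- nu) * (p ^ j * p ^ j)))%C by rewrite RtoC_mult; ring.
rewrite -G1 -G2 /q pow_opp_p !RtoC_mult; ring.
Qed.

Lemma rsum_exp r n : 0 <= r -> rsum (fun j => / INR (fact j) * r ^ j) n <= exp r.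
Proof.
move=> r0; apply: rsum_le_series.
  move=> k; apply: Rmult_le_pos; [left; apply: Rinv_0_lt_compat; exact: INR_fact_lt_0 | exact: pow_le].
have := is_exp_Reals r; rewrite /is_pseries; apply: is_series_ext => k.
by rewrite pow_n_pow /scal /= /mult /= Rmult_comm.
Qed.

(** Decay and positivity of K are read off from this integral; they are hidden in the cancellation
    between the two growing series. Letting J grow is harmless because [nonint_dist] bounds all
    tails at once. *)
Lemma Kf_Mint nu z : nonint nu -> 0 < Re z -> Kf nu z = (RtoC (/ 2) * Mint nu (RtoC (/ 2) * z))%C.
Proof.
move=> hn hz; set p := (RtoC (/ 2) * z)%C.
have hp : 0 < Re p by rewrite /p Re_scal; lra.
have m0 := Cmod_ge_0 p.
have [d [d0 hd]] := nonint_dist _ hn.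
set B1 := Re (Qi nu (RtoC (Re p))) + Re (Qi (- nu) (RtoC (Re p))).
set c := fun J => Cmod p ^ J / INR (fact J) * exp (Cmod p).
have c0 : forall J, 0 <= c J.
  move=> J; apply: Rmult_le_pos; last by left; exact: exp_pos.
  apply: Rmult_le_pos; [exact: pow_le | left; apply: Rinv_0_lt_compat; exact: INR_fact_lt_0].
pose A J := csum (fun j => RtoC (Gamma (- nu)) * Cpower p nu * (RtoC (Ec nu j) * (p * p) ^ j) + RtoC (Gamma nu) * Cpower p (- nu) * (RtoC (Ec (- nu) j) * (p * p) ^ j))%C J.
have H : forall J, Cmod (Mint nu p - A J)%C <= c J * (B1 + 2 * / d * exp (Cmod p)).
  move=> J; have h1 := Mint_approx nu p J hp; rewrite (Mint_partial _ _ _ hn hp) -/(A J) -/(c J) -/B1 in h1.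
  move: h1; set T := csum _ J => h1.
  have h2 : Cmod T <= c J * (2 * / d) * exp (Cmod p).
    apply: (Rle_trans _ (rsum (fun j => c J * (2 * / d) * (/ INR (fact j) * Cmod p ^ j)) J)).
      have E : Cmod (- (1) * p)%C = Cmod p by rewrite Cmod_mult Cmod_opp Cmod_1 Rmult_1_l.
      apply: csum_le => j _; rewrite 2!Cmod_mult Cmod_R Cmod_pow E Rabs_pos_eq; last first.
        left; apply: Rinv_0_lt_compat; exact: INR_fact_lt_0.
      rewrite Rmult_comm; apply: Rmult_le_compat_r.
        apply: Rmult_le_pos; [left; apply: Rinv_0_lt_compat; exact: INR_fact_lt_0 | exact: pow_le].
      apply: Rle_trans (Cmod_triangle _ _) _.
      have di : 0 <= / d by left; exact: Rinv_0_lt_compat.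
      have t1 := CPS_tail (gco (nu - INR j)) (/ d) (- (1) * p)%C J di.
      have t2 := CPS_tail (gco (- nu - INR j)) (/ d) (- (1) * p)%C J di.
      rewrite E -/(c J) in t1 t2.
      have := t1 (fun k => gco_bound _ _ _ d0 (hd j k)).
      have hd2 : forall k, d <= Rabs (- nu - INR j + INR k).
        move=> k; have := hd k j; by rewrite -Rabs_Ropp (_ : - (nu - INR k + INR j) = - nu - INR j + INR k) //; ring.
      have := t2 (fun k => gco_bound _ _ _ d0 (hd2 k)); lra.
    rewrite rsum_scal; apply: Rmult_le_compat_l; last exact: rsum_exp.
    apply: Rmult_le_pos => //; have : 0 < / d by exact: Rinv_0_lt_compat.
    lra.
  rewrite (_ : (Mint nu p - A J)%C = ((Mint nu p - (A J - T)) - T)%C); last by ring.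
  apply: Rle_trans (Cmod_triangle _ _) _; rewrite Cmod_opp; nra.
have cl : is_lim_seq c 0.
  apply: (is_lim_seq_ext (fun J => exp (Cmod p) * (Cmod p ^ J / INR (fact J)))); first by move=> n; rewrite /c; ring.
  have -> : Finite 0 = Rbar_mult (exp (Cmod p)) 0 by rewrite /= Rmult_0_r.
  apply: is_lim_seq_scal_l; apply: ex_series_lim_0; exists (exp (Cmod p)).
  have := is_exp_Reals (Cmod p); rewrite /is_pseries; apply: is_series_ext => k.
  by rewrite pow_n_pow.
have e1 := entire_Ec _ (nonint_1p _ hn); have e2 := entire_Ec _ (nonint_1p _ (nonint_opp _ hn)).
have S1 : CSum (fun j => RtoC (Gamma (- nu)) * Cpower p nu * (RtoC (Ec nu j) * (p * p) ^ j) + RtoC (Gamma nu) * Cpower p (- nu) * (RtoC (Ec (- nu) j) * (p * p) ^ j))%C (RtoC 2 * Kf nu z)%C.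
  rewrite /Kf !Lf_half // -/p Ropp_involutive.
  rewrite (_ : (RtoC 2 * _)%C = (RtoC (Gamma (- nu)) * Cpower p nu * CPS (Ec nu) (p * p) + RtoC (Gamma nu) * Cpower p (- nu) * CPS (Ec (- nu)) (p * p))%C); last first.
    rewrite !RtoC_div; try lra; field; apply: RtoC_neq0; lra.
  apply: CSum_plus; apply: CSum_scal; exact: CPS_sum.
have E : (RtoC 2 * Kf nu z)%C = Mint nu p; last first.
  rewrite -E Cmult_assoc -RtoC_mult (_ : / 2 * 2 = 1); [ring | field].
case: (Req_dec (Cmod (RtoC 2 * Kf nu z - Mint nu p)%C) 0) => [/Cmod_eq_0 h|nz].
  by rewrite -(Cplus_0_r (Mint nu p)) -h; ring.
exfalso; set D := Cmod (RtoC 2 * Kf nu z - Mint nu p)%C in nz.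
have D0 : 0 < D by have := Cmod_ge_0 (RtoC 2 * Kf nu z - Mint nu p)%C; rewrite -/D; lra.
set W := B1 + 2 * / d * exp (Cmod p) in H.
have Wp : 0 < Rabs W + 1 by have := Rabs_pos W; lra.
have [N1 h1] := CSum_csum _ _ S1 (D / 2) ltac:(lra).
have eps : 0 < D / 2 / (Rabs W + 1) by apply: Rdiv_lt_0_compat; lra.
have [N2 h2] := proj2 (is_lim_seq_spec c 0) cl (mkposreal _ eps).
have a1 := h1 (N1 + N2)%nat ltac:(lia); have a2 := h2 (N1 + N2)%nat ltac:(lia); rewrite /= Rminus_0_r Rabs_pos_eq // in a2.
rewrite -/(A (N1 + N2)%nat) in a1; have a3 := H (N1 + N2)%nat.
have : c (N1 + N2)%nat * W <= D / 2.
  have := Rmult_lt_compat_r _ _ _ Wp a2; rewrite (_ : D / 2 / (Rabs W + 1) * (Rabs W + 1) = D / 2); last by field; lra.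
  have := c0 (N1 + N2)%nat; have := Rle_abs W; nra.
have : D <= Cmod (Mint nu p - A (N1 + N2)%nat)%C + Cmod (A (N1 + N2)%nat - RtoC 2 * Kf nu z)%C.
  rewrite /D Cmod_sub_sym (_ : (Mint nu p - RtoC 2 * Kf nu z)%C = ((Mint nu p - A (N1 + N2)%nat) + (A (N1 + N2)%nat - RtoC 2 * Kf nu z))%C); [exact: Cmod_triangle | ring].
lra.
Qed.

(** The rate is a quarter of Re z: one half from p = z / 2 and one half given away in [Qi_bound].
    Any positive rate serves below. *)
Lemma Kf_decay nu x0 : nonint nu -> 0 < x0 -> exists B, 0 <= B /\
  forall z, x0 <= Re z -> Cmod (Kf nu z) <= B * exp (- (Re z / 4)).
Proof.
move=> hn h.
have [B [B0 hB]] := Qi_bound nu (x0 / 4) ltac:(lra); have [A [A0 hA]] := Qi_bound (- nu) (x0 / 4) ltac:(lra).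
exists (B + A); split; first lra.
move=> z hz; rewrite Kf_Mint //; last lra.
set p := (RtoC (/ 2) * z)%C; have rp : Re p = Re z / 2 by rewrite /p Re_scal; field.
have hp : 0 < Re p by lra.
rewrite Cmod_mult Cmod_R Rabs_pos_eq; last lra.
have hx : 0 < Re (RtoC (Re p)) by [].
have [I1 _] := Qi_CI nu _ hx; have [I2 _] := Qi_CI (- nu) _ hx.
have I3 := is_RInt_plus (V := R_NormedModule) _ _ _ _ _ _ I1 I2.
have L : Cmod (Mint nu p) <= plus (Re (Qi nu (RtoC (Re p)))) (Re (Qi (- nu) (RtoC (Re p)))).
  apply: (CI_le _ _ _ _ _ _ _ (Mint_CI nu p hp) _ I3); first lra.
  move=> y hy; rewrite Cmod_mult -(Rmult_1_l (plus _ _)); apply: Rmult_le_compat; try exact: Cmod_ge_0.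
    rewrite Cmod_Cexp -exp_0; have : Re (- (p * RtoC y))%C <= 0 by rewrite (_ : Re _ = - (Re p * y)); [nra | rewrite /Re /=; ring].
    case=> [l|->]; [left; exact: exp_increasing | lra].
  apply: Rle_trans (Cmod_triangle _ _) _; rewrite !Qf_mod /plus /= ?Re_Qf_RtoC; lra.
have b1 := hB (RtoC (Re p)) ltac:(change (2 * (x0 / 4) <= Re p); lra); have b2 := hA (RtoC (Re p)) ltac:(change (2 * (x0 / 4) <= Re p); lra).
have c1 := Rle_trans _ _ _ (Rle_abs _) (re_le_Cmod (Qi nu (RtoC (Re p)))).
have c2 := Rle_trans _ _ _ (Rle_abs _) (re_le_Cmod (Qi (- nu) (RtoC (Re p)))).
change (Re (RtoC (Re p))) with (Re p) in b1, b2.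
rewrite (_ : Re p / 2 = Re z / 4) in b1 b2; last by rewrite rp; field.
have m := Cmod_ge_0 (Mint nu p).
have L' : Cmod (Mint nu p) <= Re (Qi nu (RtoC (Re p))) + Re (Qi (- nu) (RtoC (Re p))) by exact: L.
rewrite Rmult_plus_distr_r; lra.
Qed.

Lemma Kf_RtoC_pos nu x : nonint nu -> 0 < x -> 0 < Re (Kf nu (RtoC x)).
Proof.
move=> hn hx; rewrite Kf_Mint // Re_scal -RtoC_mult.
have h2 : 0 < / 2 * x by lra.
apply: Rmult_lt_0_compat; first lra.
apply: RInt_gt_0; first lra.
  move=> y hy; have [r1 [-> h1]] := Qf_RtoC nu (/ 2 * x) y; have [r2 [-> h3]] := Qf_RtoC (- nu) (/ 2 * x) y.
  rewrite -RtoC_mult -RtoC_opp Cexp_RtoC -RtoC_plus -RtoC_mult /=.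
  apply: Rmult_lt_0_compat; first exact: exp_pos.
  have := h1 ltac:(lra); have := h3 ltac:(lra); lra.
move=> y hy.
by have [h _] : Ccont (fun y => Cexp (- (RtoC (/ 2 * x) * RtoC y)) * (Qf nu (RtoC (/ 2 * x)) y + Qf (- nu) (RtoC (/ 2 * x)) y))%C y
  by apply: Ccont_mult; [exact: Ccont_Cexp | apply: Ccont_plus; apply: Ccont_Qf => //; lra].
Qed.

(** * Differential recurrences of K *)

Lemma PS_derive_Ec mu r : nonint mu -> PS_derive (Ec mu) r = / (1 + mu) * Ec (mu + 1) r.
Proof.
move=> h; have np := nonint_1p _ h.
rewrite /PS_derive /Ec poch_S_l fact_simpl mult_INR (_ : 1 + mu + 1 = 1 + (mu + 1)); last by ring.
have h1 := poch_neq0 (1 + (mu + 1)) r (nonint_1p _ (nonint_S _ h)).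
have h2 := nonpole_neq0 _ np; have h3 := INR_fact_neq_0 r; have h4 : INR (S r) <> 0 by apply: not_0_INR.
field; repeat split => //.
Qed.

Lemma CPS_scal c a x : entire a -> CPS (fun n => c * a n) x = (RtoC c * CPS a x)%C.
Proof.
move=> h; apply: CSum_CSeries; apply: CSum_ext (CSum_scal (RtoC c) _ _ (CPS_sum a x h)) => n.
rewrite RtoC_mult; ring.
Qed.

Lemma Gamma_neg_S mu : nonint mu -> Gamma (- mu) = - (1 + mu) * Gamma (- (mu + 1)).
Proof.
move=> h; have np : nonpole (- (mu + 1)) by apply: nonint_nonpole; apply: nonint_opp; exact: nonint_S.
have := Gamma_S _ np; rewrite (_ : - (mu + 1) + 1 = - mu); last by ring.
move=> ->; ring.
Qed.

(** The factor of I_mu in [Lf] changes sign under mu -> mu + 1, which gives [Lf] the recurrence of K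
    instead of that of I; so the branches mu and -mu can be added. *)
Lemma Cder_Lf mu z : nonint mu -> 0 < Re z ->
  Cder (Lf mu) z (RtoC mu * / z * Lf mu z - Lf (mu + 1) z)%C.
Proof.
move=> h hz; have nz := Re_pos_neq0 z hz.
have e1 := entire_Ec _ (nonint_1p _ h); have e2 := entire_Ec _ (nonint_1p _ (nonint_S _ h)).
have K := Cder_scal (RtoC (Gamma (- mu) / 2 * Rpower 2 (- mu))) _ _ _ (Cder_mult _ _ _ _ _ (Cder_Cpower z mu hz)
  (Cder_comp (CPS (Ec mu)) (fun w => RtoC (/ 4) * (w * w))%C z _ _ (Cder_scal (RtoC (/ 4)) _ _ _ (Cder_mult _ _ _ _ _ (Cder_id z) (Cder_id z))) (Cder_CPS _ _ e1))).
apply: (Cder_eq _ _ _ _ _ K) => //.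
rewrite (CPS_ext _ _ _ (fun n => PS_derive_Ec mu n h)) CPS_scal //.
rewrite /Lf (Gamma_neg_S _ h).
have E1 : Cpower z (mu + 1) = (Cpower z mu * z)%C by rewrite Cpower_plus Cpower_1.
have E2 : Cpower z mu = (Cpower z (mu - 1) * z)%C by rewrite -{3}(Cpower_1 z hz) -Cpower_plus; congr Cpower; ring.
rewrite E1 E2.
have -> : Rpower 2 (- (mu + 1)) = Rpower 2 (- mu) * / 2.
  have -> : - (mu + 1) = - mu + - (1) by ring.
  rewrite Rpower_plus (Rpower_Ropp 2 1) Rpower_1 //; lra.
have m1 := nonpole_neq0 _ (nonint_1p _ h).
set P := CPS (Ec mu) _; set Q := CPS (Ec (mu + 1)) _; set G := Gamma _; set r := Rpower 2 _; set w := Cpower z (mu - 1).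
have -> : (RtoC (/ (1 + mu)) * Q * (RtoC (/ 4) * (1 * z + z * 1)) = RtoC (/ (1 + mu) * / 2) * Q * z)%C.
  rewrite !RtoC_mult (_ : / 2 = / 4 * 2); last by field.
  rewrite RtoC_mult; ring.
have -> : RtoC (- (1 + mu) * G / 2 * r) = (RtoC (1 + mu) * RtoC (- (G / 2 * r)))%C by rewrite -RtoC_mult; congr RtoC; field.
have -> : RtoC (G / 2 * (r * / 2)) = (RtoC (G / 2 * r) * RtoC (/ 2))%C by rewrite -RtoC_mult; congr RtoC; field.
rewrite RtoC_mult RtoC_inv // RtoC_opp; field; split; [exact: nz | exact: RtoC_neq0].
Qed.

(** Converts the raised index in the derivative of [Lf (- mu)] into the lowered one that belongs to
    the second branch of [Kf (mu + 1)]. *)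
Lemma Lf_rec mu z : nonint mu -> 0 < Re z ->
  (Lf (mu + 1) z - Lf (mu - 1) z)%C = (RtoC (2 * mu) * / z * Lf mu z)%C.
Proof.
move=> h hz; have nz := Re_pos_neq0 z hz.
set x := (RtoC (/ 4) * (z * z))%C.
have e0 := entire_Ec _ (nonint_1p _ (nonint_P _ h)).
have e1 := entire_Ec _ (nonint_1p _ h); have e2 := entire_Ec _ (nonint_1p _ (nonint_S _ h)).
have m1 := nonpole_neq0 _ (nonint_1p _ h).
have C1 : (RtoC (/ (1 + mu)) * (x * CPS (Ec (mu + 1)) x) = RtoC mu * CPS (Ec (mu - 1)) x - RtoC mu * CPS (Ec mu) x)%C.
  have D : (x * CPS (PS_derive (Ec mu)) x = RtoC (/ (1 + mu)) * (x * CPS (Ec (mu + 1)) x))%C.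
    rewrite (CPS_ext _ _ _ (fun n => PS_derive_Ec mu n h)) CPS_scal //; ring.
  rewrite -D; apply: (CSum_unique _ _ _ (CPS_xderive _ x e1)).
  apply: CSum_ext (CSum_minus _ _ _ _ (CSum_scal (RtoC mu) _ _ (CPS_sum _ x e0)) (CSum_scal (RtoC mu) _ _ (CPS_sum _ x e1))) => n.
  rewrite !Cmult_assoc -!RtoC_mult (_ : forall a b c : C, (a * c - b * c)%C = ((a - b) * c)%C); last by move=> a b c; ring.
  rewrite -RtoC_minus; congr (RtoC _ * _)%C.
  rewrite /Ec (_ : 1 + (mu - 1) = mu); last by ring.
  have p1 := poch_neq0 _ n (nonint_nonpole _ h); have f0 := INR_fact_neq_0 n.
  have E : mu * poch (1 + mu) n = poch mu n * (mu + INR n) by rewrite -poch_S_r poch_S_l (Rplus_comm mu 1).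
  have n1 := nonint_nonpole _ h n.
  have -> : poch (1 + mu) n = poch mu n * (mu + INR n) / mu by rewrite -E; field.
  field; repeat split => //.
have Hm : Gamma (- (mu - 1)) = - mu * Gamma (- mu).
  rewrite (Gamma_neg_S _ (nonint_P _ h)).
  have -> : mu - 1 + 1 = mu by ring.
  ring.
have Hp : Gamma (- (mu + 1)) = - / (1 + mu) * Gamma (- mu) by rewrite (Gamma_neg_S _ h); field.
rewrite /Lf Hm Hp -/x.
have E1 : Cpower z (mu + 1) = (Cpower z (mu - 1) * (z * z))%C.
  have -> : mu + 1 = mu - 1 + (1 + 1) by ring.
  by rewrite Cpower_plus Cpower_plus Cpower_1.
have E2 : Cpower z mu = (Cpower z (mu - 1) * z)%C by rewrite -{3}(Cpower_1 z hz) -Cpower_plus; congr Cpower; ring.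
have R1 : Rpower 2 (- (mu + 1)) = Rpower 2 (- mu) * / 2.
  have -> : - (mu + 1) = - mu + - (1) by ring.
  rewrite Rpower_plus (Rpower_Ropp 2 1) Rpower_1 //; lra.
have R2 : Rpower 2 (- (mu - 1)) = Rpower 2 (- mu) * 2.
  have -> : - (mu - 1) = - mu + 1 by ring.
  rewrite Rpower_plus Rpower_1 //; lra.
rewrite E1 E2 R1 R2.
set Q := CPS (Ec (mu + 1)) x in C1 *; set P := CPS (Ec mu) x in C1 *; set Q0 := CPS (Ec (mu - 1)) x in C1 *.
set G := Gamma _; set r := Rpower 2 _; set w := Cpower z (mu - 1).
have zx : (z * z)%C = (RtoC 4 * x)%C.
  by rewrite /x Cmult_assoc -RtoC_mult Rinv_r; [ring | lra].
transitivity (RtoC (- (G * r)) * w * (RtoC (/ (1 + mu)) * (x * Q)) + RtoC (G * r) * w * (RtoC mu * Q0))%C.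
  rewrite zx.
  have -> : RtoC (- / (1 + mu) * G / 2 * (r * / 2)) = (RtoC (/ (1 + mu)) * RtoC (- (G * r)) * RtoC (/ 4))%C by rewrite -!RtoC_mult; congr RtoC; field.
  have -> : RtoC (- mu * G / 2 * (r * 2)) = (- (RtoC (G * r) * RtoC mu))%C by rewrite -RtoC_mult -RtoC_opp; congr RtoC; field.
  have E4 : (RtoC (/ 4) * RtoC 4)%C = 1%C by rewrite -RtoC_mult Rinv_l //; lra.
  transitivity (RtoC (/ (1 + mu)) * RtoC (- (G * r)) * w * x * Q * (RtoC (/ 4) * RtoC 4) + RtoC (G * r) * RtoC mu * w * Q0)%C; first ring.
  rewrite E4; ring.
rewrite C1 RtoC_opp.
have -> : RtoC (G / 2 * r) = (RtoC (G * r) * RtoC (/ 2))%C by rewrite -RtoC_mult; congr RtoC; field.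
have -> : RtoC (2 * mu) = (RtoC 2 * RtoC mu)%C by rewrite RtoC_mult.
rewrite RtoC_inv; last lra.
field; repeat split; first [exact: nz | apply: RtoC_neq0; lra].
Qed.

Lemma Kf_even mu z : Kf (- mu) z = Kf mu z.
Proof. by rewrite /Kf Ropp_involutive Cplus_comm. Qed.

Lemma Cder_Kf mu z : nonint mu -> 0 < Re z ->
  Cder (Kf mu) z (RtoC mu * / z * Kf mu z - Kf (mu + 1) z)%C.
Proof.
move=> h hz.
apply: (Cder_eq _ _ _ _ _ (Cder_plus _ _ _ _ _ (Cder_Lf mu z h hz) (Cder_Lf (- mu) z (nonint_opp _ h) hz))) => //.
have := Lf_rec (- mu) z (nonint_opp _ h) hz => E.
rewrite /Kf (_ : - (mu + 1) = - mu - 1); last by ring.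
have -> : Lf (- mu + 1) z = (RtoC (2 * - mu) * / z * Lf (- mu) z + Lf (- mu - 1) z)%C by rewrite -E; ring.
rewrite RtoC_mult !RtoC_opp; ring.
Qed.

Lemma Gamma_poch mu n : nonint mu -> Gamma (mu + INR n + 1) = Gamma (1 + mu) * poch (1 + mu) n.
Proof.
move=> h; elim: n => [|n IH]; first by rewrite /= Rmult_1_r Rplus_0_r Rplus_comm.
rewrite poch_S_r -Rmult_assoc -IH S_INR (_ : mu + (INR n + 1) + 1 = (mu + INR n + 1) + 1); last by ring.
rewrite Gamma_S; first by ring.
apply: nonint_nonpole; apply: nonint_S; exact: nonint_plus_nat.
Qed.

Lemma BesselI_Ec mu z : nonint mu -> BesselI mu z = (Cpower (z / 2) mu * (RtoC (/ Gamma (1 + mu)) * CPS (Ec mu) (z ^ 2 / 4)))%C.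
Proof.
move=> h; rewrite /BesselI; congr (_ * _)%C.
have g0 := Gamma_neq0 _ (nonint_1p _ h).
apply: CSum_CSeries.
apply: CSum_ext (CSum_scal (RtoC (/ Gamma (1 + mu))) _ _ (CPS_sum _ (z ^ 2 / 4)%C (entire_Ec _ (nonint_1p _ h)))) => n.
have p0 := poch_neq0 _ n (nonint_1p _ h); have f0 := INR_fact_neq_0 n.
rewrite Gamma_poch // /Ec /Cdiv -(RtoC_inv (INR (fact n) * _)); last first.
  apply: Rmult_integral_contrapositive_currified => //; exact: Rmult_integral_contrapositive_currified.
rewrite (_ : / (INR (fact n) * (Gamma (1 + mu) * poch (1 + mu) n)) = / Gamma (1 + mu) * / (poch (1 + mu) n * INR (fact n))); last by field.
rewrite RtoC_mult; ring.
Qed.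

Lemma BesselK_Kf nu z : nonint nu -> 0 < Re z -> BesselK nu z = Kf nu z.
Proof.
move=> h hz; have h' := nonint_opp _ h.
rewrite /BesselK !BesselI_Ec // /Kf !Lf_half // Ropp_involutive.
have -> : (z / 2)%C = (RtoC (/ 2) * z)%C by rewrite RtoC_inv; [rewrite /Cdiv; ring | lra].
have -> : (z ^ 2 / 4)%C = ((RtoC (/ 2) * z) * (RtoC (/ 2) * z))%C.
  rewrite (_ : (RtoC (/ 2) * z * (RtoC (/ 2) * z))%C = (RtoC (/ 2 * / 2) * (z * z))%C); last by rewrite RtoC_mult; ring.
  rewrite (_ : / 2 * / 2 = / 4); last by field.
  rewrite RtoC_inv; [rewrite /Cdiv /=; ring | lra].
set p := (RtoC (/ 2) * z)%C.
have s0 := sin_nonint _ h; rewrite (Rmult_comm nu).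
have R1 := Gamma_reflect _ h; have R2 := Gamma_reflect _ h'.
rewrite (_ : 1 - - nu = 1 + nu) in R2; last by ring.
rewrite (_ : PI * - nu = - (PI * nu)) ?sin_neg in R2; last by ring.
have g1 := Gamma_neq0 _ (nonint_1p _ h); have g2 := Gamma_neq0 _ (nonint_1p _ h').
rewrite (_ : 1 - nu = 1 + - nu) in R1; last by ring.
have E1 : Gamma nu / 2 = PI / 2 * / Gamma (1 + - nu) * / sin (PI * nu).
  apply: (Rmult_eq_reg_r (Gamma (1 + - nu))) => //.
  transitivity (Gamma nu * Gamma (1 + - nu) / 2); first by field.
  rewrite R1; field; split => //.
have E2 : Gamma (- nu) / 2 = - (PI / 2 * / Gamma (1 + nu) * / sin (PI * nu)).
  apply: (Rmult_eq_reg_r (Gamma (1 + nu))) => //.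
  transitivity (Gamma (- nu) * Gamma (1 + nu) / 2); first by field.
  rewrite R2; field; split => //.
rewrite E1 E2 RtoC_opp !RtoC_mult (RtoC_inv (sin _)) // /Cdiv; ring.
Qed.

(** Orders at 0 and at infinity differ, so symbols are estimated on two regions. They overlap for M
    = 2, so that a chain of steps of total length at most 1 lies in one of them. *)
Definition Near (k M : R) (z : C) : Prop := Sect k z /\ Cmod z <= M.
Definition Far (k : R) (z : C) : Prop := Sect k z /\ 1 <= Cmod z.

Lemma Near_pos k M z : Near k M z -> 0 < Re z.
Proof. by case=> [[]]. Qed.
Lemma Far_pos k z : Far k z -> 0 < Re z.
Proof. by case=> [[]]. Qed.
Lemma Near_mod k M z : Near k M z -> 0 < Cmod z.
Proof. by move=> /Near_pos; exact: Re_pos_Cmod. Qed.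
Lemma Far_mod k z : Far k z -> 0 < Cmod z.
Proof. by move=> /Far_pos; exact: Re_pos_Cmod. Qed.

Lemma Rpower_le1 x s : 1 <= x -> s <= 0 -> Rpower x s <= 1.
Proof.
move=> hx hs; rewrite -(Rpower_O x); last lra.
by apply: Rle_Rpower.
Qed.

Lemma Rpower_le_M x M s : 0 < x <= M -> 0 <= s -> Rpower x s <= Rpower M s.
Proof. by move=> hx hs; apply: Rle_Rpower_l. Qed.

Lemma Sm_near_weaken k M n al be f : be <= al -> Sm (Near k M) n al f -> Sm (Near k M) n be f.
Proof.
move=> h; apply: (Sm_weaken _ _ _ _ (Rpower M (al - be))).
- exact: Near_mod.
- left; exact: exp_pos.
- move=> z hz; apply: Rpower_le_M; last lra.
  split; [exact: (Near_mod _ _ _ hz) | by case: hz].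
Qed.

Lemma Sm_far_weaken k n al be f : al <= be -> Sm (Far k) n al f -> Sm (Far k) n be f.
Proof.
move=> h; apply: (Sm_weaken _ _ _ _ 1).
- exact: Far_mod.
- lra.
- by move=> z [_ hz]; apply: Rpower_le1 => //; lra.
Qed.

Lemma Sm_inv1_near k M n : 0 < k <= 1 -> Sm (Near k M) n 0 (fun z => / (1 + z * z))%C.
Proof.
move=> hk; apply: (Sm_inv1 _ _ k) => //; first by move=> z [].
- exists 1; split; first lra.
  move=> z hz; rewrite Ropp_0 Rpower_O; last exact: Near_mod hz.
  have := pow2_ge_0 (Cmod z); lra.
- exists (Rpower M (0 + 2)); split; first by left; exact: exp_pos.
  move=> z hz; apply: Rpower_le_M; last lra.
  split; [exact: (Near_mod _ _ _ hz) | by case: hz].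
Qed.

Lemma Sm_inv1_far k n : 0 < k <= 1 -> Sm (Far k) n (-2) (fun z => / (1 + z * z))%C.
Proof.
move=> hk; apply: (Sm_inv1 _ _ k) => //; first by move=> z [].
- exists 1; split; first lra.
  move=> z hz; have -> : - (-2) = INR 2 by rewrite /=; ring.
  rewrite Rpower_pow; last exact: Far_mod hz.
  lra.
- exists 1; split; first lra.
  move=> z [_ hz]; apply: Rpower_le1 => //; lra.
Qed.

(** Exponential decay gives any order al; derivatives lead to K with index mu and mu + 1, whence an
    induction over all mu and al at once. *)
Lemma Sm_Kf_far k b n mu al : 0 < k <= 1 -> 0 < b -> nonint mu ->
  Sm (Far k) n al (fun z => Kf mu (RtoC b * z)%C).
Proof.
move=> hk hb; elim: n mu al => [|n IH] mu al h.
  all: have bd : exists B, 0 <= B /\ forall z, Far k z -> Cmod (Kf mu (RtoC b * z)%C) <= B * Rpower (Cmod z) al.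
  1,3: have bk : 0 < b * k by apply: Rmult_lt_0_compat; lra.
  1,2: have [B [B0 hB]] := Kf_decay mu (b * k) h bk.
  1,2: have [A [A0 hA]] := Rpower_exp_bound (b * k / 4) (- al) ltac:(lra).
  1,2: exists (B * A); split; first by nra.
  1,2: move=> z [[h1 h2] h3]; have hr : b * k <= Re (RtoC b * z)%C by rewrite Re_scal; nra.
  1,2: apply: Rle_trans (hB _ hr) _; rewrite Re_scal Rmult_assoc; apply: Rmult_le_compat_l => //.
  1,2: have := hA (Cmod z) h3 => a1.
  1,2: have R0 : 0 < Rpower (Cmod z) al by exact: exp_pos.
  1,2: have E : Rpower (Cmod z) (- al) * Rpower (Cmod z) al = 1 by rewrite -Rpower_plus Rplus_opp_l Rpower_O //; lra.
  1,2: have a2 : Rpower (Cmod z) (- al) * exp (- (b * k / 4 * Cmod z)) <= A.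
  1,3: apply: Rle_trans a1 _; rewrite -{2}(Rmult_1_r A); apply: Rmult_le_compat_l => //.
  1,2: rewrite -Rinv_1; apply: Rinv_le_contravar; [lra | apply: pow_R1_Rle; lra].
  1,2: have a3 : exp (- (b * Re z / 4)) <= exp (- (b * k / 4 * Cmod z)).
  1,3: have : - (b * Re z / 4) <= - (b * k / 4 * Cmod z) by nra.
  1,2: by case=> [l|->]; [left; exact: exp_increasing | lra].
  1,2: apply: Rle_trans a3 _; rewrite -(Rmult_1_l (exp _)) -E.
  1,2: have := Rmult_le_compat_r _ _ _ (Rlt_le _ _ R0) a2; lra.
by split.
apply: (Sm_S _ _ _ _ (fun z => RtoC mu * (Cpower z (-1) * Kf mu (RtoC b * z)) + - RtoC b * Kf (mu + 1) (RtoC b * z))%C) => //.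
  move=> z hz; have hr := Far_pos _ _ hz; have hr' : 0 < Re (RtoC b * z)%C by rewrite Re_scal; nra.
  have nz := Re_pos_neq0 z hr.
  apply: (Cder_eq _ _ _ _ _ (Cder_comp (Kf mu) (fun w => RtoC b * w)%C z _ _ (Cder_scal (RtoC b) _ _ _ (Cder_id z)) (Cder_Kf _ _ h hr'))) => //.
  rewrite (_ : -1 = - (1)) // Cpower_opp Cpower_1 //; field; split; [exact: nz | apply: RtoC_neq0; lra].
apply: Sm_plus; apply: Sm_scal; try exact: Far_mod.
  apply: (Sm_eq _ _ (-1 + al)); first ring.
  apply: Sm_mult; [apply: Sm_power; exact: Far_pos | exact: IH].
apply: IH; exact: nonint_S.
Qed.

(** * Euler's transformation of alternating sums *)

Fixpoint Dr (n : nat) (f : nat -> R) : nat -> R :=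
  match n with O => f | S m => Dr m (fun k => f k - f (S k)) end.
Fixpoint Dc (n : nat) (f : nat -> C) : nat -> C :=
  match n with O => f | S m => Dc m (fun k => f k - f (S k))%C end.

Lemma Dr_ext n f g : (forall k, f k = g k) -> forall k, Dr n f k = Dr n g k.
Proof. elim: n f g => [|n IH] f g h k //=; apply: IH => j; by rewrite !h. Qed.

Lemma Dc_ext n f g : (forall k, f k = g k) -> forall k, Dc n f k = Dc n g k.
Proof. elim: n f g => [|n IH] f g h k //=; apply: IH => j; by rewrite !h. Qed.

Lemma Dr_add n m f k : Dr (n + m) f k = Dr m (Dr n f) k.
Proof. elim: n f k => [|n IH] f k //=; exact: IH. Qed.

Lemma Dr_S n f k : Dr (S n) f k = Dr n f k - Dr n f (S k).
Proof.
elim: n f k => [|n IH] f k //.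
exact: (IH (fun k => f k - f (S k))).
Qed.

Lemma Dc_RtoC n f k : Dc n (fun k => RtoC (f k)) k = RtoC (Dr n f k).
Proof.
elim: n f k => [|n IH] f k //=; rewrite -IH; apply: Dc_ext => j; by rewrite RtoC_minus.
Qed.

Lemma Dc_Dn n h F z k : Dc n (fun k => F (z + RtoC (INR k) * h)%C) k = Dn n h F (z + RtoC (INR k) * h)%C.
Proof.
elim: n F k => [|n IH] F k //=; rewrite -(IH (Dl h F)); apply: Dc_ext => j.
rewrite /Dl; congr (_ - F _)%C; rewrite -/(INR (S j)) S_INR RtoC_plus; ring.
Qed.

Lemma Dc_plus n f g k : Dc n (fun k => f k + g k)%C k = (Dc n f k + Dc n g k)%C.
Proof. elim: n f g k => [|n IH] f g k //=; rewrite -IH; apply: Dc_ext => j; ring. Qed.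

Lemma Dc_scal n c f k : Dc n (fun k => c * f k)%C k = (c * Dc n f k)%C.
Proof. elim: n f k => [|n IH] f k //=; rewrite -IH; apply: Dc_ext => j; ring. Qed.

(* The value of sum_k (-1)^k f k after N steps of Euler's transformation: it exists for f k = k^la with la + 1 < N, even where the sum itself diverges. *)
Definition altN (N : nat) (f : nat -> C) (l : C) : Prop := exists m,
  CSum (fun k => RtoC ((-1) ^ k) * Dc N f k)%C m /\
  l = (csum (fun n => RtoC (/ 2 ^ S n) * Dc n f 0%nat) N + RtoC (/ 2 ^ N) * m)%C.

Lemma altN_ext N f g l : (forall k, f k = g k) -> altN N f l -> altN N g l.
Proof.
move=> E [m [h1 h2]]; exists m; split.
  by apply: CSum_ext h1 => k; rewrite (Dc_ext N f g).
by rewrite h2; congr (_ + _)%C; apply: csum_ext => n _; rewrite (Dc_ext n f g).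
Qed.

Lemma altN_plus N f g l m : altN N f l -> altN N g m -> altN N (fun k => f k + g k)%C (l + m)%C.
Proof.
move=> [a [h1 h2]] [b [h3 h4]]; exists (a + b)%C; split.
  by apply: CSum_ext (CSum_plus _ _ _ _ h1 h3) => k; rewrite Dc_plus; ring.
have E : csum (fun n => RtoC (/ 2 ^ S n) * Dc n (fun k => f k + g k) 0%nat)%C N =
  (csum (fun n => RtoC (/ 2 ^ S n) * Dc n f 0%nat) N + csum (fun n => RtoC (/ 2 ^ S n) * Dc n g 0%nat) N)%C.
  rewrite -csum_plus; apply: csum_ext => k _; rewrite (Dc_plus k f g); ring.
rewrite h2 h4 E; ring.
Qed.

Lemma altN_scal N c f l : altN N f l -> altN N (fun k => c * f k)%C (c * l)%C.
Proof.
move=> [a [h1 h2]]; exists (c * a)%C; split.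
  by apply: CSum_ext (CSum_scal c _ _ h1) => k; rewrite Dc_scal; ring.
have E : csum (fun n => RtoC (/ 2 ^ S n) * Dc n (fun k => c * f k) 0%nat)%C N =
  (c * csum (fun n => RtoC (/ 2 ^ S n) * Dc n f 0%nat) N)%C.
  rewrite -csum_scal; apply: csum_ext => k _; rewrite (Dc_scal k c f); ring.
rewrite h2 E; ring.
Qed.

Lemma altN_unique N f l m : altN N f l -> altN N f m -> l = m.
Proof. by move=> [a [h1 ->]] [b [h2 ->]]; rewrite (CSum_unique _ _ _ h1 h2). Qed.

Lemma pow_m1_S k : RtoC ((-1) ^ S k) = (- RtoC ((-1) ^ k))%C.
Proof. rewrite -RtoC_opp; congr RtoC; rewrite /=; ring. Qed.

Lemma csum_S_l u n : csum u (S n) = (u O + csum (fun k => u (S k)) n)%C.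
Proof. elim: n => [|n IH]; first by rewrite /=; ring. rewrite [csum u _]/= -/(csum u (S n)) IH /=; ring. Qed.

(** Adding a convergent alternating series to its shifted copy gives 2 l - f 0 as the alternating
    sum of the first differences: every Euler step preserves the value. *)
Lemma altN_CSum N f l : CSum (fun k => RtoC ((-1) ^ k) * f k)%C l -> altN N f l.
Proof.
elim: N f l => [|N IH] f l h.
  by exists l; split => //=; rewrite Rinv_1; ring.
have h2 : CSum (fun k => RtoC ((-1) ^ k) * (f k - f (S k)))%C (RtoC 2 * l - f O)%C.
  have := CSum_plus _ _ _ _ h (CSum_shift _ _ h).
  rewrite (_ : (l + (l - RtoC ((-1) ^ 0) * f 0%nat) = RtoC 2 * l - f O)%C); last by rewrite /= RtoC_plus; ring.
  apply: CSum_ext => k; rewrite pow_m1_S; ring.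
have [m [h3 h4]] := IH _ _ h2; exists m; split => //.
have E : l = (RtoC (/ 2) * (f O + (RtoC 2 * l - f O)))%C.
  transitivity (RtoC (/ 2) * RtoC 2 * l)%C; last by ring.
  rewrite -RtoC_mult Rinv_l; [ring | lra].
rewrite E h4 csum_S_l.
rewrite (_ : csum (fun k => RtoC (/ 2 ^ S (S k)) * Dc (S k) f 0%nat)%C N = (RtoC (/ 2) * csum (fun n => RtoC (/ 2 ^ S n) * Dc n (fun k => f k - f (S k)) 0%nat) N)%C); last first.
  rewrite -csum_scal; apply: csum_ext => k _.
  by rewrite -(tech_pow_Rmult _ (S k)) Rinv_mult RtoC_mult /=; ring.
rewrite -(tech_pow_Rmult _ N) Rinv_mult RtoC_mult [2 ^ 1]/= Rmult_1_r [Dc 0 f 0%nat]/=; ring.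
Qed.

Lemma rsum_S_l u n : rsum u (S n) = u O + rsum (fun k => u (S k)) n.
Proof. elim: n => [|n IH]; first by rewrite /=; ring. rewrite [rsum u _]/= -/(rsum u (S n)) IH /=; ring. Qed.

Lemma rsum_plus u v n : rsum (fun k => u k + v k) n = rsum u n + rsum v n.
Proof. elim: n => /= [|n ->]; ring. Qed.

Lemma rsum_ext u v n : (forall k, (k < n)%nat -> u k = v k) -> rsum u n = rsum v n.
Proof. elim: n => //= n IH h; rewrite IH ?h //; by move=> k hk; apply: h; lia. Qed.

Lemma Dr_binomial n f : Dr n f 0%nat = sum_n (fun k => (-1) ^ k * Binomial.C n k * f k) n.
Proof.
rewrite -rsum_sum_n; elim: n f => [|n IH] f.
  by rewrite /= /Binomial.C /=; field.
have C0 : forall m, Binomial.C m 0 = 1.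
  move=> m; rewrite /Binomial.C Nat.sub_0_r /=; field; exact: INR_fact_neq_0.
have Cn : forall m, Binomial.C m m = 1.
  move=> m; rewrite /Binomial.C Nat.sub_diag /=; field; exact: INR_fact_neq_0.
rewrite [LHS]/= IH (rsum_S_l _ (S n)).
rewrite (rsum_ext _ (fun k => (-1) ^ k * Binomial.C n k * f k + (-1) * ((-1) ^ k * Binomial.C n k * f (S k)))); last first.
  move=> k _; ring.
rewrite rsum_plus rsum_scal {1}rsum_S_l !C0 /= Cn -!/(pow _ _).
rewrite Cn (_ : rsum (fun k => -1 * (-1) ^ k * Binomial.C (S n) (S k) * f (S k)) n =
   rsum (fun k => -1 * (-1) ^ k * Binomial.C n (S k) * f (S k) + (-1) * ((-1) ^ k * Binomial.C n k * f (S k))) n); last first.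
  apply: rsum_ext => k hk; rewrite -pascal //; ring.
rewrite rsum_plus rsum_scal; ring.
Qed.

(* F j is (-1)^j times the j-th derivative of F 0: complete monotonicity from order J on. *)
Definition CM (J : nat) (F : nat -> R -> R) : Prop := forall j x, 0 < x ->
  is_derive (F j) x (- F (S j) x) /\ ((J <= j)%nat -> 0 <= F j x).

Lemma CM_decr J F j x : CM J F -> (J <= S j)%nat -> 0 < x -> F j (x + 1) <= F j x.
Proof.
move=> h hj hx.
have := MVT_le (fun t => - F j t) (fun t => F (S j) t) x (x + 1) ltac:(lra) => H.
suff : - F j x <= - F j (x + 1) by lra.
apply: H => t ht.
  have [d _] := h j t ltac:(lra).
  by have := is_derive_opp (V := R_NormedModule) _ _ _ d; rewrite /opp /= Ropp_involutive.
by have [_ p] := h (S j) t ltac:(lra); exact: p.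
Qed.

(** The sign of a difference is that of the next derivative, so positivity starts one order earlier
    after differencing. *)
Lemma CM_D J F : CM J F -> CM (J - 1) (fun j x => F j x - F j (x + 1)).
Proof.
move=> h j x hx; split.
  have [d1 _] := h j x hx; have [d2 _] := h j (x + 1) ltac:(lra).
  have H2 : is_derive (fun y : R => y + 1) x 1 by auto_derive.
  have d3 := is_derive_comp (F j) (fun y => y + 1) x _ _ d2 H2.
  have := is_derive_minus (V := R_NormedModule) _ _ _ _ _ d1 d3.
  by rewrite (_ : minus _ _ = - (F (S j) x - F (S j) (x + 1))) // /minus /plus /opp /scal /= /mult /=; ring.
by move=> hj; have := CM_decr J F j x h ltac:(lia) hx; lra.
Qed.

Lemma CM_Dr n J F k : CM J F -> (J <= n)%nat -> 0 <= Dr n (fun k => F O (INR (S k))) k.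
Proof.
elim: n J F => [|n IH] J F h hJ.
  have [_ p] := h O (INR (S k)) ltac:(apply: lt_0_INR; lia); by apply: p; lia.
have := IH _ _ (CM_D _ _ h) ltac:(lia) => H; apply: Rle_trans H _; right => /=.
by apply: Dr_ext => j; rewrite -/(INR (S j)) -/(INR (S (S j))) (S_INR (S j)).
Qed.

(** The product of i - la for i < j, that is, the coefficient of x^(la - j) in (-1)^j times the j-th
    derivative of x^la. *)
Fixpoint fallc (la : R) (j : nat) : R :=
  match j with O => 1 | S i => fallc la i * (INR i - la) end.

Lemma is_derive_Rpower s x : 0 < x -> is_derive (fun t => Rpower t s) x (s * Rpower x (s - 1)).
Proof.
move=> hx; have := Cder_curve _ (fun t => t) x _ 1 (Cder_Cpower (RtoC x) s hx) (is_derive_id x) => -[h _].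
apply: (is_derive_ext_loc (fun t => Re (Cpower (RtoC t) s))).
  apply: (filter_imp (fun t => 0 < t)); last exact: (open_gt 0 x hx).
  by move=> t ht; rewrite Cpower_RtoC.
by rewrite Cpower_RtoC // Cmult_1_r -RtoC_mult in h.
Qed.

(** From i = N on all factors i - la are positive, so the sign reached at N persists. *)
Lemma fallc_sign la N : la < INR N -> exists sg, (sg = 1 \/ sg = -1) /\ forall j, (N <= j)%nat -> 0 <= sg * fallc la j.
Proof.
move=> h; have [sg [h1 h2]] : exists sg, (sg = 1 \/ sg = -1) /\ 0 <= sg * fallc la N.
  case: (Rle_dec 0 (fallc la N)) => c; [exists 1 | exists (-1)]; split; try lra; auto.
exists sg; split => // j; elim=> // i hi IH /=.
rewrite -Rmult_assoc; apply: Rmult_le_pos => //.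
have : INR N <= INR i by apply: le_INR.
lra.
Qed.

Lemma CM_power la N sg : (forall j, (N <= j)%nat -> 0 <= sg * fallc la j) ->
  CM N (fun j x => sg * fallc la j * Rpower x (la - INR j)).
Proof.
move=> hs j x hx; split; last by move=> hj; apply: Rmult_le_pos; [exact: hs | left; exact: exp_pos].
have := is_derive_scal _ _ (sg * fallc la j) _ (is_derive_Rpower (la - INR j) x hx).
rewrite (_ : - _ = sg * fallc la j * ((la - INR j) * Rpower x (la - INR j - 1))) //.
rewrite [fallc la (S j)]/= S_INR (_ : la - (INR j + 1) = la - INR j - 1); ring.
Qed.

Lemma Dr_scal n c f k : Dr n (fun k => c * f k) k = c * Dr n f k.
Proof. elim: n f k => [|n IH] f k //=; rewrite -IH; apply: Dr_ext => j; ring. Qed.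

Lemma power_Dr_sign la N : la < INR N -> exists sg, (sg = 1 \/ sg = -1) /\
  forall n k, (N <= n)%nat -> 0 <= sg * Dr n (fun k => Rpower (INR (S k)) la) k.
Proof.
move=> h; have [sg [h1 h2]] := fallc_sign _ _ h; exists sg; split => // n k hn.
rewrite -Dr_scal; have := CM_Dr n N _ k (CM_power _ _ _ h2) hn => H; apply: Rle_trans H _; right.
by apply: Dr_ext => j; rewrite [fallc la 0]/= [INR 0]/= Rminus_0_r Rmult_1_r.
Qed.

(** The symbol estimate for z^la on [Sect 1], applied with step 1 from the starting point k + 1. *)
Lemma power_Dr_bound la N : la <= INR N -> exists B, 0 <= B /\ forall k,
  Rabs (Dr N (fun k => Rpower (INR (S k)) la) k) <= B * Rpower (INR (S k)) (la - INR N).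
Proof.
move=> h; have posR : forall z, Sect 1 z -> 0 < Re z by move=> z [].
have [B [B0 hB]] := Sm_Dn _ _ _ _ (Sm_power (Sect 1) N la posR) h.
exists B; split => // k.
have k0 : 0 < INR (S k) by apply: lt_0_INR; lia.
have H := hB 1%C (RtoC (INR (S k))) (INR (S k)) k0.
have E : forall t, (RtoC (INR (S k)) + RtoC t * 1)%C = RtoC (INR (S k) + t) by move=> t; rewrite RtoC_plus; ring.
have := H _; rewrite Cmod_1 pow1 Rmult_1_l => H2.
have E2 : Dn N 1 (fun z => Cpower z la) (RtoC (INR (S k))) = RtoC (Dr N (fun k => Rpower (INR (S k)) la) k).
  rewrite -Dc_RtoC; have := Dc_Dn N 1%C (fun z => Cpower z la) 1%C k.
  rewrite (_ : (1 + RtoC (INR k) * 1)%C = RtoC (INR (S k))); last by rewrite S_INR RtoC_plus; ring.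
  move=> <-; apply: Dc_ext => j; rewrite (_ : (1 + RtoC (INR j) * 1)%C = RtoC (INR (S j))); last by rewrite S_INR RtoC_plus; ring.
  by rewrite Cpower_RtoC //; apply: lt_0_INR; lia.
rewrite E2 Cmod_R in H2; apply: H2 => t ht; rewrite E Cmod_R Rabs_pos_eq; last lra.
split; last lra.
split; first by change (0 < INR (S k) + t); lra.
rewrite Cmod_R Rabs_pos_eq; last lra.
by change (1 * (INR (S k) + t) <= INR (S k) + t); lra.
Qed.

Lemma ex_series_bounded (u : nat -> R) B : (forall k, 0 <= u k) -> (forall n, sum_n u n <= B) -> ex_series u.
Proof.
move=> pos hb; have [l hl] : ex_finite_lim_seq (sum_n u).
  apply: (ex_finite_lim_seq_incr _ B) => // n; rewrite sum_SnR; have := pos (S n); lra.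
by exists l.
Qed.

Lemma ex_series_Rpower s : s < -1 -> ex_series (fun k => Rpower (INR (S k)) s).
Proof.
move=> hs; have s1 : s + 1 < 0 by lra.
apply/ex_series_incr_1.
pose G t := Rpower t (s + 1) / (s + 1).
apply: (ex_series_bounded _ (- G 1)); first by move=> k; left; exact: exp_pos.
have step : forall k, Rpower (INR (S (S k))) s <= G (INR (S (S k))) - G (INR (S k)).
  move=> k; have k0 : 0 < INR (S k) by apply: lt_0_INR; lia.
  rewrite (S_INR (S k)); set x := INR (S k) in k0 *.
  have := MVT_le (fun t => G t - Rpower (x + 1) s * t) (fun t => Rpower t s - Rpower (x + 1) s) x (x + 1) ltac:(lra) => H.
  have : G x - Rpower (x + 1) s * x <= G (x + 1) - Rpower (x + 1) s * (x + 1); last lra.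
  apply: H => t ht.
    apply: (is_derive_minus (V := R_NormedModule) G); last by auto_derive => //; ring.
    have := is_derive_scal _ _ (/ (s + 1)) _ (is_derive_Rpower (s + 1) t ltac:(lra)).
    rewrite (_ : / (s + 1) * ((s + 1) * Rpower t (s + 1 - 1)) = Rpower t s).
      by apply: is_derive_ext => u; rewrite /G Rmult_comm.
    rewrite (_ : s + 1 - 1 = s); [field; lra | ring].
  have := Rpower_le_base t (x + 1) s ltac:(lra) ltac:(lra); lra.
have neg : forall t, G t <= 0.
  move=> t; have r : 0 < Rpower t (s + 1) by exact: exp_pos.
  have : / (s + 1) < 0 by apply: Rinv_lt_0_compat.
  rewrite /G /Rdiv; nra.
move=> n; have : sum_n (fun k => Rpower (INR (S (S k))) s) n <= G (INR (S (S n))) - G (INR 1).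
  elim: n => [|n IH]; first by rewrite sum_O; exact: (step O).
  rewrite sum_SnR; have := step (S n); lra.
have E1 : INR 1 = 1 by [].
rewrite E1; have := neg (INR (S (S n))); lra.
Qed.

Lemma half_series : is_series (fun m => / 2 ^ S m) 1.
Proof.
have := is_series_geom (1/2) ltac:(rewrite Rabs_pos_eq; lra) => h.
have := is_series_scal (1/2) _ _ h; rewrite (_ : scal (1/2) (/ (1 - 1/2)) = 1); last by rewrite /scal /= /mult /=; field.
apply: is_series_ext => n; rewrite /scal /= /mult /= (_ : 1 / 2 = / 2) ?pow_inv ?Rinv_mult //; field.
Qed.

(** Let e K be the transformed value of the series started at K. Signs of the differences give |e K|
    <= |phi K|, and telescoping gives e K + e (K + 1) = phi K. Hence the alternating partial sums
    are e 0 up to a term bounded by |phi|, which tends to 0. *)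
Lemma euler_transform (phi : nat -> R) sg : (sg = 1 \/ sg = -1) ->
  (forall n k, 0 <= sg * Dr n phi k) -> is_lim_seq phi 0 ->
  exists e, is_series (fun m => / 2 ^ S m * Dr m phi 0%nat) e /\ is_series (fun k => (-1) ^ k * phi k) e.
Proof.
move=> hsg pos lim.
have bd : forall m k, Rabs (Dr m phi k) <= Rabs (phi k).
  move=> m k; have A : forall m, Rabs (Dr m phi k) = sg * Dr m phi k.
    move=> n; have p := pos n k; rewrite -(Rabs_pos_eq _ p) Rabs_mult.
    by rewrite (_ : Rabs sg = 1) ?Rmult_1_l //; case: hsg => ->; rewrite ?Rabs_Ropp Rabs_R1.
  rewrite A (A O); elim: m => [|m IH]; first lra.
  rewrite Dr_S; have := pos m (S k); lra.
have conv : forall K, ex_series (fun m => / 2 ^ S m * Dr m phi K).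
  move=> K; apply: (ex_series_dominated _ (fun m => Rabs (phi K) * / 2 ^ S m)); last first.
    by exists (Rabs (phi K) * 1); apply: (is_series_scal (Rabs (phi K)) _ _ half_series).
  move=> m; rewrite Rabs_mult Rmult_comm (Rabs_pos_eq (/ _)); last by left; apply: Rinv_0_lt_compat; apply: pow_lt; lra.
  apply: Rmult_le_compat_r => //; left; apply: Rinv_0_lt_compat; apply: pow_lt; lra.
pose e K := Series (fun m => / 2 ^ S m * Dr m phi K).
have he : forall K, is_series (fun m => / 2 ^ S m * Dr m phi K) (e K) by move=> K; exact: Series_correct.
have be : forall K, Rabs (e K) <= Rabs (phi K).
  move=> K; have S1 := is_series_scal (Rabs (phi K)) _ _ half_series.
  have dom : forall m, Rabs (/ 2 ^ S m * Dr m phi K) <= scal (Rabs (phi K)) (/ 2 ^ S m).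
    move=> m; rewrite Rabs_mult /scal /= /mult /= Rmult_comm (Rabs_pos_eq (/ _)); last by left; apply: Rinv_0_lt_compat; apply: (pow_lt 2 (S m)); lra.
    apply: Rmult_le_compat_r => //; left; apply: Rinv_0_lt_compat; apply: (pow_lt 2 (S m)); lra.
  have := CSum_le _ _ _ _ (CSum_RtoC _ _ (he K)) (fun m => _) S1; rewrite Cmod_R /scal /= /mult /= Rmult_1_r; apply=> m.
  rewrite Cmod_R; exact: dom.
have rec : forall K, e K + e (S K) = phi K.
  move=> K.
  have h1 : is_series (fun m => / 2 ^ S m * Dr m phi K + / 2 ^ S m * Dr m phi (S K)) (e K + e (S K)) by exact: is_series_plus.
  have h2 : is_series (fun m => / 2 ^ m * Dr m phi K - / 2 ^ S m * Dr (S m) phi K) (phi K).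
    have tele : forall n, @eq R (sum_n (fun m => / 2 ^ m * Dr m phi K - / 2 ^ S m * Dr (S m) phi K) n) (phi K - / 2 ^ S n * Dr (S n) phi K).
      elim=> [|n IH]; first by rewrite sum_O /= Rinv_1; ring.
      rewrite sum_SnR IH; ring.
    change (is_lim_seq (sum_n (fun m => / 2 ^ m * Dr m phi K - / 2 ^ S m * Dr (S m) phi K)) (phi K)).
    apply: (is_lim_seq_ext (fun n => phi K - / 2 ^ S n * Dr (S n) phi K)); first by move=> n; rewrite tele.
    rewrite -{2}(Rminus_0_r (phi K)); apply: is_lim_seq_minus'; first exact: is_lim_seq_const.
    apply/is_lim_seq_abs_0.
    apply: (is_lim_seq_le_le (fun _ => 0) _ (fun n => Rabs (phi K) * / 2 ^ S n)).
    - move=> n; split; first exact: Rabs_pos.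
      rewrite Rabs_mult Rmult_comm (Rabs_pos_eq (/ _)); last by left; apply: Rinv_0_lt_compat; apply: pow_lt; lra.
      apply: Rmult_le_compat_r => //; left; apply: Rinv_0_lt_compat; apply: pow_lt; lra.
    - exact: is_lim_seq_const.
    - have -> : Finite 0 = Rbar_mult (Rabs (phi K)) 0 by rewrite /= Rmult_0_r.
      apply: is_lim_seq_scal_l; apply: ex_series_lim_0; by exists 1; exact: half_series.
  have E := is_series_unique _ _ h1; rewrite -E -(is_series_unique _ _ h2); apply: Series_ext => m.
  have p2 : 2 ^ m <> 0 by apply: pow_nonzero; lra.
  rewrite Dr_S -tech_pow_Rmult; field; done.
exists (e O); split; first exact: he.
have part : forall n, @eq R (sum_n (fun k => (-1) ^ k * phi k) n) (e O - (-1) ^ S n * e (S n)).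
  elim=> [|n IH]; first by rewrite sum_O -rec /=; ring.
  rewrite sum_SnR IH -(rec (S n)) /=; ring.
change (is_lim_seq (sum_n (fun k => (-1) ^ k * phi k)) (e O)).
apply: (is_lim_seq_ext (fun n => e O - (-1) ^ S n * e (S n))); first by move=> n; rewrite part.
rewrite -{2}(Rminus_0_r (e O)); apply: is_lim_seq_minus'; first exact: is_lim_seq_const.
apply/is_lim_seq_abs_0.
apply: (is_lim_seq_le_le (fun _ => 0) _ (fun n => Rabs (phi (S n)))).
- move=> n; split; first exact: Rabs_pos.
  by rewrite Rabs_mult pow_1_abs Rmult_1_l; exact: be.
- exact: is_lim_seq_const.
- by have := proj1 (is_lim_seq_incr_1 phi 0) lim => h; have := is_lim_seq_abs _ _ h; rewrite /= Rabs_R0.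
Qed.

(** Hasse's series for (1 - 2^(1 + la)) zeta(-la), in a form that also makes sense at la = -1. *)
Definition Hs (la : R) : R := Series (fun n => / 2 ^ S n * sum_n (fun k => (-1) ^ k * Binomial.C n k * Rpower (INR (S k)) la) n).

Lemma Rpower_INR_to_0 s : s < 0 -> is_lim_seq (fun k => Rpower (INR (S k)) s) 0.
Proof.
move=> hs; have L : is_lim_seq (fun k => s * ln (INR (S k))) m_infty.
  have -> : m_infty = Rbar_mult s p_infty.
    by rewrite /Rbar_mult /=; case: Rle_dec => // a; case: Rle_lt_or_eq_dec => //; lra.
  apply: is_lim_seq_scal_l.
  apply: (is_lim_comp_seq ln (fun k => INR (S k)) p_infty p_infty) => //; first exact: is_lim_ln_p.
    by exists O.
  exact: (proj1 (is_lim_seq_incr_1 INR p_infty) is_lim_seq_INR).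
rewrite /Rpower; apply: (is_lim_comp_seq exp _ m_infty 0) L; first exact: is_lim_exp_m.
by exists O.
Qed.

(** After N differences the sequence tends to 0 and its further differences keep one sign, so
    Euler's transformation is legitimate for it; preceded by the first N terms it is Hasse's
    series. *)
Lemma altN_Hasse la N : la + 1 < INR N -> altN N (fun k => RtoC (Rpower (INR (S k)) la)) (RtoC (Hs la)).
Proof.
move=> h; set f := fun k => Rpower (INR (S k)) la.
have h1 : la < INR N by lra.
have [sg [hsg pos]] := power_Dr_sign _ _ h1.
have [B [B0 hB]] := power_Dr_bound la N ltac:(lra).
have lim : is_lim_seq (Dr N f) 0.
  apply/is_lim_seq_abs_0.
  apply: (is_lim_seq_le_le (fun _ => 0) _ (fun k => B * Rpower (INR (S k)) (la - INR N))).
  - by move=> k; split; [exact: Rabs_pos | exact: hB].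
  - exact: is_lim_seq_const.
  - have -> : Finite 0 = Rbar_mult B 0 by rewrite /= Rmult_0_r.
    apply: is_lim_seq_scal_l; apply: Rpower_INR_to_0; lra.
have [e [e1 e2]] := euler_transform (Dr N f) sg hsg (fun n k => eq_ind _ (fun x => 0 <= sg * x) (pos (N + n)%nat k ltac:(lia)) _ (Dr_add N n f k)) lim.
exists (RtoC e); split.
  by apply: CSum_ext (CSum_RtoC _ _ e2) => k; rewrite Dc_RtoC -RtoC_mult.
have S1 : is_series (fun n => / 2 ^ S n * Dr n f 0%nat) (rsum (fun n => / 2 ^ S n * Dr n f 0%nat) N + / 2 ^ N * e).
  case: (N) e1 => [|M] e1.
    by rewrite /= Rinv_1 Rmult_1_l Rplus_0_l; exact: e1.
  rewrite rsum_sum_n; apply: (is_series_decr_n _ (S M)); first lia.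
  have pl : forall a b : R, plus (a + b) (opp a) = b by move=> a b; rewrite /plus /opp /=; ring.
  rewrite pl.
  have := is_series_scal (/ 2 ^ S M) _ _ e1; apply: is_series_ext => n.
  have Es : forall a b : R, scal a b = a * b by [].
  rewrite -Dr_add Es -Rmult_assoc -Rinv_mult -pow_add; congr (/ 2 ^ _ * _); lia.
have -> : Hs la = rsum (fun n => / 2 ^ S n * Dr n f 0%nat) N + / 2 ^ N * e.
  rewrite -(is_series_unique _ _ S1) /Hs; apply: Series_ext => n; by rewrite Dr_binomial.
rewrite RtoC_plus RtoC_mult; congr (_ + _)%C.
have cr : forall u n, RtoC (rsum u n) = csum (fun k => RtoC (u k)) n.
  by move=> u; elim=> //= n IH; rewrite RtoC_plus IH.
rewrite cr; apply: csum_ext => k _; by rewrite Dc_RtoC RtoC_mult.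
Qed.

(** With u k the sample at k + 1, the odd indices are the even multiples; removing them twice is the
    passage from h to 2h in the sum. *)
Lemma is_series_even_odd (u : nat -> C) l m :
  ex_series (fun n => Cmod (u n)) -> CSum u l -> CSum (fun n => u (S (2 * n))%nat) m ->
  CSum (fun k => RtoC ((-1) ^ k) * u k)%C (l - RtoC 2 * m)%C.
Proof.
move=> hex h1 h2.
have ha : CSum (fun k => RtoC ((-1) ^ k) * u k)%C (CSeries (fun k => RtoC ((-1) ^ k) * u k)%C).
  apply: CSum_abs; apply: ex_series_ext hex => n; by rewrite Cmod_mult Cmod_R pow_1_abs Rmult_1_l.
set s := CSeries _ in ha.
have part : forall n, csum (fun k => RtoC ((-1) ^ k) * u k)%C (2 * n) = (csum u (2 * n) - RtoC 2 * csum (fun k => u (S (2 * k))%nat) n)%C.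
  elim=> [|n IH]; first by rewrite /=; ring.
  rewrite (_ : (2 * S n)%nat = S (S (2 * n))); last lia.
  have Sr : forall v k, csum v (S k) = (csum v k + v k)%C by [].
  rewrite !Sr IH pow_m1_S pow_1_even (_ : RtoC 2 = (1 + 1)%C); last by rewrite -RtoC_plus.
  ring.
have E : s = (l - RtoC 2 * m)%C; last by rewrite -E.
case: (Req_dec (Cmod (s - (l - RtoC 2 * m))%C) 0) => [/Cmod_eq_0 h|nz].
  by rewrite -(Cplus_0_r (l - RtoC 2 * m)%C) -h; ring.
exfalso; set D := Cmod _ in nz.
have D0 : 0 < D by have := Cmod_ge_0 (s - (l - RtoC 2 * m))%C; rewrite -/D; lra.
have [N1 k1] := CSum_csum _ _ ha (D / 4) ltac:(lra).
have [N2 k2] := CSum_csum _ _ h1 (D / 4) ltac:(lra).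
have [N3 k3] := CSum_csum _ _ h2 (D / 8) ltac:(lra).
set n := (N1 + N2 + N3)%nat.
have a1 := k1 (2 * n)%nat ltac:(lia); have a2 := k2 (2 * n)%nat ltac:(lia); have a3 := k3 n ltac:(lia).
rewrite part in a1; move: a1 a2 a3; set X := csum u _; set Y := csum _ n => a1 a2 a3.
have : D <= Cmod (X - RtoC 2 * Y - s)%C + (Cmod (X - l)%C + 2 * Cmod (Y - m)%C).
  rewrite /D (_ : (s - (l - RtoC 2 * m))%C = ((- (X - RtoC 2 * Y - s)) + ((X - l) + - (RtoC 2 * (Y - m))))%C); last by ring.
  apply: Rle_trans (Cmod_triangle _ _) _; rewrite Cmod_opp; apply: Rplus_le_compat_l.
  apply: Rle_trans (Cmod_triangle _ _) _; rewrite Cmod_opp Cmod_mult Cmod_R Rabs_pos_eq; lra.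
lra.
Qed.

Definition eta (la : R) : R := (1 - Rpower 2 (1 + la)) * zeta (- la).

(** The two branches of [zeta] need two arguments: the Dirichlet series for la < -1 and Hasse's
    series otherwise, where la <> -1 makes the factor 1 - 2^(1 + la) invertible. *)
Lemma altN_eta la N : la <> -1 -> la + 1 < INR N -> altN N (fun k => RtoC (Rpower (INR (S k)) la)) (RtoC (eta la)).
Proof.
move=> hn h; case: (Rlt_dec la (-1)) => hl.
  have ex := ex_series_Rpower _ hl.
  have S0 := CSum_RtoC _ _ (Series_correct _ ex).
  have E : eta la = Series (fun k => Rpower (INR (S k)) la) - 2 * (Rpower 2 la * Series (fun k => Rpower (INR (S k)) la)).
    rewrite /eta /zeta; case: Rlt_dec => c; last lra.
    rewrite Ropp_involutive Rpower_plus Rpower_1; [ring | lra].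
  apply: altN_CSum; rewrite E RtoC_minus (RtoC_mult 2); apply: is_series_even_odd => //.
    by apply: ex_series_ext ex => n; rewrite Cmod_R Rabs_pos_eq //; left; exact: exp_pos.
  apply: CSum_RtoC; have := is_series_scal (Rpower 2 la) _ _ (Series_correct _ ex).
  apply: is_series_ext => n; rewrite /scal /= /mult /= Rpower_mult_distr; [|lra|apply: (lt_0_INR (S n)); lia].
  congr (Rpower _ la); rewrite -/(INR (S n)) -/(Nat.mul 2 n) (_ : 2 * INR (S n) = INR (S (S (2 * n)))) //.
  by rewrite !S_INR mult_INR /=; ring.
have E : eta la = Hs la.
  rewrite /eta /zeta; case: Rlt_dec => c; first lra.
  rewrite (_ : 1 - - la = 1 + la); last by ring.
  have nz : 1 - Rpower 2 (1 + la) <> 0.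
    have l2 : 0 < ln 2 by rewrite -ln_1; apply: ln_increasing; lra.
    have : exp 0 < exp ((1 + la) * ln 2) by apply: exp_increasing; apply: Rmult_lt_0_compat; lra.
    rewrite exp_0 -/(Rpower 2 (1 + la)).
    lra.
  rewrite -Rmult_assoc Rinv_r // Rmult_1_l /Hs; apply: Series_ext => n.
  by congr (_ * _); apply: sum_n_ext => k; rewrite Ropp_involutive.
rewrite E; exact: altN_Hasse.
Qed.

(** * The expansion up to its constant term *)

(* The part [Lf mu] of K contributes to the expansion of the summand [gf] at 0 the powers u^(la nu mu k) with the coefficients [cc b mu k]; the exponent -1 occurs only for mu = nu, k = 0. *)
Definition Acf (b mu : R) : R := Gamma (- mu) / 2 * Rpower (b / 2) mu.
Definition chi_ (b : R) : R := b ^ 2 / 4.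
Definition gf (b nu : R) (u : C) : C :=
  (Cpower u (- nu - 1) * (Kf nu (RtoC b * u) * / (1 + u * u)))%C.
Definition Fsum (mu x : R) (K : nat) : R := rsum (fun r => (- x) ^ r * Ec mu r) K.
Definition la (nu mu : R) (k : nat) : R := mu - nu - 1 + 2 * INR k.
Definition cc (b mu : R) (k : nat) : R := Acf b mu * ((-1) ^ k * Fsum mu (chi_ b) (S k)).
Definition pw (b nu mu : R) (K : nat) (u : C) : C :=
  csum (fun k => RtoC (cc b mu k) * Cpower u (la nu mu k))%C K.
(** Numerator of the remainder when the series in chi u^2 is divided by 1 + u^2 up to K terms: the
    tail of the series plus the carry of the division. *)
Definition TE (b mu : R) (K : nat) (u : C) : C :=
  (RtoC (chi_ b ^ K) * CPS (fun n => Ec mu (n + K)%nat) (RtoC (chi_ b) * (u * u)) + RtoC ((-1) ^ K * Fsum mu (chi_ b) K))%C.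

Lemma Fsum_F1 mu x k : Fsum mu x (S k) = F1 k mu x.
Proof. by rewrite /Fsum /F1 rsum_sum_n. Qed.

Lemma Rpower_half b mu : 0 < b -> Rpower (b / 2) mu = Rpower 2 (- mu) * Rpower b mu.
Proof.
move=> hb; rewrite /Rpower -exp_plus ln_div //; last lra.
congr exp; ring.
Qed.

Lemma Lf_scaled b mu u : 0 < b -> 0 < Re u ->
  Lf mu (RtoC b * u) = (RtoC (Acf b mu) * (Cpower u mu * CPS (Ec mu) (RtoC (chi_ b) * (u * u))))%C.
Proof.
move=> hb hu; rewrite /Lf Cpower_scal // /Acf Rpower_half //.
have -> : (RtoC (/ 4) * (RtoC b * u * (RtoC b * u)))%C = (RtoC (chi_ b) * (u * u))%C.
  have -> : chi_ b = / 4 * (b * b) by rewrite /chi_; field.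
  rewrite !RtoC_mult; ring.
rewrite !RtoC_mult; ring.
Qed.

(** Long division by 1 + w: the alternating partial sums are the quotient coefficients, and
    multiplying back leaves the series and one carry. *)
Lemma telescope_F mu x (w : C) K :
  ((1 + w) * csum (fun k => RtoC ((-1) ^ k * Fsum mu x (S k)) * w ^ k) K)%C =
  (csum (fun k => RtoC (Ec mu k) * (RtoC x * w) ^ k) K - RtoC ((-1) ^ K * Fsum mu x K) * w ^ K)%C.
Proof.
elim: K => [|K IH].
  rewrite /= /Fsum /= Rmult_0_r; ring.
have Sr : forall v k, csum v (S k) = (csum v k + v k)%C by [].
rewrite !Sr Cmult_plus_distr_l IH Cpow_mult_l -RtoC_pow.
have E : (-1) ^ K * Fsum mu x (S K) = (-1) ^ K * Fsum mu x K + x ^ K * Ec mu K.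
  rewrite /Fsum [rsum _ (S K)]/= Rmult_plus_distr_l; congr (_ + _).
  rewrite -Rmult_assoc -Rpow_mult_distr (_ : -1 * - x = x) //; ring.
have -> : (-1) ^ S K * Fsum mu x (S K) = - ((-1) ^ K * Fsum mu x (S K)) by rewrite /=; ring.
rewrite E RtoC_opp !RtoC_plus !RtoC_mult /=; ring.
Qed.

Lemma CPS_over_inv1 b mu u K : nonint mu -> 0 < Re u ->
  (CPS (Ec mu) (RtoC (chi_ b) * (u * u)) * / (1 + u * u))%C =
  (csum (fun k => RtoC ((-1) ^ k * Fsum mu (chi_ b) (S k)) * (u * u) ^ k) K
   + (u * u) ^ K * (TE b mu K u * / (1 + u * u)))%C.
Proof.
move=> h hu; have nz := one_plus_sq_neq0 u hu.
have T := telescope_F mu (chi_ b) (u * u)%C K.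
rewrite (CPS_split _ _ K (entire_Ec _ (nonint_1p _ h))).
set X := csum (fun k => RtoC ((-1) ^ k * _) * _)%C K in T *; set Y := csum _ K in T *.
have -> : Y = ((1 + u * u) * X + RtoC ((-1) ^ K * Fsum mu (chi_ b) K) * (u * u) ^ K)%C by rewrite T; ring.
rewrite /TE [((RtoC (chi_ b) * (u * u)) ^ K)%C]Cpow_mult_l RtoC_pow; field; exact: nz.
Qed.

Lemma Cpow_Cpower (u : C) k : 0 < Re u -> ((u * u) ^ k)%C = Cpower u (2 * INR k).
Proof.
move=> hu; rewrite Cpow_mult_l -!Cpower_nat // -Cpower_plus; congr Cpower; ring.
Qed.

Lemma part_expand b nu mu u K : 0 < b -> nonint mu -> 0 < Re u ->
  (Cpower u (- nu - 1) * (Lf mu (RtoC b * u) * / (1 + u * u)))%C =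
  (pw b nu mu K u + RtoC (Acf b mu) * (Cpower u (la nu mu K) * (TE b mu K u * / (1 + u * u))))%C.
Proof.
move=> hb h hu; rewrite Lf_scaled //.
have -> : (Cpower u (- nu - 1) * (RtoC (Acf b mu) * (Cpower u mu * CPS (Ec mu) (RtoC (chi_ b) * (u * u))) * / (1 + u * u)))%C =
  (RtoC (Acf b mu) * ((Cpower u (- nu - 1) * Cpower u mu) * (CPS (Ec mu) (RtoC (chi_ b) * (u * u)) * / (1 + u * u))))%C by ring.
rewrite -Cpower_plus (CPS_over_inv1 b mu u K h hu) /pw.
have E : forall k, Cpower u (la nu mu k) = (Cpower u (- nu - 1 + mu) * (u * u) ^ k)%C.
  move=> k; rewrite Cpow_Cpower // -Cpower_plus; congr Cpower; rewrite /la; ring.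
rewrite E (csum_ext (fun k => RtoC (cc b mu k) * Cpower u (la nu mu k))%C (fun k => (RtoC (Acf b mu) * Cpower u (- nu - 1 + mu)) * (RtoC ((-1) ^ k * Fsum mu (chi_ b) (S k)) * (u * u) ^ k))%C).
  rewrite csum_scal; ring.
move=> k _; rewrite E /cc RtoC_mult; ring.
Qed.

Definition rho (b nu : R) (K1 K2 : nat) (u : C) : C :=
  (gf b nu u - pw b nu (- nu) K1 u - pw b nu nu K2 u)%C.

Definition rem (b nu mu : R) (K : nat) (u : C) : C :=
  (RtoC (Acf b mu) * (Cpower u (la nu mu K) * (TE b mu K u * / (1 + u * u))))%C.

Lemma rho_rem b nu K1 K2 u : 0 < b -> nonint nu -> 0 < Re u ->
  rho b nu K1 K2 u = (rem b nu (- nu) K1 u + rem b nu nu K2 u)%C.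
Proof.
move=> hb h hu; rewrite /rho /gf /Kf.
have E1 := part_expand b nu (- nu) u K1 hb (nonint_opp _ h) hu.
have E2 := part_expand b nu nu u K2 hb h hu.
rewrite -/(rem b nu (- nu) K1 u) in E1; rewrite -/(rem b nu nu K2 u) in E2.
transitivity (Cpower u (- nu - 1) * (Lf nu (RtoC b * u) * / (1 + u * u)) + Cpower u (- nu - 1) * (Lf (- nu) (RtoC b * u) * / (1 + u * u)) - pw b nu (- nu) K1 u - pw b nu nu K2 u)%C; first ring.
rewrite E1 E2; ring.
Qed.

Lemma Sm_rem k M n b nu mu K : 0 < k <= 1 -> nonint mu -> Sm (Near k M) n (la nu mu K) (rem b nu mu K).
Proof.
move=> hk h; have posR := Near_pos k M; have posM := Near_mod k M.
apply: Sm_scal => //.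
apply: (Sm_eq _ _ (la nu mu K + (0 + 0))); first ring.
apply: Sm_mult; first exact: Sm_power.
apply: Sm_mult; last exact: Sm_inv1_near.
apply: Sm_plus; last exact: Sm_const.
apply: Sm_scal => //; apply: (Sm_CPS _ _ M) => //; first by move=> z [].
apply: entire_shiftn; apply: entire_Ec; exact: nonint_1p.
Qed.

Lemma Sm_rho_near k M n b nu K1 K2 al : 0 < k <= 1 -> 0 < b -> nonint nu ->
  al <= la nu (- nu) K1 -> al <= la nu nu K2 -> Sm (Near k M) n al (rho b nu K1 K2).
Proof.
move=> hk hb h h1 h2.
apply: (Sm_ext _ _ _ (fun u => rem b nu (- nu) K1 u + rem b nu nu K2 u)%C); first exact: Near_pos.
  by move=> z hz; rewrite rho_rem.
apply: Sm_plus; apply: Sm_near_weaken; try apply: Sm_rem => //; try eassumption.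
exact: nonint_opp.
Qed.

Lemma Sm_gf_far k n b nu al : 0 < k <= 1 -> 0 < b -> nonint nu -> Sm (Far k) n al (gf b nu).
Proof.
move=> hk hb h; apply: (Sm_eq _ _ ((- nu - 1) + ((al + nu + 3) + -2))); first ring.
apply: Sm_mult; first by apply: Sm_power; exact: Far_pos.
apply: Sm_mult; [exact: Sm_Kf_far | exact: Sm_inv1_far].
Qed.

Lemma Sm_pw_far k n b nu mu K al : (forall j, (j < K)%nat -> la nu mu j <= al) -> Sm (Far k) n al (pw b nu mu K).
Proof.
elim: K => [|K IH] h; first exact: Sm_zero.
apply: (Sm_plus _ _ _ (pw b nu mu K)); first by apply: IH => j hj; apply: h; lia.
apply: Sm_scal; first exact: Far_mod.
apply: (Sm_far_weaken _ _ (la nu mu K)); first by apply: h; lia.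
apply: Sm_power; exact: Far_pos.
Qed.

(** At infinity the summand is smaller than every power, so the subtracted powers determine the
    order: al has to lie above their exponents, while near 0 it has to lie below the first omitted
    ones. *)
Lemma Sm_rho_far k n b nu K1 K2 al : 0 < k <= 1 -> 0 < b -> nonint nu ->
  (forall j, (j < K1)%nat -> la nu (- nu) j <= al) -> (forall j, (j < K2)%nat -> la nu nu j <= al) ->
  Sm (Far k) n al (rho b nu K1 K2).
Proof.
move=> hk hb h h1 h2.
apply: (Sm_ext _ _ _ (fun u => gf b nu u + (-1) * pw b nu (- nu) K1 u + (-1) * pw b nu nu K2 u)%C); first exact: Far_pos.
  move=> z _; rewrite /rho; ring.
apply: Sm_plus; first apply: Sm_plus; first exact: Sm_gf_far.
  apply: Sm_scal; [exact: Far_mod | exact: Sm_pw_far].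
apply: Sm_scal; [exact: Far_mod | exact: Sm_pw_far].
Qed.

Lemma Sect_scal k r z : 0 < r -> Sect k z -> Sect k (RtoC r * z).
Proof.
move=> r0 [h1 h2]; split; rewrite Re_scal; first nra.
rewrite Cmod_mult Cmod_R Rabs_pos_eq; nra.
Qed.

Lemma Dc_max n f B : (forall i, (i <= n)%nat -> Cmod (f i) <= B) -> Cmod (Dc n f 0%nat) <= 2 ^ n * B.
Proof.
elim: n f B => [|n IH] f B h; first by rewrite /= Rmult_1_l; apply: h.
rewrite (_ : 2 ^ S n * B = 2 ^ n * (2 * B)); last by rewrite /=; ring.
apply: IH => i hi; apply: Rle_trans (Cmod_triangle _ _) _; rewrite Cmod_opp.
have := h i ltac:(lia); have := h (S i) ltac:(lia); lra.
Qed.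

Lemma is_series_ge0 (a : nat -> R) l : is_series a l -> (forall n, 0 <= a n) -> 0 <= l.
Proof.
move=> h pos; rewrite -(is_series_unique _ _ h) -(Rmult_0_l (Series (fun _ => 0))) -Series_scal_l.
apply: Series_le; last by exists l.
by move=> n; rewrite Rmult_0_l; split; [lra | exact: pos].
Qed.

(** The N-th difference at the sample (j + 1) h is O(|h|^N |(j + 1) h|^(al - N)), that is, |h|^al
    times (j + 1)^(al - N), and this is summable since al - N <= -2. The lower differences involve
    only the first N samples. *)
Lemma altN_small f N al k : 0 < k <= 1 -> (2 <= N)%nat -> al + 2 <= INR N ->
  Sm (Near k 2) N al f -> Sm (Far k) N al f -> exists B, 0 <= B /\
  forall h, Sect k h -> INR N * Cmod h <= 1 ->
  exists l, altN N (fun j => f (RtoC (INR (S j)) * h)%C) l /\ Cmod l <= B * Rpower (Cmod h) al.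
Proof.
move=> hk hN2 hN hn hf.
have [B1 [B10 H1]] := Sm_Dn _ _ _ _ hn ltac:(lra).
have [B2 [B20 H2]] := Sm_Dn _ _ _ _ hf ltac:(lra).
have [B3 [B30 H3]] := Sm_bound _ _ _ _ hn.
set Z := Series (fun j => Rpower (INR (S j)) (al - INR N)).
have exZ : ex_series (fun j => Rpower (INR (S j)) (al - INR N)) by apply: ex_series_Rpower; lra.
(* The first N samples have moduli between |h| and N |h|, so for either sign of al their al-th
   powers are at most P times that of |h|. *)
set P := Rpower (INR N) (Rabs al).
have P0 : 0 < P by exact: exp_pos.
have Z0 : 0 <= Z by apply: (is_series_ge0 _ _ (Series_correct _ exZ)) => n; left; exact: exp_pos.
exists (rsum (fun n => / 2 ^ S n * (2 ^ n * (B3 * P))) N + / 2 ^ N * ((B1 + B2) * Z)); split.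
  have r : forall m, 0 <= rsum (fun n => / 2 ^ S n * (2 ^ n * (B3 * P))) m.
    elim=> [|m IH]; first exact: Rle_refl.
    rewrite [rsum _ (S m)]/rsum -/(rsum _ m); apply: Rplus_le_le_0_compat => //.
    apply: Rmult_le_pos; first by left; apply: Rinv_0_lt_compat; apply: pow_lt; lra.
    by apply: Rmult_le_pos; [apply: pow_le; lra | apply: Rmult_le_pos => //; lra].
  apply: Rplus_le_le_0_compat; first exact: r.
  apply: Rmult_le_pos; first by left; apply: Rinv_0_lt_compat; apply: pow_lt; lra.
  by apply: Rmult_le_pos => //; lra.
move=> h hs hsmall; have h0 : 0 < Cmod h by apply: Re_pos_Cmod; case: hs.
set F := fun j => f (RtoC (INR (S j)) * h)%C.
have FE : forall n j, Dc n F j = Dn n h f (h + RtoC (INR j) * h)%C.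
  move=> n j; rewrite -Dc_Dn; apply: Dc_ext => i; rewrite /F; congr f; rewrite S_INR RtoC_plus; ring.
have mz : forall x, 0 <= x -> Cmod (RtoC x * h)%C = x * Cmod h.
  by move=> x hx; rewrite Cmod_mult Cmod_R Rabs_pos_eq.
have bd : forall j, Cmod (Dc N F j) <= (B1 + B2) * Rpower (Cmod h) al * Rpower (INR (S j)) (al - INR N).
  move=> j; rewrite FE; have j0 : 0 < INR (S j) by apply: lt_0_INR; lia.
  have m0 : 0 < INR (S j) * Cmod h by apply: Rmult_lt_0_compat.
  have E : forall B, B * (Cmod h ^ N * Rpower (INR (S j) * Cmod h) (al - INR N)) = B * Rpower (Cmod h) al * Rpower (INR (S j)) (al - INR N).
    move=> B; rewrite -Rpower_mult_distr // -Rpower_pow //.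
    rewrite (_ : Rpower (Cmod h) al = Rpower (Cmod h) (INR N) * Rpower (Cmod h) (al - INR N)); first ring.
    rewrite -Rpower_plus; congr Rpower; ring.
  have Ez : forall t, (h + RtoC (INR j) * h + RtoC t * h)%C = (RtoC (INR (S j) + t) * h)%C.
    move=> t; rewrite S_INR !RtoC_plus; ring.
  have Rp : 0 < Rpower (Cmod h) al * Rpower (INR (S j)) (al - INR N) by apply: Rmult_lt_0_compat; exact: exp_pos.
  (* All N + 1 points of the difference lie in one region: N steps have total length at most 1, so
     they stay below 2 if they start below 1, and moduli only grow otherwise. *)
  case: (Rle_dec (INR (S j) * Cmod h) 1) => c.
    apply: (Rle_trans _ (B1 * Rpower (Cmod h) al * Rpower (INR (S j)) (al - INR N))); last by rewrite !Rmult_assoc; apply: Rmult_le_compat_r; lra.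
    rewrite -E; apply: H1 => // t ht; rewrite Ez mz; last lra.
    split; last nra.
    split; first by apply: Sect_scal => //; lra.
    rewrite mz; nra.
  apply: (Rle_trans _ (B2 * Rpower (Cmod h) al * Rpower (INR (S j)) (al - INR N))); last by rewrite !Rmult_assoc; apply: Rmult_le_compat_r; lra.
  rewrite -E; apply: H2 => // t ht; rewrite Ez mz; last lra.
  split; last nra.
  split; first by apply: Sect_scal => //; lra.
  rewrite mz; nra.
have S1 := is_series_scal ((B1 + B2) * Rpower (Cmod h) al) _ _ (Series_correct _ exZ).
have bd2 : forall j, Cmod (RtoC ((-1) ^ j) * Dc N F j)%C <= scal ((B1 + B2) * Rpower (Cmod h) al) (Rpower (INR (S j)) (al - INR N)).
  by move=> j; rewrite Cmod_mult Cmod_R pow_1_abs Rmult_1_l; exact: bd.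
have C1 : CSum (fun j => RtoC ((-1) ^ j) * Dc N F j)%C (CSeries (fun j => RtoC ((-1) ^ j) * Dc N F j)%C).
  apply: CSum_abs; apply: (ex_series_dominated _ (fun j => scal ((B1 + B2) * Rpower (Cmod h) al) (Rpower (INR (S j)) (al - INR N)))).
    by move=> j; rewrite Rabs_pos_eq; [exact: bd2 | exact: Cmod_ge_0].
  by eexists; exact: S1.
set m := CSeries _ in C1.
have bm := CSum_le _ _ _ _ C1 bd2 S1.
exists (csum (fun n => RtoC (/ 2 ^ S n) * Dc n F 0%nat) N + RtoC (/ 2 ^ N) * m)%C; split; first by exists m.
apply: Rle_trans (Cmod_triangle _ _) _; rewrite Rmult_plus_distr_r; apply: Rplus_le_compat; last first.
  rewrite Cmod_mult Cmod_R Rabs_pos_eq; last by left; apply: Rinv_0_lt_compat; apply: pow_lt; lra.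
  rewrite Rmult_assoc; apply: Rmult_le_compat_l; first by left; apply: Rinv_0_lt_compat; apply: pow_lt; lra.
  apply: Rle_trans bm _; right; rewrite /scal /= /mult /= -/Z; ring.
rewrite (Rmult_comm (rsum _ _)) -rsum_scal; apply: csum_le => n hn'.
rewrite Cmod_mult Cmod_R Rabs_pos_eq; last by left; apply: Rinv_0_lt_compat; apply: pow_lt; lra.
rewrite (Rmult_comm (Rpower _ _)) Rmult_assoc; apply: Rmult_le_compat_l; first by left; apply: Rinv_0_lt_compat; apply: pow_lt; lra.
rewrite Rmult_assoc; apply: Dc_max => i hi; rewrite /F.
have i0 : 0 < INR (S i) by apply: lt_0_INR; lia.
have iN : INR (S i) <= INR N by apply: le_INR; lia.
apply: Rle_trans (H3 _ _) _.
  split; first exact: Sect_scal.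
  rewrite mz; nra.
rewrite mz; last lra.
rewrite -Rpower_mult_distr // Rmult_assoc; apply: Rmult_le_compat_l => //; apply: Rmult_le_compat_r; first by left; exact: exp_pos.
have i1 : 1 <= INR (S i) by rewrite (_ : 1 = INR 1) //; apply: le_INR; lia.
apply: (Rle_trans _ (Rpower (INR (S i)) (Rabs al))); first by apply: Rle_Rpower => //; exact: Rle_abs.
by apply: Rle_Rpower_l; [exact: Rabs_pos | lra].
Qed.

(** * Dyadic differences of the sum *)

Definition Sg (b nu : R) (h : C) : C := CSeries (fun j => gf b nu (RtoC (INR (S j)) * h)%C).

Lemma gf_summable b nu k h : 0 < k <= 1 -> 0 < b -> 0 < nu -> nonint nu -> Sect k h ->
  ex_series (fun j => Cmod (gf b nu (RtoC (INR (S j)) * h)%C)).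
Proof.
move=> hk hb hn hni hs; have h0 : 0 < Cmod h by apply: Re_pos_Cmod; case: hs.
have [B1 [B10 H1]] := Sm_bound _ _ _ _ (Sm_rho_near k 1 0 b nu 0 0 (- 2 * nu - 1) hk hb hni ltac:(rewrite /la /=; lra) ltac:(rewrite /la /=; lra)).
have [B2 [B20 H2]] := Sm_bound _ _ _ _ (Sm_gf_far k 0 b nu (- 2) hk hb hni).
set s := - 2 * nu - 3.
have e1 : ex_series (fun j => Rpower (INR (S j)) s) by apply: ex_series_Rpower; rewrite /s; lra.
have e2 : ex_series (fun j => Rpower (INR (S j)) (-2)) by apply: ex_series_Rpower; lra.
have e3 := ex_series_plus _ _ (ex_series_scal (B1 * Rpower (Cmod h) s) _ e1) (ex_series_scal (B2 * Rpower (Cmod h) (-2)) _ e2).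
apply: (ex_series_dominated _ _ _ e3) => j.
have j0 : 0 < INR (S j) by apply: lt_0_INR; lia.
have mz : Cmod (RtoC (INR (S j)) * h)%C = INR (S j) * Cmod h by rewrite Cmod_mult Cmod_R Rabs_pos_eq; lra.
have m0 : 0 < INR (S j) * Cmod h by apply: Rmult_lt_0_compat.
rewrite Rabs_pos_eq; last exact: Cmod_ge_0.
rewrite /plus /scal /= /mult /= -/(INR (S j)).
have r1 : 0 <= B1 * Rpower (Cmod h) s * Rpower (INR (S j)) s.
  by apply: Rmult_le_pos; [apply: Rmult_le_pos => //|]; left; exact: exp_pos.
have r2 : 0 <= B2 * Rpower (Cmod h) (-2) * Rpower (INR (S j)) (-2).
  by apply: Rmult_le_pos; [apply: Rmult_le_pos => //|]; left; exact: exp_pos.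
have E : forall B t, B * Rpower (Cmod h) t * Rpower (INR (S j)) t = B * Rpower (INR (S j) * Cmod h) t.
  by move=> B t; rewrite -Rpower_mult_distr //; ring.
case: (Rle_dec (INR (S j) * Cmod h) 1) => c.
  apply: (Rle_trans _ (B1 * Rpower (Cmod h) s * Rpower (INR (S j)) s)); last by move: r2; rewrite /Rdiv; lra.
  have -> : gf b nu (RtoC (INR (S j)) * h)%C = rho b nu 0 0 (RtoC (INR (S j)) * h)%C by rewrite /rho /pw /=; ring.
  have Hn : Near k 1 (RtoC (INR (S j)) * h)%C by split; [exact: Sect_scal | rewrite mz].
  apply: Rle_trans (H1 _ Hn) _; rewrite E mz; apply: Rmult_le_compat_l => //.
  rewrite /Rpower; have l0 : ln (INR (S j) * Cmod h) <= 0 by rewrite -ln_1; apply: ln_le.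
  have : (-2 * nu - 1) * ln (INR (S j) * Cmod h) <= s * ln (INR (S j) * Cmod h) by rewrite /s; nra.
  case=> [l|->]; [left; exact: exp_increasing | lra].
apply: (Rle_trans _ (B2 * Rpower (Cmod h) (-2) * Rpower (INR (S j)) (-2))); last by move: r1; lra.
have Hf : Far k (RtoC (INR (S j)) * h)%C by split; [exact: Sect_scal | rewrite mz; lra].
apply: Rle_trans (H2 _ Hf) _; rewrite E mz; lra.
Qed.

Definition zt (b nu mu : R) (k : nat) (h : C) : C :=
  (RtoC (cc b mu k) * (RtoC (zeta (- la nu mu k)) * Cpower h (la nu mu k + 1)))%C.
(* Replacing each power u^l of the expansion by its zeta-regularized sum, with log for l = -1; the limit at h = 0 is the constant term. *)
Definition Ef (b nu : R) (K1 K2 : nat) (h : C) : C :=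
  (h * Sg b nu h - csum (fun k => zt b nu (- nu) k h) K1 - csum (fun k => zt b nu nu (S k) h) K2
   + RtoC (cc b nu 0) * Cln h)%C.

Lemma Sg_alt b nu k N h : 0 < k <= 1 -> 0 < b -> 0 < nu -> nonint nu -> Sect k h ->
  altN N (fun j => gf b nu (RtoC (INR (S j)) * h)%C) (Sg b nu h - 2 * Sg b nu (2 * h))%C.
Proof.
move=> hk hb hn hni hs; apply: altN_CSum.
have hs2 : Sect k (RtoC 2 * h) by apply: Sect_scal => //; lra.
have e1 := gf_summable b nu k h hk hb hn hni hs.
apply: is_series_even_odd => //; first exact: CSum_abs.
apply: (CSum_ext (fun j => gf b nu (RtoC (INR (S j)) * (2 * h))%C)); last by apply: CSum_abs; exact: (gf_summable b nu k _ hk hb hn hni hs2).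
move=> n; congr gf; have -> : INR (S (S (2 * n))) = INR (S n) * 2 by rewrite !S_INR mult_INR /=; ring.
rewrite RtoC_mult; ring.
Qed.

Lemma altN_csum N (f : nat -> nat -> C) (l : nat -> C) K : (forall i, (i < K)%nat -> altN N (f i) (l i)) ->
  altN N (fun j => csum (fun i => f i j) K) (csum l K).
Proof.
elim: K => [|K IH] h.
  have Z : CSum (fun k => RtoC ((-1) ^ k) * 0)%C 0%C.
    apply: (CSum_ext (fun _ => RtoC 0)); first by move=> n; ring.
    apply: CSum_RtoC; have := is_series_scal 0 _ _ (Series_correct _ (ex_intro _ _ half_series)); rewrite /scal /= /mult /= Rmult_0_l.
    by apply: is_series_ext => n; exact: Rmult_0_l.
  by apply: altN_CSum.
by apply: (altN_plus N (fun j => csum (fun i => f i j) K)); [apply: IH => i hi; apply: h; lia | apply: h].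
Qed.

Lemma altN_Cpower la N h : la + 1 < INR N -> 0 < Re h ->
  altN N (fun j => Cpower (RtoC (INR (S j)) * h)%C la) (RtoC (Hs la) * Cpower h la)%C.
Proof.
move=> hN hh; apply: (altN_ext _ (fun j => Cpower h la * RtoC (Rpower (INR (S j)) la))%C).
  move=> j; rewrite Cpower_scal //; first ring.
  by apply: lt_0_INR; lia.
rewrite Cmult_comm; apply: altN_scal; exact: altN_Hasse.
Qed.

Lemma Hs_eta la : la <> -1 -> Hs la = eta la.
Proof.
move=> h; have [N hN] := nat_above (la + 1).
apply: RtoC_inj; apply: (altN_unique N); [exact: altN_Hasse | exact: altN_eta].
Qed.

Lemma zt_diff b nu mu k h : 0 < Re h -> la nu mu k <> -1 ->
  (h * (RtoC (cc b mu k) * (RtoC (Hs (la nu mu k)) * Cpower h (la nu mu k))))%C = (zt b nu mu k h - zt b nu mu k (2 * h))%C.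
Proof.
move=> hh hl; rewrite Hs_eta // /zt /eta Cpower_scal; try lra => //.
have -> : Cpower h (la nu mu k + 1) = (Cpower h (la nu mu k) * h)%C by rewrite Cpower_plus Cpower_1.
have -> : 1 + la nu mu k = la nu mu k + 1 by ring.
rewrite RtoC_mult RtoC_minus; ring.
Qed.

Lemma rho_pw b nu K1 K2 u : (rho b nu K1 K2 u + pw b nu (- nu) K1 u + pw b nu nu K2 u)%C = gf b nu u.
Proof. rewrite /rho; ring. Qed.

(* Here (1 - 2^(1+l)) zeta(-l) h^(l+1) is the increment of the regularized power between 2h and h. *)
Lemma Ef_step b nu k K1 K2 al N : 0 < k <= 1 -> 0 < b -> 0 < nu -> nonint nu ->
  (2 <= N)%nat -> al + 2 <= INR N ->
  al <= la nu (- nu) K1 -> al <= la nu nu (S K2) ->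
  (forall j, (j < K1)%nat -> la nu (- nu) j <= al) -> (forall j, (j < S K2)%nat -> la nu nu j <= al) ->
  exists B d, 0 <= B /\ forall h, Sect k h -> INR N * Cmod h <= 1 ->
  Cmod (Ef b nu K1 K2 h - Ef b nu K1 K2 (2 * h) - d)%C <= B * Rpower (Cmod h) (al + 1).
Proof.
move=> hk hb hn hni N2 hN n1 n2 f1 f2.
have [B [B0 H]] := altN_small (rho b nu K1 (S K2)) N al k hk N2 hN (Sm_rho_near k 2 N b nu K1 (S K2) al hk hb hni n1 n2) (Sm_rho_far k N b nu K1 (S K2) al hk hb hni f1 f2).
(* The constant stems from the exponent -1: [Hs (-1)] is its Euler value, and - ln 2 comes from the
   logarithm in [Ef]. That it is zero need not be computed here, since [dyadic_tail] derives it from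
   the existence of a limit. *)
exists B, (RtoC (cc b nu 0) * (RtoC (Hs (-1)) - RtoC (ln 2)))%C; split => // h hs hsm.
have hh : 0 < Re h by case: hs.
have h0 : 0 < Cmod h by exact: Re_pos_Cmod.
have [l [Hl bl]] := H h hs hsm.
have A1 : forall mu K, (forall j, (j < K)%nat -> la nu mu j <= al) ->
  altN N (fun j => pw b nu mu K (RtoC (INR (S j)) * h)%C) (csum (fun i => RtoC (cc b mu i) * (RtoC (Hs (la nu mu i)) * Cpower h (la nu mu i)))%C K).
  move=> mu K hj; apply: altN_csum => i hi; apply: altN_scal; apply: altN_Cpower => //.
  have := hj i hi; lra.
have A2 := altN_plus _ _ _ _ _ (altN_plus _ _ _ _ _ Hl (A1 _ _ f1)) (A1 _ _ f2).
have A3 := altN_unique _ _ _ _ (Sg_alt b nu k N h hk hb hn hni hs) (altN_ext _ _ _ _ (fun j => rho_pw _ _ _ _ _) A2).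
have D1 : (h * csum (fun i => RtoC (cc b (- nu) i) * (RtoC (Hs (la nu (- nu) i)) * Cpower h (la nu (- nu) i)))%C K1)%C =
  (csum (fun i => zt b nu (- nu) i h) K1 - csum (fun i => zt b nu (- nu) i (2 * h)) K1)%C.
  rewrite -csum_scal -csum_minus; apply: csum_ext => i _; apply: zt_diff => //.
  rewrite /la => E; apply: (nonint_neq0 (nu - INR i)); first exact: nonint_minus_nat.
  lra.
have D2 : (h * csum (fun i => RtoC (cc b nu i) * (RtoC (Hs (la nu nu i)) * Cpower h (la nu nu i)))%C (S K2))%C =
  (RtoC (cc b nu 0) * RtoC (Hs (-1)) + (csum (fun i => zt b nu nu (S i) h) K2 - csum (fun i => zt b nu nu (S i) (2 * h)) K2))%C.
  rewrite csum_S_l Cmult_plus_distr_l -csum_scal -csum_minus; congr (_ + _)%C.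
    have -> : la nu nu 0 = -1 by rewrite /la /=; ring.
    have -> : Cpower h (-1) = (/ h)%C by rewrite Cpower_opp Cpower_1.
    field; exact: Re_pos_neq0.
  apply: csum_ext => i _; apply: zt_diff => //.
  rewrite /la S_INR; have := pos_INR i; lra.
have -> : (Ef b nu K1 K2 h - Ef b nu K1 K2 (2 * h) - RtoC (cc b nu 0) * (RtoC (Hs (-1)) - RtoC (ln 2)))%C = (h * l)%C.
  rewrite /Ef Cln_scal //; last lra.
  transitivity (h * (Sg b nu h - 2 * Sg b nu (2 * h)) - (csum (fun i => zt b nu (- nu) i h) K1 - csum (fun i => zt b nu (- nu) i (2 * h)) K1)
    - (RtoC (cc b nu 0) * RtoC (Hs (-1)) + (csum (fun i => zt b nu nu (S i) h) K2 - csum (fun i => zt b nu nu (S i) (2 * h)) K2)))%C; first ring.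
  rewrite -D1 -D2 A3; ring.
rewrite Cmod_mult Rpower_plus Rpower_1 // -Rmult_assoc Rmult_comm.
by apply: Rmult_le_compat_r => //; lra.
Qed.

(** Along h / 2^n both values in the difference tend to q, which forces d = 0. The errors then add
    up to B |h|^al times at most the sum of 2^(-n) over n >= 1, because al >= 1; that sum is 1, so B
    is kept. *)
Lemma dyadic_tail (F : C -> C) k q d B al r0 : 0 <= B -> 0 < r0 -> 1 <= al ->
  (forall h, Sect k h -> Cmod h <= r0 -> Cmod (F h - F (2 * h) - d)%C <= B * Rpower (Cmod h) al) ->
  (forall e, 0 < e -> exists x0, 0 < x0 /\ forall h, Sect k h -> Cmod h <= x0 -> Cmod (F h - q)%C <= e) ->
  forall h, Sect k h -> Cmod h <= r0 -> Cmod (F h - q)%C <= B * Rpower (Cmod h) al.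
Proof.
move=> B0 r00 al1 hF hq h hs hr.
have h0 : 0 < Cmod h by apply: Re_pos_Cmod; case: hs.
have p2 : forall n, 0 < / 2 ^ n <= 1.
  move=> n; have := pow_R1_Rle 2 n ltac:(lra) => H; split; first by apply: Rinv_0_lt_compat; lra.
  by rewrite -Rinv_1; apply: Rinv_le_contravar; lra.
have cm : forall n, Cmod (RtoC (/ 2 ^ n) * h)%C = / 2 ^ n * Cmod h.
  by move=> n; rewrite Cmod_mult Cmod_R Rabs_pos_eq //; left; case: (p2 n).
have sc : forall n, Sect k (RtoC (/ 2 ^ n) * h)%C by move=> n; apply: Sect_scal => //; case: (p2 n).
have lr : forall n, Cmod (RtoC (/ 2 ^ n) * h)%C <= r0 by move=> n; rewrite cm; have := p2 n; nra.
have pl : is_lim_seq (fun n => / 2 ^ n) 0.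
  apply: (is_lim_seq_ext (fun n => (/ 2) ^ n)); first by move=> n; rewrite pow_inv.
  by apply: is_lim_seq_geom; rewrite Rabs_pos_eq; lra.
have small : forall e, 0 < e -> exists n0, forall n, (n0 <= n)%nat -> / 2 ^ n <= e.
  move=> e e0; have := pl; rewrite -is_lim_seq_spec => /(_ (mkposreal e e0)) [n0 H]; exists n0 => n hn.
  have /= := H n hn; rewrite Rminus_0_r Rabs_pos_eq; last by left; case: (p2 n).
  lra.
have st : forall n, (2 * (RtoC (/ 2 ^ S n) * h))%C = (RtoC (/ 2 ^ n) * h)%C.
  move=> n; rewrite Cmult_assoc -RtoC_mult; congr (RtoC _ * _)%C; have := p2 n => _.
  rewrite /= Rinv_mult; field; apply: pow_nonzero; lra.
have rp : forall n, Rpower (Cmod (RtoC (/ 2 ^ n) * h)%C) al <= / 2 ^ n * Rpower (Cmod h) al.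
  move=> n; rewrite cm -Rpower_mult_distr //; last by case: (p2 n).
  apply: Rmult_le_compat_r; first by left; exact: exp_pos.
  rewrite -[X in _ <= X](Rpower_1 (/ 2 ^ n)); last by case: (p2 n).
  rewrite /Rpower; have : ln (/ 2 ^ n) <= 0 by rewrite -ln_1; apply: ln_le; case: (p2 n).
  move=> l0; have : al * ln (/ 2 ^ n) <= 1 * ln (/ 2 ^ n) by nra.
  by case=> [l|->]; [left; exact: exp_increasing | lra].
have R0 : 0 <= B * Rpower (Cmod h) al by apply: Rmult_le_pos => //; left; exact: exp_pos.
have step : forall n, Cmod (F (RtoC (/ 2 ^ S n) * h) - F (RtoC (/ 2 ^ n) * h) - d)%C <= / 2 ^ S n * (B * Rpower (Cmod h) al).
  move=> n; have := hF _ (sc (S n)) (lr (S n)); rewrite st => H; apply: Rle_trans H _.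
  have := rp (S n) => H; rewrite (_ : / 2 ^ S n * (B * Rpower (Cmod h) al) = B * (/ 2 ^ S n * Rpower (Cmod h) al)); last ring.
  exact: Rmult_le_compat_l.
have d0 : d = 0%C.
  apply: Cmod_eq_0; apply: Rle_antisym; last exact: Cmod_ge_0.
  apply: le_epsilon => e e0; rewrite Rplus_0_l.
  have [x0 [x00 Hx]] := hq (e / 4) ltac:(lra).
  set y := Rmin (x0 / Cmod h) (e / 2 / (1 + B * Rpower (Cmod h) al)).
  have y0 : 0 < y.
    by apply: Rmin_glb_lt; apply: Rdiv_lt_0_compat; lra.
  have [n0 Hn] := small y y0.
  have hn : forall n, (n0 <= n)%nat -> Cmod (RtoC (/ 2 ^ n) * h)%C <= x0.
    move=> n hn; rewrite cm; have := Hn n hn => H; have := Rmin_l (x0 / Cmod h) (e / 2 / (1 + B * Rpower (Cmod h) al)); rewrite -/y => H2.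
    apply: (Rle_trans _ (x0 / Cmod h * Cmod h)); first by apply: Rmult_le_compat_r; lra.
    by right; field; lra.
  have a1 := Hx _ (sc n0) (hn n0 ltac:(lia)); have a2 := Hx _ (sc (S n0)) (hn (S n0) ltac:(lia)).
  have a3 : / 2 ^ S n0 * (B * Rpower (Cmod h) al) <= e / 2.
    have H := Hn (S n0) ltac:(lia); have H2 := Rmin_r (x0 / Cmod h) (e / 2 / (1 + B * Rpower (Cmod h) al)); rewrite -/y in H2.
    apply: (Rle_trans _ (e / 2 / (1 + B * Rpower (Cmod h) al) * (1 + B * Rpower (Cmod h) al))); last by right; field; lra.
    by apply: Rmult_le_compat; try lra; left; case: (p2 (S n0)).
  have a4 := step n0.
  rewrite (_ : d = ((F (RtoC (/ 2 ^ S n0) * h) - q) + - (F (RtoC (/ 2 ^ n0) * h) - q) + - (F (RtoC (/ 2 ^ S n0) * h) - F (RtoC (/ 2 ^ n0) * h) - d))%C); last ring.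
  apply: Rle_trans (Cmod_triangle _ _) _; rewrite Cmod_opp.
  have := Cmod_triangle (F (RtoC (/ 2 ^ S n0) * h) - q)%C (- (F (RtoC (/ 2 ^ n0) * h) - q))%C; rewrite Cmod_opp; lra.
have sum : forall n, Cmod (F h - F (RtoC (/ 2 ^ n) * h))%C <= (1 - / 2 ^ n) * (B * Rpower (Cmod h) al).
  elim=> [|n IH].
    rewrite /= Rinv_1 Cmult_1_l (_ : (F h - F h)%C = 0%C) ?Cmod_0; last ring.
    lra.
  rewrite (_ : (F h - F (RtoC (/ 2 ^ S n) * h))%C = ((F h - F (RtoC (/ 2 ^ n) * h)) + - (F (RtoC (/ 2 ^ S n) * h) - F (RtoC (/ 2 ^ n) * h) - d))%C); last by rewrite d0; ring.
  apply: Rle_trans (Cmod_triangle _ _) _; rewrite Cmod_opp; have := step n.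
  have -> : / 2 ^ n = 2 * / 2 ^ S n by rewrite /= Rinv_mult; field; apply: pow_nonzero; lra.
  move: IH; have -> : / 2 ^ n = 2 * / 2 ^ S n by rewrite /= Rinv_mult; field; apply: pow_nonzero; lra.
  nra.
apply: le_epsilon => e e0.
have [x0 [x00 Hx]] := hq e e0.
have [n0 Hn] := small (x0 / Cmod h) ltac:(exact: Rdiv_lt_0_compat).
have a1 : Cmod (F (RtoC (/ 2 ^ n0) * h) - q)%C <= e.
  apply: Hx; first exact: sc.
  rewrite cm; apply: (Rle_trans _ (x0 / Cmod h * Cmod h)); last by right; field; lra.
  by apply: Rmult_le_compat_r; [lra | exact: Hn].
rewrite (_ : (F h - q)%C = ((F h - F (RtoC (/ 2 ^ n0) * h)) + (F (RtoC (/ 2 ^ n0) * h) - q))%C); last ring.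
apply: Rle_trans (Cmod_triangle _ _) _; have := sum n0; have := p2 n0; nra.
Qed.

(** With al = 2 (K + 1) - 1 the first omitted exponent of the branch nu is exactly al. The m extra
    terms of the branch -nu bring its last kept and first omitted exponents to the two sides of al,
    which is where nu < m < nu + 1 enters. *)
Lemma main_asym b nu k m K q : 0 < k <= 1 -> 0 < b -> 0 < nu -> nonint nu ->
  nu < INR m < nu + 1 ->
  (forall e, 0 < e -> exists x0, 0 < x0 /\ forall h, Sect k h -> Cmod h <= x0 -> Cmod (Ef b nu (S K + m) K h - q)%C <= e) ->
  exists B r0, 0 <= B /\ 0 < r0 /\ forall h, Sect k h -> Cmod h <= r0 ->
    Cmod (Ef b nu (S K + m) K h - q)%C <= B * Rpower (Cmod h) (2 * INR (S K)).
Proof.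
move=> hk hb hn hni hm hq.
have SK : INR (S K) = INR K + 1 by exact: S_INR.
have K0 := pos_INR K.
have nE : INR (2 * S K + 1) = 2 * INR (S K) + 1 by rewrite plus_INR mult_INR [INR 2]/= [INR 1]/=; ring.
have := Ef_step b nu k (S K + m) K (2 * INR (S K) - 1) (2 * S K + 1) hk hb hn hni.
case.
- lia.
- lra.
- rewrite /la plus_INR; lra.
- rewrite /la; lra.
- move=> j hj; rewrite /la; have : INR (S j) <= INR (S K + m) by apply: le_INR; lia.
  rewrite plus_INR S_INR; lra.
- move=> j hj; rewrite /la; have : INR j <= INR K by apply: le_INR; lia.
  lra.
move=> B [d [B0 H]].
exists B, (/ INR (2 * S K + 1)); split => //.
have n0 : 0 < INR (2 * S K + 1) by rewrite nE; lra.
split; first exact: Rinv_0_lt_compat.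
apply: (dyadic_tail _ _ _ d) => //; first exact: Rinv_0_lt_compat.
  lra.
move=> h hs hr; have := H h hs; have -> : 2 * INR (S K) - 1 + 1 = 2 * INR (S K) by ring.
apply; apply: (Rle_trans _ (INR (2 * S K + 1) * / INR (2 * S K + 1))); last by right; field; lra.
apply: Rmult_le_compat_l; lra.
Qed.

(** * The constant term: reduction to the real axis *)

(** Recovers the derivative from f alone, so that the derivatives furnished separately on [Near] and
    [Far] are values of one function. *)
Definition Cd (f : C -> C) (z : C) : C :=
  (Derive (fun t => Re (f (z + RtoC t)%C)) 0, Derive (fun t => Im (f (z + RtoC t)%C)) 0).

Lemma Cder_Cd f z l : Cder f z l -> Cd f z = l.
Proof.
move=> H.
have H' : Cder f (z + RtoC 0 * 1)%C l by rewrite (_ : (z + RtoC 0 * 1)%C = z) //; ring.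
have [h1 h2] := Cder_CD f z 1%C 0 l H'.
rewrite Cmult_1_r in h1 h2; apply: C_eq; rewrite /Cd /=; apply: is_derive_unique.
  by apply: is_derive_ext h1 => s /=; rewrite Cmult_1_r.
by apply: is_derive_ext h2 => s /=; rewrite Cmult_1_r.
Qed.

Lemma Cder_unique f z l m : Cder f z l -> Cder f z m -> l = m.
Proof. by move=> /Cder_Cd <- /Cder_Cd <-. Qed.

Lemma Cder_taylor1 D f f' z h B :
  (forall w, D w -> Cder f w (f' w)) -> Dbd 1 D f' B ->
  (forall t, 0 <= t <= 1 -> D (z + RtoC t * h)%C) ->
  Cmod (f (z + h) - f z - h * f' z)%C <= B * Cmod h ^ 2.
Proof.
move=> hf [f'' [hf' hb]] hD.
have E : forall t, 0 <= t <= 1 -> Cmod (f' (z + RtoC t * h) - f' z)%C <= B * Cmod h.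
  move=> t ht; have mt : Cmod (RtoC t * h)%C <= Cmod h.
    by rewrite Cmod_mult Cmod_R Rabs_pos_eq; [have := Cmod_ge_0 h; nra | lra].
  have hs : forall s, 0 <= s <= 1 -> D (z + RtoC s * (RtoC t * h))%C.
    move=> s hs; rewrite (_ : (RtoC s * (RtoC t * h))%C = (RtoC (s * t) * h)%C); last by rewrite RtoC_mult; ring.
    apply: hD; nra.
  have B0 : 0 <= B.
    apply: Rle_trans (hb _ (hD 0 _)); [exact: Cmod_ge_0 | lra].
  apply: (Rle_trans _ (B * Cmod (RtoC t * h)%C)); last exact: Rmult_le_compat_l.
  by apply: (Cder_mean f' f'') => s hss; [apply: hf' | apply: hb]; apply: hs.
have M := Cder_mean (fun w => f w + - f' z * w)%C (fun w => f' w - f' z)%C z h (B * Cmod h).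
rewrite (_ : (f (z + h) - f z - h * f' z)%C = (f (z + h) + - f' z * (z + h) - (f z + - f' z * z))%C); last ring.
rewrite (_ : B * Cmod h ^ 2 = B * Cmod h * Cmod h); last ring.
apply: M => t ht; last exact: E.
apply: (Cder_eq _ _ _ _ _ (Cder_plus _ _ _ _ _ (hf _ (hD t ht)) (Cder_scal (- f' z)%C _ _ _ (Cder_id (z + RtoC t * h)%C)))) => //=; ring.
Qed.

Lemma Sm_taylor1 D f P al : Sm D 2 al f -> al <= 2 -> (forall z, D z -> Cder f z (P z)) ->
  exists B, 0 <= B /\ forall z h m, 0 < m ->
  (forall t, 0 <= t <= 1 -> D (z + RtoC t * h)%C /\ m <= Cmod (z + RtoC t * h)%C) ->
  Cmod (f (z + h) - f z - h * P z)%C <= B * (Cmod h ^ 2 * Rpower m (al - 2)).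
Proof.
move=> hs hal hP; have [B [B0 H]] := Sm_Dbd _ _ _ _ hs hal.
exists B; split => // z h m m0 hz.
have [f' [h1 h2]] := H m m0.
have dz : D z /\ m <= Cmod z by have := hz 0 ltac:(lra); rewrite (_ : (z + RtoC 0 * h)%C = z) //; ring.
rewrite (Cder_unique _ _ _ _ (hP z (proj1 dz)) (h1 z dz)).
have := Cder_taylor1 _ f f' z h _ h1 h2 hz; rewrite [INR 2]/= (_ : 1 + 1 = 2); last ring.
by rewrite Rmult_assoc (Rmult_comm (Rpower _ _)).
Qed.

(** In w = ln h the term h rho(n h) has derivative h Phi1'(n h): rotating the sum leads to Riemann
    sums of the derivative of [Phi1]. *)
Definition Phi1 (b nu : R) (m : nat) (u : C) : C := (u * rho b nu m 0 u)%C.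

Lemma rho1_rho2 b nu m u : 0 < Re u -> rho b nu m 0 u = (rho b nu m 1 u + RtoC (cc b nu 0) * / u)%C.
Proof.
move=> hu; rewrite /rho /pw [csum _ 0]/= [csum _ 1]/=.
have -> : la nu nu 0 = -1 by rewrite /la /=; ring.
rewrite Cpower_opp Cpower_1 //; ring.
Qed.

Lemma Sect_near z : 0 < Re z -> exists k M, 0 < k <= 1 /\ Near k M z.
Proof.
move=> h; have m0 := Re_pos_Cmod z h; exists (Re z / Cmod z), (Cmod z); split.
  split; first exact: Rdiv_lt_0_compat.
  apply: (Rmult_le_reg_r (Cmod z)) => //; rewrite /Rdiv Rmult_assoc Rinv_l; last lra.
  rewrite Rmult_1_l Rmult_1_r; apply: Rle_trans (Rle_abs _) _; exact: re_le_Cmod.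
split; last lra; split => //; right; field; lra.
Qed.

Lemma rho_Cder b nu K1 K2 z : 0 < b -> nonint nu -> 0 < Re z -> exists l, Cder (rho b nu K1 K2) z l.
Proof.
move=> hb hn hz; have [k [M [hk hN]]] := Sect_near z hz.
set al := Rmin (la nu (- nu) K1) (la nu nu K2).
have [_ [f' [H _]]] := Sm_rho_near k M 1 b nu K1 K2 al hk hb hn (Rmin_l _ _) (Rmin_r _ _).
by exists (f' z); exact: H.
Qed.

Lemma seg_cases k h x : Sect k h -> Cmod h <= 1 -> 1 <= x ->
  (forall t, 0 <= t <= 1 -> Near k 2 (RtoC x * h + RtoC t * h)%C /\ x * Cmod h <= Cmod (RtoC x * h + RtoC t * h)%C) \/
  (forall t, 0 <= t <= 1 -> Far k (RtoC x * h + RtoC t * h)%C /\ x * Cmod h <= Cmod (RtoC x * h + RtoC t * h)%C).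
Proof.
move=> hs h1 hx; have h0 : 0 < Cmod h by apply: Re_pos_Cmod; case: hs.
have E : forall t, (RtoC x * h + RtoC t * h)%C = (RtoC (x + t) * h)%C by move=> t; rewrite RtoC_plus; ring.
have M : forall t, 0 <= t -> Cmod (RtoC (x + t) * h)%C = (x + t) * Cmod h.
  by move=> t ht; rewrite Cmod_mult Cmod_R Rabs_pos_eq; lra.
case: (Rle_dec (x * Cmod h) 1) => c; [left | right] => t ht; rewrite E M; try lra.
  split; last nra.
  split; first by apply: Sect_scal => //; lra.
  rewrite M; nra.
split; last nra.
split; first by apply: Sect_scal => //; lra.
rewrite M; nra.
Qed.

(** Collects, with one exponent and one constant, what both the rotation and the comparison with the
    integral require of the summand with its non-integrable powers removed. *)
Lemma rho_class b nu k m : 0 < k <= 1 -> 0 < b -> 0 < nu -> nonint nu -> nu < INR m < nu + 1 ->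
  exists eps B P, 0 < eps < 1 /\ 0 <= B /\
  (forall z, 0 < Re z -> Cder (Phi1 b nu m) z (P z)) /\
  (forall h x, Sect k h -> Cmod h <= 1 -> 1 <= x ->
    Cmod (Phi1 b nu m (RtoC x * h + h) - Phi1 b nu m (RtoC x * h) - h * P (RtoC x * h))%C <= B * (Cmod h ^ 2 * Rpower (x * Cmod h) (eps - 2))) /\
  (forall h, Sect k h -> Cmod h <= 1 -> Cmod (Phi1 b nu m h - RtoC (cc b nu 0))%C <= B * Rpower (Cmod h) eps) /\
  (forall z, Far k z -> Cmod (Phi1 b nu m z) <= B * Rpower (Cmod z) (- eps)) /\
  (forall h x t, Sect k h -> Cmod h <= 1 -> 1 <= x -> 0 <= t <= 1 ->
    Cmod (rho b nu m 1 (RtoC x * h) - rho b nu m 1 (RtoC x * h + RtoC t * h))%C <= B * (Cmod h * Rpower (x * Cmod h) (eps - 2))).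
Proof.
move=> hk hb hn hni hm.
(* After multiplication by u, the first omitted power at 0 has exponent 2 (m - nu) and the last
   subtracted one decays with exponent 2 (nu + 1 - m). The bound 1/2 keeps e - 2 below -1, so that
   sums over the samples converge. *)
set e := Rmin (1 / 2) (Rmin (2 * (INR m - nu)) (2 * (nu + 1 - INR m))).
have e1 : e <= 1 / 2 by exact: Rmin_l.
have e2 : e <= 2 * (INR m - nu) by apply: Rle_trans (Rmin_r _ _) (Rmin_l _ _).
have e3 : e <= 2 * (nu + 1 - INR m) by apply: Rle_trans (Rmin_r _ _) (Rmin_r _ _).
have e0 : 0 < e by apply: Rmin_glb_lt; [lra | apply: Rmin_glb_lt; lra].
have SN : Sm (Near k 2) 2 (e - 1) (rho b nu m 1).
  by apply: Sm_rho_near => //; rewrite /la /=; lra.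
have SF : Sm (Far k) 2 (e - 1) (rho b nu m 1).
  apply: Sm_rho_far => // j hj; rewrite /la; last by (have -> : j = 0%nat by lia); rewrite /=; lra.
  have : INR (S j) <= INR m by apply: le_INR; lia.
  rewrite S_INR; lra.
have SF1 : Sm (Far k) 0 (- 1 - e) (rho b nu m 0).
  apply: Sm_rho_far => // j hj; rewrite /la; last by lia.
  have : INR (S j) <= INR m by apply: le_INR; lia.
  rewrite S_INR; lra.
have PSN : Sm (Near k 2) 2 e (fun u => u * rho b nu m 1 u)%C.
  apply: (Sm_eq _ _ (1 + (e - 1))); first ring.
  by apply: Sm_mult => //; apply: Sm_id; exact: Near_pos.
have PSF : Sm (Far k) 2 e (fun u => u * rho b nu m 1 u)%C.
  apply: (Sm_eq _ _ (1 + (e - 1))); first ring.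
  by apply: Sm_mult => //; apply: Sm_id; exact: Far_pos.
have PE : forall u, 0 < Re u -> Phi1 b nu m u = (u * rho b nu m 1 u + RtoC (cc b nu 0))%C.
  move=> u hu; rewrite /Phi1 rho1_rho2 //; field; exact: Re_pos_neq0.
set P := Cd (Phi1 b nu m).
have HP : forall z, 0 < Re z -> Cder (Phi1 b nu m) z (P z).
  move=> z hz; have [l Hl] := rho_Cder b nu m 0 z hb hni hz.
  have H := Cder_mult _ _ _ _ _ (Cder_id z) Hl; rewrite -/(Phi1 b nu m) in H.
  by rewrite /P (Cder_Cd _ _ _ H).
have HP2 : forall z, 0 < Re z -> Cder (fun u => u * rho b nu m 1 u)%C z (P z).
  move=> z hz; apply: (Cder_ext_half (fun u => Phi1 b nu m u + - RtoC (cc b nu 0))%C) => //.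
    by move=> w hw; rewrite PE //; ring.
  apply: (Cder_eq _ _ _ _ _ (Cder_plus _ _ _ _ _ (HP z hz) (Cder_const (- RtoC (cc b nu 0))%C z))) => //; ring.
have [B1 [B10 H1]] := Sm_taylor1 _ _ _ _ PSN ltac:(lra) (fun z hz => HP2 z (Near_pos _ _ _ hz)).
have [B2 [B20 H2]] := Sm_taylor1 _ _ _ _ PSF ltac:(lra) (fun z hz => HP2 z (Far_pos _ _ hz)).
have [B3 [B30 H3]] := Sm_bound _ _ _ _ PSN.
have [B4 [B40 H4]] := Sm_bound _ _ _ _ SF1.
have [B5 [B50 H5]] := Sm_Dn _ 1 _ _ (Sm_pred _ _ _ _ SN) ltac:(rewrite /=; lra).
have [B6 [B60 H6]] := Sm_Dn _ 1 _ _ (Sm_pred _ _ _ _ SF) ltac:(rewrite /=; lra).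
exists e, (B1 + B2 + B3 + B4 + B5 + B6), P.
have up : forall B X, 0 <= X -> 0 <= B -> B <= B1 + B2 + B3 + B4 + B5 + B6 -> forall y, y <= B * X -> y <= (B1 + B2 + B3 + B4 + B5 + B6) * X.
  move=> B X X0 B0 hB y hy; apply: Rle_trans hy _; exact: Rmult_le_compat_r.
do 3 (split; first by [lra | exact: HP]).
split.
  move=> h x hs h1 hx; have h0 : 0 < Cmod h by apply: Re_pos_Cmod; case: hs.
  have xh : 0 < Re (RtoC x * h)%C by rewrite Re_scal; case: hs; nra.
  have xh' : 0 < Re (RtoC x * h + h)%C by move: xh; case: hs => h2 _; rewrite /Re /=; move: h2; rewrite /Re; lra.
  have X0 : 0 <= Cmod h ^ 2 * Rpower (x * Cmod h) (e - 2) by apply: Rmult_le_pos; [apply: pow_le; lra | left; exact: exp_pos].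
  have -> : (Phi1 b nu m (RtoC x * h + h) - Phi1 b nu m (RtoC x * h) - h * P (RtoC x * h))%C =
    ((RtoC x * h + h) * rho b nu m 1 (RtoC x * h + h) - (RtoC x * h) * rho b nu m 1 (RtoC x * h) - h * P (RtoC x * h))%C.
    rewrite !PE //; ring.
  case: (seg_cases k h x hs h1 hx) => hc; [apply: (up B1) | apply: (up B2)] => //; try lra.
    by apply: H1 => //; nra.
  by apply: H2 => //; nra.
split.
  move=> h hs h1; have h0 : 0 < Cmod h by apply: Re_pos_Cmod; case: hs.
  have -> : (Phi1 b nu m h - RtoC (cc b nu 0))%C = (h * rho b nu m 1 h)%C by rewrite PE; [ring | case: hs].
  apply: (up B3); try lra; first by left; exact: exp_pos.
  apply: H3; split => //; lra.
split.
  move=> z hz; have z0 := Far_mod _ _ hz.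
  apply: (up B4); try lra; first by left; exact: exp_pos.
  rewrite /Phi1 Cmod_mult; have -> : B4 * Rpower (Cmod z) (- e) = Cmod z * (B4 * Rpower (Cmod z) (- 1 - e)).
    rewrite (_ : - e = 1 + (- 1 - e)); last ring.
    rewrite [Rpower _ (1 + _)]Rpower_plus Rpower_1 //; ring.
  by apply: Rmult_le_compat_l; [lra | exact: H4].
move=> h x t hs h1 hx ht; have h0 : 0 < Cmod h by apply: Re_pos_Cmod; case: hs.
have X0 : 0 <= Cmod h * Rpower (x * Cmod h) (e - 2) by apply: Rmult_le_pos; [lra | left; exact: exp_pos].
have th : Cmod (RtoC t * h)%C <= Cmod h by rewrite Cmod_mult Cmod_R Rabs_pos_eq; nra.
have rr : 0 < Rpower (x * Cmod h) (e - 2) by exact: exp_pos.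
have seg : forall s, (RtoC x * h + RtoC s * (RtoC t * h))%C = (RtoC x * h + RtoC (s * t) * h)%C by move=> s; rewrite RtoC_mult; ring.
have m0 : 0 < x * Cmod h by nra.
case: (seg_cases k h x hs h1 hx) => hc; [apply: (up B5) | apply: (up B6)] => //; try lra.
  have := H5 (RtoC t * h)%C (RtoC x * h)%C (x * Cmod h) m0; rewrite /Dn /Dl [INR 1]/= pow_1 (_ : e - 1 - 1 = e - 2); last ring.
  move=> H; apply: Rle_trans (H _) _; first by move=> s hs'; rewrite seg; apply: hc; nra.
  by apply: Rmult_le_compat_l => //; apply: Rmult_le_compat_r; lra.
have := H6 (RtoC t * h)%C (RtoC x * h)%C (x * Cmod h) m0; rewrite /Dn /Dl [INR 1]/= pow_1 (_ : e - 1 - 1 = e - 2); last ring.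
move=> H; apply: Rle_trans (H _) _; first by move=> s hs'; rewrite seg; apply: hc; nra.
by apply: Rmult_le_compat_l => //; apply: Rmult_le_compat_r; lra.
Qed.

Lemma zeta_series s : 1 < s -> is_series (fun k => Rpower (INR (S k)) (- s)) (zeta s).
Proof.
move=> hs; rewrite /zeta; case: Rlt_dec => // _; apply: Series_correct; apply: ex_series_Rpower; lra.
Qed.

Lemma CSum_csum_fin (u : nat -> nat -> C) (l : nat -> C) K :
  (forall i, (i < K)%nat -> CSum (u i) (l i)) -> CSum (fun n => csum (fun i => u i n) K) (csum l K).
Proof.
elim: K => [|K IH] h.
  apply: (CSum_RtoC (fun _ => 0)); have := is_series_scal 0 _ _ half_series; rewrite /scal /= /mult /= Rmult_0_l.
  by apply: is_series_ext => n; exact: Rmult_0_l.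
by apply: (CSum_plus (fun n => csum (fun i => u i n) K)); [apply: IH => i hi; apply: h; lia | apply: h].
Qed.

(** For K1 = m and K2 = 0 the subtracted exponents lie below -1; their zeta values are convergent
    sums and can be moved inside. *)
Lemma Ef_CSum b nu k m h : 0 < k <= 1 -> 0 < b -> 0 < nu -> nonint nu -> nu < INR m < nu + 1 -> Sect k h ->
  CSum (fun n => h * rho b nu m 0 (RtoC (INR (S n)) * h))%C (Ef b nu m 0 h - RtoC (cc b nu 0) * Cln h)%C.
Proof.
move=> hk hb hn hni hm hs; have hh : 0 < Re h by case: hs.
have H1 := CSum_scal h _ _ (CSum_abs _ (gf_summable b nu k h hk hb hn hni hs)).
have H2 : CSum (fun n => csum (fun i => h * (RtoC (cc b (- nu) i) * Cpower (RtoC (INR (S n)) * h) (la nu (- nu) i)))%C m) (csum (fun i => zt b nu (- nu) i h) m).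
  apply: CSum_csum_fin => i hi.
  have l1 : 1 < - la nu (- nu) i.
    rewrite /la; have : INR (S i) <= INR m by apply: le_INR; lia.
    rewrite S_INR; lra.
  have Z := CSum_RtoC _ _ (zeta_series _ l1).
  have := CSum_scal (RtoC (cc b (- nu) i) * (h * Cpower h (la nu (- nu) i)))%C _ _ Z.
  rewrite (_ : (RtoC (cc b (- nu) i) * (h * Cpower h (la nu (- nu) i)) * RtoC (zeta (- la nu (- nu) i)))%C = zt b nu (- nu) i h).
    apply: CSum_ext => n; rewrite Cpower_scal //; last by apply: lt_0_INR; lia.
    rewrite Ropp_involutive; ring.
  rewrite /zt Cpower_plus Cpower_1 //; ring.
have := CSum_minus _ _ _ _ H1 H2.
rewrite (_ : (h * CSeries (fun j => gf b nu (RtoC (INR (S j)) * h)) - csum (fun i => zt b nu (- nu) i h) m)%C = (Ef b nu m 0 h - RtoC (cc b nu 0) * Cln h)%C).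
  apply: CSum_ext => n; rewrite csum_scal /rho /pw [csum _ 0]/=; ring.
rewrite /Ef [csum _ 0]/= /Sg; ring.
Qed.

Lemma csum_telescope (f : nat -> C) N : csum (fun n => f (S n) - f n)%C N = (f N - f O)%C.
Proof. elim: N => [|N IH] /=; [ring | rewrite IH; ring]. Qed.

Lemma cos_Rabs x : cos (Rabs x) = cos x.
Proof. by rewrite /Rabs; case: Rcase_abs => // _; exact: cos_neg. Qed.

(** The arc from |h| to h is the exponential of a vertical segment; it stays in the sector because
    the cosine decreases away from 0. *)
Lemma Sect_polar k h t : Sect k h -> 0 <= t <= 1 ->
  Sect k (Cexp (RtoC (ln (Cmod h)) + RtoC t * (0, Carg h))%C) /\
  Cmod (Cexp (RtoC (ln (Cmod h)) + RtoC t * (0, Carg h))%C) = Cmod h.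
Proof.
move=> [h1 h2] ht; have m0 := Re_pos_Cmod h h1.
have hc := Carg_bound h h1.
set w := (_ + _)%C.
have Rw : Re w = ln (Cmod h) by rewrite /w /Re /=; ring.
have Iw : Im w = t * Carg h by rewrite /w /Im /=; ring.
have Mw : Cmod (Cexp w) = Cmod h by rewrite Cmod_Cexp Rw exp_ln.
have Rh : Re h = Cmod h * cos (Carg h).
  by rewrite -{1}(exp_ln (Cmod h)) // -{1}(Cexp_Cln h).
have RE : Re (Cexp w) = Cmod h * cos (t * Carg h) by rewrite /Cexp -Iw -{1}(exp_ln (Cmod h)) // -Rw.
have C1 : cos (Carg h) <= cos (t * Carg h).
  rewrite -(cos_Rabs (Carg h)) -(cos_Rabs (t * Carg h)) Rabs_mult (Rabs_pos_eq t); last lra.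
  have A := Rabs_pos (Carg h); have A2 : Rabs (Carg h) < PI / 2 by apply: Rabs_def1; lra.
  apply: cos_decr_1; nra.
have : Re h <= Re (Cexp w) by rewrite RE Rh; apply: Rmult_le_compat_l; lra.
by rewrite /Sect Mw; lra.
Qed.

(** The mean value inequality is applied along the arc to partial sums, whose derivatives are
    explicit finite sums, and N tends to infinity only afterwards; no termwise differentiation of
    the infinite sum is involved. *)
Lemma Ef_rotate b nu k m : 0 < k <= 1 -> 0 < b -> 0 < nu -> nonint nu -> nu < INR m < nu + 1 ->
  exists B e, 0 <= B /\ 0 < e /\ forall h, Sect k h -> Cmod h <= 1 ->
  Cmod (Ef b nu m 0 h - Ef b nu m 0 (RtoC (Cmod h)))%C <= B * Rpower (Cmod h) e.
Proof.
move=> hk hb hn hni hm.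
have [e [B [P [he [B0 [HP [H1 [H2 [H3 _]]]]]]]]] := rho_class b nu k m hk hb hn hni hm.
set c := RtoC (cc b nu 0).
set Z := Series (fun j => Rpower (INR (S j)) (e - 2)).
have exZ : ex_series (fun j => Rpower (INR (S j)) (e - 2)) by apply: ex_series_Rpower; lra.
have Z0 : 0 <= Z by apply: (is_series_ge0 _ _ (Series_correct _ exZ)) => n; left; exact: exp_pos.
exists (4 * (B + B * Z)), e; split; first by have := Rmult_le_pos _ _ B0 Z0; lra.
split; first lra.
move=> h hs h1; have h0 : 0 < Cmod h by apply: Re_pos_Cmod; case: hs.
have hh : 0 < Re h by case: hs.
(* Up to Taylor errors the sum is Phi1((N + 1) g) - Phi1(g). The first value is small by decay and
   the second is c up to O(|g|^e), whence the added c. *)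
have tel : forall g N, Sect k g -> Cmod g <= 1 -> 1 <= INR (S N) * Cmod g ->
  Cmod (csum (fun n => g * P (RtoC (INR (S n)) * g))%C N + c)%C <= (B + B * Z) * Rpower (Cmod g) e + B * Rpower (INR (S N) * Cmod g) (- e).
  move=> g N gs g1 gN; have g0 : 0 < Cmod g by apply: Re_pos_Cmod; case: gs.
  set f := fun n => Phi1 b nu m (RtoC (INR (S n)) * g)%C.
  have F0 : f O = Phi1 b nu m g by rewrite /f; congr Phi1; rewrite [INR 1]/=; ring.
  have -> : (csum (fun n => g * P (RtoC (INR (S n)) * g))%C N + c)%C =
    (f N + - (f O - c) + - (csum (fun n => f (S n) - f n)%C N - csum (fun n => g * P (RtoC (INR (S n)) * g))%C N))%C.
    rewrite csum_telescope; ring.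
  apply: Rle_trans (Cmod_triangle _ _) _; rewrite Cmod_opp.
  have T := Cmod_triangle (f N) (- (f O - c))%C; rewrite Cmod_opp F0 in T; have T2 := H2 g gs g1.
  have T3 : Cmod (f N) <= B * Rpower (INR (S N) * Cmod g) (- e).
    have E : Cmod (RtoC (INR (S N)) * g)%C = INR (S N) * Cmod g by rewrite Cmod_mult Cmod_R Rabs_pos_eq //; exact: pos_INR.
    rewrite -E; apply: H3; split; last by rewrite E.
    by apply: Sect_scal => //; apply: lt_0_INR; lia.
  have T4 : Cmod (csum (fun n => f (S n) - f n)%C N - csum (fun n => g * P (RtoC (INR (S n)) * g))%C N)%C <= B * Z * Rpower (Cmod g) e.
    rewrite -csum_minus.
    apply: (Rle_trans _ (rsum (fun n => (B * Rpower (Cmod g) e) * Rpower (INR (S n)) (e - 2)) N)).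
      apply: csum_le => n _; rewrite /f.
      have n1 : 1 <= INR (S n) by rewrite S_INR; have := pos_INR n; lra.
      have -> : (RtoC (INR (S (S n))) * g)%C = (RtoC (INR (S n)) * g + g)%C by rewrite (S_INR (S n)) RtoC_plus; ring.
      apply: Rle_trans (H1 g (INR (S n)) gs g1 n1) _; right.
      rewrite -Rpower_mult_distr //; last lra.
      rewrite (_ : Rpower (Cmod g) e = Cmod g ^ 2 * Rpower (Cmod g) (e - 2)); first ring.
      rewrite -(Rpower_pow 2) // -Rpower_plus; congr Rpower; rewrite /=; ring.
    rewrite rsum_scal (_ : B * Z * Rpower (Cmod g) e = B * Rpower (Cmod g) e * Z); last ring.
    apply: Rmult_le_compat_l; first by apply: Rmult_le_pos => //; left; exact: exp_pos.
    by apply: rsum_le_series; [move=> n; left; exact: exp_pos | exact: Series_correct].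
  move: T T2 T3 T4; rewrite F0 -/c; lra.
set L := RtoC (ln (Cmod h)); set D : C := (0, Carg h).
have LD : (L + D)%C = Cln h by apply: C_eq; rewrite /L /D /Cln /Re /Im /=; ring.
have LR : L = Cln (RtoC (Cmod h)) by rewrite /L Cln_RtoC.
have sr : Sect k (RtoC (Cmod h)).
  split => //; rewrite /Re /= Cmod_R Rabs_pos_eq; nra.
(* Partial sums in the variable w = ln h, in which the logarithmic term is linear. *)
pose F N w := (csum (fun n => RtoC (/ INR (S n)) * Phi1 b nu m (RtoC (INR (S n)) * Cexp w))%C N + c * w)%C.
have FD : forall N w, 0 < Re (Cexp w) -> Cder (F N) w (csum (fun n => Cexp w * P (RtoC (INR (S n)) * Cexp w))%C N + c)%C.
  move=> N w hw; rewrite /F.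
  apply: (Cder_eq _ _ _ _ _ (Cder_plus (fun w => csum (fun n => RtoC (/ INR (S n)) * Phi1 b nu m (RtoC (INR (S n)) * Cexp w))%C N) _ _ (csum (fun n => Cexp w * P (RtoC (INR (S n)) * Cexp w))%C N) _ _ (Cder_scal c _ _ _ (Cder_id w)))) => //; last ring.
  elim: N => [|N IH]; first exact: Cder_const.
  apply: (Cder_plus (fun w => csum (fun n => RtoC (/ INR (S n)) * Phi1 b nu m (RtoC (INR (S n)) * Cexp w))%C N)) => //.
  have n0 : 0 < INR (S N) by apply: lt_0_INR; lia.
  have hz : 0 < Re (RtoC (INR (S N)) * Cexp w)%C by rewrite Re_scal; nra.
  have C1 := Cder_comp (Phi1 b nu m) (fun w => RtoC (INR (S N)) * Cexp w)%C w _ _ (Cder_scal _ _ _ _ (Cder_Cexp w)) (HP _ hz).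
  apply: (Cder_eq _ _ _ _ _ (Cder_scal (RtoC (/ INR (S N))) _ _ _ C1)) => //.
  rewrite RtoC_inv; last lra.
  by field; apply: RtoC_neq0; lra.
have key : forall N, 1 <= INR (S N) * Cmod h ->
  Cmod (F N (Cln h) - F N (Cln (RtoC (Cmod h))))%C <= ((B + B * Z) * Rpower (Cmod h) e + B * Rpower (INR (S N) * Cmod h) (- e)) * 4.
  move=> N hN; rewrite -LR -LD.
  have DD : Cmod D <= 4.
    rewrite /D; apply: Rle_trans (Cmod_le_abs _ _) _; rewrite Rabs_R0 Rplus_0_l.
    have := Carg_bound h hh; have := PI_4 => p4 hc; apply: Rabs_le; lra.
  apply: (Rle_trans _ (((B + B * Z) * Rpower (Cmod h) e + B * Rpower (INR (S N) * Cmod h) (- e)) * Cmod D)).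
    apply: (Cder_mean (F N) (fun w => csum (fun n => Cexp w * P (RtoC (INR (S n)) * Cexp w))%C N + c)%C) => t ht.
      by apply: FD; case: (Sect_polar k h t hs ht) => [[]].
    have [s1 s2] := Sect_polar k h t hs ht.
    rewrite -s2; apply: tel => //; rewrite -/D -/L s2 //.
  apply: Rmult_le_compat_l => //; have := exp_pos (e * ln (Cmod h)); have := exp_pos (- e * ln (INR (S N) * Cmod h)).
  rewrite -/(Rpower _ _) -/(Rpower _ _) => a1 a2; have := Rmult_le_pos _ _ B0 Z0; nra.
have FE : forall N g, 0 < Re g -> F N (Cln g) = (csum (fun n => g * rho b nu m 0 (RtoC (INR (S n)) * g))%C N + c * Cln g)%C.
  move=> N g hg; rewrite /F Cexp_Cln //; congr (_ + _)%C; apply: csum_ext => n _.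
  rewrite /Phi1 RtoC_inv; last by apply: not_0_INR; lia.
  by field; apply: RtoC_neq0; apply: not_0_INR; lia.
apply: le_epsilon => ep ep0.
have [N1 K1] := CSum_csum _ _ (Ef_CSum b nu k m h hk hb hn hni hm hs) (ep / 4) ltac:(lra).
have [N2 K2] := CSum_csum _ _ (Ef_CSum b nu k m _ hk hb hn hni hm sr) (ep / 4) ltac:(lra).
have [N3 K3] : exists N3, forall N, (N3 <= N)%nat -> 1 <= INR (S N) * Cmod h /\ 4 * (B * Rpower (INR (S N) * Cmod h) (- e)) <= ep / 2.
  have L1 := Rpower_INR_to_0 (- e) ltac:(lra).
  set y := ep / 8 / (1 + B * Rpower (Cmod h) (- e)).
  have bp : 0 <= B * Rpower (Cmod h) (- e) by apply: Rmult_le_pos => //; left; exact: exp_pos.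
  have y0 : 0 < y by apply: Rdiv_lt_0_compat; lra.
  have := L1; rewrite -is_lim_seq_spec => /(_ (mkposreal _ y0)) [n1 Hn1].
  have [n2 Hn2] := nat_above (/ Cmod h).
  exists (n1 + n2)%nat => N hN; split.
    apply: (Rle_trans _ (/ Cmod h * Cmod h)); first by right; field; lra.
    apply: Rmult_le_compat_r; first lra.
    have : INR n2 <= INR (S N) by apply: le_INR; lia.
    lra.
  have /= := Hn1 N ltac:(lia); rewrite Rminus_0_r Rabs_pos_eq; last by left; exact: exp_pos.
  have sN0 : 0 < INR (S N) by apply: lt_0_INR; lia.
  move=> hy; rewrite -(Rpower_mult_distr _ _ _ sN0 h0).
  apply: (Rle_trans _ (4 * (y * (1 + B * Rpower (Cmod h) (- e))))).
    apply: Rmult_le_compat_l; first lra.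
    rewrite (Rmult_comm (Rpower _ _)) -Rmult_assoc (Rmult_comm _ (Rpower (INR _) _)).
    apply: Rmult_le_compat; try lra; first by left; exact: exp_pos.
    left; exact: hy.
  rewrite /y; right; field; lra.
set N := (N1 + N2 + N3)%nat.
have a1 := K1 N ltac:(lia); have a2 := K2 N ltac:(lia); have [a3 a4] := K3 N ltac:(lia).
have := key N a3; rewrite !FE // -/c => a5.
set S1 := csum _ N in a1 a5; set S2 := csum _ N in a2 a5.
set E1 := Ef b nu m 0 h in a1 *; set E2 := Ef b nu m 0 (RtoC (Cmod h)) in a2 *.
rewrite -/c in a1 a2.
have -> : (E1 - E2)%C = (- (S1 - (E1 - c * Cln h)) + (S2 - (E2 - c * Cln (RtoC (Cmod h)))) + ((S1 + c * Cln h) - (S2 + c * Cln (RtoC (Cmod h)))))%C by ring.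
apply: Rle_trans (Cmod_triangle _ _) _.
have := Cmod_triangle (- (S1 - (E1 - c * Cln h)))%C (S2 - (E2 - c * Cln (RtoC (Cmod h))))%C; rewrite Cmod_opp.
move: a1 a2 a4 a5; lra.
Qed.

(** * Integrals and finite parts on the half-line *)

Lemma primitive_half (f : R -> R) : (forall u, 0 < u -> continuous f u) ->
  exists F, forall u, 0 < u -> is_derive F u (f u).
Proof.
move=> hf; exists (fun u => RInt f 1 u) => u hu.
apply: (is_derive_RInt f _ 1); last exact: hf.
exists (mkposreal (u / 2) ltac:(lra)) => v hv.
apply: RInt_correct; apply: ex_RInt_continuous => z hz; apply: hf.
have hv' : Rabs (v - u) < u / 2 by exact: hv.
have v0 : 0 < v by move: hv' => /Rabs_def2; lra.
have : 0 < Rmin 1 v by apply: Rmin_glb_lt; lra.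
lra.
Qed.

Lemma mono_lim_0 (G : R -> R) m : (forall x y, 0 < x <= y -> G x <= G y) -> (forall x, 0 < x -> m <= G x) ->
  exists l, m <= l /\ filterlim G (at_right 0) (locally l).
Proof.
move=> mono low.
set E := fun y => exists x, 0 < x /\ y = - G x.
have [l [h1 h2]] : {l | is_lub E l}.
  apply: completeness; first by exists (- m) => y [x [hx ->]]; have := low x hx; lra.
  by exists (- G 1), 1; split; lra.
exists (- l); split.
  have := h2 (- m); move=> H; have : l <= - m; last lra.
  by apply: H => y [x [hx ->]]; have := low x hx; lra.
apply/filterlim_locally => e.
have [x [hx hG]] : exists x, 0 < x /\ G x < - l + e.
  case: (Classical_Prop.classic (exists x, 0 < x /\ G x < - l + e)) => // N.
  have : l <= l - e; last by have := cond_pos e; lra.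
  apply: h2 => y [x [hx ->]]; case: (Rlt_dec (G x) (- l + e)) => c; first by case: N; exists x.
  lra.
exists (mkposreal x hx) => y hy y0.
have hy' : Rabs (y - 0) < x by exact: hy.
have yx : y <= x by move: hy' => /Rabs_def2; lra.
have := mono y x (conj y0 yx) => H.
have : - G y <= l by apply: h1; exists y.
move=> H2; change (Rabs (G y - - l) < e); apply: Rabs_def1; lra.
Qed.

Lemma mono_lim_oo (G : R -> R) m : (forall x y, 0 < x <= y -> G x <= G y) -> (forall x, 0 < x -> G x <= m) ->
  exists l : R, is_lim G p_infty l.
Proof.
move=> mono up.
set E := fun y => exists x, 0 < x /\ y = G x.
have [l [h1 h2]] : {l | is_lub E l}.
  apply: completeness; first by exists m => y [x [hx ->]]; exact: up.
  by exists (G 1), 1; split; lra.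
exists l; apply/is_lim_spec => e.
have [x [hx hG]] : exists x, 0 < x /\ l - e < G x.
  case: (Classical_Prop.classic (exists x, 0 < x /\ l - e < G x)) => // N.
  have : l <= l - e; last by have := cond_pos e; lra.
  apply: h2 => y [x [hx ->]]; case: (Rlt_dec (l - e) (G x)) => c; first by case: N; exists x.
  lra.
exists x => y hy; have := mono x y ltac:(lra) => H.
have : G y <= l by apply: h1; exists y; split; lra.
move=> H2; have := cond_pos e => e0; apply: Rabs_def1; lra.
Qed.

(** With primitives F of f and G of g, both F + G and G - F increase, and G is bounded; so F has
    limits at both ends. *)
Lemma Int_dominated (f g : R -> R) M : (forall u, 0 < u -> continuous f u) ->
  (forall u, 0 < u -> Rabs (f u) <= g u) -> Int g M -> exists l, Int f l /\ Rabs l <= M.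
Proof.
move=> cf hfg hg; have [G [g1 [g2 g3]]] := hg.
have [F hF] := primitive_half f cf.
have b1 : forall u, 0 < u -> - g u <= f u <= g u by move=> u hu; have /Rabs_le_between := hfg u hu.
have mG := mono_pos G g g1 (fun u hu => Rle_trans _ _ _ (Rabs_pos _) (hfg u hu)).
have q1 : forall u, 0 < u -> 0 <= f u + g u by move=> u hu; have := b1 u hu; lra.
have q2 : forall u, 0 < u -> 0 <= g u + - f u by move=> u hu; have := b1 u hu; lra.
have q3 : forall u, 0 < u -> -1 * g u <= f u by move=> u hu; have := b1 u hu; lra.
have mH := mono_pos (fun u => F u + G u) (fun u => f u + g u) (fun u hu => is_derive_plus _ _ _ _ _ (hF u hu) (g1 u hu)) q1.
have mK := mono_pos (fun u => G u + - F u) (fun u => g u + - f u) (fun u hu => is_derive_plus _ _ _ _ _ (g1 u hu) (is_derive_opp _ _ _ (hF u hu)))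
  q2.
have Gle : forall u, 0 < u -> G u <= 0 by exact: mono_le_lim.
have Gge : forall u, 0 < u -> - M <= G u by exact: mono_ge_lim.
have q4 : forall x, 0 < x -> F 1 + G 1 - 2 * M <= F x + G x.
  move=> x hx; case: (Rle_dec x 1) => c; [have := mK x 1 (conj hx c) | have := mH 1 x ltac:(lra)];
  have := Gle 1 Rlt_0_1; have := Gge x hx; have := Gle x hx; have := Gge 1 Rlt_0_1; lra.
have [h0 [_ H0]] := mono_lim_0 _ (F 1 + G 1 - 2 * M) mH q4.
have [h Hoo] : exists h : R, is_lim (fun u => F u + G u) p_infty h.
  apply: (mono_lim_oo _ (F 1 + G 1 + 2 * M) mH) => x hx; case: (Rle_dec x 1) => c.
    have := mH x 1 ltac:(lra); have := Gle 1 Rlt_0_1; have := Gge 1 Rlt_0_1; lra.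
  have := mK 1 x ltac:(lra); have := Gle x hx; have := Gge 1 Rlt_0_1; lra.
have I : Int f (h - h0 - M).
  exists (fun u => F u + - h); split.
    move=> u hu; rewrite -(Rplus_0_r (f u)); apply: is_derive_plus; [exact: hF | exact: is_derive_const].
  split.
    apply: (is_lim_ext (fun u => (F u + G u) + (- G u + - h))); first by move=> u; ring.
    have -> : Finite 0 = Rbar_plus h (Finite (- 0 + - h)) by rewrite /=; congr Finite; ring.
    apply: is_lim_plus'; first exact: Hoo.
    apply: is_lim_plus'; last exact: is_lim_const.
    exact: (is_lim_opp _ _ 0).
  apply: (filterlim_ext (fun u => (F u + G u) + (- 1 * G u + - h))); first by move=> u; ring.
  have -> : - (h - h0 - M) = h0 + (-1 * - M + - h) by ring.
  apply: filterlim_Rplus => //; apply: filterlim_Rplus; last exact: filterlim_const.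
  exact: filterlim_comp g3 (filterlim_scal_r (K := R_AbsRing) (V := R_NormedModule) (-1) (- M)).
exists (h - h0 - M); split => //; apply/Rabs_le_between; split.
  have := Int_le _ _ _ _ q3 (Int_scal (-1) _ _ hg) I; lra.
exact: (Int_le _ _ _ _ (fun u hu => proj2 (b1 u hu)) I hg).
Qed.

Lemma Int_FTC (F f : R -> R) (a : R) : (forall u, 0 < u -> is_derive F u (f u)) -> is_lim F p_infty 0 ->
  filterlim F (at_right 0) (locally a) -> Int f (- a).
Proof. by move=> h1 h2 h3; exists F; rewrite Ropp_involutive. Qed.

Lemma Rpower_to_oo s : s < 0 -> is_lim (fun u => Rpower u s) p_infty 0.
Proof.
move=> hs; apply/is_lim_spec => e.
exists (Rpower e (/ s) + 1) => u hu; have e0 := cond_pos e.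
have p0 : 0 < Rpower e (/ s) by exact: exp_pos.
rewrite Rminus_0_r Rabs_pos_eq; last by left; exact: exp_pos.
rewrite -[X in _ < X](Rpower_1 e) // -(Rinv_l s); last lra.
rewrite -Rpower_mult /Rpower; apply: exp_increasing.
rewrite -/(Rpower e (/ s)); have : ln (Rpower e (/ s)) < ln u by apply: ln_increasing; lra.
nra.
Qed.

(** A majorant with the elementary primitive -1/(1 + u^e), comparable to u^(e - 1) near 0 and to
    u^(-e - 1) at infinity. *)
Definition bump (e u : R) : R := e * Rpower u (e - 1) / (1 + Rpower u e) ^ 2.

Lemma bump_Int e : 0 < e -> Int (bump e) 1.
Proof.
move=> e0; have -> : 1 = - -1 by ring.
have P : forall u, 0 < Rpower u e by move=> u; exact: exp_pos.
apply: (Int_FTC (fun u => - / (1 + Rpower u e))).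
- move=> u hu; have D := is_derive_Rpower e u hu.
  have D2 : is_derive (fun u => 1 + Rpower u e) u (e * Rpower u (e - 1)).
    rewrite -(Rplus_0_l (e * _)); apply: is_derive_plus => //; exact: is_derive_const.
  have := is_derive_opp _ _ _ (is_derive_inv _ _ _ D2 ltac:(have := P u; lra)).
  by rewrite /bump /opp /= Rdiv_opp_l Ropp_involutive.
- have L := Rpower_to_oo (- e) ltac:(lra).
  apply: (is_lim_dominated _ (fun u => Rpower u (- e))) => // t ht.
  rewrite Rabs_Ropp Rabs_pos_eq; last by left; apply: Rinv_0_lt_compat; have := P t; lra.
  rewrite Rpower_Ropp; apply: Rinv_le_contravar; have := P t; lra.
have L := Rpower_to_0 e e0.
have C : continuous (fun x => - / (1 + x)) 0.
  apply: (ex_derive_continuous (fun x => - / (1 + x))); auto_derive; lra.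
have := filterlim_comp _ _ _ _ _ _ _ _ L C; rewrite Rplus_0_r Rinv_1; exact.
Qed.

Lemma bump_near e u : 0 < e -> 0 < u <= 1 -> Rpower u (e - 1) <= 4 / e * bump e u.
Proof.
move=> e0 [u0 u1]; have P : 0 < Rpower u e by exact: exp_pos.
have P1 : Rpower u e <= 1.
  have l0 : ln u <= 0 by rewrite -ln_1; apply: ln_le.
  have := exp_ineq1_le (- (e * ln u)); rewrite exp_Ropp -/(Rpower u e) => H.
  apply: (Rmult_le_reg_r (/ Rpower u e)); first exact: Rinv_0_lt_compat.
  rewrite Rinv_r; last lra.
  nra.
have P2 : 0 < Rpower u (e - 1) by exact: exp_pos.
have -> : 4 / e * bump e u = Rpower u (e - 1) * (4 * / (1 + Rpower u e) ^ 2) by rewrite /bump; field; lra.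
rewrite -{1}(Rmult_1_r (Rpower u (e - 1))); apply: Rmult_le_compat_l; first lra.
rewrite -(Rinv_r 4); last lra.
apply: Rmult_le_compat_l; first lra.
apply: Rinv_le_contravar; nra.
Qed.

Lemma bump_far e u : 0 < e -> 1 <= u -> Rpower u (- e - 1) <= 4 / e * bump e u.
Proof.
move=> e0 u1; set X := Rpower u e; have P : 1 <= X.
  by rewrite /X -(Rpower_O u); [apply: Rle_Rpower; lra | lra].
have P2 : 0 < Rpower u (e - 1) by exact: exp_pos.
have -> : Rpower u (- e - 1) = Rpower u (e - 1) * (/ X * / X).
  rewrite /X -!Rpower_Ropp -!Rpower_plus; congr Rpower; ring.
have -> : 4 / e * bump e u = Rpower u (e - 1) * (4 * / (1 + X) ^ 2) by rewrite /bump -/X; field; lra.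
apply: Rmult_le_compat_l; first lra.
have -> : / X * / X = 4 * / (2 * X) ^ 2 by field; lra.
apply: Rmult_le_compat_l; first lra.
apply: Rinv_le_contravar; nra.
Qed.

Lemma Int_power_bounds (f : R -> R) B e : 0 < e -> 0 <= B -> (forall u, 0 < u -> continuous f u) ->
  (forall u, 0 < u <= 1 -> Rabs (f u) <= B * Rpower u (e - 1)) ->
  (forall u, 1 <= u -> Rabs (f u) <= B * Rpower u (- e - 1)) ->
  exists l, Int f l /\ Rabs l <= B * (4 / e).
Proof.
move=> e0 B0 cf h1 h2.
apply: (Int_dominated f (fun u => B * (4 / e) * bump e u)) => //; last first.
  rewrite -{2}(Rmult_1_r (B * _)); apply: Int_scal; exact: bump_Int.
move=> u hu; rewrite Rmult_assoc; case: (Rle_dec u 1) => c.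
  by apply: Rle_trans (h1 u (conj hu c)) _; apply: Rmult_le_compat_l => //; exact: bump_near.
have c' : 1 <= u by lra.
by apply: Rle_trans (h2 u c') _; apply: Rmult_le_compat_l => //; exact: bump_far.
Qed.

(** * Hadamard finite parts *)

(* The exponent 0 is not a singular term: its coefficient belongs to the constant [cst]. *)
Definition pw1 (a u : R) : R := match Req_dec_T a 0 with left _ => 0 | right _ => Rpower u a end.
Fixpoint gp (L : list (R * R)) (u : R) : R :=
  match L with [] => 0 | (d, a) :: L' => d * pw1 a u + gp L' u end.
Fixpoint cst (L : list (R * R)) : R :=
  match L with [] => 0 | (d, a) :: L' => match Req_dec_T a 0 with left _ => d | right _ => 0 end + cst L' end.

(* Hadamard's finite part of the integral of f over (0, oo); no exponent 0 may be hidden in the divergent part [gp L + d0 ln]. *)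
Definition FPI (f : R -> R) (l : R) : Prop := exists F L d0,
  (forall u, 0 < u -> is_derive F u (f u)) /\ is_lim F p_infty 0 /\
  filterlim (fun u => - F u - gp L u - d0 * ln u) (at_right 0) (locally l).

Definition gscal (c : R) (L : list (R * R)) := map (fun p => (c * fst p, snd p)) L.

Lemma gp_scal c L u : gp (gscal c L) u = c * gp L u.
Proof. elim: L => [|[d a] L IH] /=; [ring | rewrite IH; ring]. Qed.

Lemma gp_app L M u : gp (L ++ M) u = gp L u + gp M u.
Proof. elim: L => [|[d a] L IH] /=; [ring | rewrite IH; ring]. Qed.

(** The operator f(u) -> f(2u) - 2^a f(u) on sums of powers: it multiplies each coefficient and
    annihilates the exponent a. *)
Definition Tlist (a : R) (L : list (R * R)) := map (fun p => (fst p * (Rpower 2 (snd p) - Rpower 2 a), snd p)) L.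

Lemma gp_T a L u : 0 < u -> gp (Tlist a L) u = gp L (2 * u) - Rpower 2 a * gp L u.
Proof.
move=> hu; elim: L => [|[d c] L IH] /=; first ring.
rewrite IH /pw1; case: Req_dec_T => h; first ring.
rewrite -Rpower_mult_distr; try lra; ring.
Qed.

Lemma at_right_scal c : 0 < c -> filterlim (fun u => c * u) (at_right 0) (at_right 0).
Proof.
move=> hc P [e He]; exists (mkposreal (e / c) (Rdiv_lt_0_compat _ _ (cond_pos e) hc)) => y hy y0.
apply: He; last nra.
change (Rabs (c * y - 0) < e); have hy' : Rabs (y - 0) < e / c by exact: hy.
rewrite Rminus_0_r Rabs_mult (Rabs_pos_eq c); last lra.
rewrite Rminus_0_r in hy'; apply: (Rlt_le_trans _ (c * (e / c))); first exact: Rmult_lt_compat_l.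
by right; field; lra.
Qed.

Lemma at_right_pos : at_right 0 (fun u => 0 < u).
Proof. by exists (mkposreal 1 Rlt_0_1). Qed.

Lemma filterlim_at_right_ext (f g : R -> R) l : (forall u, 0 < u -> f u = g u) ->
  filterlim f (at_right 0) (locally l) -> filterlim g (at_right 0) (locally l).
Proof.
move=> h; apply: filterlim_ext_loc; apply: filter_imp at_right_pos => u hu; exact: h.
Qed.

Lemma filterlim_Rscal {T} (F : (T -> Prop) -> Prop) {FF : Filter F} (f : T -> R) c l :
  filterlim f F (locally l) -> filterlim (fun x => c * f x) F (locally (c * l)).
Proof. move=> h; exact: filterlim_comp h (filterlim_scal_r (K := R_AbsRing) (V := R_NormedModule) c l). Qed.

(** Comparing u with 2u removes one exponent at a time and multiplies the limit by 1 - 2^a, which is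
    nonzero for a <> 0. *)
Lemma gp_lim_0 n L l : (length L <= n)%nat -> filterlim (gp L) (at_right 0) (locally l) -> l = 0.
Proof.
elim: n L l => [|n IH] L l; case: L => [|[d a] L].
- move=> _ h; symmetry; exact: (filterlim_locally_unique (fun _ => 0) _ _ (filterlim_const 0) h).
- by move=> /= hl; lia.
- move=> _ h; symmetry; exact: (filterlim_locally_unique (fun _ => 0) _ _ (filterlim_const 0) h).
move=> /= hl h; case: (Req_dec_T a 0) => ha.
  apply: (IH L); first lia.
  apply: filterlim_ext h => u; rewrite /pw1; case: Req_dec_T => // _; ring.
have H : (1 - Rpower 2 a) * l = 0.
  apply: (IH (Tlist a L)); first by rewrite /Tlist length_map; lia.
  have -> : (1 - Rpower 2 a) * l = l + (- Rpower 2 a) * l by ring.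
  have h2 := filterlim_comp _ _ _ _ _ _ _ _ (at_right_scal 2 ltac:(lra)) h.
  apply: (filterlim_at_right_ext _ _ _ _ (filterlim_Rplus _ _ _ _ _ h2 (filterlim_Rscal _ _ (- Rpower 2 a) _ h))).
  move=> u hu; have := gp_T a ((d, a) :: L) u hu; rewrite /= => E.
  have E2 : d * (Rpower 2 a - Rpower 2 a) * pw1 a u = 0 by ring.
  lra.
case: (Rmult_integral _ _ H) => // E; exfalso.
have E2 : exp (a * ln 2) = exp 0 by rewrite exp_0 -/(Rpower 2 a); lra.
have := exp_inv _ _ E2; have := ln_lt_2 => l2 E3; case: (Rmult_integral _ _ E3); lra.
Qed.

Lemma gp_ln_lim_0 L d0 l : filterlim (fun u => gp L u + d0 * ln u) (at_right 0) (locally l) -> l = 0.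
Proof.
move=> h; have D : - (d0 * ln 2) = 0.
  apply: (gp_lim_0 _ (Tlist 0 L) _ (Nat.le_refl _)).
  have h2 := filterlim_comp _ _ _ _ _ _ _ _ (at_right_scal 2 ltac:(lra)) h.
  have -> : - (d0 * ln 2) = l + (-1 * l + - (d0 * ln 2)) by ring.
  apply: (filterlim_at_right_ext _ _ _ _ (filterlim_Rplus _ _ _ _ _ h2 (filterlim_Rplus _ _ _ _ _ (filterlim_Rscal _ _ (-1) _ h) (filterlim_const (- (d0 * ln 2)))))).
  move=> u hu; rewrite gp_T // Rpower_O; last lra.
  rewrite ln_mult; try lra; ring.
have l2 := ln_lt_2; have H : d0 * ln 2 = 0 by lra.
have d00 : d0 = 0 by case: (Rmult_integral _ _ H) => ?; lra.
apply: (gp_lim_0 _ L _ (Nat.le_refl _)); apply: filterlim_ext h => u; rewrite d00; ring.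
Qed.

Lemma zero_derive_lim (F : R -> R) : (forall u, 0 < u -> is_derive F u 0) -> is_lim F p_infty 0 ->
  forall u, 0 < u -> F u = 0.
Proof.
move=> h1 h2 u hu; apply: Rle_antisym.
  by apply: (mono_le_lim F 0) => // x y; apply: (mono_pos F (fun _ => 0)) => // *; lra.
have m : forall x y, 0 < x <= y -> - F x <= - F y.
  apply: (mono_pos (fun u => - F u) (fun _ => - 0)); last by move=> *; lra.
  by move=> x hx; apply: is_derive_opp; exact: h1.
have L : is_lim (fun u => - F u) p_infty 0.
  have -> : Finite 0 = Rbar_opp 0 by rewrite /= Ropp_0.
  exact: is_lim_opp.
have := mono_le_lim (fun u => - F u) 0 m L u hu; lra.
Qed.

(** Two primitives that vanish at infinity coincide, so the singular parts differ by powers and a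
    logarithm with limit l - m, which [gp_ln_lim_0] forces to be 0. *)
Lemma FPI_unique f l m : FPI f l -> FPI f m -> l = m.
Proof.
move=> [F [L [d0 [f1 [f2 f3]]]]] [G [M [e0 [g1 [g2 g3]]]]].
have E : forall u, 0 < u -> F u + - G u = 0.
  apply: (zero_derive_lim (fun u => F u + - G u)).
    move=> u hu; rewrite -(Rplus_opp_r (f u)); apply: is_derive_plus; first exact: f1.
    by apply: is_derive_opp; exact: g1.
  have -> : Finite 0 = Finite (0 + - 0) by congr Finite; ring.
  apply: is_lim_plus' => //; exact: (is_lim_opp _ _ 0).
have : l + -1 * m = 0; last lra.
apply: (gp_ln_lim_0 (gscal (-1) L ++ M) (e0 - d0)).
apply: (filterlim_at_right_ext _ _ _ _ (filterlim_Rplus _ _ _ _ _ f3 (filterlim_Rscal _ _ (-1) _ g3))) => u hu.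
rewrite gp_app gp_scal; have := E u hu; lra.
Qed.

Lemma FPI_ext f g l : (forall u, 0 < u -> f u = g u) -> FPI f l -> FPI g l.
Proof. by move=> E [F [L [d0 [h1 h2]]]]; exists F, L, d0; split => // u hu; rewrite -E //; exact: h1. Qed.

Lemma FPI_Int f l : Int f l -> FPI f l.
Proof.
move=> [F [h1 [h2 h3]]]; exists F, [], 0; split => //; split => //=.
rewrite -(Ropp_involutive l) (_ : - - l = -1 * - l); last ring.
apply: (filterlim_ext (fun u => -1 * F u)); first by move=> u; ring.
exact: filterlim_Rscal.
Qed.

Lemma FPI_scal c f l : FPI f l -> FPI (fun u => c * f u) (c * l).
Proof.
move=> [F [L [d0 [h1 [h2 h3]]]]]; exists (fun u => c * F u), (gscal c L), (c * d0); split.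
  by move=> u hu; apply: is_derive_scal; exact: h1.
split.
  have -> : Finite 0 = Rbar_mult c 0 by rewrite /= Rmult_0_r.
  exact: is_lim_scal_l.
apply: (filterlim_ext (fun u => c * (- F u - gp L u - d0 * ln u))); last exact: filterlim_Rscal.
move=> u; rewrite gp_scal; ring.
Qed.

Lemma FPI_plus f g l m : FPI f l -> FPI g m -> FPI (fun u => f u + g u) (l + m).
Proof.
move=> [F [L [d0 [f1 [f2 f3]]]]] [G [M [e0 [g1 [g2 g3]]]]].
exists (fun u => F u + G u), (L ++ M), (d0 + e0); split.
  by move=> u hu; apply: is_derive_plus; [exact: f1 | exact: g1].
split.
  have -> : Finite 0 = Finite (0 + 0) by congr Finite; ring.
  exact: is_lim_plus'.
apply: (filterlim_ext _ _ _ (filterlim_Rplus _ _ _ _ _ f3 g3)) => u; rewrite gp_app; ring.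
Qed.

Lemma FPI_rsum (f : nat -> R -> R) (l : nat -> R) n : (forall i, (i < n)%nat -> FPI (f i) (l i)) ->
  FPI (fun u => rsum (fun i => f i u) n) (rsum l n).
Proof.
elim: n => [|n IH] h.
  apply: FPI_Int; have := Int_scal 0 _ _ (bump_Int 1 Rlt_0_1); rewrite Rmult_0_l.
  by apply: Int_ext => u _; rewrite Rmult_0_l.
by apply: (FPI_plus (fun u => rsum (fun i => f i u) n)); [apply: IH => i hi; apply: h; lia | apply: h].
Qed.

Lemma gp_cst L u : 0 < u -> gp L u + cst L = fold_right (fun p s => fst p * Rpower u (snd p) + s) 0 L.
Proof.
move=> hu; elim: L => [|[d a] L IH] /=; first ring.
rewrite -IH /pw1; case: Req_dec_T => h; last ring.
rewrite h Rpower_O //; ring.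
Qed.

Fixpoint glist (d a : nat -> R) (n : nat) : list (R * R) :=
  match n with O => [] | S k => (d k, a k) :: glist d a k end.

Lemma gp_glist d a n u : 0 < u -> gp (glist d a n) u + cst (glist d a n) = rsum (fun i => d i * Rpower u (a i)) n.
Proof. move=> hu; rewrite gp_cst //; elim: n => [|n IH] //=; rewrite IH; ring. Qed.

Lemma cst_none d a n : (forall i, (i < n)%nat -> a i <> 0) -> cst (glist d a n) = 0.
Proof.
elim: n => [|n IH] h //=; rewrite IH; last by move=> i hi; apply: h; lia.
case: Req_dec_T => E; [by case: (h n (Nat.lt_succ_diag_r n)) | ring].
Qed.

Lemma cst_one d a n r : (r < n)%nat -> a r = 0 -> (forall i, (i < n)%nat -> i <> r -> a i <> 0) ->
  cst (glist d a n) = d r.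
Proof.
elim: n => [|n IH] hr ar h; first lia.
case: (Nat.eq_dec r n) => E /=.
  rewrite -E cst_none; last by move=> i hi; apply: h; lia.
  case: Req_dec_T => E2; [ring | by case: E2].
rewrite IH //; [| lia | by move=> i hi; apply: h; lia].
by case: Req_dec_T => E2; [case: (h n ltac:(lia) ltac:(lia)) | ring].
Qed.

Lemma cst_app L M : cst (L ++ M) = cst L + cst M.
Proof. elim: L => [|[d a] L IH] /=; [ring | rewrite IH; ring]. Qed.

(* Only the coefficient of u^0 at the origin survives the finite part of an exact derivative. *)
Lemma FPI_FTC (G g : R -> R) L d0 : (forall u, 0 < u -> is_derive G u (g u)) -> is_lim G p_infty 0 ->
  filterlim (fun u => G u - (gp L u + cst L) - d0 * ln u) (at_right 0) (locally 0) -> FPI g (- cst L).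
Proof.
move=> h1 h2 h3; exists G, (gscal (-1) L), (- d0); split => //; split => //.
have -> : - cst L = -1 * 0 + - cst L by ring.
apply: (filterlim_ext _ _ _ (filterlim_Rplus _ _ _ _ _ (filterlim_Rscal _ _ (-1) _ h3) (filterlim_const (- cst L)))) => u.
rewrite gp_scal; ring.
Qed.

(** * Mellin transforms of K *)

Definition kap (b mu u : R) : R := Re (Kf mu (RtoC b * RtoC u)%C).
Definition eR (mu x : R) : R := PSeries (Ec mu) x.
Definition eT (mu x : R) (n : nat) : R := rsum (fun i => Ec mu i * x ^ i) n.
(** Majorizes the series in chi u^2 for u <= 2; the radius 4 chi is where the gain (u/2)^(2n), and
    with it the error 4^(-R), comes from. *)
Definition CE (b mu : R) : R := Series (fun n => Rabs (Ec mu n) * (4 * chi_ b) ^ n).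
Definition Lr (b mu u : R) : R := Acf b mu * (Rpower u mu * eR mu (chi_ b * u ^ 2)).

Lemma chi_pos b : 0 < b -> 0 < chi_ b.
Proof. move=> h; rewrite /chi_; have := pow_lt b 2 h; lra. Qed.

Lemma Lf_Lr b mu u : 0 < b -> nonint mu -> 0 < u -> Lf mu (RtoC b * RtoC u)%C = RtoC (Lr b mu u).
Proof.
move=> hb h hu; rewrite Lf_scaled // Cpower_RtoC //.
have -> : (RtoC (chi_ b) * (RtoC u * RtoC u))%C = RtoC (chi_ b * u ^ 2) by rewrite -!RtoC_mult; congr RtoC; ring.
rewrite CPS_RtoC; last by apply: entire_Ec; exact: nonint_1p.
by rewrite -!RtoC_mult.
Qed.

Lemma Kf_kap b mu u : 0 < b -> nonint mu -> 0 < u -> Kf mu (RtoC b * RtoC u)%C = RtoC (Lr b mu u + Lr b (- mu) u).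
Proof.
move=> hb h hu; rewrite /Kf !Lf_Lr // ?RtoC_plus //; exact: nonint_opp.
Qed.

Lemma kap_Lr b mu u : 0 < b -> nonint mu -> 0 < u -> kap b mu u = Lr b mu u + Lr b (- mu) u.
Proof. by move=> hb h hu; rewrite /kap Kf_kap. Qed.

Lemma Kf_kap_R b mu u : 0 < b -> nonint mu -> 0 < u -> Kf mu (RtoC b * RtoC u)%C = RtoC (kap b mu u).
Proof. by move=> hb h hu; rewrite Kf_kap // kap_Lr. Qed.

Lemma kap_even b mu u : kap b (- mu) u = kap b mu u.
Proof. by rewrite /kap Kf_even. Qed.

Lemma kap_pos b mu u : 0 < b -> nonint mu -> 0 < u -> 0 < kap b mu u.
Proof. move=> hb h hu; rewrite /kap -RtoC_mult; apply: Kf_RtoC_pos => //; nra. Qed.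

Lemma Rabs_rsum_le f g n : (forall i, (i < n)%nat -> Rabs (f i) <= g i) -> Rabs (rsum f n) <= rsum g n.
Proof.
elim: n => [|n IH] h /=; first by rewrite Rabs_R0; lra.
apply: Rle_trans (Rabs_triang _ _) _; apply: Rplus_le_compat; [apply: IH => i hi|]; apply: h; lia.
Qed.

Lemma CE_series b mu : 0 < b -> nonint mu -> is_series (fun n => Rabs (Ec mu n) * (4 * chi_ b) ^ n) (CE b mu).
Proof.
move=> hb h; apply: Series_correct; apply: (entire_Ec _ (nonint_1p _ h)); have := chi_pos b hb; lra.
Qed.

Lemma CE_ge0 b mu : 0 < b -> nonint mu -> 0 <= CE b mu.
Proof.
move=> hb h; apply: (is_series_ge0 _ _ (CE_series b mu hb h)) => n; apply: Rmult_le_pos; first exact: Rabs_pos.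
apply: pow_le; have := chi_pos b hb; lra.
Qed.

Lemma scaled_pow b u i : (chi_ b * u ^ 2) ^ i = (4 * chi_ b) ^ i * (u / 2) ^ (2 * i).
Proof. rewrite (pow_mult (u / 2)) -Rpow_mult_distr; congr (_ ^ _); field. Qed.

(** Each term beyond the n-th is (u/2)^(2i) times a term at radius 4 chi, and (u/2)^(2i) <=
    (u/2)^(2n) for u <= 2. *)
Lemma eR_tail b mu u n : 0 < b -> nonint mu -> 0 < u <= 2 ->
  Rabs (eR mu (chi_ b * u ^ 2) - eT mu (chi_ b * u ^ 2) n) <= (u / 2) ^ (2 * n) * CE b mu.
Proof.
move=> hb h hu; set x := chi_ b * u ^ 2; have c0 := chi_pos b hb.
have ent := entire_Ec _ (nonint_1p _ h).
have x0 : 0 <= x by rewrite /x; nra.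
have E := CPS_split _ (RtoC x) n ent.
rewrite CPS_RtoC // (CPS_RtoC (fun i => Ec mu (i + n)%nat)) in E; last exact: entire_shiftn.
have E2 : csum (fun k => RtoC (Ec mu k) * RtoC x ^ k)%C n = RtoC (eT mu x n).
  rewrite /eT; elim: n {E} => [|n IH] //=; by rewrite IH RtoC_plus RtoC_mult RtoC_pow.
rewrite E2 -RtoC_pow -RtoC_mult -RtoC_plus in E; move/RtoC_inj: E => E.
rewrite /eR E (_ : eT mu x n + x ^ n * PSeries (fun i => Ec mu (i + n)%nat) x - eT mu x n = x ^ n * PSeries (fun i => Ec mu (i + n)%nat) x); last ring.
have B := CPS_bound _ (RtoC x) (4 * chi_ b) (entire_shiftn _ n ent).
rewrite CPS_RtoC in B; last exact: entire_shiftn.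
have x4 : x <= 4 * chi_ b by rewrite /x; have : u ^ 2 <= 4; nra.
have {}B := B ltac:(by rewrite Cmod_R Rabs_pos_eq).
rewrite Rabs_mult (Rabs_pos_eq (x ^ n)); last exact: pow_le.
rewrite Cmod_R in B.
apply: (Rle_trans _ (x ^ n * Series (fun i => Rabs (Ec mu (i + n)%nat) * (4 * chi_ b) ^ i))).
  by apply: Rmult_le_compat_l; first exact: pow_le.
rewrite /x scaled_pow -/x (Rmult_comm (_ ^ n)) Rmult_assoc; apply: Rmult_le_compat_l; first by apply: pow_le; lra.
rewrite -Series_scal_l.
have S1 : is_series (fun i => Rabs (Ec mu (i + n)%nat) * (4 * chi_ b) ^ (i + n)) (CE b mu - rsum (fun i => Rabs (Ec mu i) * (4 * chi_ b) ^ i) n).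
  elim: n {E E2 B} => [|n IH].
    rewrite /= Rminus_0_r; apply: is_series_ext (CE_series b mu hb h) => i; by rewrite Nat.add_0_r.
  have := is_series_incr_1 (fun i => Rabs (Ec mu (i + n)%nat) * (4 * chi_ b) ^ (i + n)) (CE b mu - rsum (fun i => Rabs (Ec mu i) * (4 * chi_ b) ^ i) (S n)).
  move=> H; apply: (is_series_ext (fun i => Rabs (Ec mu (S i + n)%nat) * (4 * chi_ b) ^ (S i + n))).
    by move=> i; rewrite Nat.add_succ_comm.
  apply: H; rewrite /plus /= (_ : CE b mu - (rsum (fun i => Rabs (Ec mu i) * (4 * chi_ b) ^ i) n + Rabs (Ec mu n) * (4 * chi_ b) ^ n) + Rabs (Ec mu n) * (4 * chi_ b) ^ n = CE b mu - rsum (fun i => Rabs (Ec mu i) * (4 * chi_ b) ^ i) n) //; ring.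
rewrite (Series_ext _ (fun i => Rabs (Ec mu (i + n)%nat) * (4 * chi_ b) ^ (i + n))); last by move=> i; rewrite pow_add; ring.
rewrite (is_series_unique _ _ S1).
suff : 0 <= rsum (fun i => Rabs (Ec mu i) * (4 * chi_ b) ^ i) n by lra.
apply: Rle_trans (Rabs_rsum_le (fun i => Rabs (Ec mu i) * (4 * chi_ b) ^ i) _ n _); first exact: Rabs_pos.
move=> i _; rewrite Rabs_pos_eq; first lra.
apply: Rmult_le_pos; [exact: Rabs_pos | apply: pow_le; lra].
Qed.

Lemma Lr_near b mu u : 0 < b -> nonint mu -> 0 < u <= 2 -> Rabs (Lr b mu u) <= Rabs (Acf b mu) * CE b mu * Rpower u mu.
Proof.
move=> hb h hu; have := eR_tail b mu u 0 hb h hu; rewrite /eT [rsum _ 0]/= Rminus_0_r Nat.mul_0_r pow_O Rmult_1_l => H.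
have p : 0 < Rpower u mu by exact: exp_pos.
have A0 := Rabs_pos (Acf b mu).
rewrite /Lr (Rabs_mult (Acf b mu)) (Rabs_mult (Rpower u mu)) (Rabs_pos_eq (Rpower u mu)); last lra.
have -> : Rabs (Acf b mu) * CE b mu * Rpower u mu = Rabs (Acf b mu) * (Rpower u mu * CE b mu) by ring.
by apply: Rmult_le_compat_l => //; apply: Rmult_le_compat_l => //; lra.
Qed.

Lemma Rpower_near_le u s t : 0 < u <= 1 -> t <= s -> Rpower u s <= Rpower u t.
Proof.
move=> hu hst; rewrite /Rpower; have : ln u <= 0 by rewrite -ln_1; apply: ln_le; lra.
move=> h; have : s * ln u <= t * ln u by nra.
by case=> [l|->]; [left; exact: exp_increasing | lra].
Qed.

Lemma kap_near b mu : 0 < b -> nonint mu -> exists B, 0 <= B /\ forall u, 0 < u <= 1 -> Rabs (kap b mu u) <= B * Rpower u (- Rabs mu).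
Proof.
move=> hb h; set B1 := Rabs (Acf b mu) * CE b mu; set B2 := Rabs (Acf b (- mu)) * CE b (- mu).
have h' := nonint_opp _ h.
have p1 : 0 <= B1 by apply: Rmult_le_pos; [exact: Rabs_pos | exact: CE_ge0].
have p2 : 0 <= B2 by apply: Rmult_le_pos; [exact: Rabs_pos | exact: CE_ge0].
exists (B1 + B2); split; first lra.
move=> u hu; rewrite kap_Lr //; last lra.
apply: Rle_trans (Rabs_triang _ _) _; rewrite Rmult_plus_distr_r; apply: Rplus_le_compat.
  apply: Rle_trans (Lr_near b mu u hb h ltac:(lra)) _; apply: Rmult_le_compat_l => //; apply: Rpower_near_le => //.
  have := Rle_abs (- mu); rewrite Rabs_Ropp; lra.
apply: Rle_trans (Lr_near b (- mu) u hb h' ltac:(lra)) _; apply: Rmult_le_compat_l => //; apply: Rpower_near_le => //.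
have := Rle_abs mu; lra.
Qed.

Lemma Sect_RtoC u : 0 < u -> Sect 1 (RtoC u).
Proof. by move=> hu; split => //; rewrite /Re /= Cmod_R Rabs_pos_eq; lra. Qed.

Lemma kap_far b mu al : 0 < b -> nonint mu -> exists B, 0 <= B /\ forall u, 1 <= u -> Rabs (kap b mu u) <= B * Rpower u al.
Proof.
move=> hb h; have [B [B0 H]] := Sm_bound _ _ _ _ (Sm_Kf_far 1 b 0 mu al ltac:(lra) hb h).
exists B; split => // u hu; have hf : Far 1 (RtoC u).
  by split; [apply: Sect_RtoC; lra | rewrite Cmod_R Rabs_pos_eq; lra].
have := H _ hf; rewrite Kf_kap_R //; last lra.
rewrite !Cmod_R (Rabs_pos_eq u) //; lra.
Qed.

Lemma kap_derive0 b mu u : 0 < b -> nonint mu -> 0 < u -> is_derive (kap b mu) u (mu / u * kap b mu u - b * kap b (mu + 1) u).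
Proof.
move=> hb h hu; have hbu : 0 < Re (RtoC b * RtoC u)%C by rewrite -RtoC_mult /Re /=; nra.
have C1 := Cder_comp (Kf mu) (fun w => RtoC b * w)%C (RtoC u) _ _ (Cder_scal (RtoC b) _ _ _ (Cder_id (RtoC u))) (Cder_Kf mu _ h hbu).
have [H _] := Cder_curve (fun w => Kf mu (RtoC b * w))%C (fun s => s) u _ 1 C1 (is_derive_id u).
move: H; rewrite !Kf_kap_R //; last exact: nonint_S.
rewrite -/(kap b mu) /kap; set k1 := Re (Kf mu _); set k2 := Re (Kf (mu + 1) _).
have -> : Re ((RtoC mu * / (RtoC b * RtoC u) * RtoC k1 - RtoC k2) * (RtoC b * 1) * 1)%C = mu / u * k1 - b * k2; last by [].
rewrite -RtoC_mult -RtoC_inv; last by nra.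
rewrite !Cmult_1_r -!RtoC_mult -RtoC_minus -RtoC_mult /Re /=; field; lra.
Qed.

Lemma kap_derive b mu s u : 0 < b -> nonint mu -> 0 < u ->
  is_derive (fun u => Rpower u s * kap b mu u) u ((s + mu) * (Rpower u (s - 1) * kap b mu u) - b * (Rpower u s * kap b (mu + 1) u)).
Proof.
move=> hb h hu.
have := is_derive_mult _ _ _ _ _ (is_derive_Rpower s u hu) (kap_derive0 b mu u hb h hu) Rmult_comm.
rewrite /plus /mult /= => H.
have E : Rpower u s = u * Rpower u (s - 1).
  by rewrite -{2}(Rpower_1 u hu) -Rpower_plus; congr Rpower; ring.
have -> : (s + mu) * (Rpower u (s - 1) * kap b mu u) - b * (Rpower u s * kap b (mu + 1) u) =
  s * Rpower u (s - 1) * kap b mu u + Rpower u s * (mu / u * kap b mu u - b * kap b (mu + 1) u) => //.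
rewrite E; field; lra.
Qed.

Lemma kap_derive_m b mu s u : 0 < b -> nonint mu -> 0 < u ->
  is_derive (fun u => Rpower u s * kap b mu u) u ((s - mu) * (Rpower u (s - 1) * kap b mu u) - b * (Rpower u s * kap b (mu - 1) u)).
Proof.
move=> hb h hu; have := kap_derive b (- mu) s u hb (nonint_opp _ h) hu.
have -> : - mu + 1 = - (mu - 1) by ring.
rewrite !kap_even; apply: is_derive_ext => t; by rewrite kap_even.
Qed.

Lemma continuous_Rpower s u : 0 < u -> continuous (fun u => Rpower u s) u.
Proof. move=> h; apply: ex_derive_continuous; eexists; exact: is_derive_Rpower. Qed.

Lemma kap_cont b mu u : 0 < b -> nonint mu -> 0 < u -> continuous (kap b mu) u.
Proof. move=> hb h hu; apply: ex_derive_continuous; eexists; exact: kap_derive0. Qed.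

Lemma pkap_lim_oo b mu s : 0 < b -> nonint mu -> is_lim (fun u => Rpower u s * kap b mu u) p_infty 0.
Proof.
move=> hb h; have [B [B0 H]] := kap_far b mu (- s - 2) hb h.
apply: (is_lim_dominated _ (fun t => B / t ^ 2)); last exact: is_lim_inv_sq.
move=> t ht; rewrite Rabs_mult Rabs_pos_eq; last by left; exact: exp_pos.
have -> : B / t ^ 2 = Rpower t s * (B * Rpower t (- s - 2)).
  rewrite /Rdiv -(Rpower_pow 2) -?Rpower_Ropp; last lra.
  rewrite (_ : - INR 2 = s + (- s - 2)); last by rewrite /=; ring.
  rewrite Rpower_plus; ring.
by apply: Rmult_le_compat_l; [left; exact: exp_pos | exact: H].
Qed.

Lemma filterlim_dominated_0 (f g : R -> R) : (forall u, 0 < u <= 1 -> Rabs (f u) <= g u) ->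
  filterlim g (at_right 0) (locally 0) -> filterlim f (at_right 0) (locally 0).
Proof.
move=> h hg; apply/filterlim_locally => e.
have /filterlim_locally/(_ e) [d Hd] := hg.
exists (mkposreal _ (Rmin_glb_lt d 1 0 (cond_pos d) Rlt_0_1)) => u hu u0.
have hu' : Rabs (u - 0) < Rmin d 1 by exact: hu.
have u1 : u < 1 by have := Rmin_r d 1; move: hu' => /Rabs_def2; lra.
have ud : Rabs (u - 0) < d by have := Rmin_l d 1; lra.
have G := Hd u ud u0; have G' : Rabs (g u - 0) < e by exact: G.
change (Rabs (f u - 0) < e); rewrite Rminus_0_r; apply: Rle_lt_trans (h u ltac:(lra)) _.
rewrite Rminus_0_r in G'; apply: Rle_lt_trans G'; exact: Rle_abs.
Qed.

Lemma filterlim_scaled_power_0 B e : 0 < e -> filterlim (fun u => B * Rpower u e) (at_right 0) (locally 0).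
Proof. move=> e0; have := filterlim_Rscal _ _ B _ (Rpower_to_0 e e0); rewrite Rmult_0_r; exact. Qed.

Lemma pkap_lim_0 b mu s : 0 < b -> nonint mu -> Rabs mu < s -> filterlim (fun u => Rpower u s * kap b mu u) (at_right 0) (locally 0).
Proof.
move=> hb h hs; have [B [B0 H]] := kap_near b mu hb h.
apply: (filterlim_dominated_0 _ (fun u => B * Rpower u (s - Rabs mu))); last by apply: filterlim_scaled_power_0; lra.
move=> u hu; rewrite Rabs_mult Rabs_pos_eq; last by left; exact: exp_pos.
rewrite Rpower_plus -Rmult_assoc (Rmult_comm B) Rmult_assoc; apply: Rmult_le_compat_l; [left; exact: exp_pos | exact: H].
Qed.

Lemma Mellin_ex b mu s : 0 < b -> nonint mu -> Rabs mu < s -> exists l, Int (fun u => Rpower u (s - 1) * kap b mu u) l.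
Proof.
move=> hb h hs; set e := s - Rabs mu; have e0 : 0 < e by rewrite /e; lra.
have [B1 [p1 H1]] := kap_near b mu hb h; have [B2 [p2 H2]] := kap_far b mu (- s - e) hb h.
have [l [Hl _]] : exists l, Int (fun u => Rpower u (s - 1) * kap b mu u) l /\ Rabs l <= (B1 + B2) * (4 / e); last by exists l.
have pp : forall u a, 0 <= Rpower u a by move=> u a; left; exact: exp_pos.
apply: Int_power_bounds => //; first lra.
- move=> u hu; apply: (continuous_mult (K := R_AbsRing)); [exact: continuous_Rpower | exact: kap_cont].
- move=> u hu; rewrite Rabs_mult Rabs_pos_eq; last exact: pp.
  rewrite (_ : e - 1 = (s - 1) + - Rabs mu); last by rewrite /e; ring.
  rewrite Rpower_plus -Rmult_assoc (Rmult_comm (B1 + B2)) Rmult_assoc; apply: Rmult_le_compat_l; first exact: pp.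
  apply: Rle_trans (H1 u hu) _; apply: Rmult_le_compat_r; [exact: pp | lra].
move=> u hu; rewrite Rabs_mult Rabs_pos_eq; last exact: pp.
rewrite (_ : - e - 1 = (s - 1) + (- s - e)); last by ring.
rewrite Rpower_plus -Rmult_assoc (Rmult_comm (B1 + B2)) Rmult_assoc; apply: Rmult_le_compat_l; first exact: pp.
apply: Rle_trans (H2 u hu) _; apply: Rmult_le_compat_r; [exact: pp | lra].
Qed.

Lemma Mellin_up b mu s l : 0 < b -> nonint mu -> Rabs mu < s ->
  Int (fun u => Rpower u (s - 1) * kap b mu u) l -> Int (fun u => Rpower u s * kap b (mu + 1) u) ((s + mu) / b * l).
Proof.
move=> hb h hs hl.
have H : Int (fun u => (s + mu) * (Rpower u (s - 1) * kap b mu u) - b * (Rpower u s * kap b (mu + 1) u)) (- 0).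
  apply: (Int_FTC (fun u => Rpower u s * kap b mu u)); [by move=> u hu; exact: kap_derive | exact: pkap_lim_oo | exact: pkap_lim_0].
have := Int_plus _ _ _ _ (Int_scal ((s + mu) / b) _ _ hl) (Int_scal (- / b) _ _ H).
rewrite (_ : (s + mu) / b * l + - / b * - 0 = (s + mu) / b * l); last ring.
apply: Int_ext => u _; field; lra.
Qed.

Lemma Mellin_down b mu s l : 0 < b -> nonint mu -> Rabs mu < s ->
  Int (fun u => Rpower u (s - 1) * kap b mu u) l -> Int (fun u => Rpower u s * kap b (mu - 1) u) ((s - mu) / b * l).
Proof.
move=> hb h hs hl.
have hl' : Int (fun u => Rpower u (s - 1) * kap b (- mu) u) l by apply: Int_ext hl => u _; rewrite kap_even.
have := Mellin_up b (- mu) s l hb (nonint_opp _ h) ltac:(by rewrite Rabs_Ropp) hl'.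
apply: Int_ext => u _; by rewrite (_ : - mu + 1 = - (mu - 1)) ?kap_even //; ring.
Qed.

(** Chooses the value of the integral, so that Mellin transforms become functions of their
    parameter, as [bohr_mollerup] requires. *)
Definition IntV (f : R -> R) : R := epsilon (inhabits 0) (Int f).

Lemma IntV_spec f : (exists l, Int f l) -> Int f (IntV f).
Proof. exact: epsilon_spec. Qed.

(** The Mellin transform of K_q(bu) at s = 2 y + q, a parametrization in which y -> y + 1 has the
    multiplier y (y + q) / chi. *)
Definition MK (b q y : R) : R := IntV (fun u => Rpower u (2 * y + q - 1) * kap b q u).

Lemma MK_Int b q y : 0 < b -> 0 < q < 1 -> 0 < y -> Int (fun u => Rpower u (2 * y + q - 1) * kap b q u) (MK b q y).
Proof.
move=> hb hq hy; apply: IntV_spec; apply: Mellin_ex => //; first exact: nonint_01.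
rewrite Rabs_pos_eq; lra.
Qed.

(** The index is lowered from q to q - 1 and raised again; each recurrence adds one to the exponent
    of u. *)
Lemma MK_S b q y : 0 < b -> 0 < q < 1 -> 0 < y -> MK b q (y + 1) = y * (y + q) / chi_ b * MK b q y.
Proof.
move=> hb hq hy; have ni := nonint_01 q hq.
have H1 := Mellin_down b q (2 * y + q) _ hb ni ltac:(rewrite Rabs_pos_eq; lra) (MK_Int b q y hb hq hy).
have H1' : Int (fun u => Rpower u (2 * y + q + 1 - 1) * kap b (q - 1) u) ((2 * y + q - q) / b * MK b q y).
  by apply: Int_ext H1 => u _; congr (Rpower u _ * _); ring.
have H2 := Mellin_up b (q - 1) (2 * y + q + 1) _ hb ltac:(rewrite (_ : q - 1 = q - INR 1); [exact: nonint_minus_nat | by []]) ltac:(rewrite Rabs_left; lra) H1'.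
have -> : y * (y + q) / chi_ b * MK b q y = (2 * y + q + 1 + (q - 1)) / b * ((2 * y + q - q) / b * MK b q y).
  rewrite /chi_; field; lra.
apply: Int_unique H2; apply: Int_ext (MK_Int b q (y + 1) hb hq ltac:(lra)) => u _.
by congr (Rpower u _ * kap b _ u); ring.
Qed.

Lemma MK_pos b q y : 0 < b -> 0 < q < 1 -> 0 < y -> 0 < MK b q y.
Proof.
move=> hb hq hy; apply: Int_pos (MK_Int b q y hb hq hy) => u hu.
by apply: Rmult_lt_0_compat; [exact: exp_pos | apply: kap_pos => //; exact: nonint_01].
Qed.

Lemma chi_S_pos b q y : 0 < b -> 0 < q -> 0 < y -> 0 < y * (y + q) / chi_ b.
Proof.
move=> hb hq hy; apply: Rdiv_lt_0_compat; last exact: chi_pos.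
by apply: Rmult_lt_0_compat; lra.
Qed.

Lemma MK_convex b q y t : 0 < b -> 0 < q < 1 -> 0 < y -> 0 <= t <= 1 ->
  MK b q (y + t) <= MK b q y * Rpower (y * (y + q) / chi_ b) t.
Proof.
move=> hb hq hy ht.
apply: (Int_logconvex _ _ _ _ _ _ _ _ _ ht _ _ (MK_Int b q y hb hq hy) (MK_Int b q (y + 1) hb hq _) (MK_Int b q (y + t) hb hq _)); try lra.
- by apply: chi_S_pos => //; lra.
- move=> u hu; left; apply: Rmult_lt_0_compat; [exact: exp_pos | apply: kap_pos => //; exact: nonint_01].
- exists 2; split; first lra.
  split=> u hu; rewrite -Rmult_assoc -Rpower_plus; congr (Rpower u _ * _); ring.
exact: MK_S.
Qed.

(** The function to be compared with [MK]: it has the same multiplier, and its convexity is that of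
    Gamma. *)
Definition GG (b q y : R) : R := Rpower (chi_ b) (- y) * (Gamma y * Gamma (y + q)).

Lemma GG_pos b q y : 0 < q -> 0 < y -> 0 < GG b q y.
Proof.
move=> hq hy; apply: Rmult_lt_0_compat; first exact: exp_pos.
by apply: Rmult_lt_0_compat; apply: Gamma_pos; lra.
Qed.

Lemma ratio_lim c x : is_lim_seq (fun n => (INR n + x + c) / (INR n + c)) 1.
Proof.
apply: (is_lim_seq_ext_loc (fun n => 1 + x * / (INR n + c))).
  have [n0 h] := nat_above (- c); exists n0 => n hn; have := le_INR _ _ hn => h2; field; lra.
have -> : Finite 1 = Finite (1 + 0) by congr Finite; ring.
apply: is_lim_seq_plus'; first exact: is_lim_seq_const.
have -> : Finite 0 = Rbar_mult x 0 by rewrite /= Rmult_0_r.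
apply: is_lim_seq_scal_l; have -> : Finite 0 = Rbar_inv p_infty by [].
apply: is_lim_seq_inv => //.
apply: (is_lim_seq_plus _ _ p_infty c) => //; [exact: is_lim_seq_INR | exact: is_lim_seq_const].
Qed.

Lemma MK_GG b q y : 0 < b -> 0 < q < 1 -> 0 < y <= 1 -> MK b q y * GG b q 1 = GG b q y * MK b q 1.
Proof.
move=> hb hq hy; have c0 := chi_pos b hb.
apply: (bohr_mollerup (fun y => y * (y + q) / chi_ b)) => //.
- by move=> z hz; apply: chi_S_pos => //; lra.
- by move=> z hz; apply: MK_pos.
- by move=> z hz; apply: GG_pos => //; lra.
- by move=> z hz; exact: MK_S.
- move=> z hz; rewrite /GG (_ : z + 1 + q = z + q + 1); last ring.
  rewrite !Gamma_S; try (apply: nonpole_pos; lra).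
  rewrite Ropp_plus_distr Rpower_plus (Rpower_Ropp _ 1) Rpower_1 //; field; lra.
- by move=> z t hz ht; exact: MK_convex.
- move=> z t hz ht; rewrite /GG.
  have -> : Rpower (z * (z + q) / chi_ b) t = Rpower z t * Rpower (z + q) t * Rpower (chi_ b) (- t).
    have zq : 0 < z * (z + q) by apply: Rmult_lt_0_compat; lra.
    rewrite /Rdiv -(Rpower_mult_distr _ _ t zq (Rinv_0_lt_compat _ c0)) -(Rpower_mult_distr z (z + q) t); try lra.
    congr (_ * _).
    rewrite /Rpower ln_Rinv //; congr exp; ring.
  rewrite Ropp_plus_distr Rpower_plus.
  have -> : Rpower (chi_ b) (- z) * (Gamma z * Gamma (z + q)) * (Rpower z t * Rpower (z + q) t * Rpower (chi_ b) (- t)) =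
    Rpower (chi_ b) (- z) * Rpower (chi_ b) (- t) * ((Gamma z * Rpower z t) * (Gamma (z + q) * Rpower (z + q) t)) by ring.
  apply: Rmult_le_compat_l; first by left; apply: Rmult_lt_0_compat; exact: exp_pos.
  rewrite (_ : z + t + q = z + q + t); last ring.
  apply: Rmult_le_compat; try (left; apply: Gamma_pos; lra); apply: Gamma_convex; lra.
apply: (is_lim_seq_ext_loc (fun n => ((INR n + y + 0) / (INR n + 0)) * ((INR n + y + q) / (INR n + q)))).
  exists 1%nat => n hn; have : 0 < INR n by apply: lt_0_INR; lia.
  move=> n0; field; lra.
have -> : Finite 1 = Finite (1 * 1) by congr Finite; ring.
apply: is_lim_seq_mult'; exact: ratio_lim.
Qed.

Lemma is_derive_GG b q y : 0 < b -> 0 < q -> 0 < y ->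
  is_derive (GG b q) y (GG b q y * (psi y + psi (y + q) - ln (chi_ b))).
Proof.
move=> hb hq hy.
have D1 : is_derive (fun y => Rpower (chi_ b) (- y)) y (Rpower (chi_ b) (- y) * - ln (chi_ b)).
  rewrite /Rpower; auto_derive => //; ring.
have D2 := is_derive_Gamma_pos y hy; have D3 : is_derive (fun y => Gamma (y + q)) y (Gamma (y + q) * digam (y + q)).
  have D := is_derive_Gamma_pos (y + q) ltac:(lra).
  have Dl : is_derive (fun y => y + q) y 1 by auto_derive => //; ring.
  have := is_derive_comp Gamma (fun y => y + q) y _ _ D Dl; rewrite /scal /= /mult /= Rmult_1_l; exact.
have := is_derive_mult _ _ _ _ _ D1 (is_derive_mult _ _ _ _ _ D2 D3 Rmult_comm) Rmult_comm.
rewrite /plus /mult /= /GG !psi_pos; try lra.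
have -> : Rpower (chi_ b) (- y) * (Gamma y * Gamma (y + q)) * (digam y + digam (y + q) - ln (chi_ b)) =
  Rpower (chi_ b) (- y) * - ln (chi_ b) * (Gamma y * Gamma (y + q)) +
  Rpower (chi_ b) (- y) * (Gamma y * digam y * Gamma (y + q) + Gamma y * (Gamma (y + q) * digam (y + q))) by ring.
exact.
Qed.

Lemma ln_abs_near e u : 0 < e -> 0 < u <= 1 -> Rabs (ln u) <= / e * Rpower u (- e).
Proof.
move=> e0 hu; have l0 : ln u <= 0 by rewrite -ln_1; apply: ln_le; lra.
have := exp_ineq1_le (- e * ln u); rewrite -/(Rpower u (- e)) => H.
rewrite Rabs_left1 //; apply: (Rmult_le_reg_l e) => //.
rewrite -Rmult_assoc Rinv_r; lra.
Qed.

Lemma ln_abs_far u : 1 <= u -> Rabs (ln u) <= u.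
Proof.
move=> hu; have l0 : 0 <= ln u by rewrite -ln_1; apply: ln_le; lra.
rewrite Rabs_pos_eq //; have := ln_le_sub1 u ltac:(lra); lra.
Qed.

Lemma lnMellin_ex b q : 0 < b -> 0 < q < 1 -> exists l, Int (fun u => ln u * (Rpower u q * kap b (1 - q) u)) l.
Proof.
move=> hb hq; have ni : nonint (1 - q) by apply: nonint_01; lra.
have [B1 [p1 H1]] := kap_near b (1 - q) hb ni; have [B2 [p2 H2]] := kap_far b (1 - q) (- q - q - 2) hb ni.
have pp : forall u a, 0 <= Rpower u a by move=> u a; left; exact: exp_pos.
have q0 : 0 <= / q by left; apply: Rinv_0_lt_compat; lra.
have [l [Hl _]] : exists l, Int (fun u => ln u * (Rpower u q * kap b (1 - q) u)) l /\ Rabs l <= (/ q * B1 + B2) * (4 / q); last by exists l.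
have qB : 0 <= / q * B1 by exact: Rmult_le_pos.
apply: Int_power_bounds; [lra | lra | | |].
- move=> u hu; apply: (continuous_mult (K := R_AbsRing)).
    apply: ex_derive_continuous; auto_derive; lra.
  apply: (continuous_mult (K := R_AbsRing)); [exact: continuous_Rpower | exact: kap_cont].
- move=> u hu; rewrite !Rabs_mult (Rabs_pos_eq (Rpower u q)); last exact: pp.
  apply: (Rle_trans _ (/ q * Rpower u (- q) * (Rpower u q * (B1 * Rpower u (- Rabs (1 - q)))))).
    apply: Rmult_le_compat; [exact: Rabs_pos | by apply: Rmult_le_pos => //; exact: Rabs_pos | apply: ln_abs_near; lra |].
    by apply: Rmult_le_compat_l; [exact: pp | exact: H1].
  rewrite Rabs_pos_eq; last lra.
  have -> : / q * Rpower u (- q) * (Rpower u q * (B1 * Rpower u (- (1 - q)))) = / q * B1 * (Rpower u (- q) * Rpower u q * Rpower u (- (1 - q))) by ring.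
  rewrite -!Rpower_plus (_ : - q + q + - (1 - q) = q - 1); last ring.
  apply: Rmult_le_compat_r; [exact: pp | lra].
move=> u hu; rewrite !Rabs_mult (Rabs_pos_eq (Rpower u q)); last exact: pp.
apply: (Rle_trans _ (u * (Rpower u q * (B2 * Rpower u (- q - q - 2))))).
  apply: Rmult_le_compat; [exact: Rabs_pos | by apply: Rmult_le_pos => //; exact: Rabs_pos | exact: ln_abs_far |].
  by apply: Rmult_le_compat_l; [exact: pp | exact: H2].
rewrite -{1}(Rpower_1 u); last lra.
have -> : Rpower u 1 * (Rpower u q * (B2 * Rpower u (- q - q - 2))) = B2 * (Rpower u 1 * Rpower u q * Rpower u (- q - q - 2)) by ring.
rewrite -!Rpower_plus (_ : 1 + q + (- q - q - 2) = - q - 1); last ring.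
apply: Rmult_le_compat_r; [exact: pp | lra].
Qed.

(* Convexity of s |-> u^s gives N(q + s/2) >= N(q) + s L for all small s of both signs, so L is the derivative: no interchange of limits. *)
Lemma lnMellin_value b q l : 0 < b -> 0 < q < 1 ->
  Int (fun u => ln u * (Rpower u q * kap b (1 - q) u)) l ->
  l = MK b (1 - q) q * ((psi q + psi 1 - ln (chi_ b)) / 2).
Proof.
move=> hb hq hl; have hq' : 0 < 1 - q < 1 by lra.
have ni := nonint_01 _ hq'.
have low : forall y, 0 < y -> MK b (1 - q) q + 2 * (y - q) * l <= MK b (1 - q) y.
  move=> y hy; have H := Int_plus _ _ _ _ (MK_Int b (1 - q) q hb hq' ltac:(lra)) (Int_scal (2 * (y - q)) _ _ hl).
  apply: (Int_le _ _ _ _ _ H (MK_Int b (1 - q) y hb hq' hy)) => u hu.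
  have E : Rpower u (2 * y + (1 - q) - 1) = Rpower u (2 * q + (1 - q) - 1) * Rpower u (2 * (y - q)).
    by rewrite -Rpower_plus; congr Rpower; ring.
  have -> : 2 * q + (1 - q) - 1 = q by ring.
  rewrite E (_ : 2 * q + (1 - q) - 1 = q); last ring.
  have P := kap_pos b (1 - q) u hb ni hu; have P2 : 0 < Rpower u q by exact: exp_pos.
  have := exp_ineq1_le (2 * (y - q) * ln u); rewrite -/(Rpower u (2 * (y - q))) => X.
  have P3 : 0 < Rpower u q * kap b (1 - q) u by exact: Rmult_lt_0_compat.
  have -> : Rpower u q * Rpower u (2 * (y - q)) * kap b (1 - q) u = Rpower u (2 * (y - q)) * (Rpower u q * kap b (1 - q) u) by ring.
  have : (1 + 2 * (y - q) * ln u) * (Rpower u q * kap b (1 - q) u) <= Rpower u (2 * (y - q)) * (Rpower u q * kap b (1 - q) u) by apply: Rmult_le_compat_r; lra.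
  lra.
set c := MK b (1 - q) 1 / GG b (1 - q) 1.
have g1 := GG_pos b (1 - q) 1 ltac:(lra) ltac:(lra).
have E : forall y, 0 < y <= 1 -> MK b (1 - q) y = c * GG b (1 - q) y.
  move=> y hy; have := MK_GG b (1 - q) y hb hq' hy => H; apply: (Rmult_eq_reg_r (GG b (1 - q) 1)); last lra.
  rewrite H /c; field; lra.
have D : is_derive (fun y => c * GG b (1 - q) y + - (2 * (y - q) * l)) q (c * (GG b (1 - q) q * (psi q + psi (q + (1 - q)) - ln (chi_ b))) + - (2 * l)).
  apply: is_derive_plus; first by apply: is_derive_scal; apply: is_derive_GG => //; lra.
  auto_derive => //; ring.
have ex : ex_derive (fun y => c * GG b (1 - q) y + - (2 * (y - q) * l)) q by eexists; exact: D.
have pr := ex_derive_Reals_0 _ _ ex.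
(* By [low], the Mellin transform minus 2 (y - q) l attains its minimum over (0, 1) at the interior
   point q, so its derivative there is zero. *)
have Z := deriv_minimum _ 0 1 q pr ltac:(lra) ltac:(lra).
rewrite Derive_Reals (is_derive_unique _ _ _ D) in Z.
have {}Z := Z (fun y h1 h2 => ltac:(have := low y h1; rewrite !E; lra)).
rewrite (_ : q + (1 - q) = 1) in Z; last ring.
rewrite E; lra.
Qed.

Definition glK (b mu s : R) (n : nat) : list (R * R) :=
  glist (fun i => Acf b mu * (Ec mu i * chi_ b ^ i)) (fun i => s + mu + 2 * INR i) n.

Lemma glK_eT b mu s n u : 0 < u ->
  gp (glK b mu s n) u + cst (glK b mu s n) = Rpower u s * (Acf b mu * (Rpower u mu * eT mu (chi_ b * u ^ 2) n)).
Proof.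
move=> hu; rewrite gp_glist // /eT.
have -> : Rpower u s * (Acf b mu * (Rpower u mu * rsum (fun i => Ec mu i * (chi_ b * u ^ 2) ^ i) n)) =
  Rpower u s * Acf b mu * Rpower u mu * rsum (fun i => Ec mu i * (chi_ b * u ^ 2) ^ i) n by ring.
rewrite -rsum_scal; apply: rsum_ext => i _.
rewrite !Rpower_plus Rpow_mult_distr -pow_mult -(Rpower_pow (2 * i)) // (_ : INR (2 * i) = 2 * INR i); [ring | by rewrite mult_INR].
Qed.

Lemma Lr_rem_bound b mu s n u : 0 < b -> nonint mu -> 0 < u <= 1 ->
  Rabs (Rpower u s * Lr b mu u - (gp (glK b mu s n) u + cst (glK b mu s n))) <= Rabs (Acf b mu) * CE b mu * Rpower u (s + mu + 2 * INR n).
Proof.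
move=> hb h hu; rewrite glK_eT; last lra.
rewrite /Lr (_ : _ - _ = Rpower u s * Rpower u mu * (Acf b mu * (eR mu (chi_ b * u ^ 2) - eT mu (chi_ b * u ^ 2) n))); last ring.
rewrite -Rpower_plus Rabs_mult Rabs_pos_eq; last by left; exact: exp_pos.
rewrite (Rabs_mult (Acf b mu)); have A0 := Rabs_pos (Acf b mu).
have T := eR_tail b mu u n hb h ltac:(lra); have C0 := CE_ge0 b mu hb h.
have p0 : 0 < Rpower u (s + mu) by exact: exp_pos.
have H : (u / 2) ^ (2 * n) <= Rpower u (2 * INR n).
  rewrite (_ : 2 * INR n = INR (2 * n)); last by rewrite mult_INR.
  rewrite Rpower_pow; last lra.
  apply: pow_incr; lra.
rewrite (Rpower_plus (s + mu)).
have -> : Rabs (Acf b mu) * CE b mu * (Rpower u (s + mu) * Rpower u (2 * INR n)) = Rpower u (s + mu) * (Rabs (Acf b mu) * (Rpower u (2 * INR n) * CE b mu)) by ring.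
apply: Rmult_le_compat_l; first lra.
apply: Rmult_le_compat_l => //; apply: Rle_trans T _; exact: Rmult_le_compat_r.
Qed.

Lemma Lr_rem_lim b mu s n : 0 < b -> nonint mu -> 0 < s + mu + 2 * INR n ->
  filterlim (fun u => Rpower u s * Lr b mu u - (gp (glK b mu s n) u + cst (glK b mu s n))) (at_right 0) (locally 0).
Proof.
move=> hb h h0; apply: (filterlim_dominated_0 _ (fun u => Rabs (Acf b mu) * CE b mu * Rpower u (s + mu + 2 * INR n))).
  move=> u hu; exact: Lr_rem_bound.
exact: filterlim_scaled_power_0.
Qed.

Lemma pkap_rem_lim b mu s n m : 0 < b -> nonint mu -> 0 < s + mu + 2 * INR n -> 0 < s - mu + 2 * INR m ->
  filterlim (fun u => Rpower u s * kap b mu u - (gp (glK b mu s n ++ glK b (- mu) s m) u + cst (glK b mu s n ++ glK b (- mu) s m))) (at_right 0) (locally 0).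
Proof.
move=> hb h h1 h2.
have := filterlim_Rplus _ _ _ _ _ (Lr_rem_lim b mu s n hb h h1) (Lr_rem_lim b (- mu) s m hb (nonint_opp _ h) ltac:(lra)).
rewrite Rplus_0_r; apply: filterlim_at_right_ext => u hu.
rewrite kap_Lr // gp_app cst_app; ring.
Qed.

Lemma FPI_pkap_derive b mu s n m : 0 < b -> nonint mu -> 0 < s + mu + 2 * INR n -> 0 < s - mu + 2 * INR m ->
  (forall g, (forall u, 0 < u -> is_derive (fun u => Rpower u s * kap b mu u) u (g u)) ->
  FPI g (- (cst (glK b mu s n) + cst (glK b (- mu) s m)))).
Proof.
move=> hb h h1 h2 g hg; rewrite -cst_app.
apply: (FPI_FTC (fun u => Rpower u s * kap b mu u) g _ 0) => //; first exact: pkap_lim_oo.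
apply: filterlim_at_right_ext (pkap_rem_lim b mu s n m hb h h1 h2) => u _; ring.
Qed.

(** In u^(q - r) K_(q+r)(bu) the exponent 0 occurs in the r-th term of the branch -(q + r); this is
    its coefficient. *)
Lemma coefK b q r : 0 < b -> nonint q ->
  Acf b (- (q + INR r)) * (Ec (- (q + INR r)) r * chi_ b ^ r) = (-1) ^ r * Gamma q / (2 * INR (fact r)) * Rpower (b / 2) (INR r - q).
Proof.
move=> hb hq; have h := nonint_opp _ (nonint_plus_nat q r hq).
have := Gamma_down _ r h; rewrite Ropp_involutive (_ : q + INR r - INR r = q); last ring.
move=> E; rewrite /Acf Ropp_involutive.
have -> : chi_ b ^ r = Rpower (b / 2) (2 * INR r).
  rewrite (_ : 2 * INR r = INR (2 * r)); last by rewrite mult_INR.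
  rewrite Rpower_pow; last lra.
  rewrite pow_mult /chi_; congr (_ ^ _); field.
have -> : Rpower (b / 2) (INR r - q) = Rpower (b / 2) (- (q + INR r)) * Rpower (b / 2) (2 * INR r).
  by rewrite -Rpower_plus; congr Rpower; ring.
have f0 := INR_fact_neq_0 r.
have -> : Gamma (q + INR r) / 2 * Rpower (b / 2) (- (q + INR r)) * (Ec (- (q + INR r)) r * Rpower (b / 2) (2 * INR r)) =
  (Gamma (q + INR r) * Ec (- (q + INR r)) r) / 2 * Rpower (b / 2) (- (q + INR r)) * Rpower (b / 2) (2 * INR r) by field.
rewrite -E; field; exact: f0.
Qed.

(* Derived from 1/4 (b/2)^(-p-q) Gamma(p) Gamma(q), the Mellin transform of K_(q-p)(bu) at p + q, by taking the finite part at the pole p = -r. *)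
Definition VK (b q : R) (r : nat) : R :=
  (-1) ^ r * Gamma q / (4 * INR (fact r)) * Rpower (b / 2) (INR r - q) * (psi (1 + INR r) + psi q - ln (chi_ b)).

Lemma cst_glK_p b q r n : nonint q -> cst (glK b (q + INR r) (q - INR r) n) = 0.
Proof.
move=> hq; apply: cst_none => i _ E; apply: (nonint_neq0 (q + INR i)); first exact: nonint_plus_nat.
lra.
Qed.

Lemma cst_glK_m b q r : 0 < b -> nonint q ->
  cst (glK b (- (q + INR r)) (q - INR r) (S r)) = (-1) ^ r * Gamma q / (2 * INR (fact r)) * Rpower (b / 2) (INR r - q).
Proof.
move=> hb hq; rewrite -coefK //; apply: (cst_one _ _ _ r); [lia | ring |].
move=> i _ hi E; apply: hi; apply: INR_eq; lra.
Qed.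

(** Integration by parts against ln u: the derivative of ln u u^q K_q(bu) is the wanted integrand
    minus b times a convergent logarithmic Mellin integrand. At 0 the product behaves like A ln u
    without a constant term, so the exact derivative has finite part 0. *)
Lemma FPI_base b q : 0 < b -> 0 < q < 1 -> FPI (fun u => Rpower u (q - 1) * kap b q u) (VK b q 0).
Proof.
move=> hb hq; have ni := nonint_01 q hq; set A := Acf b (- q).
have A_E : A = Gamma q / 2 * Rpower (b / 2) (- q) by rewrite /A /Acf Ropp_involutive.
have G1 : glK b (- q) q 1 = [(A, 0)] by rewrite /glK /= /Ec /= -/A; congr [(_, _)]; [field | ring].
have D := fun u hu => kap_derive_m b q q u hb ni hu.
have L0 : filterlim (fun u => Rpower u q * kap b q u) (at_right 0) (locally A).
  have FC : filterlim (fun _ : R => A) (at_right 0) (locally A) by exact: filterlim_const.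
  have PL := pkap_rem_lim b q q 0 1 hb ni ltac:(rewrite /=; lra) ltac:(rewrite /=; lra).
  rewrite -(Rplus_0_l A); apply: (filterlim_at_right_ext _ _ _ _ (filterlim_Rplus _ _ _ _ _ PL FC)) => u _; rewrite G1 /= /pw1.
  case: Req_dec_T => // _; ring.
(* With exponent and index both q, one term of the derivative drops out and u^q K_(1-q)(bu) is an
   exact derivative up to the factor -b. *)
have I0 : Int (fun u => Rpower u q * kap b (1 - q) u) (A / b).
  have := Int_scal (- / b) _ _ (Int_FTC _ _ _ D (pkap_lim_oo b q q hb ni) L0).
  rewrite (_ : - / b * - A = A / b); last by field; lra.
  apply: Int_ext => u _; rewrite -(kap_even b (1 - q)) (_ : - (1 - q) = q - 1); last ring.
  field; lra.
have M0 : MK b (1 - q) q = A / b.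
  apply: Int_unique I0; apply: Int_ext (MK_Int b (1 - q) q hb ltac:(lra) ltac:(lra)) => u _.
  by congr (Rpower u _ * _); ring.
have [l hl] := lnMellin_ex b q hb hq.
have lE := lnMellin_value b q l hb hq hl.
have F1 : FPI (fun u => Rpower u (q - 1) * kap b q u + - b * (ln u * (Rpower u q * kap b (1 - q) u))) (- cst []).
  apply: (FPI_FTC (fun u => ln u * (Rpower u q * kap b q u)) _ [] A).
  - move=> u hu; have Dl : is_derive ln u (/ u) by auto_derive => //; ring.
    have := is_derive_mult _ _ _ _ _ Dl (D u hu) Rmult_comm; rewrite /plus /mult /=.
    have -> : Rpower u (q - 1) = Rpower u q / u by rewrite Rpower_plus Rpower_Ropp Rpower_1.
    have -> : kap b (1 - q) u = kap b (q - 1) u by rewrite -(kap_even b (1 - q)); congr (kap b _ u); ring.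
    set k := kap b q u; set k' := kap b (q - 1) u; set p := Rpower u q.
    have -> : p / u * k + - b * (ln u * (p * k')) = / u * (p * k) + ln u * ((q - q) * (p / u * k) - b * (p * k')); last exact.
    by field; lra.
  - apply: (is_lim_dominated _ (fun u => Rpower u (q + 1) * kap b q u)); last exact: pkap_lim_oo.
    move=> t ht; rewrite Rabs_mult [Rabs (_ * kap _ _ _)]Rabs_pos_eq; last first.
      by apply: Rmult_le_pos; left; [exact: exp_pos | apply: kap_pos => //; lra].
    have P := kap_pos b q t hb ni ltac:(lra).
    rewrite Rpower_plus Rpower_1; last lra.
    rewrite (Rmult_comm _ t) Rmult_assoc; apply: Rmult_le_compat_r; last exact: ln_abs_far.
    by apply: Rmult_le_pos; left; [exact: exp_pos | exact: P].
  set B1 := Rabs (Acf b q) * CE b q; set B2 := Rabs (Acf b (- q)) * CE b (- q).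
  apply: (filterlim_dominated_0 _ (fun u => / q * (B1 + B2) * Rpower u q)); last exact: (filterlim_scaled_power_0 _ q (proj1 hq)).
  move=> u hu; rewrite /= (_ : ln u * (Rpower u q * kap b q u) - (0 + 0) - A * ln u = ln u * (Rpower u q * kap b q u - A)); last ring.
  have R1 := Lr_rem_bound b q q 0 u hb ni hu; have R2 := Lr_rem_bound b (- q) q 1 u hb (nonint_opp _ ni) hu.
  rewrite /= in R1; rewrite G1 /= in R2; rewrite /pw1 in R2; move: R2; case: Req_dec_T => // _ R2.
  have E : Rpower u q * kap b q u - A = (Rpower u q * Lr b q u - (0 + 0)) + (Rpower u q * Lr b (- q) u - (A * 0 + 0 + (A + 0))).
    rewrite kap_Lr //; [ring | lra].
  have CN := CE_ge0 b q hb ni; have CM := CE_ge0 b (- q) hb (nonint_opp _ ni).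
  have p2 : 0 <= B2 by apply: Rmult_le_pos => //; exact: Rabs_pos.
  have W : Rabs (Rpower u q * kap b q u - A) <= (B1 + B2) * Rpower u (q + q).
    rewrite E; apply: Rle_trans (Rabs_triang _ _) _; rewrite Rmult_plus_distr_r; apply: Rplus_le_compat.
      apply: Rle_trans R1 _; right; rewrite /B1; congr (_ * Rpower u _); ring.
    apply: Rle_trans R2 _; apply: Rmult_le_compat_l => //; apply: Rpower_near_le => //; lra.
  rewrite Rabs_mult; have LA := ln_abs_near q u (proj1 hq) hu.
  apply: Rle_trans (Rmult_le_compat _ _ _ _ (Rabs_pos _) (Rabs_pos _) LA W) _; right.
  rewrite (_ : / q * Rpower u (- q) * ((B1 + B2) * Rpower u (q + q)) = / q * (B1 + B2) * (Rpower u (- q) * Rpower u (q + q))); last ring.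
  by rewrite -Rpower_plus; congr (_ * Rpower u _); ring.
have := FPI_plus _ _ _ _ F1 (FPI_scal b _ _ (FPI_Int _ _ hl)).
have -> : - cst [] + b * l = VK b q 0.
  rewrite lE M0 A_E /VK /= Rplus_0_r (_ : 0 - q = - q); last ring.
  field; lra.
apply: FPI_ext => u _; ring.
Qed.

(** The raising recurrence carries the value from (0, 1) to all non-integer q in both directions;
    the boundary contribution of each step is the coefficient of u^0. *)
Lemma FPI_K0 b q : 0 < b -> nonint q -> FPI (fun u => Rpower u (q - 1) * kap b q u) (VK b q 0).
Proof.
move=> hb; have step : forall q, nonint q ->
  FPI (fun u => (q + q) * (Rpower u (q - 1) * kap b q u) - b * (Rpower u q * kap b (q + 1) u)) (- (Gamma q / 2 * Rpower (b / 2) (- q))).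
  move=> {}q hq; have [n hn] := nat_above (- q).
  have := FPI_pkap_derive b q q n 1 hb hq ltac:(lra) ltac:(rewrite /=; lra) _ (fun u hu => kap_derive b q q u hb hq hu).
  have := cst_glK_p b q 0 n hq; have := cst_glK_m b q 0 hb hq.
  rewrite [INR 0]/= Rplus_0_r Rminus_0_r => -> ->.
  rewrite [fact 0]/= [INR 1]/= pow_O Rplus_0_l (_ : 0 - q = - q); last ring.
  by rewrite Rmult_1_l Rmult_1_r.
have val : forall q, nonint q -> (q + q) * VK b q 0 + Gamma q / 2 * Rpower (b / 2) (- q) = b * VK b (q + 1) 0.
  move=> {}q hq; have np := nonint_nonpole _ hq; have q0 := nonint_neq0 _ hq.
  rewrite /VK [INR 0]/= Gamma_S // psi_S // (_ : 0 - (q + 1) = - q + - (1)); last ring.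
  rewrite (_ : 0 - q = - q); last ring.
  rewrite Rpower_plus Rpower_Ropp -[Rpower (b / 2) (- (1))]/(Rpower (b / 2) (- (1))) (Rpower_Ropp _ 1) Rpower_1; last lra.
  rewrite /=; field; split; [lra | split; [lra | have := exp_pos (q * ln (b / 2)); rewrite -/(Rpower _ _); lra]].
move: q; apply: nonint_ind.
- move=> x hx; exact: FPI_base.
- move=> x hx IH.
  have H := FPI_plus _ _ _ _ (FPI_scal (/ b * (x + x)) _ _ IH) (FPI_scal (- / b) _ _ (step x hx)).
  have -> : VK b (x + 1) 0 = / b * (x + x) * VK b x 0 + - / b * - (Gamma x / 2 * Rpower (b / 2) (- x)).
    apply: (Rmult_eq_reg_l b); last lra.
    rewrite -val //; field; lra.
  apply: FPI_ext H => u _; rewrite (_ : x + 1 - 1 = x); last ring.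
  field; lra.
move=> x hx IH; have x0 := nonint_neq0 _ hx.
have H := FPI_plus _ _ _ _ (FPI_scal (/ (x + x) * b) _ _ IH) (FPI_scal (/ (x + x)) _ _ (step x hx)).
have -> : VK b x 0 = / (x + x) * b * VK b (x + 1) 0 + / (x + x) * - (Gamma x / 2 * Rpower (b / 2) (- x)).
  rewrite Rmult_assoc -val //; field; lra.
apply: FPI_ext H => u _; rewrite (_ : x + 1 - 1 = x); last ring.
field; lra.
Qed.

(** Passes from one pole to the next by the lowering recurrence; the boundary coefficient of u^0
    supplies the term 1/(r + 1) by which psi(1 + r) grows. *)
Lemma FPI_K b q r : 0 < b -> nonint q -> FPI (fun u => Rpower u (q - INR r - 1) * kap b (q + INR r) u) (VK b q r).
Proof.
move=> hb hq; elim: r => [|r IH].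
  by apply: FPI_ext (FPI_K0 b q hb hq) => u _; rewrite [INR 0]/= Rminus_0_r Rplus_0_r.
have hm := nonint_plus_nat q (S r) hq; have [n hn] := nat_above (- q).
have r0 : 0 < INR (S r) by apply: lt_0_INR; lia.
have st := FPI_pkap_derive b (q + INR (S r)) (q - INR (S r)) n (S (S r)) hb hm ltac:(lra) ltac:(rewrite !S_INR; lra) _ (fun u hu => kap_derive_m b _ _ u hb hm hu).
rewrite cst_glK_p // cst_glK_m // Rplus_0_l in st.
have H := FPI_plus _ _ _ _ (FPI_scal (- / (2 * INR (S r))) _ _ st) (FPI_scal (- / (2 * INR (S r)) * b) _ _ IH).
have -> : VK b q (S r) = - / (2 * INR (S r)) * - ((-1) ^ S r * Gamma q / (2 * INR (fact (S r))) * Rpower (b / 2) (INR (S r) - q)) + - / (2 * INR (S r)) * b * VK b q r.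
  have f0 := INR_fact_neq_0 r.
  rewrite /VK.
  have -> : 1 + INR (S r) = 1 + INR r + 1 by rewrite S_INR; ring.
  rewrite psi_S; last by apply: nonpole_pos; have := pos_INR r; lra.
  have -> : Rpower (b / 2) (INR (S r) - q) = Rpower (b / 2) (INR r - q) * (b / 2).
    by rewrite -{3}(Rpower_1 (b / 2)); [rewrite -Rpower_plus; congr Rpower; rewrite S_INR; ring | lra].
  have -> : INR (fact (S r)) = INR (S r) * INR (fact r) by rewrite -mult_INR.
  have -> : 1 + INR r = INR (S r) by rewrite S_INR; ring.
  have -> : (-1) ^ S r = - (-1) ^ r by rewrite /=; ring.
  field; split; [exact: f0 | lra].
apply: FPI_ext H => u _.
have -> : q - INR r - 1 = q - INR (S r) by rewrite S_INR; ring.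
have -> : q + INR (S r) - 1 = q + INR r by rewrite S_INR; ring.
field; lra.
Qed.

(** * The integral of u^(w-1)/(1+u^2) *)

(** A second parameter y is introduced to obtain a recursion in z; the wanted integrand is the case
    y + z = 1. *)
Definition bet (y z u : R) : R := Rpower u (2 * z - 1) * Rpower (1 + u ^ 2) (- (z + y)).

Lemma bet_pos y z u : 0 < bet y z u.
Proof. by apply: Rmult_lt_0_compat; exact: exp_pos. Qed.

Lemma bet_far y z u a : 0 <= z + y -> 1 <= u -> Rpower u a * Rpower (1 + u ^ 2) (- (z + y)) <= Rpower u (a - 2 * z - 2 * y).
Proof.
move=> hzy hu; have -> : a - 2 * z - 2 * y = a + - (2 * (z + y)) by ring.
rewrite Rpower_plus; apply: Rmult_le_compat_l; first by left; exact: exp_pos.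
have -> : Rpower u (- (2 * (z + y))) = Rpower (u ^ 2) (- (z + y)).
  rewrite -(Rpower_pow 2); last lra.
  rewrite Rpower_mult; congr Rpower; rewrite /=; ring.
apply: Rpower_le_base; nra.
Qed.

Lemma bet_near y z u : 0 <= z + y -> Rpower (1 + u ^ 2) (- (z + y)) <= 1.
Proof. move=> h; apply: Rpower_le1; nra. Qed.

Lemma is_derive_1sq a u : is_derive (fun u => Rpower (1 + u ^ 2) a) u (2 * a * u * Rpower (1 + u ^ 2) (a - 1)).
Proof.
have p : 0 < 1 + u ^ 2 by nra.
have D : is_derive (fun u => 1 + u ^ 2) u (2 * u) by auto_derive => //; ring.
have := is_derive_comp (fun v => Rpower v a) (fun u => 1 + u ^ 2) u _ _ (is_derive_Rpower a _ p) D.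
rewrite /scal /= /mult /=.
have -> : 2 * a * u * Rpower (1 + u * (u * 1)) (a - 1) = 2 * u * (a * Rpower (1 + u * (u * 1)) (a - 1)) by ring.
exact.
Qed.

Lemma bet_ex y z : 0 < y -> 0 < z -> exists l, Int (bet y z) l.
Proof.
move=> hy hz; set e := 2 * Rmin y z; have e0 : 0 < e by rewrite /e; have := Rmin_glb_lt y z 0 hy hz; lra.
have ey : e <= 2 * y by rewrite /e; have := Rmin_l y z; lra.
have ez : e <= 2 * z by rewrite /e; have := Rmin_r y z; lra.
have [l [Hl _]] : exists l, Int (bet y z) l /\ Rabs l <= 1 * (4 / e); last by exists l.
apply: Int_power_bounds => //; first lra.
- move=> u hu; apply: (continuous_mult (K := R_AbsRing)); first exact: continuous_Rpower.
  apply: ex_derive_continuous; eexists; exact: is_derive_1sq.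
- move=> u hu; rewrite Rabs_pos_eq; last by left; exact: bet_pos.
  rewrite Rmult_1_l /bet -[X in _ <= X]Rmult_1_r; apply: Rmult_le_compat; try (left; exact: exp_pos).
    apply: Rpower_near_le => //; lra.
  apply: bet_near; lra.
move=> u hu; rewrite Rabs_pos_eq; last by left; exact: bet_pos.
rewrite Rmult_1_l; apply: Rle_trans (bet_far y z u _ ltac:(lra) hu) _.
apply: Rle_Rpower; lra.
Qed.

Definition BT (y z : R) : R := IntV (bet y z).

Lemma BT_Int y z : 0 < y -> 0 < z -> Int (bet y z) (BT y z).
Proof. move=> hy hz; apply: IntV_spec; exact: bet_ex. Qed.

Lemma bet_S y z u : 0 < u -> bet y (z + 1) u = u ^ 2 / (1 + u ^ 2) * bet y z u.
Proof.
move=> hu; rewrite /bet; have p : 0 < 1 + u ^ 2 by nra.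
have -> : Rpower u (2 * (z + 1) - 1) = u ^ 2 * Rpower u (2 * z - 1).
  by rewrite -(Rpower_pow 2) // -Rpower_plus; congr Rpower; rewrite /=; ring.
have -> : - (z + 1 + y) = - (1) + - (z + y) by ring.
rewrite Rpower_plus (Rpower_Ropp _ 1) Rpower_1 //; field; lra.
Qed.

Lemma BT_S y z : 0 < y -> 0 < z -> BT y (z + 1) = z / (z + y) * BT y z.
Proof.
move=> hy hz.
have H : Int (fun u => 2 * z * bet y z u + - (2 * (z + y)) * bet y (z + 1) u) (- 0).
  apply: (Int_FTC (fun u => Rpower u (2 * z) * Rpower (1 + u ^ 2) (- (z + y)))).
  - move=> u hu; have := is_derive_mult _ _ _ _ _ (is_derive_Rpower (2 * z) u hu) (is_derive_1sq (- (z + y)) u) Rmult_comm.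
    rewrite /plus /mult; have p : 0 < 1 + u ^ 2 by nra.
    have -> : 2 * z * bet y z u + - (2 * (z + y)) * bet y (z + 1) u =
      2 * z * Rpower u (2 * z - 1) * Rpower (1 + u ^ 2) (- (z + y)) + Rpower u (2 * z) * (2 * - (z + y) * u * Rpower (1 + u ^ 2) (- (z + y) - 1)); last exact.
    rewrite bet_S // /bet.
    have -> : Rpower u (2 * z) = u * Rpower u (2 * z - 1).
      by rewrite -{2}(Rpower_1 u hu) -Rpower_plus; congr Rpower; ring.
    rewrite [Rpower (1 + u ^ 2) (- (z + y) - 1)]Rpower_plus (Rpower_Ropp _ 1) (Rpower_1 (1 + u ^ 2)) //; field; nra.
  - apply: (is_lim_dominated _ (fun u => Rpower u (- 2 * y))); last by apply: Rpower_to_oo; lra.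
    move=> t ht; rewrite Rabs_pos_eq; last by apply: Rmult_le_pos; left; exact: exp_pos.
    apply: Rle_trans (bet_far y z t _ ltac:(lra) ht) _; right; congr Rpower; ring.
  apply: (filterlim_dominated_0 _ (fun u => 1 * Rpower u (2 * z))); last by apply: filterlim_scaled_power_0; lra.
  move=> u hu; rewrite Rabs_pos_eq; last by apply: Rmult_le_pos; left; exact: exp_pos.
  rewrite Rmult_comm; apply: Rmult_le_compat_r; [left; exact: exp_pos | apply: bet_near; lra].
have H2 := Int_plus _ _ _ _ (Int_scal (2 * z) _ _ (BT_Int y z hy hz)) (Int_scal (- (2 * (z + y))) _ _ (BT_Int y (z + 1) hy ltac:(lra))).
have := Int_unique _ _ _ H H2 => E; apply: (Rmult_eq_reg_l (2 * (z + y))); last lra.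
have -> : 2 * (z + y) * (z / (z + y) * BT y z) = 2 * z * BT y z by field; lra.
lra.
Qed.

Lemma BT_1 y : 0 < y -> BT y 1 = / (2 * y).
Proof.
move=> hy; apply: Int_unique (BT_Int y 1 hy Rlt_0_1) _.
rewrite -(Ropp_involutive (/ (2 * y))); apply: (Int_FTC (fun u => - / (2 * y) * Rpower (1 + u ^ 2) (- y))).
- move=> u hu; have := is_derive_scal _ _ (- / (2 * y)) _ (is_derive_1sq (- y) u).
  have -> : bet y 1 u = - / (2 * y) * (2 * - y * u * Rpower (1 + u ^ 2) (- y - 1)); last exact.
  rewrite /bet (_ : 2 * 1 - 1 = 1); last ring.
  rewrite Rpower_1 // (_ : - (1 + y) = - y - 1); last ring.
  field; lra.
- apply: (is_lim_dominated _ (fun u => / (2 * y) * Rpower u (- 2 * y))); last first.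
    have -> : Finite 0 = Rbar_mult (/ (2 * y)) 0 by rewrite /= Rmult_0_r.
    apply: is_lim_scal_l; apply: Rpower_to_oo; lra.
  move=> t ht; have i0 : 0 < / (2 * y) by apply: Rinv_0_lt_compat; lra.
  rewrite Rabs_mult Rabs_Ropp !Rabs_pos_eq; try (left; exact: exp_pos); last lra.
  apply: Rmult_le_compat_l; first lra.
  have := bet_far y 0 t 0 ltac:(lra) ht; rewrite Rpower_O ?Rmult_1_l; last lra.
  rewrite Rplus_0_l (_ : 0 - 2 * 0 - 2 * y = - 2 * y) //; ring.
have C : continuous (fun u => - / (2 * y) * Rpower (1 + u ^ 2) (- y)) 0.
  apply: ex_derive_continuous; eexists; apply: is_derive_scal; exact: is_derive_1sq.
have : filterlim (fun u => - / (2 * y) * Rpower (1 + u ^ 2) (- y)) (at_right 0) (locally (- / (2 * y) * Rpower (1 + 0 ^ 2) (- y))).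
  apply: filterlim_filter_le_1 C; exact: filter_le_within.
rewrite (_ : 1 + 0 ^ 2 = 1); last by rewrite /=; ring.
have -> : Rpower 1 (- y) = 1 by rewrite /Rpower ln_1 Rmult_0_r exp_0.
rewrite Rmult_1_r; exact.
Qed.

(** For fixed y = 1 - x, the product of the integral with Gamma(z + y) satisfies the recurrence and
    the convexity of Gamma(z), so [bohr_mollerup] applies; reflection then gives the sine. *)
Lemma BT_value x : 0 < x < 1 -> BT (1 - x) x = PI / (2 * sin (PI * x)).
Proof.
move=> hx; set y := 1 - x; have hy : 0 < y by rewrite /y; lra.
have gp0 : forall z, 0 < z -> 0 < Gamma (z + y) by move=> z hz; apply: Gamma_pos; lra.
have B0 : forall z, 0 < z -> 0 < BT y z by move=> z hz; apply: (Int_pos _ _ _ (BT_Int y z hy hz)) => u _; exact: bet_pos.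
have := bohr_mollerup (fun z => z) (fun z => BT y z * Gamma (z + y)) Gamma x ltac:(lra).
have -> : BT y 1 * Gamma (1 + y) = Gamma y / 2.
  rewrite BT_1 // Rplus_comm Gamma_S; last exact: nonpole_pos.
  field; lra.
rewrite Gamma_1 (_ : x + y = 1); last by rewrite /y; ring.
rewrite Gamma_1 !Rmult_1_r => H.
rewrite H //.
- have := Gamma_reflect x (nonint_01 x hx); rewrite -/y => R; have s0 := sin_nonint _ (nonint_01 x hx).
  have -> : Gamma x * (Gamma y / 2) = Gamma x * Gamma y / 2 by field.
  rewrite R; field; exact: s0.
- by move=> z hz; apply: Rmult_lt_0_compat; [exact: B0 | exact: gp0].
- exact: Gamma_pos.
- move=> z hz; rewrite BT_S // (_ : z + 1 + y = z + y + 1); last ring.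
  rewrite Gamma_S; last by apply: nonpole_pos; lra.
  field; lra.
- by move=> z hz; rewrite Gamma_S //; exact: nonpole_pos.
- move=> z t hz ht.
  have K : BT y (z + t) <= BT y z * Rpower (z / (z + y)) t.
    apply: (Int_young (fun u => u ^ 2 / (1 + u ^ 2)) (bet y z) (bet y (z + 1)) (bet y (z + t)) (BT y z) (BT y (z + 1))) => //.
    + by apply: Rdiv_lt_0_compat; lra.
    + by move=> u hu; apply: Rdiv_lt_0_compat; nra.
    + by move=> u _; left; exact: bet_pos.
    + by move=> u hu; exact: bet_S.
    + move=> u hu; have p : 0 < 1 + u ^ 2 by nra.
      have u2 : 0 < u ^ 2 by nra.
      rewrite /Rdiv -(Rpower_mult_distr _ _ t u2 (Rinv_0_lt_compat _ p)) /bet.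
      have -> : Rpower (u ^ 2) t = Rpower u (2 * t) by rewrite -(Rpower_pow 2) // Rpower_mult /=; congr Rpower; ring.
      have -> : Rpower (/ (1 + u ^ 2)) t = Rpower (1 + u ^ 2) (- t).
        rewrite /Rpower ln_Rinv //; congr exp; ring.
      have -> : 2 * (z + t) - 1 = 2 * t + (2 * z - 1) by ring.
      have -> : - (z + t + y) = - t + - (z + y) by ring.
      rewrite !Rpower_plus; ring.
    + exact: BT_Int.
    + by apply: BT_Int => //; lra.
    + by apply: BT_Int => //; lra.
    + exact: BT_S.
  have := Gamma_convex (z + y) t ltac:(lra) ht => G.
  have E : Rpower z t = Rpower (z / (z + y)) t * Rpower (z + y) t.
    rewrite Rpower_mult_distr; [congr (Rpower _ t); field; lra | apply: Rdiv_lt_0_compat; lra | lra].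
  rewrite E (_ : z + t + y = z + y + t); last ring.
  apply: (Rle_trans _ ((BT y z * Rpower (z / (z + y)) t) * (Gamma (z + y) * Rpower (z + y) t))); last by right; ring.
  apply: Rmult_le_compat => //; left; [apply: B0 | apply: Gamma_pos]; lra.
- exact: Gamma_convex.
apply: is_lim_seq_ext (ratio_lim 0 x) => n; by rewrite !Rplus_0_r.
Qed.

Definition iw (w u : R) : R := Rpower u (w - 1) * / (1 + u ^ 2).

(** The primitive u^w / w is a purely singular power at 0, with no constant term, and vanishes at
    infinity. *)
Lemma FPI_power w : w < 0 -> FPI (fun u => Rpower u (w - 1)) 0.
Proof.
move=> hw; exists (fun u => / w * Rpower u w), [(- / w, w)], 0; split.
  move=> u hu; have -> : Rpower u (w - 1) = / w * (w * Rpower u (w - 1)) by field; lra.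
  exact: is_derive_scal _ _ (/ w) _ (is_derive_Rpower w u hu).
split.
  have -> : Finite 0 = Rbar_mult (/ w) 0 by rewrite /= Rmult_0_r.
  apply: is_lim_scal_l; exact: Rpower_to_oo.
apply: (filterlim_ext (fun _ => 0)); last exact: filterlim_const.
move=> u; rewrite /= /pw1; case: Req_dec_T => E; [lra | ring].
Qed.

(** Since 1/(1 + u^2) = 1 - u^2/(1 + u^2) and the pure power contributes nothing, moving w by 2
    changes only the sign. *)
Lemma FPI_iw_step w l : w < 0 -> FPI (iw (w + 2)) (- l) -> FPI (iw w) l.
Proof.
move=> hw h; have := FPI_plus _ _ _ _ (FPI_power w hw) (FPI_scal (-1) _ _ h).
have -> : 0 + -1 * - l = l by ring.
apply: FPI_ext => u hu; rewrite /iw; have p : 0 < 1 + u ^ 2 by nra.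
have -> : Rpower u (w + 2 - 1) = u ^ 2 * Rpower u (w - 1).
  by rewrite -(Rpower_pow 2) // -Rpower_plus; congr Rpower; rewrite /=; ring.
field; lra.
Qed.

Lemma FPI_iw n w : 0 < w + 2 * INR n < 2 -> FPI (iw w) (PI / (2 * sin (PI * (w / 2)))).
Proof.
elim: n w => [|n IH] w.
  rewrite /= Rmult_0_r Rplus_0_r => hw; apply: FPI_Int.
  have hx : 0 < w / 2 < 1 by lra.
  rewrite -BT_value //; apply: Int_ext (BT_Int (1 - w / 2) (w / 2) ltac:(lra) ltac:(lra)) => u hu.
  rewrite /bet /iw (_ : 2 * (w / 2) - 1 = w - 1); last field.
  rewrite (_ : - (w / 2 + (1 - w / 2)) = - (1)); last field.
  rewrite (Rpower_Ropp _ 1) Rpower_1 //; nra.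
rewrite S_INR => hw; case: (Rlt_dec w 0) => w0; last first.
  case: n IH hw => [|n] IH hw; first by exfalso; rewrite /= in hw; lra.
  exfalso; rewrite S_INR in hw; have := pos_INR n; lra.
apply: FPI_iw_step => //; have := IH (w + 2) ltac:(lra).
have -> : PI * ((w + 2) / 2) = PI * (w / 2) + PI by field.
rewrite neg_sin; have -> : PI / (2 * - sin (PI * (w / 2))) = - (PI / (2 * sin (PI * (w / 2)))); last exact.
have -> : 2 * - sin (PI * (w / 2)) = - (2 * sin (PI * (w / 2))) by ring.
exact: Rdiv_opp_r.
Qed.

(** At these w the sine formula has its poles. The start is w = 0, with primitive ln u - ln(1 + u^2)
    / 2, which vanishes at infinity and has no constant term at 0. *)
Lemma FPI_iw_even m : FPI (iw (- (2 * INR m))) 0.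
Proof.
elim: m => [|m IH]; last first.
  apply: FPI_iw_step; first by rewrite S_INR; have := pos_INR m; lra.
  by rewrite Ropp_0 S_INR (_ : - (2 * (INR m + 1)) + 2 = - (2 * INR m)) //; ring.
rewrite /= Rmult_0_r Ropp_0.
exists (fun u => ln u - / 2 * ln (1 + u ^ 2)), [], (-1); split.
  move=> u hu; have p : 0 < 1 + u ^ 2 by nra.
  rewrite /iw (_ : 0 - 1 = - (1)); last ring.
  rewrite (Rpower_Ropp _ 1) Rpower_1 //; auto_derive; first by move: p; rewrite /=.
  move: p => /= p; field; lra.
split.
  apply: (is_lim_dominated _ (fun t => / 2 / t ^ 2)); last exact: is_lim_inv_sq.
  move=> t ht; have t2 : 0 < t ^ 2 by nra.
  have -> : ln t - / 2 * ln (1 + t ^ 2) = - (/ 2 * ln (1 + / t ^ 2)).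
    have -> : 1 + / t ^ 2 = (1 + t ^ 2) * / t ^ 2 by field; lra.
    rewrite ln_mult; [| nra | exact: Rinv_0_lt_compat].
    rewrite ln_Rinv // -(Rpower_pow 2); last lra.
    rewrite ln_exp /=; field.
  have i0 : 0 < / t ^ 2 by exact: Rinv_0_lt_compat.
  have l1 := ln_le_sub1 (1 + / t ^ 2) ltac:(lra).
  have l0 : 0 <= ln (1 + / t ^ 2) by rewrite -ln_1; apply: ln_le; lra.
  rewrite Rabs_Ropp Rabs_pos_eq; rewrite /Rdiv; lra.
have C : continuous (fun u => / 2 * ln (1 + u ^ 2)) 0.
  apply: ex_derive_continuous; auto_derive; lra.
have : filterlim (fun u => / 2 * ln (1 + u ^ 2)) (at_right 0) (locally (/ 2 * ln (1 + 0 ^ 2))).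
  apply: filterlim_filter_le_1 C; exact: filter_le_within.
rewrite (_ : 1 + 0 ^ 2 = 1); last by rewrite /=; ring.
rewrite ln_1 Rmult_0_r; apply: filterlim_ext => u /=; ring.
Qed.

(** * The finite part of the integral of the summand *)

Definition phi (b nu u : R) : R := Rpower u (- nu - 1) * (kap b nu u * / (1 + u ^ 2)).

(** The lengths n + 1 and n + m are chosen so that K minus this sum is integrable against u^(-nu -
    2n - 1) / (1 + u^2) at 0 and at infinity alike. *)
Definition trunc (b nu : R) (m n : nat) (u : R) : R :=
  Acf b nu * (Rpower u nu * eT nu (chi_ b * u ^ 2) (S n)) +
  Acf b (- nu) * (Rpower u (- nu) * eT (- nu) (chi_ b * u ^ 2) (n + m)).

Definition remR (b nu : R) (m n : nat) (u : R) : R :=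
  (-1) ^ n * (Rpower u (- nu - 2 * INR n - 1) * / (1 + u ^ 2)) * (kap b nu u - trunc b nu m n u).

Lemma Rpower_shift2 u a n : 0 < u -> Rpower u (a - 2 * INR (S n) - 1) = Rpower u (a - 2 * INR n - 1) / u ^ 2.
Proof.
move=> hu.
have -> : a - 2 * INR (S n) - 1 = (a - 2 * INR n - 1) + - (2) by rewrite S_INR; ring.
rewrite Rpower_plus Rpower_Ropp -(Rpower_pow 2) //.
Qed.

Lemma phi_geom b nu n u : 0 < u ->
  phi b nu u = rsum (fun r => (-1) ^ r * (Rpower u (- nu - 2 * INR (S r) - 1) * kap b nu u)) n
   + (-1) ^ n * (Rpower u (- nu - 2 * INR n - 1) * / (1 + u ^ 2)) * kap b nu u.
Proof.
move=> hu.
have u2 : 0 < u ^ 2 by nra.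
elim: n => [|n IH].
  rewrite /phi /= Rmult_0_r Rminus_0_r; ring.
rewrite IH [rsum _ (S n)]/rsum -/(rsum _ n) Rpower_shift2 // (_ : (-1) ^ S n = - (-1) ^ n); last by rewrite /=; ring.
field; split; lra.
Qed.

Lemma iw_part b nu mu n k u : 0 < u ->
  Rpower u (- nu - 2 * INR n - 1) * / (1 + u ^ 2) * (Acf b mu * (Rpower u mu * eT mu (chi_ b * u ^ 2) k)) =
  rsum (fun i => Acf b mu * (Ec mu i * chi_ b ^ i) * iw (- nu - 2 * INR n + mu + 2 * INR i) u) k.
Proof.
move=> hu; rewrite /eT.
set X := rsum (fun i => Ec mu i * _) k.
have -> : Rpower u (- nu - 2 * INR n - 1) * / (1 + u ^ 2) * (Acf b mu * (Rpower u mu * X)) =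
  Rpower u (- nu - 2 * INR n - 1) * / (1 + u ^ 2) * (Acf b mu * Rpower u mu) * X by ring.
rewrite -rsum_scal; apply: rsum_ext => i _; rewrite /iw.
have -> : Rpower u (- nu - 2 * INR n + mu + 2 * INR i - 1) = Rpower u (- nu - 2 * INR n - 1) * Rpower u mu * (u ^ 2) ^ i.
  rewrite -pow_mult -(Rpower_pow (2 * i)) // -!Rpower_plus; congr Rpower; rewrite mult_INR [INR 2]/=; ring.
rewrite Rpow_mult_distr; ring.
Qed.

Lemma phi_decomp b nu m n u : 0 < u -> phi b nu u =
  rsum (fun r => (-1) ^ r * (Rpower u (- nu - 2 * INR (S r) - 1) * kap b nu u)) n
  + (-1) ^ n * rsum (fun i => Acf b nu * (Ec nu i * chi_ b ^ i) * iw (- nu - 2 * INR n + nu + 2 * INR i) u) (S n)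
  + (-1) ^ n * rsum (fun i => Acf b (- nu) * (Ec (- nu) i * chi_ b ^ i) * iw (- nu - 2 * INR n + - nu + 2 * INR i) u) (n + m)
  + remR b nu m n u.
Proof.
move=> hu; rewrite (phi_geom b nu n u hu) -!iw_part // /remR /trunc; ring.
Qed.

Lemma pow_quarter n u : (u / 2) ^ (2 * n) = (/ 4) ^ n * u ^ (2 * n).
Proof. rewrite !pow_mult -Rpow_mult_distr; congr (_ ^ _); field. Qed.

Lemma scaled_cancel n u a : 0 < u -> Rpower u (a - 2 * INR n) * u ^ (2 * n) = Rpower u a.
Proof.
move=> hu; rewrite -(Rpower_pow (2 * n)) // -Rpower_plus; congr Rpower; rewrite mult_INR [INR 2]/=; ring.
Qed.

Lemma eT_bound_S b mu u n : 0 < b -> nonint mu -> 2 <= u ->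
  Rabs (eT mu (chi_ b * u ^ 2) (S n)) <= (u / 2) ^ (2 * n) * CE b mu.
Proof.
move=> hb h hu; have c0 := chi_pos b hb.
apply: (Rle_trans _ (rsum (fun i => (u / 2) ^ (2 * n) * (Rabs (Ec mu i) * (4 * chi_ b) ^ i)) (S n))).
  apply: Rabs_rsum_le => i hi; rewrite Rabs_mult scaled_pow Rabs_mult -Rmult_assoc.
  rewrite (Rabs_pos_eq (_ ^ i)); last by apply: pow_le; lra.
  rewrite (Rabs_pos_eq ((u / 2) ^ _)); last by apply: pow_le; lra.
  rewrite Rmult_comm; apply: Rmult_le_compat_r.
    by apply: Rmult_le_pos; [exact: Rabs_pos | apply: pow_le; lra].
  by apply: Rle_pow; [lra | lia].
rewrite rsum_scal; apply: Rmult_le_compat_l; first by apply: pow_le; lra.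
apply: rsum_le_series (CE_series b mu hb h) => k.
apply: Rmult_le_pos; [exact: Rabs_pos | apply: pow_le; lra].
Qed.

Lemma continuous_rsum (f : nat -> R -> R) n u : (forall i, continuous (f i) u) -> continuous (fun u => rsum (fun i => f i u) n) u.
Proof.
move=> h; elim: n => [|n IH]; first exact: continuous_const.
exact: (continuous_plus (K := R_AbsRing) (V := R_NormedModule) (fun u => rsum (fun i => f i u) n)).
Qed.

Lemma trunc_cont b nu m n u : 0 < u -> continuous (trunc b nu m n) u.
Proof.
move=> hu; have E : forall mu k, continuous (fun u => Acf b mu * (Rpower u mu * eT mu (chi_ b * u ^ 2) k)) u.
  move=> mu k; apply: (continuous_mult (K := R_AbsRing)); first exact: continuous_const.
  apply: (continuous_mult (K := R_AbsRing)); first exact: continuous_Rpower.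
  apply: continuous_rsum => i; apply: ex_derive_continuous; auto_derive; done.
exact: (continuous_plus (K := R_AbsRing) (V := R_NormedModule)).
Qed.

Lemma remR_cont b nu m n u : 0 < b -> nonint nu -> 0 < u -> continuous (remR b nu m n) u.
Proof.
move=> hb h hu; apply: (continuous_mult (K := R_AbsRing)).
  apply: (continuous_mult (K := R_AbsRing)); first exact: continuous_const.
  apply: (continuous_mult (K := R_AbsRing)); first exact: continuous_Rpower.
  apply: ex_derive_continuous; auto_derive; nra.
apply: (continuous_minus (K := R_AbsRing) (V := R_NormedModule)); [exact: kap_cont | exact: trunc_cont].
Qed.

Lemma remR_abs b nu m n u : 0 < u ->
  Rabs (remR b nu m n u) = Rpower u (- nu - 1 - 2 * INR n) * / (1 + u ^ 2) * Rabs (kap b nu u - trunc b nu m n u).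
Proof.
move=> hu; have p : 0 < / (1 + u ^ 2) by apply: Rinv_0_lt_compat; nra.
rewrite /remR Rabs_mult; congr (_ * _).
rewrite Rabs_mult pow_1_abs Rmult_1_l Rabs_pos_eq; last by apply: Rmult_le_pos; left => //; exact: exp_pos.
by congr (Rpower u _ * _); ring.
Qed.

Lemma scaled_piece b nu mu u n k x : 0 < u -> 0 < b -> nonint mu -> Rabs x <= (u / 2) ^ (2 * (n + k)) * CE b mu ->
  Rpower u (- nu - 1 - 2 * INR n) * Rabs (Acf b mu * (Rpower u mu * x)) <=
  (/ 4) ^ n * (Rabs (Acf b mu) * CE b mu * Rpower u (- nu - 1 + mu + 2 * INR k)).
Proof.
move=> u0 hb h T; have cm := CE_ge0 b mu hb h.
have pp : forall a, 0 < Rpower u a by move=> a; exact: exp_pos.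
rewrite (Rabs_mult (Acf b mu)) (Rabs_mult (Rpower u mu)) (Rabs_pos_eq (Rpower u mu)); last by left.
apply: (Rle_trans _ (Rpower u (- nu - 1 - 2 * INR n) * (Rabs (Acf b mu) * (Rpower u mu * ((u / 2) ^ (2 * (n + k)) * CE b mu))))).
  apply: Rmult_le_compat_l; first by left.
  apply: Rmult_le_compat_l; first exact: Rabs_pos.
  by apply: Rmult_le_compat_l; first by left.
have -> : (u / 2) ^ (2 * (n + k)) = (/ 4) ^ n * u ^ (2 * n) * (u / 2) ^ (2 * k).
  by rewrite Nat.mul_add_distr_l pow_add pow_quarter.
have -> : Rpower u (- nu - 1 - 2 * INR n) * (Rabs (Acf b mu) * (Rpower u mu * ((/ 4) ^ n * u ^ (2 * n) * (u / 2) ^ (2 * k) * CE b mu))) =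
  (/ 4) ^ n * ((Rabs (Acf b mu) * CE b mu) * ((Rpower u (- nu - 1 - 2 * INR n) * u ^ (2 * n)) * Rpower u mu * (u / 2) ^ (2 * k))) by ring.
rewrite scaled_cancel //.
apply: Rmult_le_compat_l; first by apply: pow_le; lra.
apply: Rmult_le_compat_l; first by apply: Rmult_le_pos => //; exact: Rabs_pos.
rewrite [Rpower u (- nu - 1 + mu + _)]Rpower_plus [Rpower u (- nu - 1 + mu)]Rpower_plus.
apply: Rmult_le_compat_l; first by left; apply: Rmult_lt_0_compat.
rewrite (_ : 2 * INR k = INR (2 * k)) ?Rpower_pow //; last by rewrite mult_INR.
apply: pow_incr; lra.
Qed.

(** The split is at u = 2. Below it the tails of the series gain (u/2)^(2n). Above it K and the
    partial sums are bounded separately, the partial sums by their largest powers of u/2. The weight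
    u^(-2n) leaves 4^(-n) in both cases. *)
Lemma remR_bounds b nu m : 0 < b -> 0 < nu -> nonint nu -> nu < INR m < nu + 1 ->
  exists B, 0 <= B /\ forall n,
  (forall u, 0 < u <= 1 -> Rabs (remR b nu m n u) <= B * (/ 4) ^ n * Rpower u (2 * (INR m - nu) - 1)) /\
  (forall u, 1 <= u -> Rabs (remR b nu m n u) <= B * (/ 4) ^ n * Rpower u (- (2 * (INR m - nu)) - 1)).
Proof.
move=> hb hn h hm; have h' := nonint_opp _ h.
set e := 2 * (INR m - nu); have he : 0 < e < 2 by rewrite /e; lra.
set X := Rabs (Acf b nu) * CE b nu; set Y := Rabs (Acf b (- nu)) * CE b (- nu).
have C1 := CE_ge0 b nu hb h; have C2 := CE_ge0 b (- nu) hb h'.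
have X0 : 0 <= X by apply: Rmult_le_pos => //; exact: Rabs_pos.
have Y0 : 0 <= Y by apply: Rmult_le_pos => //; exact: Rabs_pos.
have [B [B0 HB]] := kap_far b nu nu hb h.
exists (16 * (X + Y) + B); split; first lra.
move=> n; have q0 : 0 < (/ 4) ^ n by apply: pow_lt; lra.
have pp : forall u a, 0 < Rpower u a by move=> u a; exact: exp_pos.
have inv1 : forall u, 0 < u -> 0 < / (1 + u ^ 2) <= 1.
  move=> u hu; have u2 : 0 < u ^ 2 by nra.
  split; first by apply: Rinv_0_lt_compat; lra.
  rewrite -Rinv_1; apply: Rinv_le_contravar; lra.
have inv2 : forall u, 0 < u -> / (1 + u ^ 2) <= Rpower u (- (2)).
  move=> u hu; have u2 : 0 < u ^ 2 by nra.
  rewrite Rpower_Ropp (Rpower_pow 2) //; apply: Rinv_le_contravar; lra.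
have two : forall u, 0 < u <= 2 -> Rabs (remR b nu m n u) <= (/ 4) ^ n * (X * Rpower u 1 + Y * Rpower u (e - 1)) * / (1 + u ^ 2).
  move=> u hu; rewrite remR_abs; last lra.
  have [i1 i2] := inv1 u ltac:(lra).
  rewrite (Rmult_comm _ (/ (1 + u ^ 2))) Rmult_assoc (Rmult_comm _ (/ (1 + u ^ 2))); apply: Rmult_le_compat_l; first lra.
  have -> : kap b nu u - trunc b nu m n u = Acf b nu * (Rpower u nu * (eR nu (chi_ b * u ^ 2) - eT nu (chi_ b * u ^ 2) (S n))) + Acf b (- nu) * (Rpower u (- nu) * (eR (- nu) (chi_ b * u ^ 2) - eT (- nu) (chi_ b * u ^ 2) (n + m))).
    rewrite kap_Lr //; last lra.
    rewrite /trunc /Lr; ring.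
  have T1 := eR_tail b nu u (S n) hb h hu; have T2 := eR_tail b (- nu) u (n + m) hb h' hu.
  rewrite -(Nat.add_1_r n) in T1.
  have P1 := scaled_piece b nu nu u n 1 _ ltac:(lra) hb h T1; have P2 := scaled_piece b nu (- nu) u n m _ ltac:(lra) hb h' T2.
  rewrite Nat.add_1_r in P1.
  rewrite (_ : - nu - 1 + nu + 2 * INR 1 = 1) in P1; last by rewrite /=; ring.
  rewrite (_ : - nu - 1 + - nu + 2 * INR m = e - 1) in P2; last by rewrite /e; ring.
  apply: (Rle_trans _ (Rpower u (- nu - 1 - 2 * INR n) * (Rabs (Acf b nu * (Rpower u nu * (eR nu (chi_ b * u ^ 2) - eT nu (chi_ b * u ^ 2) (S n)))) + Rabs (Acf b (- nu) * (Rpower u (- nu) * (eR (- nu) (chi_ b * u ^ 2) - eT (- nu) (chi_ b * u ^ 2) (n + m))))))).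
    by apply: Rmult_le_compat_l; [left | exact: Rabs_triang].
  rewrite Rmult_plus_distr_l Rmult_plus_distr_l; exact: Rplus_le_compat.
split=> u hu.
  have [i1 i2] := inv1 u ltac:(lra).
  apply: Rle_trans (two u ltac:(lra)) _.
  have le1 : Rpower u 1 <= Rpower u (e - 1) by apply: Rpower_near_le; lra.
  have p1 := pp u 1; have p2 := pp u (e - 1).
  have Z0 : 0 <= X * Rpower u 1 + Y * Rpower u (e - 1) by apply: Rplus_le_le_0_compat; apply: Rmult_le_pos; lra.
  apply: (Rle_trans _ ((/ 4) ^ n * (X * Rpower u 1 + Y * Rpower u (e - 1)) * 1)).
    by apply: Rmult_le_compat_l => //; apply: Rmult_le_pos; lra.
  rewrite Rmult_1_r (Rmult_comm (16 * (X + Y) + B)) Rmult_assoc; apply: Rmult_le_compat_l; first lra.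
  nra.
case: (Rle_dec u 2) => c.
  apply: Rle_trans (two u ltac:(lra)) _.
  have le1 : Rpower u (e - 1) <= Rpower u 1 by apply: Rle_Rpower; lra.
  have le2 : Rpower u 1 <= 4 * Rpower u (- (1)).
    rewrite (_ : 1 = 2 + - (1)); last ring.
    rewrite [Rpower u (2 + _)]Rpower_plus (_ : - (2 + - (1)) = - (1)); last ring.
    apply: Rmult_le_compat_r; first by left.
    rewrite (Rpower_pow 2); [nra | lra].
  have le3 : Rpower u (- (1)) * Rpower u (- (2)) <= Rpower u (- e - 1) by rewrite -Rpower_plus; apply: Rle_Rpower; lra.
  have p3 := pp u (- e - 1); have p5 := pp u (e - 1).
  have i3 := inv2 u ltac:(lra); have [i4 i5] := inv1 u ltac:(lra).
  rewrite (Rmult_assoc ((/ 4) ^ n)) (_ : (16 * (X + Y) + B) * (/ 4) ^ n * Rpower u (- e - 1) = (/ 4) ^ n * ((16 * (X + Y) + B) * Rpower u (- e - 1))); last ring.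
  apply: Rmult_le_compat_l; first lra.
  apply: (Rle_trans _ ((X + Y) * (4 * Rpower u (- (1))) * Rpower u (- (2)))).
    have g1 : 0 <= X * Rpower u 1 + Y * Rpower u (e - 1) by apply: Rplus_le_le_0_compat; apply: Rmult_le_pos; lra.
    have g3 : X * Rpower u 1 + Y * Rpower u (e - 1) <= (X + Y) * (4 * Rpower u (- (1))).
      have : Y * Rpower u (e - 1) <= Y * (4 * Rpower u (- (1))) by apply: Rmult_le_compat_l; lra.
      have : X * Rpower u 1 <= X * (4 * Rpower u (- (1))) by apply: Rmult_le_compat_l; lra.
      lra.
    apply: Rmult_le_compat => //; lra.
  apply: (Rle_trans _ ((X + Y) * 4 * Rpower u (- e - 1))).
    rewrite (_ : (X + Y) * (4 * Rpower u (- (1))) * Rpower u (- (2)) = (X + Y) * 4 * (Rpower u (- (1)) * Rpower u (- (2)))); last ring.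
    apply: Rmult_le_compat_l; lra.
  apply: Rmult_le_compat_r; lra.
have u2 : 2 <= u by lra.
have u0 : 0 < u by lra.
have p3 := pp u (- e - 1).
have E1 : Rpower u (- (1) - (2)) <= Rpower u (- e - 1) by apply: Rle_Rpower; lra.
rewrite remR_abs; last lra.
have un : Rpower u (- (2 * INR n)) <= (/ 4) ^ n.
  rewrite Rpower_Ropp (_ : 2 * INR n = INR (2 * n)); last by rewrite mult_INR.
  rewrite Rpower_pow; last lra.
  rewrite pow_inv pow_mult; apply: Rinv_le_contravar; first by apply: pow_lt; lra.
  apply: pow_incr; nra.
have K1 : Rpower u (- nu - 1 - 2 * INR n) * Rabs (kap b nu u) <= (/ 4) ^ n * (B * Rpower u (- (1))).
  apply: (Rle_trans _ (Rpower u (- (2 * INR n)) * (B * (Rpower u (- nu - 1) * Rpower u nu)))).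
    rewrite (_ : - nu - 1 - 2 * INR n = - (2 * INR n) + (- nu - 1)); last ring.
    rewrite Rpower_plus Rmult_assoc; apply: Rmult_le_compat_l; first by left.
    have := HB u hu; have := pp u (- nu - 1) => ? ?.
    rewrite -Rmult_assoc (Rmult_comm B) Rmult_assoc; apply: Rmult_le_compat_l; lra.
  rewrite -Rpower_plus (_ : - nu - 1 + nu = - (1)); last ring.
  apply: Rmult_le_compat_r => //; apply: Rmult_le_pos => //; by left.
have T1 := eT_bound_S b nu u (n + 0) hb h u2.
have P1 := scaled_piece b nu nu u n 0 _ u0 hb h T1; rewrite Nat.add_0_r (_ : - nu - 1 + nu + 2 * INR 0 = - (1)) in P1; last by rewrite /=; ring.
have [m' Em] : exists m', m = S m'.
  case: m hm {e he two p3 E1} => [|m'] hm; last by exists m'.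
  by exfalso; rewrite /= in hm; lra.
have T2 := eT_bound_S b (- nu) u (n + m') hb h' u2.
have P2 := scaled_piece b nu (- nu) u n m' _ u0 hb h' T2.
rewrite -Nat.add_succ_r -Em in P2.
have P2' : Rpower u (- nu - 1 + - nu + 2 * INR m') <= Rpower u (- (1)).
  apply: Rle_Rpower; first lra.
  have : INR m = INR m' + 1 by rewrite Em S_INR.
  lra.
have [i4 i5] := inv1 u ltac:(lra); have i3 := inv2 u ltac:(lra).
have tri : Rabs (kap b nu u - trunc b nu m n u) <= Rabs (kap b nu u) + (Rabs (Acf b nu * (Rpower u nu * eT nu (chi_ b * u ^ 2) (S n))) + Rabs (Acf b (- nu) * (Rpower u (- nu) * eT (- nu) (chi_ b * u ^ 2) (n + m)))).
  apply: Rle_trans (Rabs_triang _ _) _; rewrite Rabs_Ropp; apply: Rplus_le_compat_l; exact: Rabs_triang.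
have q2 := pp u (- nu - 1 - 2 * INR n).
have tot : Rpower u (- nu - 1 - 2 * INR n) * Rabs (kap b nu u - trunc b nu m n u) <= (/ 4) ^ n * ((B + X + Y) * Rpower u (- (1))).
  apply: Rle_trans (Rmult_le_compat_l _ _ _ (Rlt_le _ _ q2) tri) _.
  rewrite !(Rmult_plus_distr_l (Rpower u (- nu - 1 - 2 * INR n))).
  have P3 : Rpower u (- nu - 1 - 2 * INR n) * Rabs (Acf b (- nu) * (Rpower u (- nu) * eT (- nu) (chi_ b * u ^ 2) (n + m))) <= (/ 4) ^ n * (Y * Rpower u (- (1))).
    apply: Rle_trans P2 _; apply: Rmult_le_compat_l; first lra.
    exact: Rmult_le_compat_l.
  rewrite -/X in P1.
  rewrite (_ : (/ 4) ^ n * ((B + X + Y) * Rpower u (- (1))) = (/ 4) ^ n * (B * Rpower u (- (1))) + ((/ 4) ^ n * (X * Rpower u (- (1))) + (/ 4) ^ n * (Y * Rpower u (- (1))))); last ring.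
  move: K1 P1 P3; lra.
rewrite (Rmult_comm _ (/ (1 + u ^ 2))) Rmult_assoc.
apply: (Rle_trans _ (Rpower u (- (2)) * ((/ 4) ^ n * ((B + X + Y) * Rpower u (- (1)))))).
  apply: Rmult_le_compat; try lra.
  apply: Rmult_le_pos; [lra | exact: Rabs_pos].
rewrite (_ : Rpower u (- (2)) * ((/ 4) ^ n * ((B + X + Y) * Rpower u (- (1)))) = (B + X + Y) * (/ 4) ^ n * (Rpower u (- (1)) * Rpower u (- (2)))); last ring.
rewrite -Rpower_plus -/(Rminus (- (1)) 2).
have g0 : 0 <= (B + X + Y) * (/ 4) ^ n by apply: Rmult_le_pos; lra.
have g : (B + X + Y) * (/ 4) ^ n <= (16 * (X + Y) + B) * (/ 4) ^ n by apply: Rmult_le_compat_r; lra.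
apply: Rmult_le_compat => //; left; exact: pp.
Qed.

Lemma is_lim_rsum u l : is_series u l -> is_lim_seq (rsum u) l.
Proof.
move=> h; apply/is_lim_seq_incr_1; apply: (is_lim_seq_ext (sum_n u)) => [n|]; [by rewrite rsum_sum_n | exact: h].
Qed.

Lemma eR_series b mu : nonint mu -> is_series (fun n => Ec mu n * (- chi_ b) ^ n) (eR mu (- chi_ b)).
Proof.
move=> h; apply: Series_correct; apply: entire_ex; apply: entire_Ec; exact: nonint_1p.
Qed.

Lemma BesselJ_eR b mu : nonint mu -> BesselJ mu b = Rpower (b / 2) mu * (/ Gamma (1 + mu) * eR mu (- chi_ b)).
Proof.
move=> h; rewrite /BesselJ; congr (_ * _).
rewrite -Series_scal_l; apply: Series_ext => n; rewrite -/(chi_ b) Gamma_poch // /Ec.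
have g0 := Gamma_neq0 _ (nonint_1p _ h); have p0 := poch_neq0 _ n (nonint_1p _ h); have f0 := INR_fact_neq_0 n.
field; do 2 (split => //).
Qed.

Lemma chi_half b nu : 0 < b -> Rpower (chi_ b) (nu / 2) = Rpower (b / 2) nu.
Proof.
move=> hb; rewrite (_ : chi_ b = (b / 2) ^ 2); last by rewrite /chi_; field.
rewrite -(Rpower_pow 2); last lra.
rewrite Rpower_mult /=; congr Rpower; field.
Qed.

Lemma Fchi_eR b nu : 0 < b -> nonint nu -> Fchi b nu (chi_ b) = 1 - eR nu (- chi_ b).
Proof.
move=> hb h; rewrite /Fchi BesselJ_eR // chi_half // Rpower_Ropp.
have g0 := Gamma_neq0 _ (nonint_1p _ h); have := exp_pos (nu * ln (b / 2)); rewrite -/(Rpower (b / 2) nu) => p.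
field; split; [exact: g0 | lra].
Qed.

(* The terms of 1 - Gamma(1+nu) (b/2)^(-nu) J_nu(b); [Dj] are the braces of the paper's F_*. *)
Definition tj (b nu : R) (j : nat) : R := - (Ec nu (S j) * (- chi_ b) ^ S j).
Definition Dj (nu : R) (j : nat) : R := psi (2 + INR j) - psi 2 + psi (2 + nu + INR j) - psi (2 + nu).

Lemma Fchi_series b nu : 0 < b -> nonint nu -> is_series (tj b nu) (Fchi b nu (chi_ b)).
Proof.
move=> hb h; rewrite Fchi_eR // /tj.
have H := is_series_decr_1 (fun n => Ec nu n * (- chi_ b) ^ n) (eR nu (- chi_ b) - 1).
have := is_series_opp _ (eR nu (- chi_ b) - 1) (is_series_incr_1 (fun n => Ec nu n * (- chi_ b) ^ n) (eR nu (- chi_ b) - 1) _).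
rewrite (_ : opp (eR nu (- chi_ b) - 1) = 1 - eR nu (- chi_ b)); last by rewrite /opp /=; ring.
apply; rewrite /plus /= /Ec /= (_ : eR nu (- chi_ b) - 1 + / (1 * 1) * 1 = eR nu (- chi_ b)); last by field.
exact: (eR_series b nu h).
Qed.

Lemma psi_nat x j : nonpole x -> psi (x + INR j) = psi x + rsum (fun i => / (x + INR i)) j.
Proof.
move=> h; elim: j => [|j IH]; first by rewrite /= !Rplus_0_r.
rewrite S_INR -Rplus_assoc psi_S; first by rewrite IH /=; ring.
elim: j {IH} => [|j IH]; first by rewrite /= Rplus_0_r.
rewrite S_INR -Rplus_assoc; exact: nonpole_S.
Qed.

Lemma Dj_bound nu j : 0 < nu -> Rabs (Dj nu j) <= 2 * INR j.
Proof.
move=> hn; rewrite /Dj !psi_nat; try (apply: nonpole_pos; lra).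
have B : forall x, 2 <= x -> Rabs (rsum (fun i => / (x + INR i)) j) <= INR j.
  move=> x hx; have -> : INR j = rsum (fun _ => 1) j by elim: j => [|j IH] //; rewrite S_INR IH.
  apply: Rabs_rsum_le => i _; have i0 := pos_INR i.
  rewrite Rabs_pos_eq; last by left; apply: Rinv_0_lt_compat; lra.
  rewrite -Rinv_1; apply: Rinv_le_contravar; lra.
have b1 := B 2 ltac:(lra); have b2 := B (2 + nu) ltac:(lra).
rewrite (_ : _ - _ = rsum (fun i => / (2 + INR i)) j + rsum (fun i => / (2 + nu + INR i)) j); last ring.
apply: Rle_trans (Rabs_triang _ _) _; lra.
Qed.

(** Going down from -1 - nu and going up from 2 + nu adds the same reciprocals, so the values at
    negative arguments become the differences in [Dj]. *)
Lemma psi_reflected nu j : 0 < nu -> nonint nu ->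
  psi (1 + INR (S j)) + psi (- nu - INR (S j)) = psi 2 + psi (-1 - nu) + Dj nu j.
Proof.
move=> hn h; rewrite /Dj (_ : 1 + INR (S j) = 2 + INR j); last by rewrite S_INR; ring.
suff -> : psi (- nu - INR (S j)) = psi (-1 - nu) + (psi (2 + nu + INR j) - psi (2 + nu)) by ring.
elim: j => [|j IH].
  rewrite /= Rplus_0_r (_ : - nu - 1 = -1 - nu); ring.
have np : nonpole (- nu - INR (S (S j))).
  apply: nonint_nonpole; apply: nonint_minus_nat; exact: nonint_opp.
have E := psi_S _ np; rewrite (_ : - nu - INR (S (S j)) + 1 = - nu - INR (S j)) in E; last by rewrite !S_INR; ring.
have E2 : psi (2 + nu + INR (S j)) = psi (2 + nu + INR j) + / (2 + nu + INR j).
  rewrite S_INR -Rplus_assoc psi_S //; apply: nonpole_pos; have := pos_INR j; lra.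
have E3 : / (- nu - INR (S (S j))) = - / (2 + nu + INR j).
  have := pos_INR j => j0; rewrite !S_INR; field; lra.
rewrite E2; rewrite IH E3 in E; lra.
Qed.

Lemma poch2_fact j : poch 2 j = INR (fact (S j)).
Proof.
elim: j => [|j IH]; first by [].
rewrite poch_S_r IH (_ : fact (S (S j)) = (S (S j) * fact (S j))%nat) // mult_INR !S_INR; ring.
Qed.

Lemma FFstar_series b nu : 0 < b -> 0 < nu -> nonint nu -> is_series (fun j => tj b nu j * Dj nu j) (FFstar nu (chi_ b)).
Proof.
move=> hb hn h; have c0 := chi_pos b hb.
have ex : ex_series (fun j => tj b nu j * Dj nu j).
  have e1 := entire_Ec _ (nonint_1p _ h) (2 * chi_ b) ltac:(lra).
  have e2 : ex_series (fun j => Rabs (Ec nu (S j)) * (2 * chi_ b) ^ S j) by apply/(ex_series_incr_1 (fun j => Rabs (Ec nu j) * (2 * chi_ b) ^ j)).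
  apply: (ex_series_dominated _ _ _ e2) => j.
  rewrite Rabs_mult /tj Rabs_Ropp Rabs_mult -RPow_abs Rabs_Ropp (Rabs_pos_eq (chi_ b)); last lra.
  rewrite Rmult_assoc; apply: Rmult_le_compat_l; first exact: Rabs_pos.
  rewrite Rpow_mult_distr Rmult_comm; apply: Rmult_le_compat_r; first by apply: pow_le; lra.
  apply: Rle_trans (Dj_bound nu j hn) _; rewrite [2 ^ S j]/=; have := INR_le_pow2 j; lra.
have D0 : Dj nu 0 = 0 by rewrite /Dj /= !Rplus_0_r; ring.
have E : Series (fun j => tj b nu j * Dj nu j) = FFstar nu (chi_ b).
  rewrite Series_incr_1 // D0 Rmult_0_r Rplus_0_l /FFstar -Series_scal_l; apply: Series_ext => j.
  rewrite -/(Dj nu (S j)) /tj /Ec poch2_fact poch_S_l (_ : 1 + nu + 1 = 2 + nu); last ring.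
  have f0 := INR_fact_neq_0 (S (S j)); have p0 : poch (2 + nu) (S j) <> 0.
    by apply: poch_neq0; apply: nonpole_pos; lra.
  set D := Dj nu (S j); set P := poch (2 + nu) (S j) in p0 *; set F := INR (fact (S (S j))) in f0 *.
  rewrite (_ : (- chi_ b) ^ S (S j) = - chi_ b * (- chi_ b) ^ S j) //.
  field; repeat split => //; lra.
by rewrite -E; exact: Series_correct.
Qed.

(** Matches the finite parts at the poles with the series of F(chi) and of its product with the
    second series in the theorem. *)
Lemma VK_term b nu j : 0 < b -> 0 < nu -> nonint nu ->
  (-1) ^ j * VK b (- nu - INR (S j)) (S j) = Acf b nu / 2 * (tj b nu j * (psi 2 + psi (-1 - nu) - ln (chi_ b)) + tj b nu j * Dj nu j).
Proof.
move=> hb hn h; rewrite /VK /tj /Acf.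
have E := Gamma_down nu (S j) h.
have -> : Rpower (b / 2) (INR (S j) - (- nu - INR (S j))) = Rpower (b / 2) nu * chi_ b ^ S j.
  have -> : INR (S j) - (- nu - INR (S j)) = nu + INR (2 * S j) by rewrite mult_INR [INR 2]/=; ring.
  rewrite Rpower_plus Rpower_pow; last lra.
  rewrite pow_mult /chi_; congr (_ * _ ^ _); field.
rewrite -[psi _ + psi _ - _]/(psi (1 + INR (S j)) + psi (- nu - INR (S j)) - ln (chi_ b)) psi_reflected //.
have f0 := INR_fact_neq_0 (S j).
have -> : (-1) ^ S j * Gamma (- nu - INR (S j)) / (4 * INR (fact (S j))) = Gamma (- nu) * Ec nu (S j) / 4.
  rewrite -E; field; exact: f0.
have -> : (- chi_ b) ^ S j = - ((-1) ^ j * chi_ b ^ S j).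
  rewrite (_ : - chi_ b = -1 * chi_ b); last ring.
  rewrite Rpow_mult_distr [(-1) ^ S j]/=; ring.
field.
Qed.

Lemma sin_shift n x : sin (x + INR n * PI) = (-1) ^ n * sin x.
Proof.
elim: n => [|n IH]; first by rewrite /= Rmult_0_l Rplus_0_r Rmult_1_l.
rewrite S_INR (_ : x + (INR n + 1) * PI = (x + INR n * PI) + PI); last ring.
rewrite neg_sin IH /=; ring.
Qed.

Lemma sin_iw nu n i : sin (PI * ((- nu - 2 * INR n + - nu + 2 * INR i) / 2)) = - ((-1) ^ n * (-1) ^ i * sin (PI * nu)).
Proof.
have E : (-1) ^ n * sin (PI * ((- nu - 2 * INR n + - nu + 2 * INR i) / 2)) = - ((-1) ^ i * sin (PI * nu)).
  rewrite -sin_shift (_ : _ + INR n * PI = - (PI * nu) + INR i * PI); last field.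
  rewrite sin_shift sin_neg; ring.
have q : (-1) ^ n * (-1) ^ n = 1 by rewrite -Rpow_mult_distr (_ : -1 * -1 = 1) ?pow1 //; ring.
have -> : - ((-1) ^ n * (-1) ^ i * sin (PI * nu)) = (-1) ^ n * - ((-1) ^ i * sin (PI * nu)) by ring.
rewrite -E -Rmult_assoc q; ring.
Qed.

(** The brace of Res(1) without ln a and the Euler constant, which come from the power 1/u and not
    from the integral. *)
Definition Jv (b nu : R) : R :=
  - ((PI / (2 * sin (PI * nu))) ^ 2 * BesselJ (- nu) b) +
  Acf b nu * (1 / 2 * (Fchi b nu (chi_ b) * (psi 2 + psi (-1 - nu) - ln (chi_ b)) + FFstar nu (chi_ b))).

Definition Sv (b nu : R) (m n : nat) : R :=
  Acf b nu / 2 * rsum (fun j => tj b nu j * (psi 2 + psi (-1 - nu) - ln (chi_ b)) + tj b nu j * Dj nu j) n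
  + - (Acf b (- nu) * (PI / (2 * sin (PI * nu)))) * rsum (fun i => Ec (- nu) i * (- chi_ b) ^ i) (n + m).

(** Of the three groups in [phi_decomp], the geometric terms give the psi series, the branch nu
    meets only even exponents and contributes 0, and the branch -nu gives the partial sums of the
    Bessel series through the sine formula. *)
Lemma FPI_phi_n b nu m : 0 < b -> 0 < nu -> nonint nu -> nu < INR m < nu + 1 ->
  exists C, forall n, exists l, FPI (phi b nu) (Sv b nu m n + l) /\ Rabs l <= C * (/ 4) ^ n.
Proof.
move=> hb hn h hm; have [B [B0 HB]] := remR_bounds b nu m hb hn h hm.
set e := 2 * (INR m - nu); have e0 : 0 < e by rewrite /e; lra.
exists (B * (4 / e)) => n; have [H1 H2] := HB n.
have q0 : 0 < (/ 4) ^ n by apply: pow_lt; lra.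
have [l [Hl bl]] := Int_power_bounds (remR b nu m n) (B * (/ 4) ^ n) e e0 ltac:(apply: Rmult_le_pos; lra) (fun u hu => remR_cont b nu m n u hb h hu) H1 H2.
exists l; split; last by rewrite (_ : B * (4 / e) * (/ 4) ^ n = B * (/ 4) ^ n * (4 / e)) //; ring.
apply: (FPI_ext _ _ _ (fun u hu => eq_sym (phi_decomp b nu m n u hu))).
apply: FPI_plus (FPI_Int _ _ Hl).
have F1 : FPI (fun u => rsum (fun r => (-1) ^ r * (Rpower u (- nu - 2 * INR (S r) - 1) * kap b nu u)) n) (rsum (fun j => Acf b nu / 2 * (tj b nu j * (psi 2 + psi (-1 - nu) - ln (chi_ b)) + tj b nu j * Dj nu j)) n).
  apply: FPI_rsum => r _; rewrite -VK_term //; apply: FPI_scal.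
  have hq : nonint (- nu - INR (S r)) by apply: nonint_minus_nat; exact: nonint_opp.
  apply: FPI_ext (FPI_K b _ (S r) hb hq) => u _.
  rewrite (_ : - nu - INR (S r) + INR (S r) = - nu); last ring.
  rewrite kap_even; congr (Rpower u _ * _); ring.
have F2 : FPI (fun u => (-1) ^ n * rsum (fun i => Acf b nu * (Ec nu i * chi_ b ^ i) * iw (- nu - 2 * INR n + nu + 2 * INR i) u) (S n)) ((-1) ^ n * rsum (fun i => Acf b nu * (Ec nu i * chi_ b ^ i) * 0) (S n)).
  apply: FPI_scal; apply: FPI_rsum => i hi; apply: FPI_scal.
  have -> : - nu - 2 * INR n + nu + 2 * INR i = - (2 * INR (n - i)) by rewrite minus_INR; [ring | lia].
  exact: FPI_iw_even.
have F3 : FPI (fun u => (-1) ^ n * rsum (fun i => Acf b (- nu) * (Ec (- nu) i * chi_ b ^ i) * iw (- nu - 2 * INR n + - nu + 2 * INR i) u) (n + m)) ((-1) ^ n * rsum (fun i => Acf b (- nu) * (Ec (- nu) i * chi_ b ^ i) * (PI / (2 * sin (PI * ((- nu - 2 * INR n + - nu + 2 * INR i) / 2))))) (n + m)).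
  apply: FPI_scal; apply: FPI_rsum => i hi; apply: FPI_scal.
  apply: (FPI_iw (n + m - i)); rewrite minus_INR; last lia.
  rewrite plus_INR; lra.
have := FPI_plus _ _ _ _ (FPI_plus _ _ _ _ F1 F2) F3.
have -> : rsum (fun i => Acf b nu * (Ec nu i * chi_ b ^ i) * 0) (S n) = 0.
  rewrite (rsum_ext _ (fun i => 0 * 0)); last by move=> i _; ring.
  rewrite rsum_scal; ring.
rewrite Rmult_0_r Rplus_0_r /Sv -!rsum_scal.
rewrite (rsum_ext (fun k => (-1) ^ n * _) (fun k => - (Acf b (- nu) * (PI / (2 * sin (PI * nu)))) * (Ec (- nu) k * (- chi_ b) ^ k))); first by move=> H; exact: H.
move=> i _; have s0 := sin_nonint _ h.
have pm : forall k, (-1) ^ k <> 0 by move=> k; apply: pow_nonzero; lra.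
have pm2 : forall k, (-1) ^ k * (-1) ^ k = 1 by move=> k; rewrite -Rpow_mult_distr (_ : -1 * -1 = 1) ?pow1 //; ring.
rewrite sin_iw (_ : - chi_ b = -1 * chi_ b); last ring.
rewrite Rpow_mult_distr.
have -> : (-1) ^ n * (Acf b (- nu) * (Ec (- nu) i * chi_ b ^ i) * (PI / (2 * - ((-1) ^ n * (-1) ^ i * sin (PI * nu))))) =
  - (Acf b (- nu) * (PI / (2 * sin (PI * nu)))) * (Ec (- nu) i * (/ (-1) ^ i * chi_ b ^ i)) by field; repeat split.
have -> : / (-1) ^ i = (-1) ^ i by rewrite -[RHS]Rmult_1_l -(Rinv_l ((-1) ^ i)) // Rmult_assoc pm2 Rmult_1_r.
by [].
Qed.

Lemma Sv_lim b nu m : 0 < b -> 0 < nu -> nonint nu -> is_lim_seq (Sv b nu m) (Jv b nu).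
Proof.
move=> hb hn h; have h' := nonint_opp _ h.
set q := psi 2 + psi (-1 - nu) - ln (chi_ b).
have S1 := is_series_plus _ _ _ _ (is_series_scal q _ _ (Fchi_series b nu hb h)) (FFstar_series b nu hb hn h).
have L1 := is_lim_rsum _ _ S1.
have L2 := is_lim_rsum _ _ (eR_series b (- nu) h').
have L3 : is_lim_seq (fun n => rsum (fun i => Ec (- nu) i * (- chi_ b) ^ i) (n + m)) (eR (- nu) (- chi_ b)) by exact: (proj1 (is_lim_seq_incr_n (rsum _) m _) L2).
have -> : Finite (Jv b nu) = Finite (Acf b nu / 2 * (q * Fchi b nu (chi_ b) + FFstar nu (chi_ b)) + - (Acf b (- nu) * (PI / (2 * sin (PI * nu)))) * eR (- nu) (- chi_ b)).
  congr Finite; rewrite /Jv BesselJ_eR // -/q.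
  have g0 : Gamma (1 + - nu) <> 0 by apply: Gamma_neq0; exact: nonint_1p.
  have s0 := sin_nonint _ h; have := Gamma_reflect nu h; rewrite (_ : 1 - nu = 1 + - nu) // => R.
  have A : Acf b (- nu) = PI / sin (PI * nu) / Gamma (1 + - nu) / 2 * Rpower (b / 2) (- nu).
    by rewrite /Acf Ropp_involutive -R; field.
  rewrite A; field; split => //.
apply: is_lim_seq_plus'; apply: is_lim_seq_mult'; try exact: is_lim_seq_const; last exact: L3.
apply: is_lim_seq_ext L1 => n; apply: rsum_ext => i _; rewrite /plus /scal /= /mult /= -/q; ring.
Qed.

Lemma nat_ceil nu : 0 < nu -> nonint nu -> exists m, nu < INR m < nu + 1.
Proof.
move=> hn h; have [h1 h2] := archimed nu; exists (Z.to_nat (up nu)).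
have z0 : (0 <= up nu)%Z by apply: le_IZR; lra.
rewrite INR_IZR_INZ Z2Nat.id //; split; first lra.
have : IZR (up nu) <> nu + 1; last by lra.
by move=> E; apply: (h (up nu - 1)%Z); rewrite minus_IZR; lra.
Qed.

(** The finite part is one number for all n, while [Sv] differs from it by O(4^(-n)); so it is the
    limit of [Sv]. *)
Lemma FPI_phi b nu : 0 < b -> 0 < nu -> nonint nu -> FPI (phi b nu) (Jv b nu).
Proof.
move=> hb hn h.
have [m hm] := nat_ceil nu hn h.
have [C HC] := FPI_phi_n b nu m hb hn h hm.
have [l0 [F0 _]] := HC 0%nat; set J := Sv b nu m 0 + l0 in F0.
have L : is_lim_seq (Sv b nu m) J.
  apply: (is_lim_seq_ext (fun n => J + (Sv b nu m n - J))); first by move=> n; ring.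
  have -> : Finite J = Finite (J + 0) by congr Finite; ring.
  apply: is_lim_seq_plus'; first exact: is_lim_seq_const.
  apply/is_lim_seq_abs_0.
  have G : is_lim_seq (fun n => C * (/ 4) ^ n) 0.
    have -> : Finite 0 = Finite (C * 0) by congr Finite; ring.
    apply: is_lim_seq_mult'; first exact: is_lim_seq_const.
    apply: is_lim_seq_geom; rewrite Rabs_pos_eq; lra.
  apply: is_lim_seq_le_le (is_lim_seq_const 0) G => n; split; first exact: Rabs_pos.
  have [l [Fl bl]] := HC n; have := FPI_unique _ _ _ F0 Fl => E.
  rewrite (_ : Sv b nu m n - J = - l) ?Rabs_Ropp //; lra.
have := is_lim_seq_unique _ _ L; rewrite (is_lim_seq_unique _ _ (Sv_lim b nu m hb hn h)) => -[->]; exact: F0.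
Qed.

(** * The constant term on the real axis *)

Definition r1 (b nu : R) (m : nat) (u : R) : R :=
  phi b nu u - rsum (fun k => cc b (- nu) k * Rpower u (la nu (- nu) k)) m.

Lemma gf_phi b nu u : 0 < b -> nonint nu -> 0 < u -> gf b nu (RtoC u) = RtoC (phi b nu u).
Proof.
move=> hb h hu; rewrite /gf /phi Cpower_RtoC // Kf_kap_R //.
have E : (1 + RtoC u * RtoC u)%C = RtoC (1 + u ^ 2) by rewrite -RtoC_mult -RtoC_plus; congr RtoC; ring.
by rewrite E -RtoC_inv; [rewrite -!RtoC_mult | nra].
Qed.

Lemma rho_r1 b nu m u : 0 < b -> nonint nu -> 0 < u -> rho b nu m 0 (RtoC u) = RtoC (r1 b nu m u).
Proof.
move=> hb h hu; rewrite /rho gf_phi // /r1 RtoC_minus {2}/pw [csum _ 0]/=.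
have -> : pw b nu (- nu) m (RtoC u) = RtoC (rsum (fun k => cc b (- nu) k * Rpower u (la nu (- nu) k)) m).
  rewrite /pw; elim: m => [|m IH] //=; by rewrite IH Cpower_RtoC // RtoC_plus RtoC_mult.
ring.
Qed.

Lemma phi_cont b nu u : 0 < b -> nonint nu -> 0 < u -> continuous (phi b nu) u.
Proof.
move=> hb h hu; apply: (continuous_mult (K := R_AbsRing)); first exact: continuous_Rpower.
apply: (continuous_mult (K := R_AbsRing)); first exact: kap_cont.
apply: ex_derive_continuous; auto_derive; nra.
Qed.

Lemma r1_cont b nu m u : 0 < b -> nonint nu -> 0 < u -> continuous (r1 b nu m) u.
Proof.
move=> hb h hu; apply: (continuous_minus (K := R_AbsRing) (V := R_NormedModule)); first exact: phi_cont.
apply: continuous_rsum => i; apply: (continuous_mult (K := R_AbsRing)); [exact: continuous_const | exact: continuous_Rpower].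
Qed.

(** The function [iw 0] imitates 1/u at 0, decays like u^(-3) and has finite part 0, as have the
    subtracted powers; so this convergent integral equals the finite part of [phi]. *)
Lemma r1_Int b nu m : 0 < b -> 0 < nu -> nonint nu -> nu < INR m < nu + 1 ->
  Int (fun u => r1 b nu m u - cc b nu 0 * iw 0 u) (Jv b nu).
Proof.
move=> hb hn h hm; set c := cc b nu 0.
have [e [B [P [he [B0 [_ [_ [H2 [H3 _]]]]]]]]] := rho_class b nu 1 m ltac:(lra) hb hn h hm.
have cA := Rabs_pos c.
have iw0 : forall u, 0 < u -> iw 0 u = / u * / (1 + u ^ 2).
  by move=> u hu; rewrite /iw (_ : 0 - 1 = - (1)) ?(Rpower_Ropp _ 1) ?Rpower_1 //; ring.
have mu : forall u, 0 < u -> Cmod (RtoC u) = u by move=> u hu; rewrite Cmod_R Rabs_pos_eq; lra.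
have PhE : forall u, 0 < u -> Phi1 b nu m (RtoC u) = RtoC (u * r1 b nu m u) by move=> u hu; rewrite /Phi1 rho_r1 // RtoC_mult.
have R1 : forall u, 0 < u -> Rpower u (e - 1) = Rpower u e / u by move=> u hu; rewrite Rpower_plus (Rpower_Ropp _ 1) Rpower_1.
have R2 : forall u, 0 < u -> Rpower u (- e - 1) = Rpower u (- e) / u by move=> u hu; rewrite Rpower_plus (Rpower_Ropp _ 1) Rpower_1.
have [l [Hl _]] : exists l, Int (fun u => r1 b nu m u - c * iw 0 u) l /\ Rabs l <= (B + Rabs c) * (4 / e).
  apply: Int_power_bounds; [lra | lra | | |].
  - move=> u hu; apply: (continuous_minus (K := R_AbsRing) (V := R_NormedModule)); first exact: r1_cont.
    apply: (continuous_mult (K := R_AbsRing)); first exact: continuous_const.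
    apply: (continuous_mult (K := R_AbsRing)); first exact: continuous_Rpower.
    apply: ex_derive_continuous; auto_derive; nra.
  - move=> u hu; have u0 : 0 < u by lra.
    have := H2 (RtoC u) (Sect_RtoC u u0); rewrite mu // PhE // -RtoC_minus Cmod_R => H; have {}H := H (proj2 hu).
    rewrite iw0 // (_ : r1 b nu m u - c * (/ u * / (1 + u ^ 2)) = / u * (u * r1 b nu m u - c) + c * (u * / (1 + u ^ 2))); last by field; split; nra.
    apply: Rle_trans (Rabs_triang _ _) _; rewrite Rmult_plus_distr_r; apply: Rplus_le_compat.
      rewrite Rabs_mult Rabs_pos_eq; last by left; exact: Rinv_0_lt_compat.
      rewrite R1 // /Rdiv -Rmult_assoc (Rmult_comm (/ u)); apply: Rmult_le_compat_r => //; left; exact: Rinv_0_lt_compat.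
    rewrite Rabs_mult; apply: Rmult_le_compat_l => //.
    have i1 : 0 < / (1 + u ^ 2) <= 1.
      split; first by apply: Rinv_0_lt_compat; nra.
      rewrite -Rinv_1; apply: Rinv_le_contravar; nra.
    rewrite Rabs_pos_eq; last by nra.
    apply: (Rle_trans _ (Rpower u 1)); first by rewrite Rpower_1 //; nra.
    apply: Rpower_near_le; lra.
  move=> u hu; have u0 : 0 < u by lra.
  have hf : Far 1 (RtoC u) by split; [exact: Sect_RtoC | rewrite mu].
  have := H3 _ hf; rewrite mu // PhE // Cmod_R Rabs_mult (Rabs_pos_eq u); last lra.
  move=> H; apply: Rle_trans (Rabs_triang _ _) _; rewrite Rabs_Ropp Rmult_plus_distr_r; apply: Rplus_le_compat.
    apply: (Rmult_le_reg_l u) => //; apply: Rle_trans H _; rewrite R2 //; right; field; lra.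
  rewrite Rabs_mult; apply: Rmult_le_compat_l => //; rewrite iw0 //.
  have i2 : / (1 + u ^ 2) <= / (u * u) by apply: Rinv_le_contravar; nra.
  have i3 : 0 < / u by exact: Rinv_0_lt_compat.
  have i4 : 0 < / (1 + u ^ 2) by apply: Rinv_0_lt_compat; nra.
  rewrite Rabs_pos_eq; last by nra.
  apply: (Rle_trans _ (Rpower u (- (3)))); last by apply: Rle_Rpower; lra.
  rewrite Rpower_Ropp (_ : 3 = INR 3); last by rewrite /=; ring.
  rewrite Rpower_pow // (_ : / u ^ 3 = / u * / (u * u)); last by field; lra.
  apply: Rmult_le_compat_l; lra.
suff <- : l = Jv b nu by [].
apply: (FPI_unique (phi b nu)); last exact: FPI_phi.
have Fp : FPI (fun u => rsum (fun k => cc b (- nu) k * Rpower u (la nu (- nu) k)) m) (rsum (fun k => cc b (- nu) k * 0) m).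
  apply: FPI_rsum => i hi; apply: FPI_scal.
  apply: FPI_ext (FPI_power (la nu (- nu) i + 1) _).
    by move=> u _; congr Rpower; ring.
  rewrite /la; have : INR (S i) <= INR m by apply: le_INR; lia.
  rewrite S_INR; lra.
have Fi := FPI_scal c _ _ (FPI_iw_even 0).
rewrite (rsum_ext _ (fun k => 0 * 0)) in Fp; last by move=> i _; ring.
rewrite rsum_scal Rmult_0_l in Fp.
have := FPI_plus _ _ _ _ (FPI_plus _ _ _ _ (FPI_Int _ _ Hl) Fp) Fi.
rewrite (_ : l + 0 + c * 0 = l); last ring.
apply: FPI_ext => u hu; rewrite /r1 (_ : - (2 * INR 0) = 0); last by rewrite /=; ring.
ring.
Qed.

Lemma mean_dev (F f : R -> R) x h K : 0 < x -> 0 < h -> (forall u, 0 < u -> is_derive F u (f u)) ->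
  (forall t, 0 <= t <= 1 -> Rabs (f x - f (x + t * h)) <= K) -> Rabs (h * f x - (F (x + h) - F x)) <= K * h.
Proof.
move=> hx hh hF hK.
case: (MVT_gen F x (x + h) f).
- move=> y; rewrite Rmin_left ?Rmax_right; try lra; move=> hy; apply: hF; lra.
- move=> y; rewrite Rmin_left ?Rmax_right; try lra; move=> hy.
  by apply/continuity_pt_filterlim; apply: ex_derive_continuous; exists (f y); apply: hF; lra.
move=> y; rewrite Rmin_left ?Rmax_right; try lra; move=> -[hy E].
rewrite E (_ : x + h - x = h); last ring.
rewrite (_ : h * f x - f y * h = (f x - f y) * h); last ring.
rewrite Rabs_mult (Rabs_pos_eq h); last lra.
apply: Rmult_le_compat_r; first lra.
have := hK ((y - x) / h) _; rewrite (_ : x + (y - x) / h * h = y); last by field; lra.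
apply; split; first by apply: Rdiv_le_0_compat; lra.
apply: (Rmult_le_reg_r h) => //; rewrite /Rdiv Rmult_assoc Rinv_l; lra.
Qed.

(** Convergence is inherited from the digamma sequence at 1, which differs from minus this one by
    vanishing terms. *)
Lemma harmonic_gamma : is_lim_seq (fun n => rsum (fun k => / INR (S k)) n - ln (INR (S n))) euler_gamma.
Proof.
have E : forall n, rsum (fun k => / INR (S k)) n = sum_n_m (fun k => / INR k) 1 n.
  elim=> [|n IH]; first by rewrite sum_n_m_zero //; lia.
  rewrite sum_n_Sm; last lia.
  by rewrite -IH.
have I1 : is_lim_seq (fun n => / INR (S n)) 0.
  apply: (is_lim_seq_ext (fun n => Rpower (INR (S n)) (- (1)))); last by apply: Rpower_INR_to_0; lra.
  move=> n; rewrite (Rpower_Ropp _ 1) Rpower_1 //; apply: lt_0_INR; lia.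
have I2 : is_lim_seq (fun n => / INR (S (S n))) 0 := proj1 (is_lim_seq_incr_1 (fun n => / INR (S n)) 0) I1.
have L : is_lim_seq (fun n => rsum (fun k => / INR (S k)) n - ln (INR (S n))) (- digam 1).
  apply: (is_lim_seq_ext (fun n => -1 * dlnG n 1 + (-1 * / INR (S n) + -1 * / INR (S (S n))))).
    move=> n; rewrite /dlnG -rsum_sum_n.
    have -> : rsum (fun k => / (1 + INR k)) (S (S n)) = rsum (fun k => / INR (S k)) (S (S n)).
      by apply: rsum_ext => k _; rewrite S_INR Rplus_comm.
    have rsS : forall v k, rsum v (S k) = rsum v k + v k by [].
    rewrite !rsS; ring.
  have -> : Finite (- digam 1) = Finite (-1 * digam 1 + (-1 * 0 + -1 * 0)) by congr Finite; ring.
  apply: is_lim_seq_plus'; first by apply: is_lim_seq_mult'; [exact: is_lim_seq_const | exact: digam_lim 1 Rlt_0_1].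
  by apply: is_lim_seq_plus'; apply: is_lim_seq_mult'; try exact: is_lim_seq_const.
suff -> : euler_gamma = - digam 1 by [].
have L2 : is_lim_seq (fun n => sum_n_m (fun k => / INR k) 1 n - ln (INR n)) (- digam 1).
  apply/is_lim_seq_incr_1; apply: (is_lim_seq_ext (fun n => (rsum (fun k => / INR (S k)) n - ln (INR (S n))) + / INR (S n))).
    have rsS : forall v k, rsum v (S k) = rsum v k + v k by [].
    move=> n; rewrite -E rsS; ring.
  rewrite -(Rplus_0_r (- digam 1)); exact: is_lim_seq_plus'.
by rewrite /euler_gamma (is_lim_seq_unique _ _ L2).
Qed.

(** Cell by cell the sum is compared with the increments of a primitive; the errors sum to O(h^e),
    and the separated term c/u yields harmonic numbers, hence the Euler constant. *)
Lemma Ef_real b nu m : 0 < b -> 0 < nu -> nonint nu -> nu < INR m < nu + 1 ->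
  exists B e G, 0 <= B /\ 0 < e /\ filterlim G (at_right 0) (locally (- Jv b nu)) /\
  forall h, 0 < h <= 1 -> Cmod (Ef b nu m 0 (RtoC h) -
    RtoC (cc b nu 0 * euler_gamma - G h + cc b nu 0 / 2 * ln (1 + h ^ 2)))%C <= B * Rpower h e.
Proof.
move=> hb hn h hm; set c := cc b nu 0.
have [e [B [P [he [B0 [_ [_ [_ [_ H5]]]]]]]]] := rho_class b nu 1 m ltac:(lra) hb hn h hm.
have [G [G1 [G2 G3]]] := r1_Int b nu m hb hn h hm.
set Z := Series (fun j => Rpower (INR (S j)) (e - 2)).
have exZ : ex_series (fun j => Rpower (INR (S j)) (e - 2)) by apply: ex_series_Rpower; lra.
have Z0 : 0 <= Z by apply: (is_series_ge0 _ _ (Series_correct _ exZ)) => n; left; exact: exp_pos.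
exists (B * Z), e, G; split; first exact: Rmult_le_pos.
do 2 (split; first by [lra | exact: G3]).
move=> x hx; have x0 : 0 < x by lra.
(* G belongs to the integrand with c / (u (1 + u^2)) removed; removing c/u instead changes the
   integrand by c u / (1 + u^2), hence the logarithm in F2. *)
pose r2 u := r1 b nu m u - c / u.
pose F2 u := G u - c / 2 * ln (1 + u ^ 2).
have F2d : forall u, 0 < u -> is_derive F2 u (r2 u).
  move=> u hu; have p : 0 < 1 + u ^ 2 by nra.
  have D : is_derive (fun u => c / 2 * ln (1 + u ^ 2)) u (c * u / (1 + u ^ 2)).
    auto_derive; first by move: p; rewrite /=.
    move: p => /= p; field; lra.
  have := is_derive_minus _ _ _ _ _ (G1 u hu) D.
  have -> : r2 u = minus (r1 b nu m u - c * iw 0 u) (c * u / (1 + u ^ 2)); last exact.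
  rewrite /r2 /iw (_ : 0 - 1 = - (1)); last ring.
  rewrite (Rpower_Ropp _ 1) Rpower_1 // /minus /plus /opp /=; field; split; nra.
have rho2E : forall u, 0 < u -> rho b nu m 1 (RtoC u) = RtoC (r2 u).
  move=> u hu; have E := rho1_rho2 b nu m (RtoC u) hu; rewrite rho_r1 // in E.
  rewrite /r2 RtoC_minus E /Rdiv RtoC_mult RtoC_inv; [rewrite -/c; ring | lra].
have mx : Cmod (RtoC x) = x by rewrite Cmod_R Rabs_pos_eq; lra.
have dev : forall n, Rabs (x * r2 (INR (S n) * x) - (F2 (INR (S (S n)) * x) - F2 (INR (S n) * x))) <= B * Rpower x e * Rpower (INR (S n)) (e - 2).
  move=> n; have n1 : 1 <= INR (S n) by rewrite S_INR; have := pos_INR n; lra.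
  have nx : 0 < INR (S n) * x by nra.
  have -> : INR (S (S n)) * x = INR (S n) * x + x by rewrite (S_INR (S n)); ring.
  apply: (Rle_trans _ (B * (x * Rpower (INR (S n) * x) (e - 2)) * x)).
    apply: mean_dev => // t ht.
    have := H5 (RtoC x) (INR (S n)) t (Sect_RtoC x x0) ltac:(rewrite mx; lra) n1 ht.
    rewrite -!RtoC_mult -RtoC_plus !rho2E //; last nra.
    by rewrite -RtoC_minus Cmod_R mx.
  right; rewrite -Rpower_mult_distr //; last lra.
  rewrite (_ : Rpower x e = x * x * Rpower x (e - 2)); first ring.
  rewrite -{2 3}(Rpower_1 x) // -!Rpower_plus; congr Rpower; ring.
have sg : Sect 1 (RtoC x) := Sect_RtoC x x0.
have S1 := Ef_CSum b nu 1 m (RtoC x) ltac:(lra) hb hn h hm sg.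
have part : forall N, csum (fun n => RtoC x * rho b nu m 0 (RtoC (INR (S n)) * RtoC x))%C N =
  RtoC (rsum (fun n => x * r2 (INR (S n) * x)) N + c * rsum (fun n => / INR (S n)) N).
  elim=> [|N IH]; first by rewrite /= Rmult_0_r Rplus_0_r.
  have n0 : 0 < INR (S N) by apply: lt_0_INR; lia.
  have csS : forall v k, csum v (S k) = (csum v k + v k)%C by [].
  have rsS : forall v k, rsum v (S k) = rsum v k + v k by [].
  rewrite csS !rsS IH -RtoC_mult rho_r1 //; last by apply: Rmult_lt_0_compat.
  rewrite -RtoC_mult -RtoC_plus; congr RtoC; rewrite /r2; field; lra.
have tel : forall N, rsum (fun n => F2 (INR (S (S n)) * x) - F2 (INR (S n) * x)) N = F2 (INR (S N) * x) - F2 x.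
  elim=> [|N IH]; first by rewrite /= Rmult_1_l; ring.
  by rewrite [rsum _ (S N)]/rsum -/(rsum _ N) IH; ring.
have bound : forall N, Rabs (rsum (fun n => x * r2 (INR (S n) * x)) N - (F2 (INR (S N) * x) - F2 x)) <= B * Z * Rpower x e.
  move=> N; rewrite -tel.
  have -> : rsum (fun n => x * r2 (INR (S n) * x)) N - rsum (fun n => F2 (INR (S (S n)) * x) - F2 (INR (S n) * x)) N =
    rsum (fun n => x * r2 (INR (S n) * x) - (F2 (INR (S (S n)) * x) - F2 (INR (S n) * x))) N.
    elim: N => [|N IH]; first by rewrite /=; ring.
    have rsS : forall v k, rsum v (S k) = rsum v k + v k by [].
    rewrite !rsS -IH; ring.
  apply: Rle_trans (Rabs_rsum_le _ (fun n => B * Rpower x e * Rpower (INR (S n)) (e - 2)) N (fun i _ => dev i)) _.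
  rewrite rsum_scal (_ : B * Z * Rpower x e = B * Rpower x e * Z); last ring.
  apply: Rmult_le_compat_l; first by apply: Rmult_le_pos => //; left; exact: exp_pos.
  by apply: rsum_le_series; [move=> n; left; exact: exp_pos | exact: Series_correct].
(* What the upper end contributes once c ln((N + 1) x) has been exchanged between F2 and the
   harmonic sum; every piece tends to 0. *)
pose tail N := G (INR (S N) * x) - c / 2 * ln (/ (INR (S N) * x) ^ 2 + 1) + c * (rsum (fun n => / INR (S n)) N - ln (INR (S N)) - euler_gamma).
have tail0 : is_lim_seq tail 0.
  have xN : is_lim_seq (fun N => INR (S N) * x) p_infty.
    have := is_lim_seq_scal_r _ x _ (proj1 (is_lim_seq_incr_1 _ _) is_lim_seq_INR); rewrite /Rbar_mult /=.
    case: Rle_dec => // [hx0|]; last lra.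
    by case: Rle_lt_or_eq_dec => // ?; lra.
  rewrite /tail.
  have -> : Finite 0 = Finite (0 - c / 2 * 0 + c * 0) by congr Finite; ring.
  apply: is_lim_seq_plus'.
    apply: is_lim_seq_minus'.
      apply: (is_lim_comp_seq G _ p_infty 0 G2) => //; by exists 0%nat.
    apply: is_lim_seq_mult'; first exact: is_lim_seq_const.
    have L : is_lim_seq (fun N => / (INR (S N) * x) ^ 2 + 1) 1.
      rewrite -[X in is_lim_seq _ (Finite X)](Rplus_0_l 1); apply: is_lim_seq_plus'; last exact: is_lim_seq_const.
      apply: (is_lim_seq_ext (fun N => / (INR (S N) * x) * / (INR (S N) * x))).
        move=> N; have n0 : 0 < INR (S N) by apply: lt_0_INR; lia.
        rewrite -Rinv_mult; congr (/ _); ring.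
      have L0 : is_lim_seq (fun N => / (INR (S N) * x)) 0 by apply: (is_lim_seq_inv _ p_infty).
      have -> : Finite 0 = Finite (0 * 0) by rewrite Rmult_0_l.
      exact: is_lim_seq_mult'.
    have := is_lim_seq_continuous ln _ 1 _ L; rewrite ln_1; apply.
    apply/continuity_pt_filterlim; apply: (ex_derive_continuous ln); auto_derive; lra.
  apply: is_lim_seq_mult'; first exact: is_lim_seq_const.
  rewrite -(Rplus_opp_r euler_gamma).
  apply: is_lim_seq_minus'; [exact: harmonic_gamma | exact: is_lim_seq_const].
apply: le_epsilon => ep ep0.
have [N1 K1] := CSum_csum _ _ S1 (ep / 2) ltac:(lra).
have := tail0; rewrite -is_lim_seq_spec => /(_ (mkposreal (ep / 2) ltac:(lra))) [N2 K2].
set N := (N1 + N2)%nat.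
have a1 := K1 N ltac:(lia); have /= a2 := K2 N ltac:(lia); rewrite Rminus_0_r in a2.
rewrite part Cln_RtoC // -/c in a1.
set E := Ef b nu m 0 (RtoC x) in a1 *.
set W := rsum (fun n => x * r2 (INR (S n) * x)) N in a1; set H := rsum (fun n => / INR (S n)) N in a1.
have bN := bound N; rewrite -/W in bN.
have n0 : 0 < INR (S N) by apply: lt_0_INR; lia.
have nx : 0 < INR (S N) * x by apply: Rmult_lt_0_compat.
have tE : F2 (INR (S N) * x) + c * H = tail N + c * euler_gamma - c * ln x.
  rewrite /tail /F2 -/H.
  have -> : ln (1 + (INR (S N) * x) ^ 2) = ln (/ (INR (S N) * x) ^ 2 + 1) + 2 * (ln (INR (S N)) + ln x).
    have q2 : 0 < (INR (S N) * x) ^ 2 by apply: pow_lt.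
    rewrite (_ : 1 + (INR (S N) * x) ^ 2 = (/ (INR (S N) * x) ^ 2 + 1) * (INR (S N) * x) ^ 2); last by field; lra.
    have q3 : 0 < / (INR (S N) * x) ^ 2 by exact: Rinv_0_lt_compat.
    rewrite ln_mult //; last lra.
    rewrite -(Rpower_pow 2) // ln_exp ln_mult // [INR 2]/=; ring.
  field.
have key : (E - RtoC (c * euler_gamma - G x + c / 2 * ln (1 + x ^ 2))%R)%C =
  (- (RtoC (W + c * H)%R - (E - RtoC c * RtoC (ln x))) + RtoC ((W - (F2 (INR (S N) * x) - F2 x)) + tail N)%R)%C.
  have -> : W - (F2 (INR (S N) * x) - F2 x) + tail N = (W + c * H) - c * euler_gamma + c * ln x + F2 x by lra.
  rewrite /F2 !(RtoC_plus, RtoC_minus) !RtoC_mult; ring.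
rewrite key; apply: Rle_trans (Cmod_triangle _ _) _; rewrite Cmod_opp Cmod_R.
have := Rabs_triang (W - (F2 (INR (S N) * x) - F2 x)) (tail N); lra.
Qed.

(** * The asymptotic expansion *)

Definition Wk (k : R) (F : C -> C) (q : C) : Prop :=
  forall e, 0 < e -> exists x0, 0 < x0 /\ forall h, Sect k h -> Cmod h <= x0 -> Cmod (F h - q)%C <= e.

Lemma Wk_plus k F G p q : Wk k F p -> Wk k G q -> Wk k (fun h => F h + G h)%C (p + q)%C.
Proof.
move=> h1 h2 e e0; have [x1 [x10 H1]] := h1 (e / 2) ltac:(lra); have [x2 [x20 H2]] := h2 (e / 2) ltac:(lra).
exists (Rmin x1 x2); split; first exact: Rmin_glb_lt.
move=> h hs hh; have a1 := H1 h hs (Rle_trans _ _ _ hh (Rmin_l _ _)); have a2 := H2 h hs (Rle_trans _ _ _ hh (Rmin_r _ _)).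
rewrite (_ : (F h + G h - (p + q))%C = ((F h - p) + (G h - q))%C); last ring.
apply: Rle_trans (Cmod_triangle _ _) _; lra.
Qed.

Lemma Wk_ext k F G q : (forall h, F h = G h) -> Wk k F q -> Wk k G q.
Proof. by move=> E H e e0; have [x0 [h1 h2]] := H e e0; exists x0; split => // h; rewrite -E; exact: h2. Qed.

Lemma Wk_dominated k F q (g : R -> R) : filterlim g (at_right 0) (locally 0) ->
  (forall h, Sect k h -> Cmod h <= 1 -> Cmod (F h - q)%C <= g (Cmod h)) -> Wk k F q.
Proof.
move=> /filterlim_locally hg hF e e0; have [d Hd] := hg (mkposreal e e0).
exists (Rmin (d / 2) 1); have d0 := cond_pos d; split; first by apply: Rmin_glb_lt; lra.
move=> h hs hh; have h0 : 0 < Cmod h by apply: Re_pos_Cmod; case: hs.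
have l1 := Rle_trans _ _ _ hh (Rmin_l _ _); have l2 := Rle_trans _ _ _ hh (Rmin_r _ _).
apply: Rle_trans (hF h hs l2) _.
have : ball 0 d (Cmod h) by change (Rabs (Cmod h - 0) < d); rewrite Rminus_0_r Rabs_pos_eq; lra.
move=> hb; have := Hd _ hb h0 => H; have {H} : Rabs (g (Cmod h) - 0) < e by exact: H.
rewrite Rminus_0_r => H; have := Rle_abs (g (Cmod h)); lra.
Qed.

Lemma Cmod_zt b nu mu j h : 0 < Re h ->
  Cmod (zt b nu mu j h) = Rabs (cc b mu j * zeta (- la nu mu j)) * Rpower (Cmod h) (la nu mu j + 1).
Proof. move=> hh; rewrite /zt !Cmod_mult !Cmod_R Cmod_Cpower // Rabs_mult; ring. Qed.

Lemma Wk_zt k b nu mu j : 0 < la nu mu j + 1 -> Wk k (fun h => - zt b nu mu j h)%C 0%C.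
Proof.
move=> h; apply: (Wk_dominated _ _ _ (fun u => Rabs (cc b mu j * zeta (- la nu mu j)) * Rpower u (la nu mu j + 1))).
  exact: filterlim_scaled_power_0.
move=> z [hz _] _; rewrite (_ : (- zt b nu mu j z - 0)%C = (- zt b nu mu j z)%C); last ring.
rewrite Cmod_opp Cmod_zt //; lra.
Qed.

(** The value found on the real axis holds in every direction because [Ef_rotate] bounds the change
    along the arc by a positive power of |h|. *)
Lemma Ef_weak0 k b nu m : 0 < k <= 1 -> 0 < b -> 0 < nu -> nonint nu -> nu < INR m < nu + 1 ->
  Wk k (Ef b nu m 0) (RtoC (Jv b nu + cc b nu 0 * euler_gamma)).
Proof.
move=> hk hb hn h hm; set c := cc b nu 0.
have [B1 [e1 [p1 [q1 H1]]]] := Ef_rotate b nu k m hk hb hn h hm.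
have [B2 [e2 [G [p2 [q2 [G0 H2]]]]]] := Ef_real b nu m hb hn h hm.
apply: (Wk_dominated _ _ _ (fun u => B1 * Rpower u e1 + (B2 * Rpower u e2 + Rabs (- 1 * G u + (c / 2 * ln (1 + u ^ 2) + - Jv b nu))))).
  have -> : 0 = 0 + (0 + Rabs (- 1 * - Jv b nu + (c / 2 * ln (1 + 0 ^ 2) + - Jv b nu))).
    rewrite (_ : 1 + 0 ^ 2 = 1); last by rewrite /=; ring.
    rewrite ln_1 (_ : -1 * - Jv b nu + (c / 2 * 0 + - Jv b nu) = 0); last ring.
    rewrite Rabs_R0; ring.
  rewrite {1}(_ : 0 + (0 + Rabs (- 1 * - Jv b nu + (c / 2 * ln (1 + 0 ^ 2) + - Jv b nu))) = 0); last first.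
    rewrite (_ : 1 + 0 ^ 2 = 1); last by rewrite /=; ring.
    rewrite ln_1 (_ : -1 * - Jv b nu + (c / 2 * 0 + - Jv b nu) = 0); last ring.
    rewrite Rabs_R0; ring.
  apply: filterlim_Rplus; first exact: filterlim_scaled_power_0.
  apply: filterlim_Rplus; first exact: filterlim_scaled_power_0.
  have C : continuous (fun u => c / 2 * ln (1 + u ^ 2)) 0 by apply: ex_derive_continuous; auto_derive; lra.
  have C' : filterlim (fun u => c / 2 * ln (1 + u ^ 2)) (at_right 0) (locally (c / 2 * ln (1 + 0 ^ 2))).
    apply: filterlim_filter_le_1 C; exact: filter_le_within.
  apply: filterlim_comp (continuous_Rabs _).
  apply: filterlim_Rplus; first exact: filterlim_Rscal.
  apply: filterlim_Rplus => //; exact: filterlim_const.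
move=> z hz z1; have z0 : 0 < Cmod z by apply: Re_pos_Cmod; case: hz.
have a1 := H1 z hz z1; have a2 := H2 (Cmod z) ltac:(lra); rewrite -/c in a2.
set E2 := Ef b nu m 0 (RtoC (Cmod z)) in a1 a2.
set T := c * euler_gamma - G (Cmod z) + c / 2 * ln (1 + Cmod z ^ 2) in a2.
set U := -1 * G (Cmod z) + (c / 2 * ln (1 + Cmod z ^ 2) + - Jv b nu).
have -> : (Ef b nu m 0 z - RtoC (Jv b nu + c * euler_gamma))%C = ((Ef b nu m 0 z - E2) + ((E2 - RtoC T) + RtoC U))%C.
  have -> : U = T - (Jv b nu + c * euler_gamma) by rewrite /U /T; ring.
  rewrite RtoC_minus; ring.
apply: Rle_trans (Cmod_triangle _ _) _; apply: Rplus_le_compat => //.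
apply: Rle_trans (Cmod_triangle _ _) _; rewrite Cmod_R; exact: Rplus_le_compat_r.
Qed.

(** The further terms carry positive powers of h and leave the limit unchanged. *)
Lemma Ef_weak k b nu m i j : 0 < k <= 1 -> 0 < b -> 0 < nu -> nonint nu -> nu < INR m < nu + 1 ->
  Wk k (Ef b nu (i + m) j) (RtoC (Jv b nu + cc b nu 0 * euler_gamma)).
Proof.
move=> hk hb hn h hm; elim: j => [|j IH].
  elim: i => [|i IH]; first exact: Ef_weak0.
  have Z : Wk k (fun z => - zt b nu (- nu) (i + m) z)%C 0%C.
    apply: Wk_zt; rewrite /la plus_INR; have := pos_INR i; lra.
  have := Wk_plus _ _ _ _ _ IH Z; rewrite Cplus_0_r; apply: Wk_ext => z; rewrite /Ef /=; ring.
have Z : Wk k (fun z => - zt b nu nu (S j) z)%C 0%C.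
  apply: Wk_zt; rewrite /la S_INR; have := pos_INR j; lra.
have := Wk_plus _ _ _ _ _ IH Z; rewrite Cplus_0_r; apply: Wk_ext => z; rewrite /Ef /=; ring.
Qed.

Lemma csum_split u n m : csum u (n + m) = (csum u n + csum (fun k => u (n + k)%nat) m)%C.
Proof.
elim: m => [|m IH]; first by rewrite Nat.add_0_r /=; ring.
rewrite Nat.add_succ_r /= IH; ring.
Qed.

Lemma sum_n_m_csum (u : nat -> C) a n : sum_n_m u a (a + n) = csum (fun k => u (a + k)%nat) (S n).
Proof.
elim: n => [|n IH]; first by rewrite Nat.add_0_r sum_n_n /= Nat.add_0_r Cplus_0_l.
rewrite Nat.add_succ_r sum_n_Sm; last lia.
by rewrite IH [in RHS]/csum -/csum Nat.add_succ_r.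
Qed.

(** [Carg] is built from arccos, so an angle bound is a bound on Re a / |a|, with cos(pi/2 - delta)
    = sin delta. *)
Lemma Carg_sector delta a : 0 < delta < PI / 2 -> 0 < Cmod a -> Rabs (Carg a) <= PI / 2 - delta -> Sect (sin delta) a.
Proof.
move=> hd a0 ha; set t := Re a / Cmod a.
have ht : -1 <= t <= 1.
  have : Rabs (Re a) <= Cmod a by exact: re_le_Cmod.
  move=> /Rabs_le_between hr; split; apply: (Rmult_le_reg_r (Cmod a)) => //;
  rewrite /t /Rdiv Rmult_assoc Rinv_l; lra.
have ab := acos_bound t.
have hac : acos t <= PI / 2 - delta.
  move: ha; rewrite /Carg -/t; case: Rle_dec => _; first by rewrite Rabs_pos_eq; lra.
  rewrite Rabs_Ropp Rabs_pos_eq; lra.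
have tE : sin delta <= t.
  rewrite -(cos_acos t) // -cos_shift; apply: cos_decr_1; lra.
have s0 : 0 < sin delta by apply: sin_gt_0; lra.
have RE : Re a = t * Cmod a by rewrite /t; field; lra.
split; rewrite RE; first by apply: Rmult_lt_0_compat; lra.
apply: Rmult_le_compat_r; lra.
Qed.

Lemma Cmod_Cinv (a : C) : a <> 0%C -> Cmod (/ a)%C = / Cmod a.
Proof.
move=> h; have m0 := Cmod_pos a h; apply: (Rmult_eq_reg_l (Cmod a)); last lra.
by rewrite -Cmod_mult Cinv_r // Cmod_1 Rinv_r //; lra.
Qed.

Lemma Sect_inv k a : Sect k a -> Sect k (/ a)%C.
Proof.
move=> [h1 h2]; have a0 := Re_pos_Cmod a h1; have an := Re_pos_neq0 a h1.
split; first exact: Re_inv_pos.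
rewrite Cmod_Cinv // Re_inv; apply: (Rmult_le_reg_r (Cmod a ^ 2)); first by apply: pow_lt.
rewrite /Rdiv (Rmult_assoc (Re a)) Rinv_l; last by apply: pow_nonzero; lra.
have -> : k * / Cmod a * Cmod a ^ 2 = k * Cmod a by field; lra.
lra.
Qed.

(** With h = 1/a, the power n^(-nu - 1) is h^(nu + 1) (n h)^(-nu - 1), and the denominator n^2 + a^2
    supplies two more powers of h. *)
Lemma bessel_sum_Sg b nu k a : 0 < k <= 1 -> 0 < b -> 0 < nu -> nonint nu -> Sect k a ->
  bessel_sum b nu a = (Cpower (/ a) (nu + 3) * Sg b nu (/ a))%C.
Proof.
move=> hk hb hn h ha; have hh := Sect_inv k a ha; have a0 : 0 < Re a by case: ha.
have an := Re_pos_neq0 a a0; set z := (/ a)%C in hh *; have z0 : 0 < Re z by case: hh.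
rewrite /bessel_sum; apply: CSum_CSeries.
apply: CSum_ext (CSum_scal (Cpower z (nu + 3)) _ _ (CSum_abs _ (gf_summable b nu k z hk hb hn h hh))) => j.
have n0 : 0 < INR (S j) by apply: lt_0_INR; lia.
set n := INR (S j) in n0 *.
have nz : 0 < Re (RtoC n * z)%C by rewrite Re_scal; nra.
have E : (RtoC (n * b) / a)%C = (RtoC b * (RtoC n * z))%C by rewrite /Cdiv -/z RtoC_mult; ring.
have p : 0 < Re (RtoC b * (RtoC n * z))%C by rewrite Re_scal; nra.
cbv zeta; rewrite E BesselK_Kf // /gf Cpower_scal //.
have -> : Cpower z (nu + 3) = (Cpower z (nu + 1) * (z * z))%C.
  rewrite -{3 4}(Cpower_1 z) // -!Cpower_plus; congr Cpower; ring.
have -> : Cpower z (- nu - 1) = (/ Cpower z (nu + 1))%C by rewrite -Cpower_opp; congr Cpower; ring.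
have c0 := Cpower_neq0 z (nu + 1).
have d0 := one_plus_sq_neq0 _ nz.
have d1 : (RtoC (n ^ 2) + a ^ 2)%C = (a * a * (1 + RtoC n * z * (RtoC n * z)))%C.
  rewrite RtoC_pow /z; field; exact: an.
have -> : z = (/ a)%C by [].
rewrite d1 /Cdiv; set D := (1 + _)%C in d0 *; set CP := Cpower _ _ in c0 *.
field; repeat split => //.
Qed.

Lemma cc_0 b nu : cc b nu 0 = Acf b nu.
Proof. rewrite /cc /Fsum /Ec /=; field. Qed.

Lemma Res1_z b nu a : 0 < b -> 0 < Re a -> nonint nu ->
  Res1 b nu (- nu - 1) (chi_ b) a =
  (Cpower (/ a) (nu + 2) * (RtoC (Jv b nu + cc b nu 0 * euler_gamma) - RtoC (cc b nu 0) * Cln (/ a)))%C.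
Proof.
move=> hb ha h; rewrite /Res1 Cpower_inv // Cln_inv // cc_0.
have -> : - nu - 1 - 1 = - (nu + 2) by ring.
have -> : 1 / 2 * Rpower (chi_ b) (nu / 2) * Gamma (- nu) = Acf b nu by rewrite chi_half // /Acf; field.
rewrite /Jv !RtoC_plus !RtoC_mult; ring.
Qed.

Lemma zt_terms a s k : 0 < Re a -> (Cpower (/ a) (s + 2 * INR k))%C = (Cpower a (- s) / a ^ (2 * k))%C.
Proof.
move=> ha; rewrite Cpower_plus Cpower_inv // /Cdiv; congr (_ * _)%C.
rewrite Cpower_inv // Cpower_opp -(Cpower_nat _ (2 * k)) // mult_INR //.
Qed.

Lemma Rhat_zt b nu a k : 0 < b -> 0 < Re a ->
  Rhat_term nu (- nu - 1) (chi_ b) a k = (Cpower (/ a) (nu + 2) * zt b nu nu k (/ a))%C.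
Proof.
move=> hb ha; rewrite /zt /Rhat_term.
have -> : la nu nu k + 1 = 0 + 2 * INR k by rewrite /la; ring.
rewrite zt_terms // Ropp_0 Cpower_0 Cpower_inv // /cc Fsum_F1.
have -> : - la nu nu k = 1 - 2 * INR k by rewrite /la; ring.
have -> : - nu - 1 - 1 = - (nu + 2) by ring.
rewrite chi_half // /Acf /Cdiv (_ : 1 / 2 = / 2); last field.
rewrite /Rdiv !RtoC_mult; ring.
Qed.

Lemma R_zt b nu a k : 0 < b -> 0 < Re a ->
  R_term nu (- nu - 1) (chi_ b) a k = (Cpower (/ a) (nu + 2) * zt b nu (- nu) k (/ a))%C.
Proof.
move=> hb ha; rewrite /zt /R_term.
have -> : (Cpower (/ a) (nu + 2) * (RtoC (cc b (- nu) k) * (RtoC (zeta (- la nu (- nu) k)) * Cpower (/ a) (la nu (- nu) k + 1))))%C =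
  (RtoC (cc b (- nu) k) * RtoC (zeta (- la nu (- nu) k)) * Cpower (/ a) (2 - nu + 2 * INR k))%C.
  have -> : 2 - nu + 2 * INR k = (nu + 2) + (la nu (- nu) k + 1) by rewrite /la; ring.
  rewrite (Cpower_plus _ (nu + 2)); ring.
rewrite zt_terms // (_ : - (2 - nu) = nu - 2); last ring.
have -> : - la nu (- nu) k = - (- nu - 1) + nu - 2 * INR k by rewrite /la; ring.
rewrite /cc Fsum_F1 chi_half // /Acf Ropp_involutive /Cdiv (_ : 1 / 2 = / 2); last field.
rewrite /Rdiv !RtoC_mult; ring.
Qed.

Theorem theorem5 :
  forall b nu gam chi : R,
  0 < b ->
  0 < nu ->
  (forall m : Z, nu <> IZR m) ->
  gam = - nu - 1 ->
  chi = b ^ 2 / 4 ->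
  forall (K : nat) (delta : R),
  (1 <= K)%nat ->
  0 < delta < PI / 2 ->
  exists M A : R, 0 < A /\
  forall a : C,
  A <= Cmod a ->
  Rabs (Carg a) <= PI / 2 - delta ->
  Cmod (bessel_sum b nu a - Res1 b nu gam chi a
        - (sum_n_m (Rhat_term nu gam chi a) 1 (K - 1)
           + sum_n_m (R_term nu gam chi a) 0 (K - 1)))%C
  <= M * Rpower (Cmod a) (nu - 2 - 2 * INR K).
Proof.
move=> b nu gam chi hb hn h -> -> K delta hK hd; rewrite -/(chi_ b).
have [m hm] := nat_ceil nu hn h.
case: K hK => [|K] hK; first lia.
rewrite (_ : (S K - 1)%nat = K); last lia.
set k := sin delta.
have hk : 0 < k <= 1 by split; [apply: sin_gt_0; have := PI_RGT_0; lra | case: (SIN_bound delta)].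
have [B [r0 [B0 [r00 H]]]] := main_asym b nu k m K _ hk hb hn h hm (Ef_weak k b nu m (S K) K hk hb hn h hm).
set q := RtoC (Jv b nu + cc b nu 0 * euler_gamma) in H.
(* Weights of the m surplus terms of the branch -nu, present in [Ef] but not in the claimed sums.
   The first has order 2 (K + 1) - 2 nu in h, where K + 1 is now the K of the statement, and it
   fixes the exponent of the error; the remainder from [main_asym] is smaller. *)
pose c i := Rabs (cc b (- nu) (S K + i) * zeta (- la nu (- nu) (S K + i))).
exists (B + rsum c m), (Rmax 1 (/ r0)); split; first by have := Rmax_l 1 (/ r0); lra.
move=> a ha harg; have a1 : 1 <= Cmod a by have := Rmax_l 1 (/ r0); lra.
have sa : Sect k a by apply: Carg_sector => //; lra.
have sz := Sect_inv k a sa; have ra : 0 < Re a by case: sa.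
have an := Re_pos_neq0 a ra.
have mz : Cmod (/ a)%C = / Cmod a by exact: Cmod_Cinv.
rewrite (bessel_sum_Sg b nu k a hk hb hn h sa) Res1_z //.
have Rsum0 : sum_n_m (R_term nu (- nu - 1) (chi_ b) a) 0 K = (Cpower (/ a) (nu + 2) * csum (fun k => zt b nu (- nu) k (/ a)) (S K))%C.
  rewrite -(Nat.add_0_l K) sum_n_m_csum Nat.add_0_l -csum_scal; apply: csum_ext => i _; exact: R_zt.
have Rsum1 : sum_n_m (Rhat_term nu (- nu - 1) (chi_ b) a) 1 K = (Cpower (/ a) (nu + 2) * csum (fun k => zt b nu nu (S k) (/ a)) K)%C.
  case: K {hK H c ha Rsum0} => [|K]; first by rewrite sum_n_m_zero /=; [rewrite Cmult_0_r | lia].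
  rewrite -(Nat.add_1_l K) sum_n_m_csum Nat.add_1_l -csum_scal; apply: csum_ext => i _; rewrite Nat.add_1_l; exact: Rhat_zt.
rewrite Rsum0 Rsum1; set z := (/ a)%C in sz mz *.
have z0 : 0 < Re z by case: sz.
have zm : 0 < Cmod z by exact: Re_pos_Cmod.
have z1 : Cmod z <= 1 by rewrite mz -Rinv_1; apply: Rinv_le_contravar; lra.
have zr : Cmod z <= r0.
  rewrite mz -(Rinv_inv r0); apply: Rinv_le_contravar; first exact: Rinv_0_lt_compat.
  have := Rmax_r 1 (/ r0); lra.
have -> : (Cpower z (nu + 3) * Sg b nu z - Cpower z (nu + 2) * (q - RtoC (cc b nu 0) * Cln z) -
  (Cpower z (nu + 2) * csum (fun k => zt b nu nu (S k) z) K + Cpower z (nu + 2) * csum (fun k => zt b nu (- nu) k z) (S K)))%C =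
  (Cpower z (nu + 2) * ((Ef b nu (S K + m) K z - q) + csum (fun i => zt b nu (- nu) (S K + i) z) m))%C.
  rewrite /Ef csum_split (_ : nu + 3 = nu + 2 + 1); last ring.
  rewrite Cpower_plus Cpower_1 //; ring.
have HE := H z sz zr.
have HT : Cmod (csum (fun i => zt b nu (- nu) (S K + i) z) m) <= rsum c m * Rpower (Cmod z) (2 * INR (S K) - 2 * nu).
  rewrite Rmult_comm -rsum_scal; apply: csum_le => i _; rewrite Cmod_zt // -/(c i) Rmult_comm.
  apply: Rmult_le_compat_r; first exact: Rabs_pos.
  apply: Rpower_near_le; first lra.
  rewrite /la plus_INR; have := pos_INR i; lra.
have E : Rpower (Cmod a) (nu - 2 - 2 * INR (S K)) = Rpower (Cmod z) (nu + 2) * Rpower (Cmod z) (2 * INR (S K) - 2 * nu).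
  rewrite -Rpower_plus mz /Rpower ln_Rinv; last lra.
  congr exp; ring.
rewrite Cmod_mult Cmod_Cpower E.
rewrite (_ : (B + rsum c m) * (Rpower (Cmod z) (nu + 2) * Rpower (Cmod z) (2 * INR (S K) - 2 * nu)) =
  Rpower (Cmod z) (nu + 2) * (B * Rpower (Cmod z) (2 * INR (S K) - 2 * nu) + rsum c m * Rpower (Cmod z) (2 * INR (S K) - 2 * nu))); last ring.
apply: Rmult_le_compat_l; first by left; exact: exp_pos.
apply: Rle_trans (Cmod_triangle _ _) _; apply: Rplus_le_compat => //.
apply: Rle_trans HE _; apply: Rmult_le_compat_l => //; apply: Rpower_near_le; lra.
Qed.
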